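(* Let $N\ge1$, $\mathcal N=\{1,\dots,N\}$, $T>0$, $Q_T=(0,T)\times\mathbb R$, let $\boldsymbol U_0\in((L^1\cap\mathrm{BV})(\mathbb R;[0,1]))^N$, and assume the standing hypotheses of the context on $f^k,\nu^k,\mu^{j,k},\Gamma^{j,k}$; in particular each $\Gamma^{j,k}$ is supported in $[0,1]$ with $\int_{\mathbb R^+}\Gamma^{j,k}(\tau)\,d\tau=1$. Assume further that there is a constant $C_{\boldsymbol\Gamma}>0$ with $$\int_{\mathbb R^+}x\,\Gamma^{j,k}(x)\,dx\le C_{\boldsymbol\Gamma}<\infty\qquad\text{for all }j,k\in\mathcal N .$$ For $\delta>0$ put $\Gamma^{j,k}_\delta(t)=\frac1\delta\Gamma^{j,k}(t/\delta)$ and $\Theta^{j,k}_\delta(t,x)=\mu^{j,k}(x)\Gamma_\delta^{j,k}(t)$. Let $\boldsymbol U$ be the entropy solution (in the sense given in the context) of the memoryless system $$\partial_t U^{k}+\partial_x\big(f^k(U^k)\,\nu^k((\boldsymbol\mu\circledast\boldsymbol U)^k)\big)=0\ \text{ in }Q_T,\qquad U^k(0,\cdot)=U_0^k,\qquad k\in\mathcal N,$$ and let $\boldsymbol U^\Delta_\delta$ be the finite volume approximation, defined by the scheme in the context with space-time kernel $\boldsymbol\Theta_\delta$ (with $\lambda=\Delta t/\Delta x$ fixed and satisfying the CFL condition stated there), of the system with memory $$\partial_t U^{k}+\partial_x\big(f^k(U^k)\,\nu^k((\boldsymbol\Theta_\delta\circledast\boldsymbol U)^k)\big)=0\ \text{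 in }Q_T,\qquad U^k(0,\cdot)=U_0^k,\qquad k\in\mathcal N .$$ Then, as $\Delta x,\delta\to0$, $\boldsymbol U^\Delta_\delta$ converges to $\boldsymbol U$ in $L^1$ norm, and $$\|\boldsymbol U^\Delta_\delta(T)-\boldsymbol U(T)\|_{(L^1(\mathbb R))^N}=\mathcal O(\sqrt\delta+\sqrt{\Delta x}).$$
   Context: **Standing hypotheses** (for all $j,k\in\mathcal N$): (H1) $f^k:\mathbb R\to\mathbb R$ is Lipschitz with $f^k(0)=f^k(1)=0$. (H2) $\nu^k\in (C^2\cap \mathrm{BV}\cap W^{2,\infty})(\mathbb R^N;\mathbb R)$. (H3) $\mu^{j,k}\in C^2(\mathbb R)\cap W^{2,\infty}(\mathbb R)$ and $\Gamma^{j,k}\in C^2([0,\infty);\mathbb R^+)\cap W^{2,\infty}([0,\infty);\mathbb R^+)$ (nonnegative values). Moreover $\operatorname{supp}\Gamma^{j,k}\subseteq[0,1]$ and $\int_0^\infty\Gamma^{j,k}(\tau)\,d\tau=1$. **Nonlocal operators.** $(\boldsymbol\Theta_\delta\circledast\boldsymbol U)^k=(\Theta_\delta^{j,k}*U^j)_{j\in\mathcal N}$ and $(\boldsymbol\mu\circledast\boldsymbol U)^k=(\mu^{j,k}*U^j)_{j\in\mathcal N}$, where $$(\Theta_\delta^{j,k}*U^j)(t,x)=\int_0^t\int_{\mathbb R}U^j(\tau,\xi)\,\mu^{j,k}(x-\xi)\,\Gamma_\delta^{j,k}(t-\tau)\,d\xi\,d\tau,\qquad (\mu^{j,k}*U^j)(t,x)=\int_{\mathbb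 R}U^j(t,\xi)\,\mu^{j,k}(x-\xi)\,d\xi .$$ **Entropy solution of the memoryless system.** $\boldsymbol U\in (C([0,T];L^1(\mathbb R;[0,1]))\cap L^\infty([0,T];\mathrm{BV}(\mathbb R)))^N$ such that for each $k\in\mathcal N$, $\alpha\in\mathbb R$ and each nonnegative $\phi\in C_c^\infty([0,T)\times\mathbb R)$, $$\begin{aligned}&\int_{Q_T}|U^k-\alpha|\,\phi_t\,dx\,dt+\int_{\mathbb R}|U_0^k(x)-\alpha|\,\phi(0,x)\,dx\\&+\int_{Q_T}\mathrm{sgn}(U^k-\alpha)\,\nu^k((\boldsymbol\mu\circledast\boldsymbol U)^k)\,(f^k(U^k)-f^k(\alpha))\,\phi_x\,dx\,dt\\&-\int_{Q_T}f^k(\alpha)\,\mathrm{sgn}(U^k-\alpha)\,\partial_x\big[\nu^k((\boldsymbol\mu\circledast\boldsymbol U)^k)\big]\,\phi\,dx\,dt\ \ge 0.\end{aligned}$$ **Finite volume scheme with kernel $\boldsymbol\Theta_\delta$.** Let $\Delta x,\Delta t>0$, $\lambda=\Delta t/\Delta x$, $T=N_T\Delta t$ with $N_T\in\mathbb N$, $x_q=q\Delta x$ and $C_q=[x_{q-1/2},x_{q+1/2})$ (for integer or half-integer $q$), $t^n=n\Delta t$, $C^n=[t^n,t^{n+1})$. Set $U_{i,\delta}^{k,0}=\frac1{\Delta x}\int_{C_i}U_0^k(x)\,dx$ for $i\in\mathbb Z$. Let $\mu^{j,k}_q=\frac1{\Delta x}\int_{C_q}\mu^{j,k}(x)\,dx$,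 $\Gamma_\delta^{j,k,m}=\frac1{\Delta t}\int_{C^m}\Gamma_\delta^{j,k}(\tau)\,d\tau$, and $$c^{j,k,n,\delta}_{i+1/2}=\Delta x\,\Delta t\sum_{m=0}^n\sum_{p\in\mathbb Z}\mu^{j,k}_{i+1/2-p}\,\Gamma_\delta^{j,k,n-m}\,U^{j,m}_{p,\delta},\qquad \boldsymbol c^{k,n,\delta}_{i+1/2}=(c^{j,k,n,\delta}_{i+1/2})_{j\in\mathcal N}.$$ The numerical flux is of Lax–Friedrichs type: with a parameter $\beta\in(0,2/3)$, $$\mathcal F^k(a_1,a_2,a_3)=\frac{a_1}{2}\big(f^k(a_2)+f^k(a_3)\big)-\beta\,\frac{a_3-a_2}{2\lambda},$$ and for $n\ge0$, $i\in\mathbb Z$, $k\in\mathcal N$, $$U_{i,\delta}^{k,n+1}=U_{i,\delta}^{k,n}-\lambda\Big[\mathcal F^k\big(\nu^k(\boldsymbol c^{k,n,\delta}_{i+1/2}),U_{i,\delta}^{k,n},U_{i+1,\delta}^{k,n}\big)-\mathcal F^k\big(\nu^k(\boldsymbol c^{k,n,\delta}_{i-1/2}),U_{i-1,\delta}^{k,n},U_{i,\delta}^{k,n}\big)\Big].$$ The approximation is $U_\delta^{k,\Delta}(t,x)=U_{i,\delta}^{k,n}$ for $(t,x)\in C^n\times C_i$, $0\le n\le N_T$, $i\in\mathbb Z$, and $\boldsymbol U_\delta^\Delta=(U_\delta^{k,\Delta})_{k\in\mathcal N}$. **CFL condition.** $$\lambda\le\frac{\min(1,\,4-6\beta,\,6\beta)}{1+6\,|\boldsymbol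 f|_{(\mathrm{Lip}(\mathbb R))^N}\,\|\boldsymbol\nu\|_{(L^\infty(\mathbb R^N))^N}},$$ where $|\boldsymbol f|_{(\mathrm{Lip}(\mathbb R))^N}$ is the maximum over $k$ of the Lipschitz constants of $f^k$ and $\|\boldsymbol\nu\|_{(L^\infty(\mathbb R^N))^N}=\max_k\|\nu^k\|_{L^\infty(\mathbb R^N)}$. **Norm.** $\|\boldsymbol Z\|_{(L^1(\mathbb R))^N}=\sum_{k\in\mathcal N}\|Z^k\|_{L^1(\mathbb R)}$. The constant implied by $\mathcal O$ is independent of $\delta$ and $\Delta x$. *)

(* Defs.v *)
From HB Require Import structures.
From mathcomp Require Import all_boot all_order all_algebra.
From mathcomp Require Import all_classical all_reals all_analysis.
Set Implicit Arguments.
Unset Strict Implicit.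
Unset Printing Implicit Defensive.
Import Order.TTheory GRing.Theory Num.Theory.
Import numFieldNormedType.Exports.
Local Open Scope classical_set_scope.
Local Open Scope ring_scope.

Section FunctionSpaces.
Context {R : realType}.
Local Notation leb := (@lebesgue_measure R).

(* iter_derive [:: v1; ...; vm] f = D_v1 (... (D_vm f)) *)
Definition iter_derive (V : normedModType R) (w : seq V) (f : V -> R) : V -> R :=
  foldr (fun v g x => 'D_v g x) f w.

(* C^n: for finite-dimensional V this is the usual notion, since every iterated
   directional derivative is a linear combination of partial derivatives. *)
Definition Ck (V : normedModType R) (n : nat) (f : V -> R) : Prop :=
  forall w : seq V, (size w <= n)%N ->
    continuous (iter_derive w f) /\
    ((size w < n)%N -> forall x v, derivable (iter_derive w f) x v).

Definition Cinfty (V : normedModType R) (f : V -> R) : Prop :=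
  forall n, Ck n f.

(* W^{n,oo}, used only together with Ck n: weak derivatives are then the
   classical ones and, these being continuous, their essential suprema are
   suprema. *)
Definition Wkinfty (V : normedModType R) (n : nat) (f : V -> R) : Prop :=
  forall w : seq V, (size w <= n)%N ->
    exists M : R, forall x, `|iter_derive w f x| <= M.

(* C^2([0,oo)): the derivatives of order <= 2 on (0,oo) extend continuously
   to 0; values at negative arguments are irrelevant. *)
Definition C2_halfline (g : R -> R) : Prop :=
  [/\ {within `[0, +oo[, continuous g},
      forall t, 0 < t ->
        [/\ derivable g t 1, derivable (derive1 g) t 1 & {for t, continuous (derive1n 2 g)}],
      cvg (derive1 g t @[t --> 0^'+]) &
      cvg ((derive1n 2 g) t @[t --> 0^'+])].

(* W^{2,oo}([0,oo)), used only together with C2_halfline *)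
Definition W2infty_halfline (g : R -> R) : Prop :=
  exists M : R, forall t, 0 < t ->
    [/\ `|g t| <= M, `|derive1 g t| <= M & `|(derive1n 2 g) t| <= M].

Definition compact_support (V : normedModType R) (f : V -> R) : Prop :=
  compact (closure [set x | f x != 0]).

(* Variation of the distributional derivative on the line:
   sup { int u psi' : psi in C^1_c(R), |psi| <= 1 }. *)
Definition TV (u : R -> R) : \bar R :=
  ereal_sup [set (\int[leb]_x (u x * derive1 psi x))%:E | psi in
    [set psi : R -> R | [/\ Ck 1 psi, compact_support psi &
                            forall x, `|psi x| <= 1]]].

Definition BV (u : R -> R) : Prop := (TV u < +oo)%E.

(* Integral over R^n as an iterated Lebesgue integral; it is only applied to
   continuous compactly supported integrands, so the order is immaterial. *)
Fixpoint integral_rV (n : nat) : ('rV[R]_n -> R) -> R :=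
  match n return ('rV[R]_n -> R) -> R with
  | 0%N => fun g => g 0
  | m.+1 => fun g =>
      \int[leb]_x integral_rV (fun v : 'rV[R]_m => g (row_mx (x%:M : 'rV[R]_1) v))
  end.

Definition divergence (n : nat) (psi : 'rV[R]_n -> 'rV[R]_n) (x : 'rV[R]_n) : R :=
  \sum_(i < n) 'D_(delta_mx 0 i : 'rV[R]_n) (fun y : 'rV[R]_n => psi y 0 i) x.

(* Same as TV, on R^n, for a continuous g; |psi| is the Euclidean norm. *)
Definition TV_rV (n : nat) (g : 'rV[R]_n -> R) : \bar R :=
  ereal_sup [set (integral_rV (fun x => g x * divergence psi x))%:E | psi in
    [set psi : 'rV[R]_n -> 'rV[R]_n |
      [/\ forall i, Ck 1 (fun x => psi x 0 i),
          forall i, compact_support (fun x => psi x 0 i) &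
          forall x, \sum_(i < n) (psi x 0 i) ^+ 2 <= 1]]].

Definition BV_rV (n : nat) (g : 'rV[R]_n -> R) : Prop := (TV_rV g < +oo)%E.

(* L^1(R; [0,1]) *)
Definition L1_01 (u : R -> R) : Prop :=
  leb.-integrable setT (EFin \o u) /\ {ae leb, forall x, 0 <= u x <= 1}.

Definition lip_const (g : R -> R) : R :=
  sup [set `|g z.1 - g z.2| / `|z.1 - z.2| | z in [set z : R * R | z.1 != z.2]].

(* L^oo norm of a continuous function *)
Definition sup_norm (V : normedModType R) (g : V -> R) : R :=
  sup (range (fun x => `|g x|)).

End FunctionSpaces.

Section Entropy.
Context {R : realType} (N : nat).
Local Notation leb := (@lebesgue_measure R).

Definition QT (T : R) : set (R * R) := `]0, T[ `*` setT.

Definition rescale (delta : R) (G : R -> R) : R -> R :=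
  fun t => delta^-1 * G (t / delta).

Definition space_conv (mu : 'I_N -> 'I_N -> R -> R) (U : 'I_N -> R -> R -> R)
    (k : 'I_N) (t x : R) : 'rV[R]_N :=
  \row_j \int[leb]_xi (U j t xi * mu j k (x - xi)).

(* C_c^oo([0,T) x R): restrictions to t >= 0 of smooth functions on the plane
   with compact support in (-oo,T) x R. *)
Definition test_fun (T : R) (phi : R * R -> R) : Prop :=
  [/\ Cinfty phi, compact_support phi,
      closure [set z | phi z != 0] `<=` [set z | z.1 < T] &
      forall z, 0 <= z.1 -> 0 <= phi z].

Definition CtL1 (T : R) (u : R -> R -> R) : Prop :=
  forall t, 0 <= t <= T ->
    (\int[leb]_x (`|u s x - u t x|)%:E)%E @[s --> within `[0, T] (nbhs t)] --> 0%E.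

(* U k t x is a representative: the time slice U k t is the element of
   L^1(R;[0,1]) given by continuity in time, for every t in [0,T]. *)
Definition entropy_solution (T : R) (f : 'I_N -> R -> R)
    (nu : 'I_N -> 'rV[R]_N -> R) (mu : 'I_N -> 'I_N -> R -> R)
    (U0 : 'I_N -> R -> R) (U : 'I_N -> R -> R -> R) : Prop :=
  (forall k,
    [/\ measurable_fun (`[0, T] `*` setT) (fun z : R * R => U k z.1 z.2),
        forall t, 0 <= t <= T -> L1_01 (U k t),
        CtL1 T (U k) &
        exists M : R, {ae leb, forall t, 0 <= t <= T -> (TV (U k t) <= M%:E)%E}]) /\
  (forall k (alpha : R) (phi : R * R -> R), test_fun T phi ->
    0 <=
      \int[(leb \x leb)%E]_(z in QT T)
        (`|U k z.1 z.2 - alpha| * 'D_((1, 0) : R * R) phi z)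
    + \int[leb]_x (`|U0 k x - alpha| * phi (0, x))
    + \int[(leb \x leb)%E]_(z in QT T)
        (Num.sg (U k z.1 z.2 - alpha) * nu k (space_conv mu U k z.1 z.2)
         * (f k (U k z.1 z.2) - f k alpha) * 'D_((0, 1) : R * R) phi z)
    - \int[(leb \x leb)%E]_(z in QT T)
        (f k alpha * Num.sg (U k z.1 z.2 - alpha)
         * derive1 (fun x => nu k (space_conv mu U k z.1 x)) z.2 * phi z)).

End Entropy.

Section Scheme.
Context {R : realType} (N : nat).
Local Notation leb := (@lebesgue_measure R).

(* Space indices q are reals, so that integers and half-integers coexist. *)
Definition cell (Dx q : R) : set R := `[(q - 2^-1) * Dx, (q + 2^-1) * Dx[.
Definition tcell (Dt : R) (n : nat) : set R := `[n%:R * Dt, n.+1%:R * Dt[.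

(* sum over Z, as the limit of sum_{-M <= p < M} a p; it is only applied to
   absolutely summable families. *)
Definition sumZ (a : int -> R) : R :=
  limn (fun M => \sum_(0 <= m < M) (a (Posz m) + a (Negz m))).

Context (f : 'I_N -> R -> R) (nu : 'I_N -> 'rV[R]_N -> R)
  (mu Gam : 'I_N -> 'I_N -> R -> R) (beta : R)
  (U0 : 'I_N -> R -> R) (Dx Dt : R).

Definition mu_avg (j k : 'I_N) (q : R) : R :=
  Dx^-1 * \int[leb]_(x in cell Dx q) mu j k x.

Definition Gam_avg (j k : 'I_N) (m : nat) : R :=
  Dt^-1 * \int[leb]_(t in tcell Dt m) Gam j k t.

Definition fv_conv (V : 'I_N -> nat -> int -> R) (k : 'I_N) (n : nat) (q : R) :
    'rV[R]_N :=
  \row_j (Dx * Dt * \sum_(m < n.+1)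
    sumZ (fun p => mu_avg j k (q - p%:~R) * Gam_avg j k (n - m) * V j m p)).

Definition LFflux (k : 'I_N) (a1 a2 a3 : R) : R :=
  a1 / 2 * (f k a2 + f k a3) - beta * ((a3 - a2) / (2 * (Dt / Dx))).

Definition fv_next (V : 'I_N -> nat -> int -> R) (k : 'I_N) (n : nat) (i : int) : R :=
  V k n i - Dt / Dx *
    (LFflux k (nu k (fv_conv V k n (i%:~R + 2^-1))) (V k n i) (V k n (i + 1))
   - LFflux k (nu k (fv_conv V k n (i%:~R - 2^-1))) (V k n (i - 1)) (V k n i)).

(* The update uses the whole past, so the recursion carries the history:
   fv_hist n k m i is U_i^{k,m} for m <= n. See fv0 and fvS below. *)
Fixpoint fv_hist (n : nat) : 'I_N -> nat -> int -> R :=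
  match n with
  | 0%N => fun k _ i => Dx^-1 * \int[leb]_(x in cell Dx i%:~R) U0 k x
  | n'.+1 => fun k m i =>
      if (m <= n')%N then fv_hist n' k m i else fv_next (fv_hist n') k n' i
  end.

Definition fv (k : 'I_N) (n : nat) (i : int) : R := fv_hist n k n i.

Lemma fv0 k i : fv k 0 i = Dx^-1 * \int[leb]_(x in cell Dx i%:~R) U0 k x.
Proof. by []. Qed.

Lemma fvS k n i : fv k n.+1 i = fv_next fv k n i.
Proof.
have histE m p : (m <= p)%N -> forall k i, fv_hist p k m i = fv k m i.
  elim: p => [|p IHp]; first by rewrite leqn0 => /eqP ->.
  rewrite leq_eqVlt => /predU1P[-> //|]; rewrite ltnS => mp k' i' /=.
  by rewrite mp IHp.
have convE k' q : fv_conv (fv_hist n) k' n q = fv_conv fv k' n q.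
  apply/rowP => j; rewrite !mxE; congr (_ * _); apply: eq_bigr => m _.
  by congr sumZ; apply/funext => p; rewrite histE // -ltnS.
by rewrite {1}/fv /= ltnn /fv_next !convE !histE.
Qed.

Definition fv_fun (k : 'I_N) (t x : R) : R :=
  fv k (Num.truncn (t / Dt)) (Num.floor (x / Dx + 2^-1)).

Lemma fv_funE k n i t x : 0 < Dx -> 0 < Dt ->
  tcell Dt n t -> cell Dx i%:~R x -> fv_fun k t x = fv k n i.
Proof.
move=> Dx0 Dt0; rewrite /tcell /cell /= !in_itv /= => /andP[t1 t2] /andP[x1 x2].
rewrite /fv_fun (@truncn_def _ (t / Dt) n); last first.
  by rewrite ler_pdivlMr // ltr_pdivrMr // t1.
rewrite (@floor_def _ (x / Dx + 2^-1) i) // -lerBlDr ler_pdivlMr // x1 /=.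
by rewrite -ltrBrDr ltr_pdivrMr // intrD -addrA [1 - _](_ : _ = 2^-1) //
  {1}(splitr 1) mul1r addrK.
Qed.

End Scheme.

Section Limit.
Context {R : realType}.

Definition CFL (N : nat) (f : 'I_N -> R -> R) (nu : 'I_N -> 'rV[R]_N -> R)
    (beta lambda : R) : Prop :=
  lambda <= Num.min 1 (Num.min (4 - 6 * beta) (6 * beta)) /
    (1 + 6 * (\big[Num.max/0]_(k < N) lip_const (f k))
           * (\big[Num.max/0]_(k < N) sup_norm (nu k))).

(* (Dx, delta) -> (0, 0) jointly, along Dx, delta > 0 such that T is a multiple
   of the time step Dt = lambda * Dx. *)
Definition mesh_to0 (T lambda : R) : set_system (R * R) :=
  within [set p : R * R | [/\ 0 < p.1, 0 < p.2 &
                              exists NT : nat, T = NT%:R * (lambda * p.1)]]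
         (nbhs ((0, 0) : R * R)).

End Limit.

(* Main.v *)
(** Kuznetsov's comparison argument, in a form that differentiates only the smooth
    side. Put [eps = sqrt Dx]. The Kruzkov inequality for [U^k], with [alpha] the value
    of the scheme in the cell [(m, i)] and with a test function concentrated at distance
    [eps] from that cell, is summed over all cells and added to the discrete entropy
    inequality of the monotone scheme, weighted by the same functions. The weights
    are differences of one smooth step, so that all sums telescope up to [O(eps)] times
    the total variation of the scheme; of the exact solution nothing but continuity
    in time with values in L^1 is used. The remaining term is the difference between
    the two velocities.

    The velocity depends Lipschitz continuously, in C^1, on the L^1 size of the density.
    The scheme convolves [mu] with an average of its own past over a time of length
    [delta], and it moves by [O(Dt)] per step in L^1, so the memory costs [O(delta)],
    plus [O(1)] during the first [delta] units of time. Hence the L^1 error [E] satisfies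
    [E t <= O(eps + delta) + C * int_0^t E]. Gronwall's argument uses the supremum of
    [E t * exp (- l t)], which requires no measurability of [E]. *)
Require Import Defs.
From HB Require Import structures.
From mathcomp Require Import all_boot all_order all_algebra.
From mathcomp Require Import all_classical all_reals all_analysis.
From mathcomp Require Import measurable_realfun ring lra.
Set Implicit Arguments.
Unset Strict Implicit.
Unset Printing Implicit Defensive.
Import Order.TTheory GRing.Theory Num.Theory.
Import numFieldNormedType.Exports.
Local Open Scope classical_set_scope.
Local Open Scope ring_scope.

(** * Smooth steps and test functions *)

(** Three points shape the estimates. The weight of a cell has size e = Dx / eps, replacing a
    difference of steps by a derivative costs e^2, and about eps / Dx weights are active at a point;
    consistency therefore costs Dx / eps per unit of variation, while localising at scale eps costs
    eps, and [eps = sqrt Dx] balances the two. The Kruzkov flux is symmetric in its two values, so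
    the same number serves as flux of the exact solution with the scheme as parameter and
    conversely; only the sources differ, f of one value against f of the other, and have to be
    matched. Sums over all of Z are avoided: each estimate carries a space cutoff z of slope tau and
    an error in tau / Dx, which disappears when tau tends to 0 on a fixed mesh. Because the time
    weights form a partition of unity from time 0 on, the first one is present at once; its defect
    is of order 1, but only for t <= 2 eps, which integrates to O(eps). The final estimate is linear
    in delta, hence at most of order sqrt delta once delta <= 1. *)

Section SmoothStep.
Context {R : realType}.
Implicit Types (f g : R -> R) (x : R).

(** A quadratic remainder near x identifies the derivative. This serves where no differentiation
    rule applies: at the origin for [flat], and to recover derivability from [c11]. *)
Lemma is_derive_taylor f (x l C r : R) : 0 < r ->
  (forall h, `|h| < r -> `|f (x + h) - f x - h * l| <= C * h ^+ 2) ->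
  is_derive x (1 : R) f l.
Proof.
move=> r0 H.
have cv : (fun h : R => h^-1 *: ((f \o shift x) (h *: (1:R)) - f x)) @ 0^' --> l.
  apply/cvgrPdist_lt => e e0; near=> h.
  have hn0 : h != 0 by near: h; exact: nbhs_dnbhs_neq.
  have hr : `|h| < r by near: h; apply: dnbhs0_lt.
  have he : `|h| < e / (`|C| + 1) by near: h; apply: dnbhs0_lt; rewrite divr_gt0// ltr_wpDl.
  rewrite /= [h%:A]mulr1 [h + x]addrC.
  have -> : l - h^-1 *: (f (x + h) - f x) = - (h^-1 * (f (x + h) - f x - h * l)).
    by rewrite /GRing.scale/= [in RHS]mulrBr mulrA mulVf// mul1r opprB.
  rewrite normrN normrM normfV ltr_pdivrMl ?normr_gt0//.
  apply: le_lt_trans (H _ hr) _.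
  rewrite -real_normK ?num_real// expr2 mulrA mulrC ltr_pM2l ?normr_gt0//.
  apply: (@le_lt_trans _ _ ((`|C| + 1) * `|h|)).
    by rewrite ler_wpM2r// (le_trans (ler_norm C))// lerDl.
  by rewrite mulrC -ltr_pdivlMr// ltr_wpDl.
apply: DeriveDef; first by apply/cvg_ex; exists l.
exact/cvg_lim.
Unshelve. all: by end_near. Qed.

(** No continuity clause is needed: each derivative is continuous because it is differentiable at
    the next order. *)
Fixpoint smoothn (n : nat) f : Prop :=
  if n is n'.+1 then (forall x, derivable f x 1) /\ smoothn n' (f^`())%classic else True.
Definition smooth f := forall n, smoothn n f.

Lemma smooth_derivable f x : smooth f -> derivable f x 1.
Proof. by move/(_ 1%N) => []. Qed.

Lemma smooth_is_derive f x : smooth f -> is_derive x 1 f (f^`()%classic x).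
Proof. by move=> sf; rewrite derive1E; apply/derivableP/smooth_derivable. Qed.

Lemma smooth_derive1 f : smooth f -> smooth (f^`())%classic.
Proof. by move=> sf n; have := sf n.+1 => -[]. Qed.

Lemma derivable_cts f : (forall x, derivable f x 1) -> continuous f.
Proof. by move=> df x; apply/differentiable_continuous/derivable1_diffP/df. Qed.

Lemma smooth_cts f : smooth f -> continuous f.
Proof. by move=> sf; apply: derivable_cts => x; exact: smooth_derivable. Qed.

Lemma smoothnW n f : smoothn n.+1 f -> smoothn n f.
Proof.
elim: n f => [//|n IH] f [df /IH h]; by split.
Qed.

Lemma smoothnD n f g : smoothn n f -> smoothn n g -> smoothn n (f \+ g).
Proof.
elim: n f g => [//|n IH] f g [df sf] [dg sg]; split; first by move=> x; exact: derivableD.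
rewrite (_ : (f \+ g)^`()%classic = f^`()%classic \+ g^`()%classic); first exact: IH.
by apply/funext => x; rewrite /= !derive1E deriveD.
Qed.

Lemma smoothn_cst n c : smoothn n (cst c).
Proof.
elim: n c => [//|n IH] c; split; first by move=> x; exact: derivable_cst.
by rewrite (_ : (cst c)^`()%classic = cst 0) //; apply/funext => x; rewrite derive1_cst.
Qed.

Lemma smoothnM n f g : smoothn n f -> smoothn n g -> smoothn n (f \* g).
Proof.
elim: n f g => [//|n IH] f g [df sf] [dg sg]; split; first by move=> x; exact: derivableM.
rewrite (_ : (f \* g)^`()%classic = (f^`()%classic \* g) \+ (f \* g^`()%classic)).
  by apply: smoothnD; apply: IH => //; exact: smoothnW.
apply/funext => x; rewrite /= !derive1E; apply: etrans (deriveM (df x) (dg x)) _.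
by rewrite /GRing.scale/= addrC mulrC.
Qed.

Lemma smoothn_affine n f a b : smoothn n f -> smoothn n (fun x => f (a * x + b)).
Proof.
elim: n f => [//|n IH] f [df sf].
have D x : is_derive x (1 : R) (fun x : R => a * x + b) a.
  by apply: (is_derive_eq (is_deriveD _ _)); rewrite addr0 /GRing.scale /= mulr1.
have E x : is_derive x (1 : R) (fun x : R => f (a * x + b)) (a * f^`()%classic (a * x + b)).
    have Df : is_derive (a * x + b) (1 : R) f (f^`()%classic (a * x + b)).
      by rewrite derive1E; exact/derivableP/df.
    by apply: (is_derive_eq (@is_derive1_comp _ f (fun x : R => a * x + b) x _ _ Df (D x))); rewrite mulrC.
split; first by move=> x; case: (E x).
rewrite (_ : (fun x : R => _)^`()%classic = (cst a) \* (fun x => f^`()%classic (a * x + b))); last first.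
  by apply/funext => x; rewrite derive1E; case: (E x).
by apply: smoothnM; [exact: smoothn_cst|exact: IH].
Qed.

Lemma smoothnV n f : (forall x, f x != 0) -> smoothn n f -> smoothn n (fun x => (f x)^-1).
Proof.
move=> f0; elim: n => [//|n IH] sf; have [df sf'] := sf.
split; first by move=> x; exact: derivableV.
rewrite (_ : (fun x => _)^`()%classic =
  (cst (-1)) \* ((f^`())%classic \* ((fun x => (f x)^-1) \* (fun x => (f x)^-1)))).
  apply: smoothnM; first exact: smoothn_cst.
  by apply: smoothnM => //; apply: smoothnM; apply: IH; exact: smoothnW.
apply/funext => x; rewrite derive1E deriveV // /GRing.scale/= -derive1E.
by rewrite /= expr2 invfM; ring.
Qed.

Lemma smoothD f g : smooth f -> smooth g -> smooth (f \+ g).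
Proof. by move=> sf sg n; exact: smoothnD. Qed.
Lemma smoothM f g : smooth f -> smooth g -> smooth (f \* g).
Proof. by move=> sf sg n; exact: smoothnM. Qed.
Lemma smooth_cst c : smooth (cst c).
Proof. by move=> n; exact: smoothn_cst. Qed.
Lemma smooth_affine f a b : smooth f -> smooth (fun x => f (a * x + b)).
Proof. by move=> sf n; exact: smoothn_affine. Qed.
Lemma smoothV f : (forall x, f x != 0) -> smooth f -> smooth (fun x => (f x)^-1).
Proof. by move=> ? sf n; exact: smoothnV. Qed.

(* The functions p(1/x) exp(-1/x), extended by 0, are stable under derivation. *)
Definition flat (p : {poly R}) x := if 0 < x then p.[x^-1] * expR (- x^-1) else 0.

(** Since y^i <= i! e^y, the monomial of degree i contributes at most |p_i| i!. *)
Lemma horner_expRN_bounded (p : {poly R}) : exists C, forall y, 0 < y ->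
  `|p.[y] * expR (- y)| <= C.
Proof.
exists (\sum_(i < size p) `|p`_i| * (i`!)%:R) => y y0.
rewrite horner_coef mulr_suml; apply: le_trans (ler_norm_sum _ _ _) _.
apply: ler_sum => i _; rewrite -mulrA normrM ler_wpM2l// ger0_norm; last first.
  by rewrite mulr_ge0 ?expR_ge0// exprn_ge0// ltW.
rewrite expRN ler_pdivrMr ?expR_gt0//.
case: (nat_of_ord i) => [|n].
  by rewrite expr0 fact0 mul1r ltW// pexpR_gt1.
have := expR_ge1Dxn n (ltW y0).
rewrite -ler_pdivrMl ?ltr0n ?fact_gt0// mulrC; apply: le_trans.
by rewrite lerDr.
Qed.

(** For x > 0 the derivative of p(1/x) e^(-1/x) is x^-2 (p - p')(1/x) e^(-1/x), again of this form.
    At 0 the quadratic criterion applies, because y^2 p(y) e^(-y) is bounded, so that [flat p] is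
    O(h^2). *)
Lemma is_derive_flat (p : {poly R}) x :
  is_derive x 1 (flat p) (flat ('X^2 * (p - p^`()))%R x).
Proof.
case: (ltgtP x 0) => x0.
- rewrite /flat (lt_gtF x0); apply: (@near_eq_is_derive _ _ _ (cst (0:R))).
  near=> y; rewrite ifN// -leNgt ltW//.
  by near: y; exact: lt_nbhsl.
- rewrite {2}/flat x0.
  apply: (@near_eq_is_derive _ _ _ (fun x => p.[x^-1] * expR (- x^-1))).
    by near=> y; rewrite /flat ifT//; near: y; exact: lt_nbhsr.
  have xn0 : x != 0 by rewrite gt_eqF.
  have D1 : is_derive x (1:R) (fun x : R => x^-1) (- (x ^- 2)).
    apply: DeriveDef; first exact: (@derivableV _ R id x 1 xn0 (@derivable_id _ _ x 1)).
    by rewrite (@deriveV _ R id x 1 xn0 (@derivable_id _ _ x 1)) derive_id /GRing.scale/= mulr1.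
  have D2 : is_derive x (1:R) (horner p \o (fun x : R => x^-1)) (- (x ^- 2) * p^`().[x^-1]).
    apply: (is_derive_eq (is_derive1_comp _ _)).
    by rewrite mulrC.
  have D3 : is_derive x (1:R) (expR \o (fun x : R => - x^-1)) (x ^- 2 * expR (- x^-1)).
    apply: (is_derive_eq (is_derive1_comp _ _)).
    by rewrite opprK mulrC.
  apply: (is_derive_eq (is_deriveM D2 D3)).
  rewrite /GRing.scale/= hornerM hornerXn hornerD hornerN. field.
  by [].
rewrite x0 {2}/flat ltxx.
have [C HC] := horner_expRN_bounded ('X^2 * p)%R.
apply: (@is_derive_taylor _ _ _ `|C| 1) => // h _.
rewrite add0r mulr0 subr0 /flat ltxx subr0.
case: ifPn => h0; last by rewrite normr0 mulr_ge0 ?sqr_ge0.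
have hi : 0 < h^-1 by rewrite invr_gt0.
have := HC _ hi; rewrite hornerM hornerXn => H.
have -> : p.[h^-1] * expR (- h^-1) = h ^+ 2 * (h^-1 ^+ 2 * p.[h^-1] * expR (- h^-1)).
  have hn : h != 0 by rewrite gt_eqF.
  by field.
rewrite normrM ger0_norm ?sqr_ge0// mulrC ler_wpM2r ?sqr_ge0//.
exact: le_trans H (ler_norm C).
Unshelve. all: by end_near. Qed.

Lemma smooth_flat p : smooth (flat p).
Proof.
move=> n; elim: n p => [//|n IH] p; split.
  by move=> x; case: (is_derive_flat p x).
rewrite (_ : (flat p)^`()%classic = flat ('X^2 * (p - p^`()))%R) //.
by apply/funext => x; rewrite derive1E; case: (is_derive_flat p x).
Qed.

End SmoothStep.

Section StepAndTests.
Context {R : realType}.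
Implicit Types (f g a b : R -> R) (x : R).

(** Reduces directional derivatives to one-variable calculus, both for test functions on the plane
    and for [nu] on R^N. *)
Lemma is_derive_lineP (V : normedModType R) (f : V -> R) (p v : V) (s d : R) :
  is_derive s (1 : R) (fun s : R => f (p + s *: v)) d <-> is_derive (p + s *: v) v f d.
Proof.
have E : (fun h : R => h^-1 *: (((fun s : R => f (p + s *: v)) \o shift s) (h *: (1 : R)) - f (p + s *: v))) =
         (fun h : R => h^-1 *: ((f \o shift (p + s *: v)) (h *: v) - f (p + s *: v))).
  apply/funext => h /=; congr (_ *: (f _ - _)).
  by rewrite [h%:A]mulr1 scalerDl addrCA.
split=> -[H1 H2]; apply: DeriveDef.
- by rewrite /derivable -E.
- by rewrite /derive -E.
- by rewrite /derivable E.
- by rewrite /derive E.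
Qed.

Lemma derive1_locally_cst f x c : (\near x, f x = c) -> f^`()%classic x = 0.
Proof.
move=> H; rewrite derive1E (@near_eq_derive _ _ _ f (cst c)) ?derive_cst//.
Qed.

Lemma cts_bounded_support f (a b : R) : a <= b -> continuous f ->
  (forall x, x < a -> f x = 0) -> (forall x, b < x -> f x = 0) ->
  exists C, forall x, `|f x| <= C.
Proof.
move=> ab cf fa fb.
have cn : {within `[a, b], continuous (fun x => `|f x|)}.
  apply: continuous_subspaceT => x.
  by apply: cvg_norm; exact: cf.
have [c _ Hc] := EVT_max ab cn; exists `|f c| => x.
have [xa|xa] := ltP x a; first by rewrite fa// normr0.
have [bx|xb] := ltP b x; first by rewrite fb// normr0.
by apply: Hc; rewrite in_itv/= xa.
Qed.

Definition is_step (H : R -> R) (C : R) :=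
  [/\ smooth H, forall z, z <= 0 -> H z = 0, forall z, 1 <= z -> H z = 1,
      {homo H : x y / x <= y} &
      forall z, `|H^`()%classic z| <= C /\ `|H^`()%classic^`()%classic z| <= C].

Lemma flat1E x : flat (1%:P : {poly R}) x = if 0 < x then expR (- x^-1) else 0.
Proof. by rewrite /flat hornerC mul1r. Qed.

Lemma flat1_ge0 x : 0 <= flat (1%:P : {poly R}) x.
Proof. by rewrite flat1E; case: ifP => // _; exact: expR_ge0. Qed.

Lemma flat1_gt0 x : 0 < x -> 0 < flat (1%:P : {poly R}) x.
Proof. by rewrite flat1E => ->; exact: expR_gt0. Qed.

Lemma flat1_le0 x : x <= 0 -> flat (1%:P : {poly R}) x = 0.
Proof. by rewrite flat1E leNgt => /negbTE ->. Qed.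

Lemma flat1_homo x y : x <= y -> flat (1%:P : {poly R}) x <= flat (1%:P : {poly R}) y.
Proof.
move=> xy; have [x0|x0] := leP x 0; first by rewrite flat1_le0// flat1_ge0.
have y0 := lt_le_trans x0 xy.
by rewrite !flat1E x0 y0 ler_expR lerN2 lef_pV2.
Qed.

(** The quotient h(x) / (h(x) + h(1 - x)) with h(x) = e^(-1/x) on the positive half-line. Cross
    multiplication reduces its monotonicity to h(x) h(1 - y) <= h(y) h(1 - x) for x <= y. Its
    derivatives vanish outside [0, 1], so compactness bounds them. *)
Lemma smooth_step_exists : exists H C, is_step H C.
Proof.
pose h := flat (1%:P : {poly R}).
pose D x := h x + h (1 - x).
have D0 x : 0 < D x.
  have [x0|x0] := leP x 0; rewrite /D.
    by rewrite ltr_wpDl ?flat1_ge0// flat1_gt0// subr_gt0 (le_lt_trans x0).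
  by rewrite ltr_wpDr ?flat1_ge0// flat1_gt0.
have sh : smooth h by exact: smooth_flat.
have sh' : smooth (fun x => h (1 - x)).
  have := smooth_affine (-1) 1 sh; congr smooth.
  by apply/funext => x; rewrite mulN1r addrC.
pose H := h \* (fun x => (D x)^-1).
have sH : smooth H.
  apply: smoothM => //; apply: smoothV; first by move=> x; rewrite gt_eqF.
  exact: smoothD.
have H0 z : z <= 0 -> H z = 0 by move=> z0; rewrite /H /= /h flat1_le0// mul0r.
have H1 z : 1 <= z -> H z = 1.
  move=> z1; rewrite /H /= /D /h (@flat1_le0 (1 - z)) ?subr_le0// addr0 divff//.
  by rewrite gt_eqF// flat1_gt0// (lt_le_trans _ z1).
have Hm : {homo H : x y / x <= y}.
  move=> x y xy; rewrite /H /= ler_pdivrMr// mulrAC ler_pdivlMr// /D !mulrDr.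
  rewrite [h y * h x]mulrC lerD2l.
  by apply: ler_pM; rewrite ?flat1_ge0 ?flat1_homo// lerB.
have z0 x : x < 0 -> \near x, H^`()%classic x = 0.
  move=> x0; near=> y; apply: (@derive1_locally_cst _ _ 0); near=> z.
  rewrite H0// ltW//; near: z; apply: lt_nbhsl.
  by near: y; exact: lt_nbhsl.
have z1 x : 1 < x -> \near x, H^`()%classic x = 0.
  move=> x0; near=> y; apply: (@derive1_locally_cst _ _ 1); near=> z.
  rewrite H1// ltW//; near: z; apply: lt_nbhsr.
  by near: y; exact: lt_nbhsr.
have [C1 HC1] : exists C, forall x, `|H^`()%classic x| <= C.
  apply: (@cts_bounded_support _ 0 1) => //.
  - exact/smooth_cts/smooth_derive1.
  - by move=> x /z0 /nbhs_singleton.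
  - by move=> x /z1 /nbhs_singleton.
have [C2 HC2] : exists C, forall x, `|H^`()%classic^`()%classic x| <= C.
  apply: (@cts_bounded_support _ 0 1) => //.
  - exact/smooth_cts/smooth_derive1/smooth_derive1.
  - by move=> x /z0; exact: derive1_locally_cst.
  - by move=> x /z1; exact: derive1_locally_cst.
exists H, (Num.max C1 C2); split=> // z.
by split; rewrite le_max ?HC1// HC2 orbT.
Unshelve. all: by end_near. Qed.

(** A single product a(t) b(x) is not stable under directional derivatives, finite sums of products
    are. This is the class on which the induction over iterated derivatives runs. *)
Inductive tensor_sum : (R * R -> R) -> Prop :=
| tensor_sum0 : tensor_sum (cst 0)
| tensor_sumS a b F : smooth a -> smooth b -> tensor_sum F ->
    tensor_sum (fun z => a z.1 * b z.2 + F z).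

Lemma tensor_sum_continuous F : tensor_sum F -> continuous F.
Proof.
elim=> [|a b {}F sa sb _ cF] z; first exact: cvg_cst.
apply: cvgD; last exact: cF.
apply: cvgM.
  by apply: (@continuous_comp _ _ _ fst a); [exact: cvg_fst|exact: smooth_cts].
by apply: (@continuous_comp _ _ _ snd b); [exact: cvg_snd|exact: smooth_cts].
Qed.

Lemma is_derive_tensor a b (z v : R * R) : smooth a -> smooth b ->
  is_derive z v (fun z : R * R => a z.1 * b z.2)
   (v.1 * a^`()%classic z.1 * b z.2 + v.2 * a z.1 * b^`()%classic z.2).
Proof.
move=> sa sb.
rewrite -[X in is_derive X](addr0 z) -(scale0r v); apply/is_derive_lineP => /=.
have L (p q : R) : is_derive (0 : R) (1 : R) (fun s : R => p + s * q) q.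
  apply: (is_derive_eq (is_deriveD _ _)).
  by rewrite add0r /GRing.scale/= mulr0 add0r mulr1.
have Da : is_derive (0 : R) (1 : R) (a \o (fun s => z.1 + s * v.1)) (a^`()%classic z.1 * v.1).
  apply: is_derive1_comp; rewrite mul0r addr0; exact: smooth_is_derive.
have Db : is_derive (0 : R) (1 : R) (b \o (fun s => z.2 + s * v.2)) (b^`()%classic z.2 * v.2).
  apply: is_derive1_comp; rewrite mul0r addr0; exact: smooth_is_derive.
apply: (is_derive_eq (is_deriveM Da Db)).
by rewrite /GRing.scale/= !mul0r !addr0; ring.
Qed.

Lemma tensor_sum_derive F (v : R * R) : tensor_sum F ->
  (forall z, derivable F z v) /\ tensor_sum (fun z => 'D_v F z).
Proof.
elim=> [|a b {}F sa sb _ [dF tF]].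
  split; first by move=> z; exact: derivable_cst.
  suff -> : (fun z : R * R => 'D_v (cst (0 : R)) z) = cst 0 by exact: tensor_sum0.
  apply/funext => z; rewrite derive_cst. by [].
have D z := is_derive_tensor z v sa sb.
split.
  by move=> z; apply: derivableD => //; case: (D z).
rewrite (_ : (fun z => _) = (fun z => (cst v.1 \* a^`()%classic) z.1 * b z.2 +
   ((cst v.2 \* a) z.1 * b^`()%classic z.2 + 'D_v F z))).
  apply: tensor_sumS => //.
    by apply: smoothM; [exact: smooth_cst|exact: smooth_derive1].
  apply: tensor_sumS => //; last exact: smooth_derive1.
  by apply: smoothM => //; exact: smooth_cst.
apply/funext => z; have dz : derivable (fun z : R * R => a z.1 * b z.2) z v by case: (D z).
rewrite (deriveD dz (dF z)).
by case: (D z) => _ ->; rewrite addrA.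
Qed.

Lemma tensor_Cinfty a b : smooth a -> smooth b -> Cinfty (fun z : R * R => a z.1 * b z.2).
Proof.
move=> sa sb n w _.
have : tensor_sum (iter_derive w (fun z : R * R => a z.1 * b z.2)).
  elim: w => [|v w IH] /=; last by have [] := tensor_sum_derive v IH.
  rewrite (_ : (fun z => _) = (fun z => a z.1 * b z.2 + cst 0 z)).
    by apply: tensor_sumS => //; exact: tensor_sum0.
  by apply/funext => z; rewrite addr0.
move=> H; split; first exact: tensor_sum_continuous.
by move=> _ z v; have [] := tensor_sum_derive v H.
Qed.

Lemma support_in_closed (V : normedModType R) (f : V -> R) (A : set V) : closed A ->
  (forall z, f z != 0 -> A z) -> closure [set z | f z != 0] `<=` A.
Proof.
move=> cA fA; rewrite [X in _ `<=` X](_ : A = closure A); last exact/closure_id.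
by apply: closureS => z; exact: fA.
Qed.

Lemma tensor_test_fun (T p q r s : R) a b : q < T ->
  smooth a -> smooth b -> (forall x, 0 <= b x) -> (forall x, 0 <= x -> 0 <= a x) ->
  (forall x, a x != 0 -> p <= x <= q) -> (forall x, b x != 0 -> r <= x <= s) ->
  test_fun T (fun z : R * R => a z.1 * b z.2).
Proof.
move=> qT sa sb b0 a0 ap bp.
have cK : compact (`[p, q]%classic `*` `[r, s]%classic : set (R * R)).
  by apply: compact_setX; exact: segment_compact.
have cl : closure [set z : R * R | a z.1 * b z.2 != 0] `<=` `[p, q] `*` `[r, s].
  apply: (@support_in_closed (R * R)%type).
    by apply: compact_closed => //; exact: norm_hausdorff.
  move=> [x y]/=; rewrite mulf_eq0 negb_or => /andP[/ap ? /bp ?].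
  by rewrite !in_itv/=.
split.
- exact: tensor_Cinfty.
- apply: (subclosed_compact _ _ cl); first exact: closed_closure.
  by apply: compact_setX; exact: segment_compact.
- move=> z /cl [] /=; rewrite in_itv/= => /andP[_ zq] _; exact: le_lt_trans zq qT.
- by move=> z z0; rewrite mulr_ge0// a0.
Qed.

End StepAndTests.

(** * Integrals of real functions *)

Section IntegralToolbox.
Context d (T : measurableType d) (R : realType) (mu : {measure set T -> \bar R}).
Variables (D : set T) (mD : measurable D).
Implicit Types f g h : T -> R.

Definition L1 f := mu.-integrable D (EFin \o f).
Local Notation Int f := (\int[mu]_(x in D) f x).

Lemma L1_meas f : L1 f -> measurable_fun D f.
Proof. by move/measurable_int/measurable_EFinP. Qed.

Lemma L1_eq f g : (forall x, D x -> f x = g x) -> L1 f -> L1 g.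
Proof.
by move=> fg; apply: eq_integrable => // x; rewrite inE => Dx; rewrite /= fg.
Qed.

Lemma L1_le f g : measurable_fun D f -> (forall x, D x -> `|f x| <= g x) ->
  L1 g -> L1 f.
Proof.
move=> mf fg; apply: le_integrable => //; first exact/measurable_EFinP.
by move=> x Dx /=; rewrite lee_fin (le_trans (fg _ Dx))// ler_norm.
Qed.

Lemma L1D f g : L1 f -> L1 g -> L1 (fun x => f x + g x).
Proof. by move=> Lf Lg; have := integrableD mD Lf Lg; apply: eq_integrable. Qed.

Lemma L1N f : L1 f -> L1 (fun x => - f x).
Proof. by move=> Lf; have := integrableN Lf; apply: eq_integrable. Qed.

Lemma L1B f g : L1 f -> L1 g -> L1 (fun x => f x - g x).
Proof. by move=> Lf Lg; apply: (@L1D f (fun x => - g x)) => //; exact: L1N. Qed.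

Lemma L1Z k f : L1 f -> L1 (fun x => k * f x).
Proof. by move=> Lf; have := integrableZl mD k Lf; apply: eq_integrable. Qed.

Lemma L1_0 : L1 (fun=> 0).
Proof. exact: integrable0. Qed.

Lemma L1_sum (I : Type) (s : seq I) (P : pred I) (h : I -> T -> R) :
  (forall i, L1 (h i)) -> L1 (fun x => \sum_(i <- s | P i) h i x).
Proof.
move=> Lh; elim: s => [|i s IH].
  by under [X in L1 X]eq_fun do rewrite big_nil; exact: L1_0.
under [X in L1 X]eq_fun do rewrite big_cons.
by case: (P i) => //; exact: L1D.
Qed.

Lemma L1_abs f : L1 f -> L1 (fun x => `|f x|).
Proof. exact: integrable_norm. Qed.

Lemma L1_bM h f C : measurable_fun D h -> (forall x, D x -> `|h x| <= C) ->
  L1 f -> L1 (fun x => h x * f x).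
Proof.
move=> mh hC Lf; apply: (@L1_le _ (fun x => C * `|f x|)).
- by apply: measurable_funM => //; exact: L1_meas.
- by move=> x Dx; rewrite normrM ler_wpM2r// hC.
- exact/L1Z/L1_abs.
Qed.

Lemma int_sum (I : Type) (s : seq I) (P : pred I) (h : I -> T -> R) :
  (forall i, L1 (h i)) ->
  Int (fun x => \sum_(i <- s | P i) h i x) = \sum_(i <- s | P i) Int (h i).
Proof.
move=> Lh; elim: s => [|i s IH].
  rewrite big_nil; under eq_Rintegral do rewrite big_nil.
  by rewrite Rintegral_cst// mul0r.
rewrite big_cons; under eq_Rintegral do rewrite big_cons.
case: (P i) => //; rewrite RintegralD// ?IH//; first exact: Lh.
exact: L1_sum.
Qed.

Lemma int_absle f g : L1 f -> L1 g -> (forall x, D x -> `|f x| <= g x) ->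
  `|Int f| <= Int g.
Proof.
move=> Lf Lg fg; apply: (le_trans (le_normr_Rintegral mD Lf)).
by apply: le_Rintegral => //; exact: L1_abs.
Qed.

Lemma EFin_int f : L1 f -> (Int f)%:E = (\int[mu]_(x in D) (f x)%:E)%E.
Proof. by move=> Lf; rewrite /Rintegral fineK//; exact: integrable_fin_num. Qed.

Lemma L1_ge0 f M : measurable_fun D f -> (forall x, D x -> 0 <= f x) ->
  (\int[mu]_(x in D) (f x)%:E <= M%:E)%E -> L1 f /\ Int f <= M.
Proof.
move=> mf f0 fM.
have Lf : L1 f.
  apply/integrableP; split; first exact/measurable_EFinP.
  apply: le_lt_trans (ltry M); apply: le_trans fM.
  rewrite le_eqVlt; apply/orP; left; apply/eqP; apply: eq_integral => x.
  by rewrite inE => Dx /=; rewrite ger0_norm// f0.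
by split => //; rewrite -lee_fin EFin_int.
Qed.

End IntegralToolbox.

Section LebesgueToolbox.
Context {R : realType}.
Local Notation leb := (@lebesgue_measure R).
Implicit Types f g h : R -> R.

(* Monomorphic copies of the lemmas above: unification does not always see through
   the two convertible measurable structures carried by R. *)
Definition LI (D : set R) f := L1 leb D f.

Lemma LI_meas D f : LI D f -> measurable_fun D f.
Proof. exact: L1_meas. Qed.

Lemma LI_eq D f g : measurable D -> (forall x, D x -> f x = g x) -> LI D f -> LI D g.
Proof. by move=> mD; exact: (@L1_eq _ _ _ leb D mD). Qed.

Lemma LI_le D f g : measurable D -> measurable_fun D f ->
  (forall x, D x -> `|f x| <= g x) -> LI D g -> LI D f.
Proof. by move=> mD; exact: (@L1_le _ _ _ leb D mD). Qed.

Lemma LID D f g : measurable D -> LI D f -> LI D g -> LI D (fun x => f x + g x).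
Proof. by move=> mD; exact: (@L1D _ _ _ leb D mD). Qed.

Lemma LIB D f g : measurable D -> LI D f -> LI D g -> LI D (fun x => f x - g x).
Proof. by move=> mD; exact: (@L1B _ _ _ leb D mD). Qed.

Lemma LIZ D k f : measurable D -> LI D f -> LI D (fun x => k * f x).
Proof. by move=> mD; exact: (@L1Z _ _ _ leb D mD k f). Qed.

Lemma LI_sum D (I : Type) (s : seq I) (P : pred I) (h : I -> R -> R) : measurable D ->
  (forall i, LI D (h i)) -> LI D (fun x => \sum_(i <- s | P i) h i x).
Proof. by move=> mD; exact: (@L1_sum _ _ _ leb D mD). Qed.

Lemma LI_abs D f : LI D f -> LI D (fun x => `|f x|).
Proof. exact: L1_abs. Qed.

Lemma LI_bM D h f C : measurable D -> measurable_fun D h ->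
  (forall x, D x -> `|h x| <= C) -> LI D f -> LI D (fun x => h x * f x).
Proof. by move=> mD; exact: (@L1_bM _ _ _ leb D mD). Qed.

Lemma LI_int_absle D f g : measurable D -> LI D f -> LI D g ->
  (forall x, D x -> `|f x| <= g x) ->
  `|\int[leb]_(x in D) f x| <= \int[leb]_(x in D) g x.
Proof. by move=> mD; exact: (@int_absle _ _ _ leb D mD). Qed.

Lemma LI_int_le D f g : measurable D -> LI D f -> LI D g ->
  (forall x, D x -> f x <= g x) ->
  \int[leb]_(x in D) f x <= \int[leb]_(x in D) g x.
Proof. by move=> mD Lf Lg; exact: (@le_Rintegral _ _ _ leb D f g mD Lf Lg). Qed.

Lemma LI_intD D f g : measurable D -> LI D f -> LI D g ->
  \int[leb]_(x in D) (f x + g x) = \int[leb]_(x in D) f x + \int[leb]_(x in D) g x.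
Proof. by move=> mD; exact: (@RintegralD _ _ _ leb D f g mD). Qed.

Lemma LI_intB D f g : measurable D -> LI D f -> LI D g ->
  \int[leb]_(x in D) (f x - g x) = \int[leb]_(x in D) f x - \int[leb]_(x in D) g x.
Proof. by move=> mD; exact: (@RintegralB _ _ _ leb D f g mD). Qed.

Lemma LI_intZ D k f : measurable D -> LI D f ->
  \int[leb]_(x in D) (k * f x) = k * \int[leb]_(x in D) f x.
Proof. by move=> mD; exact: (@RintegralZl _ _ _ leb D f k mD). Qed.

Lemma LI_int_sum D (I : Type) (s : seq I) (P : pred I) (h : I -> R -> R) : measurable D ->
  (forall i, LI D (h i)) ->
  \int[leb]_(x in D) (\sum_(i <- s | P i) h i x) = \sum_(i <- s | P i) \int[leb]_(x in D) (h i x).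
Proof. by move=> mD; exact: (@int_sum _ _ _ leb D mD). Qed.

Lemma LI_ge0 D f M : measurable D -> measurable_fun D f -> (forall x, D x -> 0 <= f x) ->
  (\int[leb]_(x in D) (f x)%:E <= M%:E)%E -> LI D f /\ \int[leb]_(x in D) f x <= M.
Proof. by move=> mD; exact: (@L1_ge0 _ _ _ leb D mD). Qed.

Lemma EFin_intI D f : measurable D -> LI D f ->
  (\int[leb]_(x in D) f x)%:E = (\int[leb]_(x in D) (f x)%:E)%E.
Proof. by move=> mD; exact: (@EFin_int _ _ _ leb D mD f). Qed.

Lemma cts_measurable (D : set R) f : continuous f -> measurable_fun D f.
Proof. by move=> cf; apply: measurable_funTS; apply: continuous_measurable_fun. Qed.

Lemma itv_mu_fin (a b : R) : (leb `[a, b] < +oo)%E.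
Proof. by rewrite lebesgue_measure_itv/= lte_fin; case: ifP; rewrite -?EFinB ltry. Qed.

(** Uniqueness of Lebesgue measure: c times its image under x -> c x + a agrees with it on half-open
    intervals. *)
Lemma ge0_integral_affine (f : R -> \bar R) (c a : R) : 0 < c ->
  measurable_fun setT f -> (forall x, (0 <= f x)%E) ->
  (\int[leb]_x f (c * x + a)%R = (c^-1)%:E * \int[leb]_x f x)%E.
Proof.
move=> c0 mf f0.
pose phi (x : measurableTypeR R) : measurableTypeR R := c * x + a.
have mphi : measurable_fun setT phi.
  by apply: measurable_funD => //; exact: measurable_funM.
pose Phi : {measure set (measurableTypeR R) -> \bar R} :=
  measure_function_pushforward__canonical__measure_function_Measure leb mphi.
have E A : measurable A -> leb A = (c%:E * pushforward leb phi A)%E.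
  pose m := mscale (NngNum (ltW c0)) Phi.
  have := @lebesgue_measure_unique R m; apply.
  move=> _ [[x y] _ <-]; change (leb `]x, y] = c%:E * leb (phi @^-1` `]x, y]))%E.
  have -> : phi @^-1` `]x, y] = `](x - a) / c, (y - a) / c]%classic.
    apply/seteqP; split=> z/=; rewrite !in_itv/= /phi ltr_pdivrMr// ler_pdivlMr//;
    by rewrite ltrBlDr lerBrDr mulrC.
  rewrite !lebesgue_measure_itv/= !lte_fin ltr_pM2r ?invr_gt0// ltrD2r.
  case: ifP => _; last by rewrite mule0.
  rewrite -EFinB -EFinM; congr (_%:E); field; by rewrite gt_eqF.
have -> : (\int[leb]_x f (c * x + a)%R = \int[pushforward leb phi]_x f x)%E.
  by rewrite ge0_integral_pushforward.
rewrite [in RHS](@eq_measure_integral _ _ _ _ (mscale (NngNum (ltW c0)) Phi)).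
  rewrite ge0_integral_mscale//= muleA -EFinM mulVf ?mul1e// gt_eqF//.
by move=> A mA _; exact: E.
Qed.

Lemma ge0_integral_shift (f : R -> \bar R) (a : R) :
  measurable_fun setT f -> (forall x, (0 <= f x)%E) ->
  (\int[leb]_x f (x + a)%R = \int[leb]_x f x)%E.
Proof.
move=> mf f0; have := @ge0_integral_affine f 1 a ltr01 mf f0.
by rewrite invr1 mul1e => <-; under [in RHS]eq_integral do rewrite mul1r.
Qed.

Lemma measurable_shift f (a : R) : measurable_fun setT f ->
  measurable_fun setT (fun x : R => f (x + a)).
Proof.
move=> mf; apply: (@measurableT_comp _ _ _ _ _ _ f) => //.
exact: measurable_funD.
Qed.

Lemma L1_shift f (a : R) : LI setT f -> LI setT (fun x : R => f (x + a)).
Proof.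
move=> Lf; have mf := L1_meas Lf; apply/integrableP; split.
  by apply/measurable_EFinP; apply: (measurable_shift a mf).
case/integrableP: Lf => _; apply: le_lt_trans.
rewrite -(@ge0_integral_shift (fun x => `|(f x)%:E|)%E a)//.
by apply: measurableT_comp => //; exact/measurable_EFinP.
Qed.

Lemma int_shift f (a : R) : LI setT f ->
  \int[leb]_x f (x + a) = \int[leb]_x f x.
Proof.
move=> Lf; have mf := L1_meas Lf.
rewrite /Rintegral; congr fine; rewrite integralE [in RHS]integralE.
have mE : measurable_fun setT (EFin \o f) by apply/measurable_EFinP.
have Ep := @ge0_integral_shift (EFin \o f)^\+%E a (measurable_funepos mE) (fun=> funepos_ge0 _ _).
have En := @ge0_integral_shift (EFin \o f)^\-%E a (measurable_funeneg mE) (fun=> funeneg_ge0 _ _).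
by rewrite -Ep -En; congr (_ - _)%E; apply: eq_integral => x _; rewrite ?funeposE ?funenegE.
Qed.

Lemma int_itv_indic (a b c : R) : a <= b ->
  LI setT (\1_(`[a, b]%classic) : R -> R) /\
  \int[leb]_x (\1_(`[a, b]%classic) x : R) = b - a.
Proof.
move=> ab; split.
  exact: (@integrable_indic_itv R a b true false).
rewrite /Rintegral integral_indic//= setIT lebesgue_measure_itv/= lte_fin.
by case: ltgtP ab => //= -> _; rewrite subrr.
Qed.

Lemma measurable_floor_comp (g : int -> R) f : measurable_fun setT f ->
  measurable_fun setT (fun x : R => g (Num.floor (f x))).
Proof.
move=> mf.
have mfl : measurable_fun setT (fun y : R => g (Num.floor y)).
  move=> _ Y mY; rewrite setTI.
  have -> : (fun y : R => g (Num.floor y)) @^-1` Y =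
     \bigcup_(i : int) (if pselect (Y (g i)) then `[i%:~R, (i + 1)%:~R[%classic else set0).
    apply/seteqP; split => [y /= Yy|y [i _]].
      by exists (Num.floor y) => //=; case: pselect => //= _; rewrite in_itv/= floor_le floorD1_gt.
    by case: pselect => //= Yi; rewrite in_itv/= => /floor_def ->.
  apply: countable_bigcupT_measurable; first exact: countableP.
  by move=> i; case: pselect => _ /=; [exact: measurable_itv|exact: measurable0].
exact: (@measurableT_comp _ _ _ _ _ _ (fun y : R => g (Num.floor y))).
Qed.

End LebesgueToolbox.

Section Strips.
Context {R : realType}.
Local Notation leb := (@lebesgue_measure R).
Variables (A : set R) (mA : measurable A).

Lemma measurable_strip : measurable (A `*` [set: R]).
Proof. exact: measurableX. Qed.

Lemma measurable_strip_section (F : R * R -> R) t :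
  measurable_fun (A `*` [set: R]) F -> A t -> measurable_fun setT (fun x => F (t, x)).
Proof.
move=> mF At; have := @measurable_fun_pair1 _ _ _ _ _ _ (F \_ (A `*` [set: R])) t.
have mF' : measurable_fun setT (F \_ (A `*` [set: R])).
  by apply/(measurable_restrictT _ measurable_strip).
move=> H; have := measurableT_comp mF' (@pair1_measurable _ _ R R t).
apply: eq_measurable_fun => x _ /=; rewrite patchE ifT//.
by rewrite inE; split.
Qed.

Lemma tonelli_strip (F : R * R -> R) (M a : R) :
  measurable_fun (A `*` [set: R]) F -> (forall z, 0 <= F z) -> (leb A <= a%:E)%E ->
  (forall t, A t -> LI setT (fun x => F (t, x)) /\ \int[leb]_x F (t, x) <= M) -> 0 <= M ->
  L1 (leb \x leb)%E (A `*` [set: R]) F.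
Proof.
move=> mF F0 Aa FM M0.
have mS := measurable_strip.
pose G := (EFin \o F) \_ (A `*` [set: R]).
have mG : measurable_fun setT G.
  by apply/(measurable_restrictT _ mS); exact/measurable_EFinP.
have G0 z : (0 <= G z)%E by rewrite /G patchE; case: ifP => //= _; rewrite lee_fin.
suff H : (\int[(leb \x leb)%E]_(z in A `*` [set: R]) (F z)%:E <= (M * a)%:E)%E.
  by have [] := @L1_ge0 _ _ _ (leb \x leb)%E _ mS F _ mF (fun z _ => F0 z) H.
rewrite integral_mkcond fubini_tonelli1//.
apply: (@le_trans _ _ (\int[leb]_t (M%:E * (\1_A t)%:E))%E).
  apply: ge0_le_integral.
  - exact: measurableT.
  - by move=> t _; apply: integral_ge0.
  - exact: measurable_fun_fubini_tonelli_F.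
  - by apply: measurable_funeM; apply/measurable_EFinP.
  move=> t _; rewrite /fubini_F.
  have [At|nAt] := pselect (A t).
    have [FL FI] := FM _ At.
    rewrite indicE mem_set// mule1; apply: le_trans (_ : (\int[leb]_x F (t, x))%:E <= _)%E; last by rewrite lee_fin.
    rewrite (EFin_intI measurableT FL); rewrite le_eqVlt; apply/orP; left; apply/eqP.
    apply: eq_integral => x _; rewrite patchE ifT//.
    by rewrite inE; split.
  rewrite indicE memNset// mule0; rewrite le_eqVlt; apply/orP; left; apply/eqP.
  apply: integral0_eq => x _; rewrite patchE ifF//.
  by apply/negbTE; rewrite notin_setE => -[].
rewrite ge0_integralZl//; last exact/measurable_EFinP.
by rewrite integral_indic// setIT EFinM; apply: lee_wpmul2l.
Qed.

Lemma fubini_strip (F : R * R -> R) : L1 (leb \x leb)%E (A `*` [set: R]) F ->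
  (forall t, A t -> LI setT (fun x => F (t, x))) ->
  LI A (fun t => \int[leb]_x F (t, x)) /\
  \int[(leb \x leb)%E]_(z in A `*` [set: R]) F z = \int[leb]_(t in A) \int[leb]_x F (t, x).
Proof.
move=> LF Lt; have mS := measurable_strip.
pose G := (EFin \o F) \_ (A `*` [set: R]).
have iG : (leb \x leb)%E.-integrable setT G.
  by have [H _] := integrable_mkcond (mu := (leb \x leb)%E) (EFin \o F) mS; exact: H.
have E t : (fubini_F leb G t = ((fun t => (\int[leb]_x F (t, x))%:E) \_ A) t)%E.
  rewrite /fubini_F patchE; case: ifPn => [/set_mem At|/negP nAt].
    rewrite (EFin_intI measurableT (Lt _ At)); apply: eq_integral => x _.
    by rewrite /G patchE ifT// inE; split.
  apply: integral0_eq => x _; rewrite /G patchE ifF//; apply/negP => /set_mem [At _].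
  by apply: nAt; rewrite inE.
have EF : fubini_F leb G = (fun t => (\int[leb]_x F (t, x))%:E) \_ A by apply/funext.
split.
  have [_ H] := integrable_mkcond (mu := leb) (EFin \o (fun t => \int[leb]_x F (t, x))) mA.
  by apply: H; apply: eq_integrable (integrable_fubini_F iG) => // t _; exact: E.
rewrite [LHS]/Rintegral [RHS]/Rintegral; congr fine.
rewrite [LHS]integral_mkcond [RHS]integral_mkcond -(integral12_prod_meas1 iG).
by apply: eq_integral => t _; exact: E.
Qed.

End Strips.

Lemma homo_derive1_ge0 {R : realType} (f : R -> R) (x : R) : (forall x, derivable f x 1) ->
  {homo f : x y / x <= y} -> 0 <= f^`()%classic x.
Proof.
move=> df fm; apply/ler_addgt0Pr => e e0.
(* The tilt by e y makes the function strictly increasing; e is arbitrary, so the sign survives its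
   removal. *)
pose g := f \+ (fun y => e * y).
have D y : is_derive y (1 : R) (fun y : R => e * y) e.
  by apply: (is_derive_eq (is_deriveZ _ _)); rewrite /GRing.scale/= mulr1.
have Dg y : is_derive y (1 : R) g (f^`()%classic y + e).
  by rewrite derive1E; apply: is_deriveD; exact: derivableP.
have : 0 <= g^`()%classic x.
  apply: (@incr_derive1_ge0 _ g setT); first by move=> y _; case: (Dg y).
    by move=> y z _ _ yz; rewrite /g/= ler_ltD ?ltr_pM2l// fm// ltW.
  by rewrite interiorT.
by rewrite derive1E; case: (Dg x) => _ ->.
Qed.

Lemma int_derive1_smooth {R : realType} (F : R -> R) (b : R) : 0 < b -> smooth F ->
  LI `]0, b[ F^`()%classic /\
  \int[lebesgue_measure]_(t in `]0, b[) F^`()%classic t = F b - F 0.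
Proof.
move=> b0 sF; have cF' := smooth_cts (smooth_derive1 sF); have cF := smooth_cts sF.
have cw : {within `[0, b], continuous F^`()%classic} by exact: continuous_subspaceT.
have LF : LI `[0, b] F^`()%classic by apply: continuous_compact_integrable => //; exact: segment_compact.
have Lo : LI `[0, b[ F^`()%classic.
  by apply: integrableS LF => // t; rewrite /= !in_itv/= => /andP[-> /ltW ->].
have Loo : LI `]0, b[ F^`()%classic.
  by apply: integrableS LF => // t; rewrite /= !in_itv/= => /andP[/ltW -> /ltW ->].
split=> //.
rewrite Rintegral_itv_obnd_cbnd// Rintegral_itv_bndo_bndc// /Rintegral.
rewrite (continuous_FTC2 b0 cw (F := F))//.
by split; [move=> x _; exact: smooth_derivable|apply: cvg_at_right_filter; exact: cF|apply: cvg_at_left_filter; exact: cF].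
Qed.

Section CtL1Facts.
Context {R : realType}.
Local Notation leb := (@lebesgue_measure R).
Variables (T : R) (u : R -> R -> R).
Hypotheses (T0 : 0 < T) (uL : forall t, 0 <= t <= T -> LI setT (u t)) (uC : CtL1 T u).

Lemma CtL1_near t e : 0 <= t <= T -> 0 < e -> exists2 d, 0 < d &
  forall s, 0 <= s <= T -> `|s - t| < d -> \int[leb]_x `|u s x - u t x| < e.
Proof.
move=> tT e0; have H := uC tT.
have N : nbhs (0%E : \bar R) [set y | (y < e%:E)%E].
  by apply: open_nbhs_nbhs; split; [exact: open_ereal_lt_ereal|rewrite /= lte_fin].
have := H _ N; rewrite /nbhs/= => -[d /= d0 Hd].
exists d => // s sT sd.
have := Hd s; rewrite /ball/= distrC => /(_ sd).
rewrite in_itv/= => /(_ sT).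
by rewrite -EFin_intI// ?lte_fin//; apply: LI_abs => //; apply: LIB => //; exact: uL.
Qed.

Lemma CtL1_bounded : exists K, 0 <= K /\ forall t, 0 <= t <= T -> \int[leb]_x `|u t x| <= K.
Proof.
have cn : {within `[0, T], continuous (fun t => \int[leb]_x `|u t x|)}.
  apply/subspace_continuousP => t; rewrite /= in_itv/= => tT.
  apply/cvgrPdist_lt => e e0.
  have [d d0 Hd] := CtL1_near tT e0.
  rewrite near_withinE; near=> s; rewrite /= in_itv/= => sT.
  apply: le_lt_trans (Hd s sT _); last by rewrite distrC; near: s; apply: cvgr_dist_lt.
  have Lt := uL tT; have Ls := uL sT.
  rewrite -LI_intB//; [|exact: LI_abs..].
  apply: LI_int_absle => //.
  - by apply: LIB => //; exact: LI_abs.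
  - by apply: LI_abs => //; exact: LIB.
  - by move=> x _; rewrite distrC ler_dist_dist.
have [c _ Hc] := EVT_max (ltW T0) cn.
exists (`|\int[leb]_x `|u c x| |); split=> // t tT.
by apply: le_trans (Hc t _) (ler_norm _); rewrite in_itv.
Unshelve. all: by end_near. Qed.

End CtL1Facts.

(** * The Kruzkov inequality at a fixed time *)

Section KruzkovLocal.
Context {R : realType}.
Local Notation leb := (@lebesgue_measure R).

Lemma lipschitz_cts (f : R -> R) (L : R) : (forall a b, `|f a - f b| <= L * `|a - b|) ->
  continuous f.
Proof.
move=> fL x; apply/cvgrPdist_lt => e e0; near=> y.
apply: le_lt_trans (fL x y) _.
apply: (@le_lt_trans _ _ ((`|L| + 1) * `|x - y|)).
  by rewrite ler_wpM2r// (le_trans (ler_norm L))// lerDl.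
rewrite mulrC -ltr_pdivlMr ?ltr_wpDl//.
near: y; apply: cvgr_dist_lt; first exact: cvg_id.
by rewrite divr_gt0// ltr_wpDl.
Unshelve. all: by end_near. Qed.

Lemma sg_homo : {homo (@Num.sg R) : x y / x <= y}.
Proof.
move=> x y xy; case: (sgrP x) => hx; case: (sgrP y) => hy; subst; try lra.
Qed.

Lemma measurable_sg (D : set R) : measurable D -> measurable_fun D (@Num.sg R).
Proof. by move=> mD; apply: nondecreasing_measurable => //; exact: sg_homo. Qed.

Lemma normr_sg_le1 (x : R) : `|Num.sg x| <= 1.
Proof. by rewrite normr_sg; case: (x != 0). Qed.

Lemma cts_bounded_itv (g : R -> R) (a b : R) : a <= b -> continuous g ->
  exists C, forall t, a <= t <= b -> `|g t| <= C.
Proof.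
move=> ab cg; have cn : {within `[a, b], continuous (fun x => `|g x|)}.
  by apply: continuous_subspaceT => x; apply: cvg_norm; exact: cg.
have [c _ Hc] := EVT_max ab cn; exists `|g c| => t tab.
by apply: Hc; rewrite in_itv.
Qed.

(* Sharpening the time cutoff of the test function to the indicator of [0, Tp]. *)
Lemma time_cutoff_limit (H : R -> R) (CH : R) (chi D Q : R -> R) (p T Tp M I0 : R) : is_step H CH ->
  0 < Tp <= T -> smooth chi -> (forall x, 0 <= chi x) -> (forall x, chi x != 0 -> p <= x) ->
  LI `]0, T[ D -> LI `]0, T[ Q -> (forall t, 0 < t < T -> `|D t| <= M /\ `|Q t| <= M) ->
  (forall t, 0 <= D t) ->
  (forall e, 0 < e -> exists2 d, 0 < d &
    forall t, 0 <= t <= T -> `|t - Tp| < d -> `|D t - D Tp| <= e) ->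
  (forall a q, q < T -> smooth a -> (forall x, 0 <= x -> 0 <= a x) ->
    (forall x, a x != 0 -> p <= x <= q) ->
    0 <= \int[leb]_(t in `]0, T[) (a^`()%classic t * D t + a t * Q t) + a 0 * I0) ->
  LI `]0, Tp[ (fun t => chi^`()%classic t * D t + chi t * Q t) /\
  chi Tp * D Tp <= chi 0 * I0 + \int[leb]_(t in `]0, Tp[) (chi^`()%classic t * D t + chi t * Q t).
Proof.
move=> [sH H0 H1 Hm HC] /andP[Tp0 TpT] sc c0 cp LD LQ HM D0 Dcts test.
have T0 : 0 < T by exact: lt_le_trans TpT.
have mA : measurable (`]0, T[%classic : set R) by exact: measurable_itv.
have sc' := smooth_derive1 sc; have cc := smooth_cts sc; have cc' := smooth_cts sc'.
have H01 z : 0 <= H z <= 1.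
  apply/andP; split.
    by have [z0|/ltW z0] := leP z 0; [rewrite H0|rewrite -(H0 0)// Hm].
  by have [z0|/ltW z0] := leP 1 z; [rewrite H1|rewrite -(H1 1)// Hm].
have dH z : 0 <= H^`()%classic z.
  by apply: homo_derive1_ge0; [move=> x; exact: smooth_derivable|exact: Hm].
(* This descends from 1 to 0 on [Tp - 2 eta, Tp - eta]. It vanishes before Tp, so the product with
   [chi] is an admissible time factor even when Tp = T. *)
pose cut (eta : R) t := 1 - H (eta^-1 * t + (- (Tp - 2 * eta) / eta)).
have cutE eta t : cut eta t = 1 - H ((t - (Tp - 2 * eta)) / eta).
  by rewrite /cut mulrBl mulNr mulrC.
pose a eta := chi \* cut eta.
have scut eta : smooth (cut eta).
  have := smooth_affine (eta^-1) (- (Tp - 2 * eta) / eta) sH.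
  move=> /(smoothM (smooth_cst (-1))) /(smoothD (smooth_cst 1)); congr smooth.
  by apply/funext => t; rewrite /= /cut mulN1r.
have cut0 eta t : 0 < eta -> Tp - eta <= t -> cut eta t = 0.
  move=> e0 tT; rewrite cutE H1 ?subrr// ler_pdivlMr//; lra.
have cut1 eta t : 0 < eta -> t <= Tp - 2 * eta -> cut eta t = 1.
  move=> e0 tT; rewrite cutE H0 ?subr0// pmulr_lle0 ?invr_gt0//; lra.
have cut01 eta t : 0 <= cut eta t <= 1.
  by rewrite /cut; have := H01 (eta^-1 * t + (- (Tp - 2 * eta) / eta)); lra.
have cutD eta t : 0 < eta -> (cut eta)^`()%classic t <= 0.
  move=> e0; rewrite derive1E.
  have Dc : is_derive t (1:R) (H \o (fun t => eta^-1 * t + (- (Tp - 2 * eta) / eta)))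
      (H^`()%classic (eta^-1 * t + (- (Tp - 2 * eta) / eta)) * eta^-1).
    apply: is_derive1_comp; first exact: smooth_is_derive.
    by apply: (is_derive_eq (is_deriveD _ _)); rewrite addr0 /GRing.scale/= mulr1.
  have Dc2 := is_deriveB (is_derive_cst (1:R) t (1:R)) Dc.
  have -> : 'D_1 (cut eta) t = 0 - H^`()%classic (eta^-1 * t + (- (Tp - 2 * eta) / eta)) * eta^-1.
    by case: Dc2 => _ <-.
  by rewrite sub0r oppr_le0 mulr_ge0// ltW// invr_gt0.
have aD eta t : (a eta)^`()%classic t = chi^`()%classic t * cut eta t + chi t * (cut eta)^`()%classic t.
  rewrite derive1E; have [_ ->] := is_deriveM (smooth_is_derive t sc) (smooth_is_derive t (scut eta)).
  by rewrite /GRing.scale/= addrC mulrC.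
have key eta : 0 < eta -> 2 * eta < Tp ->
  0 <= \int[leb]_(t in `]0, T[) ((a eta)^`()%classic t * D t + a eta t * Q t) + a eta 0 * I0.
  move=> e0 eT; apply: (test _ (Tp - eta)).
  - by lra.
  - by apply: smoothM.
  - by move=> x _; rewrite /a mulr_ge0//; case/andP: (cut01 eta x).
  - move=> x; rewrite /a mulf_eq0 negb_or => /andP[/cp ->] /= h.
    by apply: contraTT h; rewrite -ltNge => /ltW /(cut0 _ _ e0) ->; rewrite eqxx.
have M0 : 0 <= M.
  by have [+ _] := HM (T / 2) ltac:(lra); apply: le_trans.
have [K HK] : exists K, forall t, 0 <= t <= T -> `|chi t| <= K /\ `|chi^`()%classic t| <= K.
  have [C1 H1'] := cts_bounded_itv (ltW T0) cc; have [C2 H2'] := cts_bounded_itv (ltW T0) cc'.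
  by exists (Num.max C1 C2) => t tT; rewrite !le_max H1'// H2'// orbT.
have K0 : 0 <= K by have [+ _] := HK 0 ltac:(lra); apply: le_trans.
pose w t := chi^`()%classic t * D t + chi t * Q t.
have in0T t : `]0, T[%classic t -> 0 <= t <= T /\ 0 < t < T.
  by rewrite /= in_itv/= => /andP[t0 tT]; rewrite t0 tT !ltW.
have Lw : LI `]0, T[ w.
  apply: LID => //; (apply: (LI_bM mA (C := K)) => //; first exact: cts_measurable).
    by move=> t /in0T [/HK []].
  by move=> t /in0T [/HK []].
have wM t : 0 < t < T -> `|w t| <= 2 * K * M.
  move=> tT; have [h1 h2] := HM _ tT; have [k1 k2] := HK t ltac:(lra).
  apply: le_trans (ler_normD _ _) _; rewrite !normrM.
  have : `|chi^`()%classic t| * `|D t| <= K * M by exact: ler_pM.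
  have : `|chi t| * `|Q t| <= K * M by exact: ler_pM.
  by lra.
have sub : (`]0, Tp[%classic : set R) `<=` `]0, T[.
  by move=> t; rewrite /= !in_itv/= => /andP[-> /lt_le_trans ->].
have LwTp : LI `]0, Tp[ w by apply: integrableS Lw.
split => //.
apply/ler_addgt0Pr => e e0.
have e2 : 0 < e / (4 * (K + 1)) by rewrite divr_gt0// mulr_gt0// ltr_wpDl.
have [d d0 Hd] : exists2 d, 0 < d & forall t, 0 <= t <= T -> `|t - Tp| < d ->
    chi Tp * D Tp - e / 2 <= chi t * D t.
  have [d1 d10 Hd1] := Dcts _ e2.
  have e4 : 0 < e / (2 * (2 * (D Tp + 1))).
    by rewrite divr_gt0// !mulr_gt0// ltr_wpDl ?D0.
  have := cc Tp; move/cvgrPdist_lt => /(_ _ e4); rewrite /nbhs/= => -[d2/= d20 Hd2].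
  exists (Num.min d1 d2); first by rewrite lt_min d10.
  move=> t tT; rewrite lt_min => /andP[t1 t2].
  have h1 := Hd1 _ tT t1; have [k1 _] := HK _ tT.
  have h2 : `|chi Tp - chi t| < e / (2 * (2 * (D Tp + 1))) by apply: Hd2; rewrite /= distrC.
  have E : chi Tp * D Tp - chi t * D t =
    (chi Tp - chi t) * D Tp - chi t * (D t - D Tp) by ring.
  have A1 : `|(chi Tp - chi t) * D Tp| <= e / 4.
    rewrite normrM (ger0_norm (D0 _)).
    apply: le_trans (_ : e / (2 * (2 * (D Tp + 1))) * D Tp <= _).
      by rewrite ler_wpM2r ?D0// ltW.
    have kp : 0 < D Tp + 1 by rewrite ltr_wpDl ?D0.
    rewrite mulrAC ler_pdivrMr ?mulr_gt0//.
    have -> : e / 4 * (2 * (2 * (D Tp + 1))) = e * (D Tp + 1) by field.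
    by rewrite ler_wpM2l ?ltW// ltrDl.
  have A2 : `|chi t * (D t - D Tp)| <= e / 4.
    rewrite normrM; apply: le_trans (ler_pM _ _ k1 h1) _ => //.
    rewrite mulrA ler_pdivrMr ?mulr_gt0 ?ltr_wpDl//.
    have -> : e / 4 * (4 * (K + 1)) = e * (K + 1) by field.
    by rewrite mulrC ler_wpM2l ?lerDl// ltW.
  have := ler_norm ((chi Tp - chi t) * D Tp).
  have := lerNnormlW A2.
  by lra.
pose m := chi Tp * D Tp - e / 2.
have KM0 : 0 <= K * M by exact: mulr_ge0.
have [eta [eta0 etaT etad etae]] : exists eta, [/\ 0 < eta, 2 * eta < Tp, 2 * eta < d &
    2 * K * M * (2 * eta) <= e / 2].
  clear - Tp0 d0 e0 KM0.
  pose eta := Num.min (Tp / 4) (Num.min (d / 4) (e / (8 * (K * M + 1)))).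
  have eta0 : 0 < eta by rewrite !lt_min !divr_gt0// mulr_gt0// ltr_wpDl.
  exists eta; split=> //.
  - by have : eta <= Tp / 4 by [rewrite ge_min lexx]; lra.
  - by have : eta <= d / 4 by [rewrite !ge_min lexx orbT]; lra.
  - have : eta <= e / (8 * (K * M + 1)) by rewrite !ge_min lexx !orbT.
    rewrite ler_pdivlMr ?mulr_gt0 ?ltr_wpDl// => h.
    by have : 0 <= eta by [exact: ltW]; lra.
have := key _ eta0 etaT.
have -> : a eta 0 = chi 0 by rewrite /a /= cut1 ?mulr1//; clear - etaT; lra.
move=> ineq.
pose J2 := (\1_(`[Tp - 2 * eta, Tp]%classic) : R -> R).
pose wp t := (\1_(`]0, Tp[%classic) : R -> R) t * w t.
(* A majorant of the tested integrand. Replacing the cutoff by the indicator of ]0, Tp[ costs at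
   most 2 K M on the last 2 eta units of time. As the derivative of the cutoff is nonpositive, the
   factor chi D next to it may be replaced by its lower bound m; that derivative integrates to -1,
   which produces the term -m. *)
pose g t := wp t + 2 * K * M * J2 t + m * (cut eta)^`()%classic t.
have [LJ2 IJ2] : LI `]0, T[ J2 /\ \int[leb]_(t in `]0, T[) J2 t <= 2 * eta.
  have ab : Tp - 2 * eta <= Tp by clear - eta0; lra.
  have [LJ _] := int_itv_indic 0 ab.
  apply: LI_ge0 => //.
  - by apply: measurable_funTS; exact: (LI_meas LJ).
  rewrite integral_indic//; apply: (le_trans (le_measure _ _ _ (@subIsetl _ _ _))); rewrite ?inE//.
    by apply: measurableI.
  change (leb `[(Tp - 2 * eta)%R, Tp]%classic <= (2 * eta)%:E)%E.
  rewrite lebesgue_measure_itv/= lte_fin; case: ifP => _; rewrite -?EFinB lee_fin; clear - eta0; lra.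
have [Lc Ic] := int_derive1_smooth T0 (scut eta).
have mA' : measurable (`]0, Tp[%classic : set R) by exact: measurable_itv.
have I01 (S : set R) x : 0 <= (\1_S x : R) <= 1.
  by rewrite indicE; case: (x \in S); rewrite /= ?ler01 ?lexx.
have Lwp : LI `]0, T[ wp.
  apply: (LI_bM mA (C := 1)) => //.
  by move=> x _; case/andP: (I01 `]0, Tp[%classic x) => ? ?; rewrite ger0_norm.
have Iwp : \int[leb]_(t in `]0, T[) wp t = \int[leb]_(t in `]0, Tp[) w t.
  rewrite -[X in \int[leb]_(t in X) w t](setIidr sub) Rintegral_mkcondr.
  apply: eq_Rintegral => t _; rewrite /wp patchE indicE.
  by case: (t \in _); rewrite ?mul1r ?mul0r.
have Lg : LI `]0, T[ g by apply: LID => //; [apply: LID => //; exact: LIZ|exact: LIZ].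
have cta : continuous (a eta) by apply: smooth_cts; apply: smoothM.
have cta' : continuous (a eta)^`()%classic by apply: smooth_cts; apply: smooth_derive1; apply: smoothM.
have [Ca HCa] := cts_bounded_itv (ltW T0) cta.
have [Ca' HCa'] := cts_bounded_itv (ltW T0) cta'.
have Ig : \int[leb]_(t in `]0, T[) ((a eta)^`()%classic t * D t + a eta t * Q t) <= \int[leb]_(t in `]0, T[) g t.
  apply: LI_int_le => //.
    apply: LID => //.
      apply: (LI_bM mA (C := Ca')) => //; first exact: cts_measurable.
      by move=> t /in0T [/HCa'].
    apply: (LI_bM mA (C := Ca)) => //; first exact: cts_measurable.
    by move=> t /in0T [/HCa].
  move=> t /in0T [tT' tT]; rewrite aD /g.
  have -> : (chi^`()%classic t * cut eta t + chi t * (cut eta)^`()%classic t) * D t + a eta t * Q t =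
     cut eta t * w t + (cut eta)^`()%classic t * (chi t * D t) by rewrite /w /a /=; ring.
  have KM2 : 0 <= 2 * K * M by rewrite -mulrA mulr_ge0.
  have tI : (t < Tp) = (t \in `]0, Tp[%classic).
    apply/idP/idP => [tp|/set_mem]; last by rewrite /= in_itv/= => /andP[].
    by apply/mem_set; rewrite /= in_itv/= tp andbT; case/andP: tT.
  have [tl|tl] := ltP t (Tp - 2 * eta).
    have -> : (cut eta)^`()%classic t = 0.
      apply: (@derive1_locally_cst _ _ _ 1); near=> y; apply: cut1 => //.
      by apply: ltW; near: y; exact: lt_nbhsl.
    rewrite mul0r mulr0 !addr0 cut1 ?(ltW tl)// mul1r /wp indicE -tI.
    have -> : t < Tp by clear - tl eta0; lra.
    by rewrite mul1r lerDl mulr_ge0//; case/andP: (I01 `[Tp - 2 * eta, Tp]%classic t).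
  have [tr|tr] := leP t Tp.
    have J1 : J2 t = 1.
      by rewrite /J2 indicE mem_set//= in_itv/= tl tr.
    apply: lerD.
      rewrite J1 mulr1 /wp indicE -tI.
      have := wM _ tT; rewrite ler_norml => /andP[w1 w2].
      have /andP[c1 c2] := cut01 eta t.
      have cw : `|cut eta t * w t| <= 2 * K * M.
        by rewrite normrM -[leRHS]mul1r; apply: ler_pM; rewrite ?(ger0_norm c1)// wM.
      have cw' : `|(1 - cut eta t) * w t| <= 2 * K * M.
        rewrite normrM -[leRHS]mul1r; apply: ler_pM; rewrite ?wM//.
        by rewrite ger0_norm; clear - c1 c2; lra.
      case: (t < Tp); rewrite /= ?mul1r ?mul0r ?add0r.
        by have := lerNnormlW cw'; clear; lra.
      exact: le_trans (ler_norm _) cw.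
    rewrite mulrC -subr_ge0 -mulrBl mulr_le0//; last exact: cutD.
    rewrite subr_le0; apply: Hd => //.
    by rewrite distrC ger0_norm; clear - tl tr etad; lra.
  have -> : (cut eta)^`()%classic t = 0.
    apply: (@derive1_locally_cst _ _ _ 0); near=> y; apply: cut0 => //.
    have yT : Tp < y by near: y; exact: lt_nbhsr.
    by move: yT; clear - eta0; lra.
  rewrite cut0//; last by clear - tr eta0; lra.
  rewrite !mul0r mulr0 !addr0 /wp indicE -tI ltNge (ltW tr) mul0r add0r.
  by rewrite mulr_ge0//; case/andP: (I01 `[Tp - 2 * eta, Tp]%classic t).
have Eg : \int[leb]_(t in `]0, T[) g t <= \int[leb]_(t in `]0, Tp[) w t + e / 2 - m.
  rewrite LI_intD//; [|by apply: LID => //; exact: LIZ|exact: LIZ].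
  rewrite LI_intD//; last exact: LIZ.
  rewrite !LI_intZ// Iwp Ic.
  have -> : cut eta T = 0 by apply: cut0 => //; clear - TpT eta0; lra.
  have -> : cut eta 0 = 1 by apply: cut1 => //; clear - etaT; lra.
  rewrite sub0r mulrN1 lerB// lerD2l; apply: le_trans etae.
  by rewrite ler_wpM2l// -mulrA mulr_ge0.
by move: Eg Ig ineq; rewrite /m /w; clear; lra.
Unshelve. all: by end_near. Qed.

Variables (T : R) (u V Vx : R -> R -> R) (f U0 : R -> R) (B L : R).
Hypotheses (T0 : 0 < T)
  (um : measurable_fun (`[0, T] `*` setT) (fun z : R * R => u z.1 z.2))
  (uL : forall t, 0 <= t <= T -> LI setT (u t)) (uC : CtL1 T u)
  (Vm : measurable_fun (QT T) (fun z : R * R => V z.1 z.2))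
  (Vxm : measurable_fun (QT T) (fun z : R * R => Vx z.1 z.2))
  (VB : forall t x, 0 < t < T -> `|V t x| <= B)
  (VxB : forall t x, 0 < t < T -> `|Vx t x| <= B)
  (fL : forall a b, `|f a - f b| <= L * `|a - b|)
  (U0L : LI setT U0).
Hypothesis ent : forall (alpha : R) (phi : R * R -> R), test_fun T phi ->
    0 <=
      \int[(leb \x leb)%E]_(z in QT T)
        (`|u z.1 z.2 - alpha| * 'D_((1, 0) : R * R) phi z)
    + \int[leb]_x (`|U0 x - alpha| * phi (0, x))
    + \int[(leb \x leb)%E]_(z in QT T)
        (Num.sg (u z.1 z.2 - alpha) * V z.1 z.2
         * (f (u z.1 z.2) - f alpha) * 'D_((0, 1) : R * R) phi z)
    - \int[(leb \x leb)%E]_(z in QT T)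
        (f alpha * Num.sg (u z.1 z.2 - alpha) * Vx z.1 z.2 * phi z).

Variables (alpha : R) (b : R -> R) (r s : R).
Hypotheses (sb : smooth b) (b0 : forall x, 0 <= b x) (rs : r <= s)
  (br : forall x, b x != 0 -> r <= x <= s).

Local Notation J := (\1_(`[r, s]%classic) : R -> R).

(** Tested with b in space, the entropy inequality says that d/dt [kdist] <= [kflux] in the sense of
    distributions in time. *)
Definition kdist t := \int[leb]_x (`|u t x - alpha| * b x).
Definition kflux_density t x :=
  Num.sg (u t x - alpha) * V t x * (f (u t x) - f alpha) * b^`()%classic x
  - f alpha * Num.sg (u t x - alpha) * Vx t x * b x.
Definition kflux t := \int[leb]_x kflux_density t x.

Let mA : measurable (`]0, T[%classic : set R). Proof. exact: measurable_itv. Qed.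

Lemma bump_bound : exists2 C, 0 <= C & forall x, `|b x| <= C * J x /\ `|b^`()%classic x| <= C * J x.
Proof.
have bl x : x < r -> b x = 0.
  by move=> xr; apply/eqP; apply: contraTT xr => /br /andP[+ _]; rewrite -leNgt.
have bg x : s < x -> b x = 0.
  by move=> xr; apply/eqP; apply: contraTT xr => /br /andP[_ +]; rewrite -leNgt.
have dl x : x < r -> b^`()%classic x = 0.
  move=> xr; apply: derive1_locally_cst; near=> y; apply: bl.
  by near: y; exact: lt_nbhsl.
have dg x : s < x -> b^`()%classic x = 0.
  move=> xr; apply: derive1_locally_cst; near=> y; apply: bg.
  by near: y; exact: lt_nbhsr.
have [C1 H1] := cts_bounded_support rs (smooth_cts sb) bl bg.
have [C2 H2] := cts_bounded_support rs (smooth_cts (smooth_derive1 sb)) dl dg.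
exists (`|C1| + `|C2|) => [|x]; first by rewrite addr_ge0.
rewrite indicE; have [xi|xi] := boolP (x \in `[r, s]%classic).
  rewrite mulr1; split.
    by apply: le_trans (H1 x) _; rewrite (le_trans (ler_norm _))// lerDl.
  by apply: le_trans (H2 x) _; rewrite (le_trans (ler_norm _))// lerDr.
rewrite mulr0 !normr_le0; move: xi; rewrite notin_setE/= in_itv/=.
move=> /negP; rewrite negb_and -!ltNge => /orP[?|?].
  by rewrite bl// dl.
by rewrite bg// dg.
Unshelve. all: by end_near. Qed.

(** The single majorant (|u| + A) 1_[r, s] dominates every integrand of the entropy inequality, and
    its slices are bounded because the L^1 norm of u is continuous on the compact interval
    [0, T]. *)
Lemma dominated_strip (A : R) : 0 <= A -> exists2 M, 0 <= M &
  forall (F : R * R -> R) (C : R), 0 <= C -> measurable_fun (QT T) F ->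
  (forall t x, 0 < t < T -> `|F (t, x)| <= C * ((`|u t x| + A) * J x)) ->
  [/\ L1 (leb \x leb)%E (QT T) F,
      forall t, 0 < t < T -> LI setT (fun x => F (t, x)) &
      forall t, 0 < t < T -> `|\int[leb]_x F (t, x)| <= C * M].
Proof.
move=> A0; have [K [K0 uK]] := CtL1_bounded T0 uL uC.
exists (K + A * (s - r)) => [|F C C0 mF FC].
  by rewrite addr_ge0// mulr_ge0// subr_ge0.
have [LJ IJ] := int_itv_indic 0 rs.
have J01 x : 0 <= J x <= 1.
  by rewrite indicE; case: (x \in _); rewrite /= ?ler01 ?lexx.
pose G (z : R * R) := C * ((`|u z.1 z.2| + A) * J z.2).
have umq : measurable_fun (QT T) (fun z : R * R => u z.1 z.2).
  apply: measurable_funS um; first by apply: measurableX => //; exact: measurable_itv.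
  by move=> [t x] [/= ]; rewrite !in_itv/= => /andP[/ltW -> /ltW ->].
have G0 z : 0 <= G z.
  by rewrite /G !mulr_ge0// ?addr_ge0//; case/andP: (J01 z.2).
have Gt t : 0 < t < T -> LI setT (fun x => G (t, x)) /\ \int[leb]_x G (t, x) <= C * (K + A * (s - r)).
  move=> /andP[t0 tT]; have tT' : 0 <= t <= T by rewrite !ltW.
  have L1u : LI setT (fun x => J x * `|u t x|).
    apply: (LI_bM measurableT (C := 1)).
    - exact: (LI_meas LJ).
    - by move=> x _; case/andP: (J01 x) => ? ?; rewrite ger0_norm.
    - by apply: LI_abs => //; exact: uL.
  have E x : G (t, x) = C * (J x * `|u t x| + A * J x) by rewrite /G/=; ring.
  have LA : LI setT (fun x => A * J x) by exact: LIZ.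
  split.
    apply: (LI_eq measurableT (f := fun x => C * (J x * `|u t x| + A * J x))); first by move=> x _; rewrite E.
    exact: (LIZ C measurableT (LID measurableT L1u LA)).
  under eq_Rintegral do rewrite E.
  rewrite LI_intZ//; last exact: (LID measurableT L1u LA).
  rewrite ler_wpM2l// LI_intD// LI_intZ// IJ lerD2r.
  apply: le_trans (uK _ tT'); apply: LI_int_le => //.
    by apply: LI_abs => //; exact: uL.
  by move=> x _; rewrite ler_piMl//; case/andP: (J01 x).
have mG : measurable_fun (QT T) G.
  apply: measurable_funM => //; apply: measurable_funM.
    by apply: measurable_funD => //; exact: measurableT_comp.
  apply: (@measurableT_comp _ _ _ _ _ _ J _ snd); first exact: (LI_meas LJ).
  exact: measurable_funTS measurable_snd.
have LG : L1 (leb \x leb)%E (QT T) G.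
  apply: (@tonelli_strip _ _ mA _ (C * (K + A * (s - r))) T) => //.
  - by rewrite lebesgue_measure_itv/= lte_fin T0 oppr0 adde0.
  - by rewrite mulr_ge0// addr_ge0// mulr_ge0// subr_ge0.
have Ft t : 0 < t < T -> LI setT (fun x => F (t, x)).
  move=> tT; apply: (LI_le measurableT (g := fun x => G (t, x))) => //.
  - by apply: (measurable_strip_section mA) => //; rewrite /= in_itv.
  - by move=> x _; exact: FC.
  - by case: (Gt _ tT).
split => //.
- apply: (@L1_le _ _ _ (leb \x leb)%E (QT T) (measurable_strip mA) F G) => //.
  by move=> [t x] [/= + _]; rewrite in_itv/=; exact: FC.
- move=> t tT; have [LGt IGt] := Gt _ tT; apply: le_trans IGt.
  by apply: LI_int_absle => //; [exact: Ft|move=> x _; exact: FC].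
Qed.

Lemma kdist_L1 t : 0 <= t <= T -> LI setT (fun x => `|u t x - alpha| * b x).
Proof.
move=> tT; have [C C0 HC] := bump_bound.
have [LJ IJ] := int_itv_indic 0 rs.
have mb : measurable_fun setT b by apply: continuous_measurable_fun; apply: smooth_cts.
have mut := LI_meas (uL tT).
apply: (LI_le measurableT (g := fun x => C * `|u t x| + C * `|alpha| * J x)) => //.
- apply: measurable_funM => //; apply: measurableT_comp => //.
  by apply: measurable_funB.
- move=> x _; rewrite normrM normr_id.
  have [Hb _] := HC x.
  have J0 : 0 <= J x <= 1 by rewrite indicE; case: (x \in _); rewrite /= ?ler01 ?lexx.
  apply: le_trans (_ : (`|u t x| + `|alpha|) * (C * J x) <= _).
    by apply: ler_pM => //; exact: ler_normB.
  rewrite mulrDl lerD//; last by rewrite mulrA [X in X * _]mulrC.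
  rewrite mulrCA mulrA ler_piMr ?mulr_ge0//; by case/andP: J0.
- apply: LID => //; apply: LIZ => //; apply: LI_abs => //; exact: uL.
Qed.

Lemma kdist_ge0 t : 0 <= kdist t.
Proof. by apply: Rintegral_ge0 => x _; rewrite mulr_ge0. Qed.

Let umq : measurable_fun (QT T) (fun z : R * R => u z.1 z.2).
Proof.
apply: measurable_funS um; first by apply: measurableX => //; exact: measurable_itv.
by move=> [t x] [/= ]; rewrite !in_itv/= => /andP[/ltW -> /ltW ->].
Qed.

Let mQ : measurable (QT T : set (R * R)). Proof. exact: measurable_strip. Qed.

Lemma measurable_snd_cts (g : R -> R) : continuous g ->
  measurable_fun (QT T) (fun z : R * R => g z.2).
Proof.
move=> cg; apply: (@measurableT_comp _ _ _ _ _ _ g); first exact: continuous_measurable_fun.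
exact: measurable_funTS measurable_snd.
Qed.

Let sgm : measurable_fun (QT T) (fun z : R * R => Num.sg (u z.1 z.2 - alpha)).
Proof.
apply: (@measurableT_comp _ _ _ _ _ _ (@Num.sg R)); first exact: measurable_sg.
exact: measurable_funB.
Qed.

Let fm : measurable_fun (QT T) (fun z : R * R => f (u z.1 z.2) - f alpha).
Proof.
apply: measurable_funB => //.
apply: (@measurableT_comp _ _ _ _ _ _ f) => //.
by apply: continuous_measurable_fun; exact: (lipschitz_cts fL).
Qed.

Let B0 : 0 <= B.
Proof.
by apply: le_trans (VB (t := T / 2) 0 _); rewrite // divr_gt0//= ltr_pdivrMr// mulrDr mulr1 ltrDl.
Qed.

Let L0 : 0 <= L.
Proof. by have := fL 1 0; rewrite subr0 normr1 mulr1; apply: le_trans. Qed.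

Definition kflux_transport (z : R * R) :=
  Num.sg (u z.1 z.2 - alpha) * V z.1 z.2 * (f (u z.1 z.2) - f alpha) * b^`()%classic z.2.
Definition kflux_source (z : R * R) := f alpha * Num.sg (u z.1 z.2 - alpha) * Vx z.1 z.2 * b z.2.

Lemma kflux_parts : exists M, [/\ L1 (leb \x leb)%E (QT T) kflux_transport,
  L1 (leb \x leb)%E (QT T) kflux_source,
  forall t, 0 < t < T -> LI setT (fun x => kflux_transport (t, x)),
  forall t, 0 < t < T -> LI setT (fun x => kflux_source (t, x)) &
  forall t, 0 < t < T -> `|\int[leb]_x kflux_transport (t, x)| <= M /\
                         `|\int[leb]_x kflux_source (t, x)| <= M].
Proof.
have [C C0 HC] := bump_bound.
pose A := `|alpha| + 1; have A0 : 0 <= A by rewrite addr_ge0.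
have [M M0 HM] := dominated_strip A0.
have J0 x : 0 <= J x <= 1 by rewrite indicE; case: (x \in _); rewrite /= ?ler01 ?lexx.
have uA t x : `|u t x - alpha| <= `|u t x| + A.
  by apply: le_trans (ler_normB _ _) _; rewrite lerD2l lerDl.
have A1 t x : 1 <= `|u t x| + A by rewrite addrA lerDr addr_ge0.
have cb := smooth_cts sb; have cb' := smooth_cts (smooth_derive1 sb).
pose F2 := kflux_transport.
have mF2 : measurable_fun (QT T) F2.
  apply: measurable_funM; last exact: measurable_snd_cts.
  by apply: measurable_funM => //; exact: measurable_funM.
have bF2 t x : 0 < t < T -> `|F2 (t, x)| <= (B * L * C) * ((`|u t x| + A) * J x).
  move=> tT; rewrite /F2/kflux_transport/= !normrM.
  have -> : B * L * C * ((`|u t x| + A) * J x) = 1 * B * (L * (`|u t x| + A)) * (C * J x) by ring.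
  apply: ler_pM; rewrite ?mulr_ge0//; last by case: (HC x).
  apply: ler_pM; rewrite ?mulr_ge0//; last by apply: le_trans (fL _ _) _; rewrite ler_wpM2l.
  by apply: ler_pM => //; [exact: normr_sg_le1|exact: VB].
pose F3 := kflux_source.
have mF3 : measurable_fun (QT T) F3.
  apply: measurable_funM; last exact: measurable_snd_cts.
  by apply: measurable_funM => //; exact: measurable_funM.
have bF3 t x : 0 < t < T -> `|F3 (t, x)| <= (`|f alpha| * B * C) * ((`|u t x| + A) * J x).
  move=> tT; rewrite /F3/kflux_source/= !normrM.
  have -> : `|f alpha| * B * C * ((`|u t x| + A) * J x) = `|f alpha| * 1 * B * ((`|u t x| + A) * (C * J x)) by ring.
  apply: ler_pM; rewrite ?mulr_ge0//.
    apply: ler_pM; rewrite ?mulr_ge0//; last exact: VxB.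
    by apply: ler_pM => //; exact: normr_sg_le1.
  apply: le_trans (_ : C * J x <= _); first by case: (HC x).
  by rewrite ler_peMl// mulr_ge0//; case/andP: (J0 x).
have [LF2 tF2 MF2] := HM F2 _ (mulr_ge0 (mulr_ge0 B0 L0) C0) mF2 bF2.
have [LF3 tF3 MF3] := HM F3 _ (mulr_ge0 (mulr_ge0 (normr_ge0 _) B0) C0) mF3 bF3.
exists (Num.max (B * L * C * M) (`|f alpha| * B * C * M)); split; [exact: LF2|exact: LF3|exact: tF2|exact: tF3|] => t tT.
have h2 := MF2 t tT; have h3 := MF3 t tT.
by rewrite !le_max; split; [rewrite h2|rewrite h3 orbT].
Qed.

Lemma kflux_density_LI t : 0 < t < T -> LI setT (kflux_density t).
Proof.
have [M [_ _ H2 H3 _]] := kflux_parts => tT.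
exact: (LIB measurableT (H2 _ tT) (H3 _ tT)).
Qed.

(** With the test function a(t) b(x), Fubini integrates the space variable out and leaves an
    inequality in time alone. *)
Lemma kruzkov_weighted_test (a : R -> R) (p q : R) : q < T -> smooth a ->
  (forall x, 0 <= x -> 0 <= a x) -> (forall x, a x != 0 -> p <= x <= q) ->
  [/\ LI `]0, T[ kdist, LI `]0, T[ kflux,
     exists M, forall t, 0 < t < T -> `|kdist t| <= M /\ `|kflux t| <= M &
     0 <= \int[leb]_(t in `]0, T[) (a^`()%classic t * kdist t + a t * kflux t)
         + a 0 * \int[leb]_x (`|U0 x - alpha| * b x)].
Proof.
move=> qT sa a0 ap.
have [C C0 HC] := bump_bound.
pose A := `|alpha| + 1; have A0 : 0 <= A by rewrite addr_ge0.
have [M M0 HM] := dominated_strip A0.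
have J0 x : 0 <= J x <= 1 by rewrite indicE; case: (x \in _); rewrite /= ?ler01 ?lexx.
have uA t x : `|u t x - alpha| <= `|u t x| + A.
  by apply: le_trans (ler_normB _ _) _; rewrite lerD2l lerDl.
have A1 t x : 1 <= `|u t x| + A by rewrite addrA lerDr addr_ge0.
have cb := smooth_cts sb; have cb' := smooth_cts (smooth_derive1 sb).
pose F1 (z : R * R) := `|u z.1 z.2 - alpha| * b z.2.
have mF1 : measurable_fun (QT T) F1.
  apply: measurable_funM; last exact: measurable_snd_cts.
  by apply: measurableT_comp => //; exact: measurable_funB.
have bF1 t x : 0 < t < T -> `|F1 (t, x)| <= C * ((`|u t x| + A) * J x).
  move=> _; rewrite /F1/= normrM normr_id mulrCA; apply: ler_pM => //.
  by case: (HC x).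
have [M' [LF2 LF3 tF2 tF3 MF23]] := kflux_parts.
pose F2 := kflux_transport; pose F3 := kflux_source.
have mF2 : measurable_fun (QT T) F2 by move/measurable_int/measurable_EFinP: LF2.
have mF3 : measurable_fun (QT T) F3 by move/measurable_int/measurable_EFinP: LF3.
have [LF1 tF1 MF1] := HM F1 C C0 mF1 bF1.
have kfE t : 0 < t < T -> kflux t = \int[leb]_x F2 (t, x) - \int[leb]_x F3 (t, x).
  by move=> tT; rewrite -LI_intB//; [exact: tF2|exact: tF3].
have in0T (P : R -> Prop) : (forall t, 0 < t < T -> P t) -> forall t, `]0, T[%classic t -> P t.
  by move=> H t; rewrite /= in_itv/=; exact: H.
have [LD _] := fubini_strip mA LF1 (in0T _ tF1).
have [LI2 _] := fubini_strip mA LF2 (in0T _ tF2).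
have [LI3 _] := fubini_strip mA LF3 (in0T _ tF3).
have LQ : LI `]0, T[ kflux.
  apply: (LI_eq mA (f := fun t => \int[leb]_x F2 (t, x) - \int[leb]_x F3 (t, x))).
    by apply: in0T => t tT; rewrite kfE.
  exact: LIB.
split => //.
  exists (C * M + (M' + M')) => t tT; have [M2 M3] := MF23 _ tT.
  have M'0 : 0 <= M' by exact: le_trans M2.
  split; first by apply: le_trans (MF1 _ tT) _; rewrite lerDl addr_ge0.
  rewrite kfE//; apply: le_trans (ler_normB _ _) _.
  by apply: le_trans (lerD M2 M3) _; rewrite lerDr mulr_ge0.
have tst := tensor_test_fun qT sa sb b0 a0 ap br.
pose phi (z : R * R) := a z.1 * b z.2.
have D1 z : 'D_((1, 0) : R * R) phi z = a^`()%classic z.1 * b z.2.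
  by have [_ ->] := is_derive_tensor z (1, 0) sa sb; rewrite /= mul1r !mul0r addr0.
have D2 z : 'D_((0, 1) : R * R) phi z = a z.1 * b^`()%classic z.2.
  by have [_ ->] := is_derive_tensor z (0, 1) sa sb; rewrite /= mul1r !mul0r add0r.
have [Ca Ha] : exists Ca, forall t, 0 < t < T -> `|a t| <= Ca /\ `|a^`()%classic t| <= Ca.
  have [C1 H1] := cts_bounded_itv (ltW T0) (smooth_cts sa).
  have [C2 H2] := cts_bounded_itv (ltW T0) (smooth_cts (smooth_derive1 sa)).
  exists (Num.max C1 C2) => t /andP[/ltW t0 /ltW tT]; have tT' : 0 <= t <= T by rewrite t0.
  by rewrite !le_max H1// H2// orbT.
have W (g : R -> R) (F : R * R -> R) : continuous g ->
   (exists Cg, forall t, 0 < t < T -> `|g t| <= Cg) ->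
   measurable_fun (QT T) F -> L1 (leb \x leb)%E (QT T) F ->
   (forall t, 0 < t < T -> LI setT (fun x => F (t, x))) ->
   \int[(leb \x leb)%E]_(z in QT T) (g z.1 * F z) = \int[leb]_(t in `]0, T[) (g t * \int[leb]_x F (t, x)).
  move=> cg [Cg gC] mF LF tF.
  have mg : measurable_fun (QT T) (fun z : R * R => g z.1).
    apply: (@measurableT_comp _ _ _ _ _ _ g); first exact: continuous_measurable_fun.
    exact: measurable_funTS measurable_fst.
  have LgF : L1 (leb \x leb)%E (QT T) (fun z => g z.1 * F z).
    apply: (@L1_bM _ _ _ (leb \x leb)%E (QT T) mQ _ _ Cg) => //.
    by move=> [t x] [/= + _]; rewrite in_itv/=; exact: gC.
  have [_ ->] := fubini_strip mA LgF (in0T _ (fun t tT => LIZ (g t) measurableT (tF t tT))).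
  apply: eq_Rintegral => t; rewrite inE/= in_itv/= => tT.
  by rewrite LI_intZ//; exact: tF.
have := ent alpha tst; rewrite -/phi.
have ca := smooth_cts sa; have ca' := smooth_cts (smooth_derive1 sa).
have Ba : exists Cg, forall t, 0 < t < T -> `|a t| <= Cg by exists Ca => t /Ha [].
have Ba' : exists Cg, forall t, 0 < t < T -> `|a^`()%classic t| <= Cg by exists Ca => t /Ha [].
under eq_Rintegral => z _ do rewrite D1 mulrCA -/(F1 z).
rewrite (W _ F1)//.
under [X in _ + X - _]eq_Rintegral => z _ do rewrite D2 mulrCA -/(F2 z).
rewrite (W _ F2)//.
under [X in _ - X]eq_Rintegral => z _ do rewrite /phi mulrCA -/(F3 z).
rewrite (W _ F3)//.
have -> : \int[leb]_x (`|U0 x - alpha| * phi (0, x)) = a 0 * \int[leb]_x (`|U0 x - alpha| * b x).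
  rewrite -LI_intZ//.
    by apply: eq_Rintegral => x _; rewrite /phi/= mulrCA.
  have [LJ _] := int_itv_indic 0 rs; have mU := LI_meas U0L.
  apply: (LI_le measurableT (g := fun x => C * `|U0 x| + C * `|alpha| * J x)) => //.
  - apply: measurable_funM => //; last exact: continuous_measurable_fun.
    by apply: measurableT_comp => //; exact: measurable_funB.
  - move=> x _; rewrite normrM normr_id; have [Hb _] := HC x.
    apply: le_trans (_ : (`|U0 x| + `|alpha|) * (C * J x) <= _).
      by apply: ler_pM => //; exact: ler_normB.
    rewrite mulrDl lerD//; last by rewrite mulrA [X in X * _]mulrC.
    by rewrite mulrCA mulrA ler_piMr ?mulr_ge0//; case/andP: (J0 x).
  - by apply: LID => //; apply: LIZ => //; exact: LI_abs.
have LaD : LI `]0, T[ (fun t => a^`()%classic t * kdist t).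
  apply: (LI_bM mA (C := Ca)) => //; first exact: cts_measurable.
  by apply: in0T => t /Ha [].
have LaQ : LI `]0, T[ (fun t => a t * kflux t).
  apply: (LI_bM mA (C := Ca)) => //; first exact: cts_measurable.
  by apply: in0T => t /Ha [].
have La2 : LI `]0, T[ (fun t => a t * \int[leb]_x F2 (t, x)).
  apply: (LI_bM mA (C := Ca)) => //; first exact: cts_measurable.
  by apply: in0T => t /Ha [].
have La3 : LI `]0, T[ (fun t => a t * \int[leb]_x F3 (t, x)).
  apply: (LI_bM mA (C := Ca)) => //; first exact: cts_measurable.
  by apply: in0T => t /Ha [].
rewrite LI_intD//.
have -> : \int[leb]_(t in `]0, T[) (a t * kflux t) =
   \int[leb]_(t in `]0, T[) (a t * \int[leb]_x F2 (t, x)) - \int[leb]_(t in `]0, T[) (a t * \int[leb]_x F3 (t, x)).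
  rewrite -LI_intB//; apply: eq_Rintegral => t; rewrite inE/= in_itv/= => tT.
  by rewrite kfE// mulrBr.
rewrite /F1/= => h.
have -> : \int[leb]_(t in `]0, T[) (a^`()%classic t * kdist t) =
  \int[leb]_(t in `]0, T[) (a^`()%classic t * \int[leb]_x (`|u t x - alpha| * b x)) by [].
have sh (x i y z : R) : x + i + y - z = x + (y - z) + i by ring.
by rewrite sh in h.
Qed.

Lemma kdist_left_cts (Tp e : R) : 0 < Tp <= T -> 0 < e -> exists2 d, 0 < d &
  forall t, 0 <= t <= T -> `|t - Tp| < d -> `|kdist t - kdist Tp| <= e.
Proof.
move=> /andP[Tp0 TpT] e0; have [C C0 HC] := bump_bound.
have TpT' : 0 <= Tp <= T by rewrite ltW.
have e'0 : 0 < e / (C + 1) by rewrite divr_gt0// ltr_wpDl.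
have [d d0 Hd] := CtL1_near uL uC TpT' e'0.
exists d => // t tT td; have H := Hd _ tT td.
rewrite /kdist -LI_intB//; [|exact: kdist_L1..].
have LL : LI setT (fun x => C * `|u t x - u Tp x|).
  by apply: LIZ => //; apply: LI_abs; apply: LIB => //; exact: uL.
apply: le_trans (LI_int_absle (g := fun x => C * `|u t x - u Tp x|) measurableT _ LL _) _.
- by apply: LIB => //; exact: kdist_L1.
- move=> x _; rewrite -mulrBl normrM mulrC; apply: ler_pM => //.
    by apply: le_trans (proj1 (HC x)) _; rewrite ler_piMr// indicE lern1 leq_b1.
  apply: le_trans (ler_dist_dist _ _) _.
  by rewrite opprB addrA subrK.
rewrite LI_intZ//; last by apply: LI_abs; apply: LIB => //; exact: uL.
apply: le_trans (_ : C * (e / (C + 1)) <= _); first by rewrite ler_wpM2l// ltW.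
by rewrite mulrA ler_pdivrMr ?ltr_wpDl// mulrC ler_wpM2l ?lerDl// ltW.
Qed.

Lemma kruzkov_at_time (H : R -> R) (CH : R) (chi : R -> R) (p Tp : R) : is_step H CH ->
  0 < Tp <= T -> smooth chi -> (forall x, 0 <= chi x) -> (forall x, chi x != 0 -> p <= x) ->
  LI `]0, Tp[ (fun t => chi^`()%classic t * kdist t + chi t * kflux t) /\
  chi Tp * kdist Tp <= chi 0 * \int[leb]_x (`|U0 x - alpha| * b x) +
    \int[leb]_(t in `]0, Tp[) (chi^`()%classic t * kdist t + chi t * kflux t).
Proof.
move=> sH TpT sc c0 cp.
(* The weight 0 is tested only to extract integrability and bounds, which do not depend on the
   weight. *)
have [LD LQ [M HM]] : [/\ LI `]0, T[ kdist, LI `]0, T[ kflux &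
    exists M, forall t, 0 < t < T -> `|kdist t| <= M /\ `|kflux t| <= M].
  have T20 : T / 2 < T by rewrite ltr_pdivrMr// mulr_natr mulr2n ltrDl.
  have z0 (x : R) : 0 <= x -> 0 <= cst (0 : R) x by [].
  have zs (x : R) : cst (0 : R) x != 0 -> 0 <= x <= T / 2 by rewrite /= eqxx.
  have sz : smooth (cst (0 : R)) by exact: smooth_cst.
  have W := @kruzkov_weighted_test (cst (0 : R)) 0 (T / 2) T20 sz.
  by have [] := W z0 zs.
apply: (time_cutoff_limit sH TpT sc c0 cp LD LQ HM kdist_ge0).
  by move=> e e0; exact: kdist_left_cts.
by move=> a q qT sa a0 ap; have [] := kruzkov_weighted_test qT sa a0 ap.
Qed.

End KruzkovLocal.

(** * Nonlocal velocities *)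

Section Velocity.
Context {R : realType}.
Local Notation leb := (@lebesgue_measure R).

(** Regularity expressed by bounds on increments: these pass through a convolution by integrating
    pointwise inequalities, with no differentiation under the integral sign. *)
Definition c11 (g g' : R -> R) (C : R) :=
  [/\ forall x, `|g' x| <= C, forall x h, `|g (x + h) - g x| <= C * `|h| &
      forall x h, `|g (x + h) - g x - h * g' x| <= C * h ^+ 2].

Lemma is_derive_c11 (g g' : R -> R) C (x : R) : c11 g g' C -> is_derive x (1 : R) g (g' x).
Proof. by move=> [_ _ H]; apply: (@is_derive_taylor _ _ _ _ C 1). Qed.

(** In the sum of the expansions at x and at y over the same segment the increments of g cancel; two
    quadratic remainders are left. *)
Lemma c11_derive (g g' : R -> R) C x y : 0 <= C -> c11 g g' C -> `|g' x - g' y| <= 2 * C * `|x - y|.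
Proof.
move=> C0 [_ _ H]; have [->|xy] := eqVneq x y; first by rewrite !subrr normr0 mulr0.
have h0 : 0 < `|x - y| by rewrite normr_gt0 subr_eq0.
rewrite -(ler_pM2l h0) -normrM.
have E : (x - y) * (g' x - g' y) =
    (g (y + (x - y)) - g y - (x - y) * g' y) + (g (x + (y - x)) - g x - (y - x) * g' x).
  have e1 : y + (x - y) = x by ring.
  have e2 : x + (y - x) = y by ring.
  by rewrite e1 e2; ring.
rewrite E; apply: le_trans (ler_normD _ _) _.
apply: le_trans (lerD (H y (x - y)) (H x (y - x))) _.
have e1 : (x - y) ^+ 2 = `|x - y| ^+ 2 by rewrite real_normK ?num_real.
have e2 : (y - x) ^+ 2 = `|x - y| ^+ 2 by rewrite -e1; ring.
rewrite e1 e2.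
by rewrite le_eqVlt; apply/orP; left; apply/eqP; ring.
Qed.

Lemma c11W (g g' : R -> R) C D : C <= D -> c11 g g' C -> c11 g g' D.
Proof.
move=> CD [H1 H2 H3]; split=> [x|x h|x h].
- exact: le_trans CD.
- by apply: le_trans (H2 _ _) _; rewrite ler_wpM2r.
- by apply: le_trans (H3 _ _) _; rewrite ler_wpM2r ?sqr_ge0.
Qed.

Lemma derivative_bound_lipschitz (F dF : R -> R) C : (forall x : R, is_derive x (1 : R) F (dF x)) ->
  (forall x, `|dF x| <= C) -> forall x y, `|F x - F y| <= C * `|x - y|.
Proof.
move=> D bd x y; wlog : x y / y <= x.
  by move=> H; have [/H//|/ltW/H] := leP y x; rewrite distrC [`|y - x|]distrC.
have cF : continuous F by apply: derivable_cts => z; case: (D z).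
move=> yx; have [c _ ->] := MVT_segment yx (fun z _ => D z) (continuous_subspaceT cF).
by rewrite normrM ler_wpM2r.
Qed.

(** For the remainder, the mean value theorem is applied to G(y) = g(y) - y g'(x), whose derivative
    is at most C |h| between x and x + h. *)
Lemma c11_of_bounds (g g' : R -> R) C : (forall x : R, is_derive x (1 : R) g (g' x)) ->
  (forall x, `|g' x| <= C) -> (forall x y, `|g' x - g' y| <= C * `|x - y|) -> c11 g g' C.
Proof.
move=> D bd lip; split=> // x h.
  by have := derivative_bound_lipschitz D bd (x + h) x; rewrite addrAC subrr add0r.
wlog C0 : / 0 <= C by apply; apply: le_trans (bd 0).
pose G y := g y - y * g' x.
have DG y : is_derive y (1:R) G (g' y - g' x).
  apply: (is_derive_eq (is_deriveB (D y) _)).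
  by rewrite scaler0 add0r [_%:A]mulr1.
have cG : continuous G.
  by apply: derivable_cts => y; case: (DG y).
have -> : g (x + h) - g x - h * g' x = G (x + h) - G x by rewrite /G; ring.
have Q (y z : R) : y <= z -> (forall w, y <= w <= z -> `|w - x| <= `|h|) -> z - y = `|h| ->
    `|G z - G y| <= C * h ^+ 2.
  move=> yz near zy; have [c cyz ->] := MVT_segment yz (fun w _ => DG w) (continuous_subspaceT cG).
  rewrite zy normrM normr_id -(real_normK (num_real h)) expr2 mulrA ler_wpM2r//.
  apply: le_trans (lip c x) _; rewrite ler_wpM2l// near//.
have [h0|/ltW h0] := leP 0 h.
  apply: Q; first by rewrite lerDl.
    by move=> w /andP[w1 w2]; rewrite [`|h|]ger0_norm// ger0_norm; clear - w1 w2; lra.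
  by rewrite ger0_norm//; ring.
rewrite distrC; apply: Q; first by rewrite gerDl.
  by move=> w /andP[w1 w2]; rewrite [`|h|]ler0_norm// ler0_norm; clear - w1 w2; lra.
by rewrite ler0_norm//; ring.
Qed.

Lemma kernel_c11 (mu : R -> R) : Ck 2 mu -> Wkinfty 2 mu ->
  exists C, [/\ 0 <= C, forall x, `|mu x| <= C, c11 mu mu^`()%classic C,
    forall x y, `|mu^`()%classic x - mu^`()%classic y| <= C * `|x - y| & continuous mu^`()%classic].
Proof.
move=> ck wk.
have [M0 H0] := wk [::] isT; have [M1 H1] := wk [:: (1:R)] isT.
have [M2 H2] := wk [:: (1:R); (1:R)] isT.
pose C := Num.max `|M0| (Num.max `|M1| `|M2|).
have D1 x : is_derive x (1:R) mu (mu^`()%classic x).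
  by rewrite derive1E; apply: derivableP; case: (ck [::] isT) => _ /(_ isT).
have E1 : mu^`()%classic = iter_derive [:: (1:R)] mu by apply/funext => x; rewrite derive1E.
have D2 x : is_derive x (1:R) mu^`()%classic (iter_derive [:: (1:R); (1:R)] mu x).
  by rewrite E1; apply: derivableP; case: (ck [:: (1:R)] isT) => _ /(_ isT).
have b0 x : `|mu x| <= C by rewrite /C !le_max (le_trans (H0 x) (ler_norm _)).
have b1 x : `|mu^`()%classic x| <= C.
  by rewrite /C !le_max E1 (le_trans (H1 x) (ler_norm _)) orbT.
have b2 x : `|iter_derive [:: (1:R); (1:R)] mu x| <= C.
  by rewrite /C !le_max (le_trans (H2 x) (ler_norm _)) !orbT.
have lip := derivative_bound_lipschitz D2 b2.
exists C; split=> //.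
- by apply: le_trans (b0 0).
- exact: c11_of_bounds.
- by apply: derivable_cts => x; case: (D2 x).
Qed.

Lemma taylor_step_ineq (C x S : R) : 0 <= C -> 0 <= x -> 0 <= S ->
  C * x ^+ 2 + x * (C * S) + C * S ^+ 2 <= C * (x + S) ^+ 2.
Proof.
move=> C0 x0 S0; have : 0 <= C * (x * S) by rewrite !mulr_ge0.
by move=> h; rewrite -subr_ge0 (_ : _ - _ = C * (x * S)) //; ring.
Qed.

Section Flux.
Variables (N : nat).
Implicit Types (a v : 'rV[R]_N).
Local Notation e_ i := (delta_mx 0 i : 'rV[R]_N).
Definition l1n a := \sum_i `|a 0 i|.

(** The coordinates are changed one at a time, each by a one-variable mean value estimate. *)
Lemma coord_lipschitz (g : 'rV[R]_N -> R) (C : R) :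
  (forall a i, derivable g a (e_ i)) -> (forall a i, `|'D_(e_ i) g a| <= C) ->
  forall a v, `|g (a + v) - g a| <= C * l1n v.
Proof.
move=> dg bd a v.
have step p (x : R) i : `|g (p + x *: e_ i) - g p| <= C * `|x|.
  have D s : is_derive s (1 : R) (fun s : R => g (p + s *: e_ i)) ('D_(e_ i) g (p + s *: e_ i)).
    by apply/is_derive_lineP; apply: derivableP.
  have := derivative_bound_lipschitz D (fun s => bd _ i) x 0.
  by rewrite scale0r addr0 subr0.
have : forall s : seq 'I_N, `|g (a + \sum_(i <- s) v 0 i *: e_ i) - g a| <= C * \sum_(i <- s) `|v 0 i|.
  elim=> [|i s IH]; first by rewrite !big_nil addr0 subrr normr0 mulr0.
  rewrite !big_cons mulrDr addrCA [_ *: _ + _]addrC.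
  apply: le_trans (lerD (step (a + \sum_(j <- s) v 0 j *: e_ j) (v 0 i) i) IH).
  by apply: le_trans (ler_normD _ _); rewrite addrA subrK.
by move/(_ (index_enum 'I_N)); rewrite -row_sum_delta.
Qed.

(** The Taylor bound in the l^1 norm is built coordinate by coordinate. Adding the increment x in
    direction i to a partial increment p of size S costs C x^2 for the one-variable expansion and C
    |x| S for moving the base point of the derivative from a + p to a; with the previous error C S^2
    this stays below C (|x| + S)^2. *)
Lemma velocity_function_c11 (nu : 'rV[R]_N -> R) : Ck 2 nu -> Wkinfty 2 nu ->
  exists C (d : 'I_N -> 'rV[R]_N -> R), [/\ 0 <= C, forall a, `|nu a| <= C,
    forall a i, `|d i a| <= C, forall a v, `|nu (a + v) - nu a| <= C * l1n v &
    (forall i a v, `|d i (a + v) - d i a| <= C * l1n v) /\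
    forall a v, `|nu (a + v) - nu a - \sum_i v 0 i * d i a| <= C * l1n v ^+ 2].
Proof.
move=> ck wk.
have bnd (w : seq 'rV[R]_N) : (size w <= 2)%N -> exists M, 0 <= M /\ forall a, `|iter_derive w nu a| <= M.
  move=> sw; have [M HM] := wk w sw; exists `|M|; split=> // a.
  exact: le_trans (HM a) (ler_norm _).
have [M0 [M00 H0]] := bnd [::] isT.
have /choice[M1 H1] : forall i, exists M, 0 <= M /\ forall a, `|'D_(e_ i) nu a| <= M.
  by move=> i; exact: (bnd [:: e_ i] isT).
have /choice[M2 H2] : forall ij : 'I_N * 'I_N, exists M, 0 <= M /\ forall a, `|'D_(e_ ij.1) (fun x => 'D_(e_ ij.2) nu x) a| <= M.
  by move=> ij; exact: (bnd [:: e_ ij.1; e_ ij.2] isT).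
pose C := M0 + (\sum_i M1 i + \sum_ij M2 ij).
have S1 : 0 <= \sum_i M1 i by apply: sumr_ge0 => i _; case: (H1 i).
have S2 : 0 <= \sum_ij M2 ij by apply: sumr_ge0 => i _; case: (H2 i).
have C0 : 0 <= C by rewrite !addr_ge0.
have b0 a : `|nu a| <= C by apply: le_trans (H0 a) _; rewrite lerDl addr_ge0.
have b1 a i : `|'D_(e_ i) nu a| <= C.
  have [m0 /(_ a) h] := H1 i; apply: le_trans h _.
  apply: le_trans (_ : \sum_i M1 i <= _); last by rewrite /C addrCA lerDl addr_ge0.
  by rewrite (bigD1 i)//= lerDl sumr_ge0// => j _; case: (H1 j).
have b2 a i j : `|'D_(e_ i) (fun x => 'D_(e_ j) nu x) a| <= C.
  have [m0 /(_ a) h] := H2 (i, j); apply: le_trans h _.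
  apply: le_trans (_ : \sum_i M2 i <= _); last by rewrite /C addrA lerDr addr_ge0.
  by rewrite (bigD1 (i, j))//= lerDl sumr_ge0// => k _; case: (H2 k).
have d1 a i : derivable nu a (e_ i) by have [_ /(_ isT)] := ck [::] isT; apply.
have d2 a i j : derivable (fun x => 'D_(e_ j) nu x) a (e_ i).
  by have [_ /(_ isT)] := ck [:: e_ j] isT; apply.
have lip1 := coord_lipschitz d1 b1.
have lip2 i := coord_lipschitz (fun a j => d2 a j i) (fun a j => b2 a j i).
exists C, (fun i a => 'D_(e_ i) nu a); split=> //; split=> // a v.
have step p (x : R) i : `|nu (p + x *: e_ i) - nu p - x * 'D_(e_ i) nu p| <= C * x ^+ 2.
  have D s : is_derive s (1 : R) (fun s : R => nu (p + s *: e_ i)) ('D_(e_ i) nu (p + s *: e_ i)).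
    by apply/is_derive_lineP; apply: derivableP.
  have D' s : is_derive s (1 : R) (fun s : R => 'D_(e_ i) nu (p + s *: e_ i)) ('D_(e_ i) (fun x => 'D_(e_ i) nu x) (p + s *: e_ i)).
    by apply/(is_derive_lineP (fun x => 'D_(e_ i) nu x)); apply: derivableP.
  have lp := derivative_bound_lipschitz D' (fun s => b2 _ i i).
  have [_ _ /(_ 0 x)] := c11_of_bounds D (fun s => b1 _ i) lp.
  by rewrite add0r scale0r addr0.
have : forall s : seq 'I_N, `|nu (a + \sum_(i <- s) v 0 i *: e_ i) - nu a - \sum_(i <- s) v 0 i * 'D_(e_ i) nu a|
    <= C * (\sum_(i <- s) `|v 0 i|) ^+ 2 /\
    l1n (\sum_(i <- s) v 0 i *: e_ i) <= \sum_(i <- s) `|v 0 i|.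
  elim=> [|i s [IH IH2]].
    rewrite !big_nil addr0 subrr subr0 normr0 mulr_ge0//; split=> //.
    by rewrite /l1n big1// => i _; rewrite mxE normr0.
  have l1D p q : l1n (p + q) <= l1n p + l1n q.
    by rewrite /l1n -big_split/=; apply: ler_sum => j _; rewrite mxE ler_normD.
  split; last first.
    rewrite !big_cons; apply: le_trans (l1D _ _) _; apply: lerD => //.
    rewrite /l1n (bigD1 i)//= big1 ?addr0 => [|j ji]; last by rewrite !mxE eqxx (negbTE ji) mulr0 normr0.
    by rewrite !mxE !eqxx mulr1.
  rewrite !big_cons addrCA [_ *: _ + _]addrC.
  set p := \sum_(j <- s) _ *: _; set S := \sum_(j <- s) `|_|; set x := v 0 i.
  have E : nu (a + p + x *: e_ i) - nu a - (x * 'D_(e_ i) nu a + \sum_(j <- s) v 0 j * 'D_(e_ j) nu a) =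
   (nu (a + p + x *: e_ i) - nu (a + p) - x * 'D_(e_ i) nu (a + p)) + x * ('D_(e_ i) nu (a + p) - 'D_(e_ i) nu a) +
   (nu (a + p) - nu a - \sum_(j <- s) v 0 j * 'D_(e_ j) nu a) by ring.
  rewrite E; apply: le_trans (ler_normD _ _) _.
  apply: le_trans (lerD (ler_normD _ _) (le_refl _)) _.
  have S0 : 0 <= S by apply: sumr_ge0.
  have Hx2 : `|x * ('D_(e_ i) nu (a + p) - 'D_(e_ i) nu a)| <= `|x| * (C * S).
    by rewrite normrM ler_wpM2l// (le_trans (lip2 _ _ _))// ler_wpM2l.
  apply: le_trans (lerD (lerD (step _ _ _) Hx2) IH) _.
  rewrite -(real_normK (num_real x)).
  exact: taylor_step_ineq.
by move/(_ (index_enum 'I_N)) => [+ _]; rewrite -row_sum_delta.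
Qed.

Variables (nu : 'rV[R]_N -> R) (mu dmu : 'I_N -> R -> R) (d : 'I_N -> 'rV[R]_N -> R) (C : R).
Hypotheses (C0 : 0 <= C) (nuC : forall a, `|nu a| <= C) (dC : forall a i, `|d i a| <= C)
  (nuL : forall a v, `|nu (a + v) - nu a| <= C * l1n v)
  (dL : forall i a v, `|d i (a + v) - d i a| <= C * l1n v)
  (nuT : forall a v, `|nu (a + v) - nu a - \sum_i v 0 i * d i a| <= C * l1n v ^+ 2)
  (muC : forall j x, `|mu j x| <= C) (mu11 : forall j, c11 (mu j) (dmu j) C)
  (dmuL : forall j x y, `|dmu j x - dmu j y| <= C * `|x - y|)
  (dmuc : forall j, continuous (dmu j)).

Definition conv (m g : R -> R) x := \int[leb]_xi (g xi * m (x - xi)).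
Definition convs (g : 'I_N -> R -> R) x : 'rV[R]_N := \row_j conv (mu j) (g j) x.
Definition vel g x := nu (convs g x).
Definition dvel g x := \sum_j d j (convs g x) * conv (dmu j) (g j) x.

Lemma conv_LI (m g : R -> R) x : continuous m -> (forall y, `|m y| <= C) -> LI setT g ->
  LI setT (fun xi => g xi * m (x - xi)).
Proof.
move=> cm mC Lg; apply: (LI_eq (f := fun xi => m (x - xi) * g xi)) => //.
  by move=> y _; rewrite mulrC.
apply: (LI_bM (C := C)) => //; apply: cts_measurable => y.
apply: (@continuous_comp _ _ _ (fun y => x - y) m); last exact: cm.
by apply: cvgB; [exact: cvg_cst|exact: cvg_id].
Qed.

Lemma conv_bound (m g : R -> R) x : continuous m -> (forall y, `|m y| <= C) -> LI setT g ->
  `|conv m g x| <= C * \int[leb]_y `|g y|.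
Proof.
move=> cm mC Lg; rewrite /conv -LI_intZ//; last exact: LI_abs.
apply: LI_int_absle => //; [exact: conv_LI|by apply: LIZ => //; exact: LI_abs|].
by move=> y _; rewrite normrM mulrC ler_wpM2r.
Qed.

Lemma conv_sub (m g h : R -> R) x : continuous m -> (forall y, `|m y| <= C) ->
  LI setT g -> LI setT h -> conv m g x - conv m h x = conv m (fun y => g y - h y) x.
Proof.
move=> cm mC Lg Lh; rewrite /conv -LI_intB//; [|exact: conv_LI..].
by apply: eq_Rintegral => y _; rewrite mulrBl.
Qed.

Lemma mu_cts j : continuous (mu j).
Proof. by apply: derivable_cts => x; case: (is_derive_c11 x (mu11 j)). Qed.

Lemma dmuC j x : `|dmu j x| <= C.
Proof. by case: (mu11 j). Qed.

Lemma conv_c11 j (g : R -> R) : LI setT g ->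
  c11 (conv (mu j) g) (conv (dmu j) g) (C * \int[leb]_y `|g y|).
Proof.
move=> Lg; have cmu := @mu_cts j; have LA := LI_abs Lg.
have Lm x := conv_LI x cmu (muC j) Lg; have Ld x := conv_LI x (@dmuc j) (@dmuC j) Lg.
split=> [x|x h|x h].
- by apply: conv_bound => //; exact: dmuC.
- rewrite /conv -LI_intB// -mulrA [_ * `|h|]mulrC mulrA -LI_intZ//.
  apply: LI_int_absle => //; [exact: LIB|exact: LIZ|].
  move=> y _; rewrite -mulrBr normrM mulrC ler_wpM2r//.
  by have [_ H _] := mu11 j; rewrite addrAC; exact: H.
- rewrite /conv -LI_intB// -LI_intZ// -LI_intB//; [|exact: LIB|exact: LIZ].
  rewrite -mulrA [_ * h ^+ 2]mulrC mulrA -LI_intZ//.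
  apply: LI_int_absle => //; [by apply: LIB => //; [exact: LIB|exact: LIZ]|exact: LIZ|].
  move=> y _; have -> : g y * mu j (x + h - y) - g y * mu j (x - y) - h * (g y * dmu j (x - y)) =
    g y * (mu j (x - y + h) - mu j (x - y) - h * dmu j (x - y)) by have -> : x - y + h = x + h - y by [ring]; ring.
  by rewrite normrM mulrC ler_wpM2r//; have [_ _ H] := mu11 j; exact: H.
Qed.

Variables (K : R) (K0 : 0 <= K).
Let P (g : 'I_N -> R -> R) := forall j, LI setT (g j) /\ \int[leb]_y `|g j y| <= K.

(** One constant for everything: the size of the velocity, its slope, its Taylor remainder, and its
    dependence on the density. *)
Definition vconst := C + N%:R * (C * (C * K)) + (N%:R * (C * (C * K)) + C * (N%:R * (C * K)) ^+ 2)
   + (C * C + N%:R * (C * C * (C * K)) + C * C).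

Let N0 : 0 <= N%:R :> R. Proof. exact: ler0n. Qed.

Let v1 : 0 <= N%:R * (C * (C * K)). Proof. by rewrite !mulr_ge0. Qed.
Let v2 : 0 <= C * (N%:R * (C * K)) ^+ 2. Proof. by rewrite mulr_ge0// sqr_ge0. Qed.
Let v3 : 0 <= N%:R * (C * C * (C * K)). Proof. by rewrite !mulr_ge0. Qed.
Let v4 : 0 <= C * C. Proof. by rewrite mulr_ge0. Qed.

Lemma vconst_ge0 : 0 <= vconst.
Proof. by rewrite /vconst !addr_ge0// ?mulr_ge0. Qed.

Lemma sum_bound (F : 'I_N -> R) (A : R) : (forall i, `|F i| <= A) -> `|\sum_i F i| <= N%:R * A.
Proof.
move=> H; apply: le_trans (ler_norm_sum _ _ _) _.
apply: le_trans (_ : \sum_(i < N) A <= _); first exact: ler_sum.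
by rewrite sumr_const card_ord mulr_natl.
Qed.

Let gc11 g j : P g -> c11 (conv (mu j) (g j)) (conv (dmu j) (g j)) (C * K).
Proof.
move=> Pg; have [Lg Kg] := Pg j; apply: c11W (conv_c11 j Lg).
by rewrite ler_wpM2l.
Qed.

Lemma vel_bound g x : `|vel g x| <= vconst.
Proof. by apply: le_trans (nuC _) _; rewrite /vconst -!addrA lerDl !addr_ge0// mulr_ge0. Qed.

(** A second-order chain rule: the Taylor remainder of [nu] between two values of the convolutions,
    plus the partial derivatives of [nu] applied to the Taylor remainders of the convolutions. *)
Lemma vel_c11 g : P g -> c11 (vel g) (dvel g) vconst.
Proof.
move=> Pg.
have lip x h : `|vel g (x + h) - vel g x| <= N%:R * (C * (C * K)) * `|h| /\
    l1n (convs g (x + h) - convs g x) <= N%:R * (C * K) * `|h|.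
  have L : l1n (convs g (x + h) - convs g x) <= N%:R * (C * K) * `|h|.
    rewrite -mulrA; apply: le_trans (ler_norm _) _; apply: sum_bound => i.
    by rewrite normr_id !mxE; have [_ H _] := gc11 i Pg; exact: H.
  split => //; have := nuL (convs g x) (convs g (x + h) - convs g x).
  rewrite addrCA subrr addr0 => H; apply: le_trans H _.
  by rewrite mulrCA -mulrA ler_wpM2l.
have b x : `|dvel g x| <= N%:R * (C * (C * K)).
  apply: sum_bound => j; rewrite normrM; apply: ler_pM => //.
  by have [H _ _] := gc11 j Pg; exact: H.
split=> [x|x h|x h].
- by apply: le_trans (b x) _; rewrite /vconst [C + _]addrC -!addrA lerDl !addr_ge0// mulr_ge0.
- apply: le_trans (proj1 (lip x h)) _; rewrite ler_wpM2r//.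
  by rewrite /vconst [C + _]addrC -!addrA lerDl !addr_ge0// mulr_ge0.
have [_ lp] := lip x h.
set v := convs g (x + h) - convs g x in lp *.
have := nuT (convs g x) v; rewrite {1}/v addrCA subrr addr0 -/(vel g (x + h)) -/(vel g x) => H1.
have E : vel g (x + h) - vel g x - h * dvel g x =
   (vel g (x + h) - vel g x - \sum_i v 0 i * d i (convs g x)) +
   \sum_i (v 0 i - h * conv (dmu i) (g i) x) * d i (convs g x).
  rewrite /dvel mulr_sumr; under [X in _ = _ + X]eq_bigr do rewrite mulrBl.
  rewrite sumrB addrA subrK; congr (_ - _); apply: eq_bigr => i _; ring.
rewrite E; apply: le_trans (ler_normD _ _) _.
apply: le_trans (_ : (N%:R * (C * (C * K)) + C * (N%:R * (C * K)) ^+ 2) * h ^+ 2 <= _); last first.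
  rewrite ler_wpM2r ?sqr_ge0// /vconst -addrA [leRHS]addrC -!addrA.
  by rewrite lerD2l lerDl !addr_ge0// mulr_ge0.
rewrite mulrDl [leRHS]addrC; apply: lerD.
  apply: le_trans H1 _; rewrite -mulrA ler_wpM2l// -(real_normK (num_real h)) -exprMn.
  rewrite ler_sqr ?nnegrE ?mulr_ge0//.
  by rewrite /l1n sumr_ge0.
rewrite -mulrA; apply: sum_bound => i; rewrite normrM mulrC -mulrA; apply: ler_pM => //.
by rewrite !mxE; have [_ _ H] := gc11 i Pg; exact: H.
Qed.

Definition l1dist (g h : 'I_N -> R -> R) := \sum_j \int[leb]_y `|g j y - h j y|.

Lemma l1dist_ge0 g h : 0 <= l1dist g h.
Proof. by apply: sumr_ge0 => j _; exact: Rintegral_ge0. Qed.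

Lemma vel_lipschitz g h x : P g -> P h ->
  `|vel g x - vel h x| <= vconst * l1dist g h /\ `|dvel g x - dvel h x| <= vconst * l1dist g h.
Proof.
move=> Pg Ph.
have cd (m : R -> R) j : continuous m -> (forall y, `|m y| <= C) ->
    `|conv m (g j) x - conv m (h j) x| <= C * \int[leb]_y `|g j y - h j y|.
  move=> cm mC; have [Lg _] := Pg j; have [Lh _] := Ph j.
  rewrite conv_sub//; apply: conv_bound => //; exact: LIB.
have L : l1n (convs g x - convs h x) <= C * l1dist g h.
  rewrite /l1dist mulr_sumr; apply: ler_sum => j _; rewrite !mxE.
  by apply: cd => //; exact: mu_cts.
have W := l1dist_ge0 g h.
have E (F : 'rV[R]_N -> R) : (forall a v, `|F (a + v) - F a| <= C * l1n v) ->
   `|F (convs g x) - F (convs h x)| <= C * C * l1dist g h.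
  move=> HF; have := HF (convs h x) (convs g x - convs h x); rewrite addrCA subrr addr0 => H'.
  by apply: le_trans H' _; rewrite -mulrA ler_wpM2l.
split.
  apply: le_trans (E nu nuL) _; rewrite ler_wpM2r//.
  by rewrite /vconst addrC -!addrA lerDl !addr_ge0// ?mulr_ge0.
rewrite /dvel -sumrB.
apply: le_trans (ler_norm_sum _ _ _) _.
apply: le_trans (_ : \sum_j (C * C * l1dist g h * (C * K) + C * (C * \int[leb]_y `|g j y - h j y|)) <= _).
  apply: ler_sum => j _.
  have -> : d j (convs g x) * conv (dmu j) (g j) x - d j (convs h x) * conv (dmu j) (h j) x =
   (d j (convs g x) - d j (convs h x)) * conv (dmu j) (g j) x +
   d j (convs h x) * (conv (dmu j) (g j) x - conv (dmu j) (h j) x) by ring.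
  apply: le_trans (ler_normD _ _) _; rewrite !normrM; apply: lerD; apply: ler_pM => //.
  - by apply: E; exact: dL.
  - by have [H _ _] := gc11 j Pg; exact: H.
  - by apply: cd => //; exact: dmuC.
rewrite big_split/= sumr_const card_ord -mulr_natl -!mulr_sumr -/(l1dist g h).
have -> : N%:R * (C * C * l1dist g h * (C * K)) + C * (C * l1dist g h) =
  (N%:R * (C * C * (C * K)) + C * C) * l1dist g h by ring.
rewrite ler_wpM2r// /vconst addrA lerD// addrA lerDr !addr_ge0//.
Qed.

End Flux.
End Velocity.

(** * The Lax-Friedrichs step *)

Section Scheme.
Context {R : realType}.

(* Summing over arbitrary duplicate-free lists, rather than over intervals, makes
   absolute summability over Z invariant under shifts of the index. *)
Definition bsum (a : int -> R) (K : R) := forall s : seq int, uniq s -> \sum_(i <- s) `|a i| <= K.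

Lemma bsum_ge0 a K : bsum a K -> 0 <= K.
Proof. by move/(_ [::] isT); rewrite big_nil. Qed.

Lemma bsum_le a b K : (forall i, `|a i| <= `|b i|) -> bsum b K -> bsum a K.
Proof. by move=> ab bK s us; apply: le_trans (bK s us); apply: ler_sum. Qed.

Lemma bsumW a K K' : K <= K' -> bsum a K -> bsum a K'.
Proof. by move=> KK' aK s us; exact: le_trans (aK s us) KK'. Qed.

Lemma bsum_shift a K j : bsum a K -> bsum (fun i => a (i + j)) K.
Proof.
move=> aK s us; rewrite -(big_map (fun i => i + j) xpredT (fun i => `|a i|)).
by apply: aK; rewrite map_inj_uniq//; exact: addIr.
Qed.

Lemma bsumD a b K K' : bsum a K -> bsum b K' -> bsum (fun i => a i + b i) (K + K').
Proof.
move=> aK bK s us; apply: le_trans (lerD (aK s us) (bK s us)).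
by rewrite -big_split/=; apply: ler_sum => i _; exact: ler_normD.
Qed.

Lemma bsumZ a K c : 0 <= c -> bsum a K -> bsum (fun i => c * `|a i|) (c * K).
Proof.
move=> c0 aK s us; apply: le_trans (ler_wpM2l c0 (aK s us)).
by rewrite mulr_sumr; apply: ler_sum => i _; rewrite normrM normr_id ger0_norm.
Qed.

Lemma ler_sum_subseq s1 s2 (F : int -> R) : uniq s1 -> uniq s2 -> {subset s1 <= s2} ->
  (forall i, 0 <= F i) -> \sum_(i <- s1) F i <= \sum_(i <- s2) F i.
Proof.
move=> u1 u2 sub F0; rewrite [leRHS](bigID (mem s1))/= -[X in _ <= X + _]big_filter.
have -> : \sum_(i <- [seq i <- s2 | i \in s1]) F i = \sum_(i <- s1) F i.
  apply: perm_big; apply: uniq_perm => //; first exact: filter_uniq.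
  by move=> i; rewrite mem_filter; case: (boolP (i \in s1)) => // /sub ->.
by rewrite lerDl sumr_ge0.
Qed.

(* Column sums of a tridiagonal matrix bound its norm on summable sequences. *)
Lemma bsum_tridiag (x y e al be ga : int -> R) (kap K Ke : R) :
  (forall i, [/\ 0 <= al i, 0 <= be i & 0 <= ga i]) ->
  (forall i, al i + be i + ga i <= kap) ->
  (forall i, y i = al i * x i + be (i + 1) * x (i + 1) + ga (i - 1) * x (i - 1) + e i) ->
  bsum x K -> bsum e Ke -> bsum y (kap * K + Ke).
Proof.
move=> pos col yE xK eK s us.
(* This list contains s and both of its translates, so the three shifted sums are all dominated by
   sums over it. *)
pose s' := undup (s ++ ([seq i + 1 | i <- s] ++ [seq i - 1 | i <- s])).
have us' : uniq s' by exact: undup_uniq.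
have k0 : 0 <= kap.
  by have [? ? ?] := pos 0; apply: le_trans (col 0); rewrite !addr_ge0.
apply: le_trans (_ : \sum_(i <- s) (al i * `|x i| + be (i + 1) * `|x (i + 1)| + ga (i - 1) * `|x (i - 1)| + `|e i|) <= _).
  apply: ler_sum => i _; rewrite yE; have [a0 _ _] := pos i.
  have [_ b0 _] := pos (i + 1); have [_ _ g0] := pos (i - 1).
  apply: le_trans (ler_normD _ _) _; rewrite lerD2r.
  apply: le_trans (ler_normD _ _) _; rewrite !normrM (ger0_norm g0) lerD2r.
  by apply: le_trans (ler_normD _ _) _; rewrite !normrM (ger0_norm a0) (ger0_norm b0).
rewrite big_split/=; apply: lerD; last exact: eK.
rewrite !big_split/=.
apply: le_trans (_ : \sum_(i <- s') (al i + be i + ga i) * `|x i| <= _); last first.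
  apply: le_trans (_ : \sum_(i <- s') kap * `|x i| <= _).
    by apply: ler_sum => i _; rewrite ler_wpM2r.
  by rewrite -mulr_sumr ler_wpM2l// xK.
have -> : \sum_(i <- s') (al i + be i + ga i) * `|x i| =
  \sum_(i <- s') al i * `|x i| + \sum_(i <- s') be i * `|x i| + \sum_(i <- s') ga i * `|x i|.
  by rewrite -!big_split/=; apply: eq_bigr => i _; rewrite !mulrDl.
have F0 (c : int -> R) : (forall i, 0 <= c i) -> forall i, 0 <= c i * `|x i|.
  by move=> c0 i; rewrite mulr_ge0.
apply: lerD; first apply: lerD.
- apply: ler_sum_subseq => //; last by apply: F0 => i; case: (pos i).
  by move=> i si; rewrite mem_undup mem_cat si.
- rewrite -(big_map (fun i => i + 1) xpredT (fun i => be i * `|x i|)).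
  apply: ler_sum_subseq => //; first by rewrite map_inj_uniq//; exact: addIr.
    by move=> i si; rewrite mem_undup !mem_cat si orbT.
  by apply: F0 => i; case: (pos i).
- rewrite -(big_map (fun i => i - 1) xpredT (fun i => ga i * `|x i|)).
  apply: ler_sum_subseq => //; first by rewrite map_inj_uniq//; exact: addIr.
    by move=> i si; rewrite mem_undup !mem_cat si !orbT.
  by apply: F0 => i; case: (pos i).
Qed.

Variables (f : R -> R) (L B lam beta : R).
Hypotheses (L0 : 0 <= L) (B0 : 0 <= B) (lam0 : 0 < lam) (beta0 : 0 < beta) (beta1 : beta < 2 / 3)
  (fL : forall a b, `|f a - f b| <= L * `|a - b|) (f0 : f 0 = 0)
  (cfl1 : lam * (L * B) <= beta) (cfl2 : lam * (L * B) <= 2 / 3 - beta).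

(** Here a and b are the velocities at the right and at the left interface, and p, q, r the left,
    central and right values. *)
Definition lf_step (a b p q r : R) := q
  - lam * ((a / 2 * (f q + f r) - beta * ((r - q) / (2 * lam)))
         - (b / 2 * (f p + f q) - beta * ((q - p) / (2 * lam)))).

Lemma lf_stepE a b p q r : lf_step a b p q r =
  q + beta / 2 * (r - 2 * q + p) - lam / 2 * (a * (f q + f r) - b * (f p + f q)).
Proof. by rewrite /lf_step; field; rewrite gt_eqF. Qed.

(** Difference quotients stand in for f', so that the scheme becomes linear and tridiagonal, with
    coefficients depending on the data. *)
Lemma slopeP (x y : R) : exists2 th, `|th| <= L & f x - f y = th * (x - y).
Proof.
have [->|xy] := eqVneq x y; first by exists 0; [rewrite normr0|rewrite !subrr mulr0].
exists ((f x - f y) / (x - y)); last by rewrite divfK// subr_eq0.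
by rewrite normrM normfV ler_pdivrMr ?normr_gt0 ?subr_eq0.
Qed.

Lemma slope_choice (x y : int -> R) : exists th : int -> R,
  forall i, `|th i| <= L /\ f (x i) - f (y i) = th i * (x i - y i).
Proof.
have /choice[th H] : forall i, exists th, `|th| <= L /\ f (x i) - f (y i) = th * (x i - y i).
  by move=> i; have [th ? ?] := slopeP (x i) (y i); exists th.
by exists th.
Qed.

(** The two roles of the CFL condition: the first bound keeps the off-diagonal coefficients beta/2
    -+ lam/2 a th nonnegative, the second keeps the diagonal ones at least 1/3. *)
Lemma AthB a th : `|a| <= B -> `|th| <= L -> `|lam / 2 * (a * th)| <= beta / 2 /\
  `|lam / 2 * (a * th)| <= (2 / 3 - beta) / 2.
Proof.
move=> aB tL; have : `|lam / 2 * (a * th)| <= lam * (L * B) / 2.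
  rewrite normrM (ger0_norm (x := lam / 2)) ?divr_ge0 ?(ltW lam0)//.
  rewrite (_ : lam * (L * B) / 2 = lam / 2 * (B * L)); last by ring.
  by rewrite ler_wpM2l ?divr_ge0 ?(ltW lam0)// normrM; apply: ler_pM.
by move=> H; split; apply: le_trans H _; rewrite ler_pM2r.
Qed.

Variables (A : int -> R) (u u' : int -> R).
Hypotheses (AB : forall i, `|A i| <= B)
  (uE : forall i, u' i = lf_step (A i) (A (i - 1)) (u (i - 1)) (u i) (u (i + 1))).

(** Conservation: with f(u_i) = th_i u_i the columns of the linearised scheme sum to exactly 1. *)
Lemma scheme_L1 K : bsum u K -> bsum u' K.
Proof.
move=> uK; have [th Hth] := slope_choice u (fun=> 0).
have fu i : f (u i) = th i * u i by have [_] := Hth i; rewrite f0 !subr0.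
have thL i : `|th i| <= L by case: (Hth i).
rewrite -[K]mul1r -[1 * K]addr0.
apply: (@bsum_tridiag u u' (fun=> 0)
  (fun i => 1 - beta - lam / 2 * ((A i - A (i - 1)) * th i))
  (fun i => beta / 2 - lam / 2 * (A (i - 1) * th i))
  (fun i => beta / 2 + lam / 2 * (A i * th i))) => //.
- move=> i; have [+ +] := AthB (AB i) (thL i); have [+ +] := AthB (AB (i - 1)) (thL i).
  rewrite !ler_norml => /andP[? ?] /andP[? ?] /andP[? ?] /andP[? ?].
  by split; lra.
- by move=> i; rewrite le_eqVlt; apply/orP; left; apply/eqP; field.
- move=> i; rewrite uE lf_stepE !fu !addrK; by field.
- by move=> s _; rewrite big1// => i _; rewrite normr0.
Qed.

Variables (om om2 K TV : R).
Hypotheses (uK : bsum u K) (uTV : bsum (fun i => u (i + 1) - u i) TV)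
  (Aom : forall i, `|A (i + 1) - A i| <= om)
  (Aom2 : forall i, `|A (i + 1) - 2 * A i + A (i - 1)| <= om2).

Lemma f_bound x : `|f x| <= L * `|x|.
Proof. by have := fL x 0; rewrite f0 !subr0. Qed.

(** The differences u_(i+1) - u_i obey a tridiagonal recursion with column sums at most 1 + lam L
    om. Its source contains the velocity only through second differences: in the application these
    are O(Dx^2) against a mass O(1/Dx) of u, so one step adds O(Dx). *)
Lemma scheme_TV : bsum (fun i => u' (i + 1) - u' i)
  ((1 + lam * L * om) * TV + lam * om2 * L * K).
Proof.
have [th Hth] := slope_choice (fun i => u (i + 1)) u.
have fu i : f (u (i + 1)) = f (u i) + th i * (u (i + 1) - u i).
  by have [_ <-] := Hth i; ring.
have thL i : `|th i| <= L by case: (Hth i).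
have om0 : 0 <= om by apply: le_trans (Aom 0).
have om20 : 0 <= om2 by apply: le_trans (Aom2 0).
have lamh : 0 <= lam / 2 by rewrite divr_ge0 ?ltW.
apply: (@bsum_tridiag (fun i => u (i + 1) - u i) (fun i => u' (i + 1) - u' i)
  (fun i => - (lam / 2 * ((A (i + 1) - 2 * A i + A (i - 1)) * (f (u i) + f (u (i + 1))))))
  (fun i => 1 - beta - lam / 2 * ((A (i + 1) - A (i - 1)) * th i))
  (fun i => beta / 2 - lam / 2 * (A i * th i))
  (fun i => beta / 2 + lam / 2 * (A i * th i))) => //.
- move=> i; have [+ +] := AthB (AB (i + 1)) (thL i); have [+ +] := AthB (AB (i - 1)) (thL i).
  have [+ _] := AthB (AB i) (thL i).
  rewrite !ler_norml => /andP[? ?] /andP[? ?] /andP[? ?] /andP[? ?] /andP[? ?].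
  by split; lra.
- move=> i; have : `|lam / 2 * ((A (i + 1) - A (i - 1)) * th i)| <= lam / 2 * (2 * om * L).
    rewrite normrM (ger0_norm lamh) ler_wpM2l// normrM; apply: ler_pM => //.
    have -> : A (i + 1) - A (i - 1) = (A (i + 1) - A i) + (A (i - 1 + 1) - A (i - 1)) by rewrite subrK; ring.
    by apply: le_trans (ler_normD _ _) _; rewrite mulr2n mulrDl mul1r lerD.
  rewrite ler_norml => /andP[h _]; move: h.
  have -> : lam / 2 * (2 * om * L) = lam * L * om by field.
  by lra.
- move=> i; rewrite !uE !lf_stepE !addrK.
  have e1 : f (u (i + 1 + 1)) = f (u i) + th i * (u (i + 1) - u i) + th (i + 1) * (u (i + 1 + 1) - u (i + 1)).
    by rewrite fu fu.
  have e2 : f (u (i - 1)) = f (u i) - th (i - 1) * (u (i - 1 + 1) - u (i - 1)).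
    by have := fu (i - 1); rewrite subrK => ->; rewrite addrK.
  by rewrite e1 e2 !fu !subrK; field.
- have E0 : 0 <= lam / 2 * (om2 * L) by rewrite mulr_ge0// mulr_ge0.
  have -> : lam * om2 * L * K = lam / 2 * (om2 * L) * K + lam / 2 * (om2 * L) * K by field.
  apply: (bsum_le (b := fun i => lam / 2 * (om2 * L) * `|u i| + lam / 2 * (om2 * L) * `|u (i + 1)|)).
    move=> i; rewrite normrN -mulrDr.
    rewrite [leRHS]ger0_norm; last by rewrite mulr_ge0// addr_ge0.
    rewrite [leRHS](_ : _ = lam / 2 * (om2 * (L * (`|u i| + `|u (i + 1)|)))); last by ring.
    rewrite normrM (ger0_norm lamh) ler_wpM2l// normrM; apply: ler_pM => //.
    by apply: le_trans (ler_normD _ _) _; rewrite mulrDr; apply: lerD; exact: f_bound.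
  by apply: bsumD; apply: bsumZ => //; exact: bsum_shift.
Qed.

Lemma scheme_time : bsum (fun i => u' i - u i) (beta * TV + lam * (B * L * TV + om * L * K)).
Proof.
have om0 : 0 <= om by apply: le_trans (Aom 0).
have lamh : 0 <= lam / 2 by rewrite divr_ge0 ?ltW.
pose c1 := beta / 2 + lam / 2 * (B * L); pose c2 := lam / 2 * (om * L).
have c10 : 0 <= c1 by rewrite addr_ge0// ?mulr_ge0// ?divr_ge0 ?ltW.
have c20 : 0 <= c2 by rewrite mulr_ge0// mulr_ge0.
pose d i := u (i + 1) - u i.
have -> : beta * TV + lam * (B * L * TV + om * L * K) = (c1 * TV + c1 * TV) + (c2 * K + c2 * K).
  by rewrite /c1 /c2; field.
apply: (bsum_le (b := fun i => (c1 * `|d i| + c1 * `|d (i - 1)|) + (c2 * `|u (i - 1)| + c2 * `|u i|))); last first.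
  apply: bsumD; apply: bsumD; apply: bsumZ => //.
    exact: (bsum_shift (a := d)).
  exact: bsum_shift.
move=> i; rewrite [leRHS]ger0_norm; last by rewrite !addr_ge0// mulr_ge0.
have -> : u' i - u i = beta / 2 * (d i - d (i - 1))
   - lam / 2 * (A i * ((f (u (i + 1)) - f (u i)) + (f (u i) - f (u (i - 1)))))
   - lam / 2 * ((A (i - 1 + 1) - A (i - 1)) * (f (u (i - 1)) + f (u i))).
  by rewrite uE lf_stepE /d !subrK; field.
have h1 : `|beta / 2 * (d i - d (i - 1))| <= beta / 2 * (`|d i| + `|d (i - 1)|).
  have b0 : 0 <= beta / 2 by rewrite divr_ge0 ?ltW.
  by rewrite normrM (ger0_norm b0) ler_wpM2l// ler_normB.
have h2 : `|lam / 2 * (A i * ((f (u (i + 1)) - f (u i)) + (f (u i) - f (u (i - 1)))))|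
    <= lam / 2 * (B * (L * (`|d i| + `|d (i - 1)|))).
  rewrite normrM (ger0_norm lamh) ler_wpM2l// normrM; apply: ler_pM => //.
  apply: le_trans (ler_normD _ _) _; rewrite mulrDr; apply: lerD; first exact: fL.
  by rewrite /d subrK; exact: fL.
have h3 : `|lam / 2 * ((A (i - 1 + 1) - A (i - 1)) * (f (u (i - 1)) + f (u i)))|
    <= lam / 2 * (om * (L * (`|u (i - 1)| + `|u i|))).
  rewrite normrM (ger0_norm lamh) ler_wpM2l// normrM; apply: ler_pM => //.
  by apply: le_trans (ler_normD _ _) _; rewrite mulrDr; apply: lerD; exact: f_bound.
apply: le_trans (ler_normB _ _) _; apply: le_trans (lerD (ler_normB _ _) (le_refl _)) _.
apply: le_trans (lerD (lerD h1 h2) h3) _.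
by rewrite /c1 /c2 le_eqVlt; apply/orP; left; apply/eqP; ring.
Qed.

(** The increment is a combination of those of p, q, r with coefficients made nonnegative by the CFL
    bounds. *)
Lemma lf_step_mono a b p q r p' q' r' : `|a| <= B -> `|b| <= B ->
  p <= p' -> q <= q' -> r <= r' -> lf_step a b p q r <= lf_step a b p' q' r'.
Proof.
move=> aB bB pp qq rr; rewrite -subr_ge0 !lf_stepE.
have [tp tpL fp] := slopeP p' p; have [tq tqL fq] := slopeP q' q; have [tr trL fr] := slopeP r' r.
have [+ _] := AthB bB tpL; have [_ +] := AthB aB tqL; have [_ +] := AthB bB tqL; have [+ _] := AthB aB trL.
rewrite !ler_norml => /andP[? ?] /andP[? ?] /andP[? ?] /andP[? ?].
have -> : q' + beta / 2 * (r' - 2 * q' + p') - lam / 2 * (a * (f q' + f r') - b * (f p' + f q')) -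
   (q + beta / 2 * (r - 2 * q + p) - lam / 2 * (a * (f q + f r) - b * (f p + f q))) =
   (q' - q) * (1 - beta - lam / 2 * (a * tq) + lam / 2 * (b * tq)) +
   (r' - r) * (beta / 2 - lam / 2 * (a * tr)) + (p' - p) * (beta / 2 + lam / 2 * (b * tp)).
  have -> : f q' = f q + tq * (q' - q) by rewrite -fq addrC subrK.
  have -> : f r' = f r + tr * (r' - r) by rewrite -fr addrC subrK.
  have -> : f p' = f p + tp * (p' - p) by rewrite -fp addrC subrK.
  by field.
by rewrite !addr_ge0// mulr_ge0 ?subr_ge0//; lra.
Qed.

(** Symmetric in its two values: at once the entropy flux of q with parameter c and that of c with
    parameter q. *)
Definition kflx (c q : R) := Num.sg (c - q) * (f c - f q).

(** Comparison with the steps from max(., c) and min(., c). By monotonicity both u1 and the image gc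
    of the constant c lie between m and M, so |u1 - gc| <= M - m, and M - m is the discrete entropy
    balance. A variable velocity does not preserve constants: gc = c - lam (a - b) f(c), whence the
    last term. *)
Lemma lf_step_entropy a b p q r c : `|a| <= B -> `|b| <= B ->
  `|lf_step a b p q r - c| - `|q - c| <=
   beta / 2 * (`|r - c| - 2 * `|q - c| + `|p - c|)
   - lam / 2 * (a * (kflx c q + kflx c r) - b * (kflx c p + kflx c q))
   + lam * (Num.sg (c - lf_step a b p q r) * ((a - b) * f c)).
Proof.
move=> aB bB; set u1 := lf_step a b p q r.
pose M := lf_step a b (Num.max p c) (Num.max q c) (Num.max r c).
pose m := lf_step a b (Num.min p c) (Num.min q c) (Num.min r c).
pose gc := lf_step a b c c c.
have gcE : gc = c - lam * ((a - b) * f c) by rewrite /gc lf_stepE; field.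
have mx x : x <= Num.max x c by rewrite le_max lexx.
have mc x : c <= Num.max x c by rewrite le_max lexx orbT.
have nx x : Num.min x c <= x by rewrite ge_min lexx.
have nc x : Num.min x c <= c by rewrite ge_min lexx orbT.
have uM : u1 <= M by apply: lf_step_mono.
have mu : m <= u1 by apply: lf_step_mono.
have gM : gc <= M by apply: lf_step_mono.
have mg : m <= gc by apply: lf_step_mono.
have absE x : Num.max x c - Num.min x c = `|x - c|.
  by case: (leP x c) => xc; [rewrite ler0_norm|rewrite gtr0_norm]; rewrite ?subr_le0 ?subr_gt0//; ring.
have flxE x : f (Num.max x c) - f (Num.min x c) = kflx c x.
  rewrite /kflx; case: (ltgtP x c) => xc.
  - by rewrite gtr0_sg ?subr_gt0// mul1r.
  - by rewrite ltr0_sg ?subr_lt0// mulN1r opprB.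
  - by rewrite xc !subrr mulr0.
have E : M - m = `|q - c| + beta / 2 * (`|r - c| - 2 * `|q - c| + `|p - c|)
   - lam / 2 * (a * (kflx c q + kflx c r) - b * (kflx c p + kflx c q)).
  by rewrite /M /m !lf_stepE -!absE -!flxE; ring.
have ug : `|u1 - gc| <= M - m.
  by rewrite ler_norml; apply/andP; split; lra.
have : `|u1 - c| <= `|u1 - gc| + lam * (Num.sg (c - u1) * ((a - b) * f c)).
  have -> : `|u1 - c| = Num.sg (u1 - c) * (u1 - gc) + lam * (Num.sg (c - u1) * ((a - b) * f c)).
    have -> : c - u1 = - (u1 - c) by ring.
    by rewrite sgrN normrEsg gcE; ring.
  rewrite lerD2r; apply: le_trans (ler_norm _) _.
  by rewrite normrM -[leRHS]mul1r ler_wpM2r// normr_sg; case: (_ != 0).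
by rewrite E in ug; lra.
Qed.

End Scheme.

(** * Discrete entropy inequality against smooth weights *)

Section CellInequality.
Context {R : realType}.

Definition zsum (I : nat) (a : int -> R) := \sum_(n < I + I) a (Posz n - Posz I).

Lemma zsumD I a b : zsum I (fun i => a i + b i) = zsum I a + zsum I b.
Proof. exact: big_split. Qed.

Lemma zsumB I a b : zsum I (fun i => a i - b i) = zsum I a - zsum I b.
Proof. exact: sumrB. Qed.

Lemma zsumZ I k a : zsum I (fun i => k * a i) = k * zsum I a.
Proof. by rewrite /zsum mulr_sumr. Qed.

Lemma zsum_le I a b : (forall i, a i <= b i) -> zsum I a <= zsum I b.
Proof. by move=> ab; apply: ler_sum. Qed.

Lemma zsum_ge0 I a : (forall i, 0 <= a i) -> 0 <= zsum I a.
Proof. by move=> a0; apply: sumr_ge0. Qed.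

Lemma zsum_norm I a : `|zsum I a| <= zsum I (fun i => `|a i|).
Proof. exact: ler_norm_sum. Qed.

Lemma eq_zsum I a b : (forall i, a i = b i) -> zsum I a = zsum I b.
Proof. by move=> ab; apply: eq_bigr. Qed.

(** The window is -I <= i < I, so the shift trades the value at -I for the one at I. *)
Lemma zsum_shift I a : a (Posz I) = 0 -> a (- Posz I) = 0 ->
  zsum I (fun i => a (i + 1)) = zsum I a.
Proof.
move=> aI aNI; apply/eqP; rewrite -subr_eq0 /zsum -sumrB.
pose F n := a (Posz n - Posz I).
rewrite (eq_bigr (fun n : 'I_(I + I) => F n.+1 - F n)); last first.
  by move=> n _; rewrite /F -addn1 PoszD addrAC.
rewrite -(big_mkord xpredT (fun n => F n.+1 - F n)) telescope_sumr// /F.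
have E : a (Posz 0 - Posz I) = 0 by rewrite sub0r.
by rewrite PoszD addrK aI E subrr.
Qed.

Lemma bsum_zsum I a K : bsum a K -> zsum I (fun i => `|a i|) <= K.
Proof.
move=> aK; rewrite /zsum -(big_map (fun n : 'I_(I + I) => Posz n - Posz I) xpredT (fun i => `|a i|)).
apply: aK; rewrite map_inj_uniq ?index_enum_uniq// => m n /addIr[] /ord_inj.
exact.
Qed.

Variables (f : R -> R) (L : R).
Hypotheses (L0 : 0 <= L) (fL : forall a b, `|f a - f b| <= L * `|a - b|) (f0 : f 0 = 0).

Lemma kflx_bound c q : `|kflx f c q| <= L * (`|c| + `|q|).
Proof.
rewrite /kflx normrM -[leRHS]mul1r; apply: ler_pM => //; first exact: normr_sg_le1.
by apply: le_trans (fL _ _) _; rewrite ler_wpM2l// ler_normB.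
Qed.

Lemma kflx_lipschitz c q r : `|kflx f c q - kflx f c r| <= L * `|q - r|.
Proof.
wlog qr : q r / q <= r.
  by move=> H; have [/H//|/ltW/H] := leP q r; rewrite distrC [`|r - q|]distrC.
have F a b : a <= b -> - (L * (b - a)) <= f b - f a <= L * (b - a).
  by move=> ab; rewrite -ler_norml; have := fL b a; rewrite [`|b - a|]ger0_norm ?subr_ge0.
rewrite [`|q - r|]distrC [`|r - q|]ger0_norm ?subr_ge0// ler_norml /kflx.
have [cq|qc] := leP c q.
  have cr := le_trans cq qr; have /andP[h1 h2] := F _ _ qr.
  have sq : Num.sg (c - q) * (f c - f q) = f q - f c.
    have [<-|ne] := eqVneq c q; first by rewrite !subrr mulr0.
    by rewrite ltr0_sg ?subr_lt0 ?lt_neqAle ?ne// mulN1r opprB.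
  have sr : Num.sg (c - r) * (f c - f r) = f r - f c.
    have [<-|ne] := eqVneq c r; first by rewrite !subrr mulr0.
    by rewrite ltr0_sg ?subr_lt0 ?lt_neqAle ?ne// mulN1r opprB.
  by rewrite sq sr; apply/andP; split; lra.
rewrite (gtr0_sg (x := c - q)) ?subr_gt0// mul1r.
have [cr|rc] := ltP c r.
  rewrite ltr0_sg ?subr_lt0// mulN1r.
  have /andP[h1 h2] := F _ _ (ltW qc); have /andP[h3 h4] := F _ _ (ltW cr).
  by apply/andP; split; lra.
have sr : Num.sg (c - r) * (f c - f r) = f c - f r.
  have [->|ne] := eqVneq c r; first by rewrite !subrr mulr0.
  by rewrite gtr0_sg ?subr_gt0 ?lt_neqAle 1?eq_sym ?ne// mul1r.
by rewrite sr; have /andP[h1 h2] := F _ _ qr; apply/andP; split; lra.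
Qed.

Variables (B lam beta : R) (lam0 : 0 < lam) (beta0 : 0 <= beta) (B0 : 0 <= B).
Variables (I : nat) (z w kap io : int -> R) (C e tau : R).
Hypotheses (C0 : 0 <= C) (e0 : 0 <= e) (tau0 : 0 <= tau)
  (z01 : forall i, 0 <= z i <= 1) (zI : z (Posz I) = 0) (zNI : z (- Posz I) = 0)
  (zL : forall i, `|z (i + 1) - z i| <= tau)
  (w0 : forall i, 0 <= w i <= C * e * io i) (io0 : forall i, 0 <= io i)
  (w1 : forall i, 0 <= w (i + 1) <= C * e * io i)
  (k1 : forall i, 0 <= kap (i + 1) <= C * e * io i)
  (wk : forall i, `|w i - kap (i + 1)| <= C * e ^+ 2 * io i)
  (wk1 : forall i, `|w (i + 1) - kap (i + 1)| <= C * e ^+ 2 * io i).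

Variables (c Dx : R) (u : int -> R).
Hypothesis Dx0 : 0 < Dx.
Local Notation d i := `|u (i + 1) - u i|.
Local Notation q i := (kflx f c (u i)).
Local Notation size i := (`|c| + `|u i| + `|u (i + 1)|).

(** Here c is the exact value at one point and u the scheme. [kF] is the transport term. The source
    -sgn(c - u_i) f(u_i) of the exact inequality is split as q_i - sgn(c - u_i) f(c), which gives
    [kQ] and [kS]: the discrete inequality with parameter c has f(c) in its source. *)
Definition kF := zsum I (fun i => z i * q i * (kap i - kap (i + 1))).
Definition kQ := zsum I (fun i => z i * w i * q i).
Definition kS (u : int -> R) := zsum I (fun i => z i * w i * (Num.sg (c - u i) * f c)).

Let Ce i : 0 <= C * e * io i. Proof. by rewrite !mulr_ge0. Qed.
Let qb i : `|q i| <= L * size i.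
Proof.
apply: le_trans (kflx_bound _ _) _; rewrite ler_wpM2l//.
by rewrite lerDl.
Qed.
Let qb1 i : `|q (i + 1)| <= L * size i.
Proof.
apply: le_trans (kflx_bound _ _) _; rewrite ler_wpM2l//.
by rewrite addrAC lerDl.
Qed.
Let zn i : `|z i| <= 1. Proof. by case/andP: (z01 i) => ? ?; rewrite ger0_norm. Qed.
Let wn i : `|w i| <= C * e * io i. Proof. by case/andP: (w0 i) => ? ?; rewrite ger0_norm. Qed.
Let w1n i : `|w (i + 1)| <= C * e * io i. Proof. by case/andP: (w1 i) => ? ?; rewrite ger0_norm. Qed.
Let k1n i : `|kap (i + 1)| <= C * e * io i. Proof. by case/andP: (k1 i) => ? ?; rewrite ger0_norm. Qed.

Lemma kF_abel : kF = zsum I (fun i => kap (i + 1) * (z (i + 1) * q (i + 1) - z i * q i)).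
Proof.
transitivity (zsum I (fun i => z i * q i * kap i) - zsum I (fun i => z i * q i * kap (i + 1))).
  by rewrite -zsumB; apply: eq_zsum => i; ring.
rewrite -(@zsum_shift I (fun i => z i * q i * kap i)) ?zI ?zNI ?mul0r//.
by rewrite -zsumB; apply: eq_zsum => i; ring.
Qed.

Lemma kF_bound : `|kF| <= zsum I (fun i => io i * (C * e * L * d i + C * e * L * tau * size i)).
Proof.
rewrite kF_abel; apply: le_trans (zsum_norm _ _) _; apply: zsum_le => i.
have -> : z (i + 1) * q (i + 1) - z i * q i = z i * (q (i + 1) - q i) + (z (i + 1) - z i) * q (i + 1) by ring.
have -> : io i * (C * e * L * d i + C * e * L * tau * size i) =
  C * e * io i * (1 * (L * d i) + tau * (L * size i)) by ring.
rewrite normrM; apply: ler_pM => //.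
apply: le_trans (ler_normD _ _) _; rewrite (normrM (z i)) (normrM (z (i + 1) - z i)).
by apply: lerD; apply: ler_pM => //; exact: kflx_lipschitz.
Qed.

Lemma kQ_bound : `|kQ| <= zsum I (fun i => io i * (C * e * L * size i)).
Proof.
apply: le_trans (zsum_norm _ _) _; apply: zsum_le => i.
have -> : io i * (C * e * L * size i) = 1 * (C * e * io i) * (L * size i) by ring.
rewrite (normrM (z i * w i)); apply: ler_pM => //.
by rewrite (normrM (z i)); exact: ler_pM.
Qed.

Lemma kS_bound u' : `|kS u'| <= zsum I (fun i => io i * (C * e * L * size i)).
Proof.
apply: le_trans (zsum_norm _ _) _; apply: zsum_le => i.
have -> : io i * (C * e * L * size i) = 1 * (C * e * io i) * (1 * (L * size i)) by ring.
rewrite !normrM; apply: ler_pM => //; rewrite ?mulr_ge0//; first exact: ler_pM.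
apply: ler_pM => //; first exact: normr_sg_le1.
apply: le_trans (f_bound fL f0 _) _; rewrite ler_wpM2l//.
by rewrite -addrA lerDl addr_ge0.
Qed.

Variables (A u' : int -> R) (v v' om : R).
Hypotheses (AB : forall i, `|A i| <= B) (vB : `|v| <= B) (om0 : 0 <= om)
  (Av : forall i, io i != 0 -> `|A i - v| <= om)
  (Av' : forall i, io i != 0 -> `|A i - A (i - 1) - Dx * v'| <= Dx * om).
Hypothesis ent : forall i, `|u' i - c| - `|u i - c| <=
   beta / 2 * (`|u (i + 1) - c| - 2 * `|u i - c| + `|u (i - 1) - c|)
   - lam / 2 * (A i * (q i + q (i + 1)) - A (i - 1) * (q (i - 1) + q i))
   + lam * (Num.sg (c - u' i) * ((A i - A (i - 1)) * f c)).

(* The differences of the weights are telescoped: what is left is of order e * (e + om)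
   per unit of total variation, where om measures the velocity mismatch. *)
Definition cell_error :=
  zsum I (fun i => io i * (C * (beta + 2 * lam * L * (1 + B)) *
    (e * (e + om + tau) * d i + e * (tau + Dx * om) * size i))).

Let io_mul i (x y : R) : (io i != 0 -> `|x| <= y) -> io i * `|x| <= io i * y.
Proof.
move=> H; have [->|/H h] := eqVneq (io i) 0; first by rewrite !mul0r.
exact: ler_wpM2l.
Qed.

Let p i := `|u i - c|.
Let Z i := (z i * w i + z (i + 1) * w (i + 1)) / 2.

Let dp i : `|p (i + 1) - p i| <= d i.
Proof.
apply: le_trans (ler_dist_dist _ _) _.
by rewrite opprB addrA subrK.
Qed.

Let T1 i : `|(z i * w i - z (i + 1) * w (i + 1)) * (p (i + 1) - p i)| <=
   io i * (C * (2 * e ^+ 2 + e * tau)) * d i.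
Proof.
rewrite normrM; apply: ler_pM => //.
have -> : z i * w i - z (i + 1) * w (i + 1) =
  z i * ((w i - kap (i + 1)) - (w (i + 1) - kap (i + 1))) - (z (i + 1) - z i) * w (i + 1) by ring.
apply: le_trans (ler_normB _ _) _; rewrite !normrM.
have -> : io i * (C * (2 * e ^+ 2 + e * tau)) =
   1 * (C * e ^+ 2 * io i + C * e ^+ 2 * io i) + tau * (C * e * io i) by ring.
apply: lerD; apply: ler_pM => //.
by apply: le_trans (ler_normB _ _) _; exact: lerD.
Qed.

Let Zk i : `|Z i - z i * kap (i + 1)| <= io i * (C * (e ^+ 2 + e * tau)).
Proof.
have -> : Z i - z i * kap (i + 1) = (z i * (w i - kap (i + 1)) + (z (i + 1) * (w (i + 1) - kap (i + 1)) +
   (z (i + 1) - z i) * kap (i + 1))) / 2 by rewrite /Z; field.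
rewrite normrM [`|2^-1|]ger0_norm ?invr_ge0// ler_pdivrMr//.
apply: le_trans (ler_normD _ _) _; apply: le_trans (lerD (le_refl _) (ler_normD _ _)) _; rewrite !normrM.
apply: le_trans (_ : 1 * (C * e ^+ 2 * io i) + (1 * (C * e ^+ 2 * io i) + tau * (C * e * io i)) <= _).
  by apply: lerD; [|apply: lerD]; apply: ler_pM.
have : 0 <= tau * (C * e * io i) by rewrite mulr_ge0.
by rewrite -subr_ge0 => h; rewrite -subr_ge0 (_ : _ - _ = tau * (C * e * io i)) -1?subr_ge0//; ring.
Qed.

Let Zb i : `|Z i| <= C * e * io i.
Proof.
rewrite /Z normrM [`|2^-1|]ger0_norm ?invr_ge0// ler_pdivrMr//.
apply: le_trans (ler_normD _ _) _; rewrite !normrM.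
have -> : C * e * io i * 2 = 1 * (C * e * io i) + 1 * (C * e * io i) by ring.
by apply: lerD; apply: ler_pM.
Qed.

Let T2 i : `|(q (i + 1) - q i) * (v * (z i * kap (i + 1)) - A i * Z i)| <=
  io i * (C * (1 + B) * L * (e * (e + om + tau))) * d i.
Proof.
have -> : io i * (C * (1 + B) * L * (e * (e + om + tau))) * d i =
  L * d i * (io i * (C * (1 + B) * (e * (e + om + tau)))) by ring.
rewrite (normrM (q (i + 1) - q i)); apply: ler_pM => //; first exact: kflx_lipschitz.
have -> : v * (z i * kap (i + 1)) - A i * Z i = - ((A i - v) * Z i) - v * (Z i - z i * kap (i + 1)) by ring.
apply: le_trans (ler_normB _ _) _; rewrite normrN (normrM (A i - v)) (normrM v).
apply: le_trans (_ : io i * (C * e * om) + io i * (B * (C * (e ^+ 2 + e * tau))) <= _).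
  apply: lerD; last by rewrite mulrCA; apply: ler_pM.
  apply: le_trans (_ : `|A i - v| * (C * e * io i) <= _); first by rewrite ler_wpM2l.
  have -> : `|A i - v| * (C * e * io i) = C * e * (io i * `|A i - v|) by ring.
  have -> : io i * (C * e * om) = C * e * (io i * om) by ring.
  by apply: ler_wpM2l; [exact: mulr_ge0|exact: io_mul (@Av i)].
have h : 0 <= io i * (C * (B * (e * om)) + C * (e * e) + C * (e * tau)) by rewrite mulr_ge0// !addr_ge0// ?mulr_ge0.
by rewrite -subr_ge0 (_ : _ - _ = io i * (C * (B * (e * om)) + C * (e * e) + C * (e * tau)))//; ring.
Qed.

Let T3 i : `|v * kap (i + 1) * ((z (i + 1) - z i) * q (i + 1))| <= io i * (C * B * L * (e * tau)) * size i.
Proof.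
have -> : io i * (C * B * L * (e * tau)) * size i = B * (C * e * io i) * (tau * (L * size i)) by ring.
rewrite (normrM (v * kap (i + 1))); apply: ler_pM => //.
  by rewrite (normrM v); exact: ler_pM.
by rewrite (normrM (z (i + 1) - z i)); exact: ler_pM.
Qed.

Let T4 i (s : R) : `|s| <= L * size i -> `|z i * w i * (A i - A (i - 1) - Dx * v') * s| <=
  io i * (C * L * (e * (Dx * om))) * size i.
Proof.
move=> sb; have -> : io i * (C * L * (e * (Dx * om))) * size i = C * e * (io i * (Dx * om)) * (L * size i) by ring.
rewrite (normrM (z i * w i * _)); apply: ler_pM => //; rewrite (normrM (z i * w i)).
apply: le_trans (_ : C * e * io i * `|A i - A (i - 1) - Dx * v'| <= _).
  by rewrite ler_wpM2r// (normrM (z i)) -[leRHS]mul1r; apply: ler_pM.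
by rewrite -[leLHS]mulrA; apply: ler_wpM2l; [exact: mulr_ge0|exact: io_mul (@Av' i)].
Qed.

(** Summation by parts, through the telescoping sequences [X1] and [X2], leaves four kinds of
    remainder: numerical viscosity ([T1]), the mismatch of velocities and of weights in the
    transport ([T2]), the variation of the cutoff ([T3]), and the mismatch between A_i - A_(i-1) and
    Dx v' ([T4]). *)
Lemma cell_inequality :
  zsum I (fun i => z i * w i * (`|u' i - c| - `|u i - c|)) +
    lam * (v * kF + Dx * v' * kQ - Dx * v' * kS u') <= cell_error.
Proof.
pose X1 i := z i * w i * (p i - p (i - 1)).
pose X2 i := z i * w i * (A (i - 1) * (q i - q (i - 1))).
have X1s : zsum I (fun i => X1 (i + 1)) = zsum I X1.
  by apply: zsum_shift; rewrite /X1 ?zI ?zNI !mul0r.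
have X2s : zsum I (fun i => X2 (i + 1)) = zsum I X2.
  by apply: zsum_shift; rewrite /X2 ?zI ?zNI !mul0r.
apply: le_trans (_ : zsum I (fun i => z i * w i * (
   beta / 2 * (p (i + 1) - 2 * p i + p (i - 1))
   - lam / 2 * (A i * (q i + q (i + 1)) - A (i - 1) * (q (i - 1) + q i))
   + lam * (Num.sg (c - u' i) * ((A i - A (i - 1)) * f c)))) +
    lam * (v * kF + Dx * v' * kQ - Dx * v' * kS u') <= _).
  rewrite lerD2r; apply: zsum_le => i; apply: ler_wpM2l; last exact: ent.
  by apply: mulr_ge0; [case/andP: (z01 i)|case/andP: (w0 i)].
rewrite kF_abel /kQ /kS mulrBr mulrDr !mulrA.
rewrite -!zsumZ -zsumD -zsumB -zsumD.
have E : zsum I (fun i => beta / 2 * X1 (i + 1) + lam / 2 * X2 (i + 1) - (beta / 2 * X1 i + lam / 2 * X2 i)) = 0.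
  by rewrite zsumB zsumD zsumD !zsumZ X1s X2s subrr.
rewrite -[leLHS]subr0 -E -zsumB.
apply: zsum_le => i; rewrite /X1 /X2 !addrK.
have := ler_norm ((z i * w i - z (i + 1) * w (i + 1)) * (p (i + 1) - p i)).
move/le_trans/(_ (T1 i)).
have := ler_norm ((q (i + 1) - q i) * (v * (z i * kap (i + 1)) - A i * Z i)).
move/le_trans/(_ (T2 i)).
have := ler_norm (v * kap (i + 1) * ((z (i + 1) - z i) * q (i + 1))).
move/le_trans/(_ (T3 i)).
have := ler_norm (- (z i * w i * (A i - A (i - 1) - Dx * v') * q i)).
rewrite normrN => /le_trans/(_ (T4 (qb i))).
have := ler_norm (z i * w i * (A i - A (i - 1) - Dx * v') * (Num.sg (c - u' i) * f c)).
have sb : `|Num.sg (c - u' i) * f c| <= L * size i.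
  rewrite normrM -[leRHS]mul1r; apply: ler_pM => //; first exact: normr_sg_le1.
  apply: le_trans (f_bound fL f0 _) _; rewrite ler_wpM2l//.
  by rewrite -addrA lerDl addr_ge0.
move=> /le_trans/(_ (T4 sb)) h5 h4 h3 h2 h1.
have b2 : 0 <= beta / 2 by rewrite divr_ge0.
have l0 := ltW lam0.
apply: le_trans (_ : beta / 2 * (io i * (C * (2 * e ^+ 2 + e * tau)) * d i) +
  lam * (io i * (C * (1 + B) * L * (e * (e + om + tau))) * d i) +
  lam * (io i * (C * B * L * (e * tau)) * size i) +
  lam * (io i * (C * L * (e * (Dx * om))) * size i) +
  lam * (io i * (C * L * (e * (Dx * om))) * size i) <= _).
  apply: le_trans (lerD (lerD (lerD (lerD (ler_wpM2l b2 h1) (ler_wpM2l l0 h2)) (ler_wpM2l l0 h3)) (ler_wpM2l l0 h4)) (ler_wpM2l l0 h5)).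
  by rewrite /Z le_eqVlt; apply/orP; left; apply/eqP; field.
have g1 : 0 <= io i * d i by rewrite mulr_ge0.
have g2 : 0 <= io i * size i by rewrite mulr_ge0// !addr_ge0.
have h : 0 <= C * (io i * d i) * (beta * (e * om) + beta * (e * tau) / 2 + lam * L * (1 + B) * (e * (e + om + tau)))
   + C * (io i * size i) * (beta * (e * (tau + Dx * om)) + lam * L * (2 + B) * (e * tau) + 2 * (lam * L * B * (e * (Dx * om)))).
  have Dx0' := ltW Dx0.
  by do ?[exact: g1|exact: g2|apply: addr_ge0|apply: mulr_ge0 => //].
rewrite -subr_ge0; apply: le_trans h _; rewrite le_eqVlt; apply/orP; left; apply/eqP; by field.
Qed.

End CellInequality.

(** * Smoothed indicators of cells and of time steps *)

Section StepDifferences.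
Context {R : realType}.
Variables (H : R -> R) (C eps h : R).
Hypotheses (sH : is_step H C) (eps0 : 0 < eps) (h0 : 0 < h) (heps : h <= eps).

(* At scale eps, wdiff y is a smoothed indicator of [y, y + h], and the derivative
   of wdiff y is (wder y - wder (y + h)) / h. *)
Definition wdiff y x := H ((x - y) / eps) - H ((x - (y + h)) / eps).
Definition wder y x := h / eps * H^`()%classic ((x - y) / eps).

Let smoothH : smooth H. Proof. by case: sH. Qed.

Lemma step_derive_ge0 x : 0 <= H^`()%classic x.
Proof.
case: sH => sm _ _ hm _; apply: homo_derive1_ge0 => // y; exact: smooth_derivable.
Qed.

Lemma step_derive_le x : `|H^`()%classic x| <= C.
Proof. by case: sH => _ _ _ _ HC; case: (HC x). Qed.

Lemma step_c11 : c11 H H^`()%classic C.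
Proof.
apply: c11_of_bounds => [x|x|]; first exact: smooth_is_derive.
  exact: step_derive_le.
apply: (derivative_bound_lipschitz (dF := H^`()^`()%classic)) => x.
  by apply: smooth_is_derive; exact: smooth_derive1.
by case: sH => _ _ _ _ HC; case: (HC x).
Qed.

Lemma step_const_ge0 : 0 <= C.
Proof. exact: le_trans (step_derive_le 0). Qed.

Let e := h / eps.
Let e0 : 0 < e. Proof. exact: divr_gt0. Qed.

Lemma affine_node y x : (x - y) / eps = eps^-1 * x + (- y / eps).
Proof. by field; rewrite gt_eqF. Qed.

Lemma smooth_node (G : R -> R) y : smooth G -> smooth (fun x => G ((x - y) / eps)).
Proof.
move=> sG; have := smooth_affine (eps^-1) (- y / eps) sG; congr smooth.
by apply/funext => x; rewrite affine_node.
Qed.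

Lemma smooth_wdiff y : smooth (wdiff y).
Proof.
have := smoothD (smooth_node y smoothH) (smoothM (smooth_cst (-1)) (smooth_node (y + h) smoothH)).
by congr smooth; apply/funext => x; rewrite /wdiff /= mulN1r.
Qed.

Lemma is_derive_node (G : R -> R) y x : smooth G ->
  is_derive x (1 : R) (fun x => G ((x - y) / eps)) (eps^-1 * G^`()%classic ((x - y) / eps)).
Proof.
move=> sG; rewrite [eps^-1 * _]mulrC.
apply: (@is_derive1_comp _ G (fun x => (x - y) / eps)); first exact: smooth_is_derive.
have -> : (fun x0 : R => (x0 - y) / eps) = (fun x0 => eps^-1 * x0 + (- y / eps)).
  by apply/funext => ?; exact: affine_node.
by apply: (is_derive_eq (is_deriveD _ _)); rewrite addr0 /GRing.scale/= mulr1.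
Qed.

Lemma wdiff_derive y x : h * (wdiff y)^`()%classic x = wder y x - wder (y + h) x.
Proof.
rewrite derive1E; have [_ ->] := is_deriveB (is_derive_node y x smoothH) (is_derive_node (y + h) x smoothH).
by rewrite /wder; field; rewrite gt_eqF.
Qed.

Lemma wdiff_ge0 y x : 0 <= wdiff y x.
Proof.
rewrite subr_ge0; case: sH => _ _ _ hm _; apply: hm.
by rewrite ler_pM2r ?invr_gt0// opprD addrA gerDl oppr_le0 ltW.
Qed.

Lemma wder_ge0 y x : 0 <= wder y x.
Proof. by rewrite mulr_ge0 ?step_derive_ge0// ltW. Qed.

Lemma wder_le y x : wder y x <= C * e.
Proof.
rewrite /wder mulrC; apply: ler_wpM2r; first exact: ltW.
exact: le_trans (ler_norm _) (step_derive_le _).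
Qed.

Let nodeB y x : (x - (y + h)) / eps = (x - y) / eps + (- e).
Proof. by rewrite /e; field; rewrite gt_eqF. Qed.

Let ne : `|- e| = e. Proof. by rewrite normrN gtr0_norm. Qed.

Lemma wdiff_le y x : wdiff y x <= C * e.
Proof.
have [_ + _] := step_c11 => /(_ ((x - y) / eps) (- e)).
rewrite -nodeB ne distrC; exact: le_trans (ler_norm _).
Qed.

(** The Taylor remainder of the step over the distance e: one order smaller than either term alone.
    This gain is what makes the scheme consistent against the weights. *)
Lemma wdiff_wder y x : `|wdiff y x - wder y x| <= C * e ^+ 2.
Proof.
have [_ _ +] := step_c11 => /(_ ((x - y) / eps) (- e)).
rewrite -nodeB sqrrN -normrN; congr (`|_| <= _); rewrite /wdiff /wder -/e; ring.
Qed.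

Lemma wdiff_wder_next y x : `|wdiff y x - wder (y + h) x| <= C * e ^+ 2.
Proof.
have [_ _ +] := step_c11 => /(_ ((x - (y + h)) / eps) e).
by rewrite nodeB subrK -nodeB.
Qed.

Lemma wdiff_supp y x : wdiff y x != 0 -> 0 <= x - y <= eps + h.
Proof.
apply: contraTT; rewrite negb_and -!ltNge negbK /wdiff; case: sH => _ H0 H1 _ _ /orP[/ltW xy|xy].
  rewrite !H0 ?subrr// pmulr_lle0 ?invr_gt0//.
  by apply: le_trans xy; rewrite opprD addrA gerDl oppr_le0 ltW.
have xy' := ltW xy.
rewrite !H1 ?subrr//; rewrite ler_pdivlMr// mul1r; first by rewrite opprD addrA lerBrDr.
by apply: le_trans xy'; rewrite lerDl ltW.
Qed.

Lemma wder_supp y x : wder y x != 0 -> 0 <= x - y <= eps.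
Proof.
apply: contraTT; rewrite negb_and -!ltNge negbK /wder; case: sH => _ H0 H1 _ _ /orP[xy|xy].
  rewrite (_ : H^`()%classic _ = 0) ?mulr0//; apply: (@derive1_locally_cst _ _ _ 0).
  near=> z; apply: H0; apply: ltW; near: z; apply: lt_nbhsl.
  by rewrite pmulr_llt0 ?invr_gt0.
rewrite (_ : H^`()%classic _ = 0) ?mulr0//; apply: (@derive1_locally_cst _ _ _ 1).
near=> z; apply: H1; apply: ltW; near: z; apply: lt_nbhsr.
by rewrite ltr_pdivlMr// mul1r.
Unshelve. all: by end_near. Qed.

(** A weight with node y is supported in [y, y + eps + h], and the reference point c is within h <=
    eps of y; hence 3 eps. *)
Definition near3 (c x : R) : R := (nat_of_bool (`|x - c| <= 3 * eps))%:R.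

Lemma near3_ge0 c x : 0 <= near3 c x.
Proof. exact: ler0n. Qed.

Lemma near3_supp (y c x a b : R) : `|c - y| <= h -> (a != 0 -> 0 <= x - y <= eps + h) -> 0 <= b ->
  a <= b -> a <= b * near3 c x.
Proof.
move=> cy as0 b0 ab; rewrite /near3; case: (leP `|x - c|) => xc /=; first by rewrite mulr1.
rewrite mulr0.
have [->//|/as0 /andP[h1 h2]] := eqVneq a 0.
move: cy xc; rewrite ler_norml => /andP[? ?].
by rewrite real_ltNge ?num_real// ler_norml; case/negP; have := h0; have := heps; lra.
Qed.

Lemma wdiff_near (y c x : R) : `|c - y| <= h -> 0 <= wdiff y x <= C * e * near3 c x.
Proof.
move=> cy; rewrite wdiff_ge0; apply: (near3_supp cy); [exact: wdiff_supp| |exact: wdiff_le].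
by rewrite mulr_ge0 ?step_const_ge0// ltW.
Qed.

Lemma wder_near (y c x : R) : `|c - y| <= h -> 0 <= wder y x <= C * e * near3 c x.
Proof.
move=> cy; rewrite wder_ge0; apply: (near3_supp cy); [| |exact: wder_le].
  by move=> /wder_supp /andP[-> /le_trans ->//]; rewrite lerDl ltW.
by rewrite mulr_ge0 ?step_const_ge0// ltW.
Qed.

Lemma wdiff_wder_near (y c x : R) : `|c - y| <= h -> `|wdiff y x - wder y x| <= C * e ^+ 2 * near3 c x.
Proof.
move=> cy; apply: (near3_supp cy); [| |exact: wdiff_wder].
  rewrite normr_eq0 => ne0; have [w0|/wdiff_supp//] := eqVneq (wdiff y x) 0.
  move: ne0; rewrite w0 sub0r oppr_eq0 => /wder_supp /andP[-> /le_trans ->//].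
  by rewrite lerDl ltW.
by rewrite mulr_ge0 ?step_const_ge0// exprn_ge0 ?ltW.
Qed.

Lemma wdiff_wder_next_near (y c x : R) : `|c - y| <= h -> `|wdiff y x - wder (y + h) x| <= C * e ^+ 2 * near3 c x.
Proof.
move=> cy; apply: (near3_supp cy); [| |exact: wdiff_wder_next].
  rewrite normr_eq0 => ne0; have [w0|/wdiff_supp//] := eqVneq (wdiff y x) 0.
  move: ne0; rewrite w0 sub0r oppr_eq0 => /wder_supp /andP[h1 h2].
  by rewrite -[x - y <= _]lerBlDr -addrA -opprD h2 andbT (le_trans h1)// opprD addrA gerDl oppr_le0 ltW.
by rewrite mulr_ge0 ?step_const_ge0// exprn_ge0 ?ltW.
Qed.

(** Counting by telescoping: the clipped affine function g gains h at each counted node, never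
    decreases, and ranges over an interval of length 6 eps + h. *)
Lemma near3_count (n : nat) s x : \sum_(m < n) near3 (m%:R * h + s) x <= 8 * eps / h.
Proof.
pose g (m : nat) := Num.min (Num.max (m%:R * h + s - x) (- (3 * eps))) (3 * eps + h).
have step (m : nat) : h * near3 (m%:R * h + s) x <= g m.+1 - g m.
  rewrite /near3 /g; set y := m%:R * h + s.
  have -> : m.+1%:R * h + s - x = y - x + h by rewrite /y -natr1; ring.
  rewrite distrC; case: (leP `|y - x|) => yx; rewrite /= ?mulr1 ?mulr0.
    move: yx; rewrite ler_norml => /andP[h1 h2].
    have e1 : Num.max (y - x) (- (3 * eps)) = y - x by apply/max_idPl.
    have e2 : Num.max (y - x + h) (- (3 * eps)) = y - x + h.
      by apply/max_idPl; apply: le_trans h1 _; rewrite lerDl ltW.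
    have e3 : Num.min (y - x + h) (3 * eps + h) = y - x + h by apply/min_idPl; rewrite lerD2r.
    have e4 : Num.min (y - x) (3 * eps + h) = y - x.
      by apply/min_idPl; apply: le_trans h2 _; rewrite lerDl ltW.
    by rewrite e1 e2 e3 e4 addrAC subrr add0r.
  have mono (a b : R) : a <= b -> Num.min (Num.max a (- (3 * eps))) (3 * eps + h) <=
     Num.min (Num.max b (- (3 * eps))) (3 * eps + h).
    move=> ab; rewrite le_min !ge_min lexx orbT andbT; apply/orP; left.
    by rewrite ge_max !le_max ab lexx orbT.
  by rewrite subr_ge0 mono// lerDl ltW.
rewrite ler_pdivlMr// mulrC mulr_sumr.
apply: le_trans (ler_sum _ (fun (m : 'I_n) _ => step m)) _.
rewrite -(big_mkord xpredT (fun m => g m.+1 - g m)) telescope_sumr//.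
have gb m : - (3 * eps) <= g m <= 3 * eps + h.
  by rewrite /g ge_min lexx orbT andbT le_min le_max lexx orbT/=; have := h0; have := eps0; lra.
by have /andP[_ ?] := gb n; have /andP[? _] := gb 0%N; have := heps; have := eps0; lra.
Qed.

End StepDifferences.

(** * Summation by parts in time *)

Section TimeSummation.
Context {R : realType}.

(** At positive times the first time weight is only switched off, never on, so its derivative has no
    contribution of index 0. *)
Definition vanish0 (k : nat -> R) (m : nat) : R := if m is 0%N then 0 else k m.

(** Adding sums that telescope to 0, one for D and one for S, turns the derivatives of the time
    weights into the differences D_(m+1) - D_m weighted by kt_(m+1) / Dt, to which the one-step
    inequality applies. The sum for S is needed because the discrete source is evaluated at the new
    time level. Exchanging chi_m for kt_(m+1) or kt_m in the other terms leaves the first two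
    errors. *)
Lemma time_abel (D F Q S CE chi dchi kt : nat -> R) (v v' B lam Dx Dt : R) (M : nat) :
  0 < lam -> 0 < Dx -> Dt = lam * Dx -> `|v| <= B -> `|v'| <= B ->
  (forall m, 0 <= kt m) -> kt M.+1 = 0 ->
  Dt * dchi 0%N = - kt 1%N -> (forall m, Dt * dchi m.+1 = kt m.+1 - kt m.+2) ->
  (forall m, D m.+1 - D m + lam * (v * F m + Dx * v' * Q m - Dx * v' * S m.+1) <= CE m) ->
  \sum_(m < M.+1) (dchi m * D m + chi m * (v * F m / Dx + v' * (Q m - S m))) <=
  \sum_(m < M.+1) (`|chi m - kt m.+1| * (B / Dx * `|F m| + B * `|Q m|) +
     `|vanish0 kt m - chi m| * (B * `|S m|) + kt m.+1 / Dt * CE m).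
Proof.
move=> lam0 Dx0 DtE vB v'B kt0 ktM d0 d1 ent.
have Dt0 : 0 < Dt by rewrite DtE mulr_gt0.
pose k0 := vanish0 kt.
have tele (G : nat -> R) : \sum_(m < M.+1) (kt m.+1 * G m.+1 - k0 m * G m) = 0.
  rewrite (eq_bigr (fun m : 'I_M.+1 => k0 m.+1 * G m.+1 - k0 m * G m))//.
  rewrite -(big_mkord xpredT (fun m => k0 m.+1 * G m.+1 - k0 m * G m)) telescope_sumr//.
  by rewrite /= ktM !mul0r subrr.
have dE m : Dt * dchi m = k0 m - kt m.+1 by case: m => [|m]; rewrite ?d0 ?d1 ?sub0r.
have dE' m : dchi m = (k0 m - kt m.+1) / Dt by rewrite -dE mulrC mulKf// gt_eqF.
pose E m := (kt m.+1 * D m.+1 - k0 m * D m) / Dt - v' * (kt m.+1 * S m.+1 - k0 m * S m).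
have E0 : \sum_(m < M.+1) E m = 0.
  by rewrite /E sumrB -mulr_suml -mulr_sumr !tele mul0r mulr0 subrr.
rewrite -[leLHS]addr0 -[X in _ + X <= _]E0 -big_split/=; apply: ler_sum => m _; rewrite -/(k0 m).
have -> : dchi m * D m + chi m * (v * F m / Dx + v' * (Q m - S m)) + E m =
  (chi m - kt m.+1) * (v / Dx * F m + v' * Q m) + (k0 m - chi m) * (v' * S m) +
  kt m.+1 / Dt * (D m.+1 - D m + lam * (v * F m + Dx * v' * Q m - Dx * v' * S m.+1)).
  by rewrite /E dE' DtE; field; rewrite !gt_eqF.
apply: lerD; first apply: lerD.
- apply: le_trans (ler_norm _) _; rewrite normrM ler_wpM2l//.
  apply: le_trans (ler_normD _ _) _; rewrite !normrM; apply: lerD.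
    by rewrite normfV (gtr0_norm Dx0) ler_wpM2r// ler_wpM2r// invr_ge0 ltW.
  by rewrite ler_wpM2r.
- by apply: le_trans (ler_norm _) _; rewrite !normrM ler_wpM2l// ler_wpM2r.
- by rewrite ler_wpM2l// divr_ge0// ltW.
Qed.

End TimeSummation.

Section KuznetsovPointwise.
Context {R : realType}.
Variables (H : R -> R) (C eps lam Dx beta L B : R) (f : R -> R).
Hypotheses (sH : is_step H C) (eps0 : 0 < eps) (lam0 : 0 < lam) (lam1 : lam <= 1)
  (Dx0 : 0 < Dx) (Dxe : Dx = eps ^+ 2) (eps1 : eps <= 1).
Local Notation Dt := (lam * Dx).

Definition xnode (i : int) : R := (i%:~R - 2^-1) * Dx.
Definition sw (i : int) (x : R) := wdiff H eps Dx (xnode i) x.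
Definition sk (i : int) (x : R) := wder H eps Dx (xnode i) x.
Definition sio (i : int) (x : R) := near3 eps (i%:~R * Dx) x.
(* The first time weight absorbs all earlier times; H (t + 2) is 1 for t >= -1 and
   only serves to bound its support from below. *)
Definition tchi (m : nat) (t : R) :=
  if m is 0%N then H (t + 2) - H ((t - Dt) / eps) else wdiff H eps Dt (m%:R * Dt) t.
Definition tkap (m : nat) (t : R) := wder H eps Dt (m%:R * Dt) t.

(** With this choice of eps the size Dx / eps of a space weight and the scale of localisation
    coincide. *)
Lemma mesh_ratio : Dx / eps = eps.
Proof. by rewrite Dxe expr2 mulfK// gt_eqF. Qed.

Lemma mesh_le : Dx <= eps.
Proof. by rewrite Dxe expr2 ler_piMl// ltW. Qed.

Lemma time_step_gt0 : 0 < Dt. Proof. exact: mulr_gt0. Qed.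

Lemma time_step_le : Dt <= eps.
Proof. by apply: le_trans mesh_le; rewrite ler_piMl// ltW. Qed.

Lemma xnodeS i : xnode (i + 1) = xnode i + Dx.
Proof. by rewrite /xnode intrD mulr1z; ring. Qed.

Lemma xnode_near i : `|i%:~R * Dx - xnode i| <= Dx /\ `|i%:~R * Dx - xnode (i + 1)| <= Dx.
Proof.
rewrite xnodeS /xnode; have -> : i%:~R * Dx - (i%:~R - 2^-1) * Dx = Dx / 2 by ring.
have -> : i%:~R * Dx - ((i%:~R - 2^-1) * Dx + Dx) = - (Dx / 2) by field.
rewrite normrN ger0_norm; last by rewrite divr_ge0// ltW.
have h : Dx / 2 <= Dx by have := Dx0; lra.
by split.
Qed.

Lemma space_weights x : [/\ (forall i, 0 <= sw i x <= C * eps * sio i x),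
  (forall i, 0 <= sw (i + 1) x <= C * eps * sio i x),
  (forall i, 0 <= sk (i + 1) x <= C * eps * sio i x),
  (forall i, `|sw i x - sk (i + 1) x| <= C * eps ^+ 2 * sio i x) &
  (forall i, `|sw (i + 1) x - sk (i + 1) x| <= C * eps ^+ 2 * sio i x)].
Proof.
split=> i; have [n1 n2] := xnode_near i.
- by have := wdiff_near sH eps0 Dx0 mesh_le x n1; rewrite mesh_ratio.
- by have := wdiff_near sH eps0 Dx0 mesh_le x n2; rewrite mesh_ratio.
- by have := wder_near sH eps0 Dx0 mesh_le x n2; rewrite mesh_ratio.
- rewrite /sk xnodeS.
  by have := wdiff_wder_next_near sH eps0 Dx0 mesh_le x n1; rewrite mesh_ratio.
- by have := wdiff_wder_near sH eps0 Dx0 mesh_le x n2; rewrite mesh_ratio.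
Qed.

Lemma smooth_tchi m : smooth (tchi m).
Proof.
have smoothH : smooth H by case: sH.
case: m => [|m]; last exact: (smooth_wdiff _ sH eps0).
have := smoothD (smooth_affine 1 2 smoothH) (smoothM (smooth_cst (-1)) (smooth_node eps0 Dt smoothH)).
by congr smooth; apply/funext => x; rewrite /= mulN1r mul1r.
Qed.

Lemma tchi_ge0 m t : 0 <= tchi m t.
Proof.
case: m => [|m]; last exact: (wdiff_ge0 sH eps0 time_step_gt0).
rewrite subr_ge0; case: sH => _ H0 H1 hm _.
have [tp|tn] := leP (-1) t.
  rewrite (H1 (t + 2)); last by lra.
  by have [z1|/ltW z1] := leP 1 ((t - Dt) / eps); [rewrite H1|rewrite -(H1 1)// hm].
rewrite (H0 ((t - Dt) / eps)); last first.
  by rewrite pmulr_lle0 ?invr_gt0//; have := time_step_gt0; lra.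
by have [z1|/ltW z1] := leP (t + 2) 0; [rewrite H0|rewrite -(H0 0)// hm].
Qed.

Lemma tchi_supp m t : tchi m t != 0 -> -2 <= t.
Proof.
have d0 := time_step_gt0.
case: m => [|m].
  apply: contraTT; rewrite -ltNge negbK => t2; case: sH => _ H0 _ _ _.
  by rewrite /tchi !H0 ?subrr//; [rewrite pmulr_lle0 ?invr_gt0//; lra|lra].
move=> /(wdiff_supp sH eps0 d0) /andP[+ _].
by rewrite subr_ge0; apply: le_trans; apply: (@le_trans _ _ 0); rewrite ?oppr_le0// mulr_ge0// ltW.
Qed.

Lemma tchi_derive m t : 0 < t -> Dt * (tchi m)^`()%classic t =
  vanish0 (fun m => tkap m t) m - tkap m.+1 t.
Proof.
have d0 := time_step_gt0; have smoothH : smooth H by case: sH.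
case: m => [|m] t0; last first.
  rewrite (wdiff_derive _ sH eps0) /tkap.
  by rewrite (_ : m.+1%:R * Dt + Dt = m.+2%:R * Dt)// -[m.+2%:R]natr1; ring.
rewrite sub0r derive1E.
have D1 : is_derive t (1 : R) (fun t => H (t + 2)) 0.
  have E : (fun t => H (t + 2))^`()%classic t = 0.
    apply: (@derive1_locally_cst _ _ _ 1); near=> y; case: sH => _ _ H1 _ _; apply: H1.
    have : 0 < y by near: y; exact: lt_nbhsr.
    by lra.
  have := smooth_is_derive t (smooth_affine 1 2 smoothH).
  have -> : (fun x : R => H (1 * x + 2)) = (fun t => H (t + 2)) by apply/funext => x; rewrite mul1r.
  by rewrite E.
have [_ ->] := is_deriveB D1 (is_derive_node eps0 Dt t smoothH).
by rewrite sub0r /tkap /wder mul1r; ring.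
Unshelve. all: by end_near. Qed.

Lemma tchi_at0 m : tchi m 0 = (m == 0%N)%:R.
Proof.
have d0 := time_step_gt0; case: sH => _ H0 H1 _ _.
case: m => [|m]; rewrite /tchi.
  by rewrite H1 ?H0 ?subr0 ?sub0r//; rewrite ?add0r ?ler1n// pmulr_lle0 ?invr_gt0// oppr_le0 ltW.
rewrite /wdiff !H0 ?subrr// pmulr_lle0 ?invr_gt0// sub0r oppr_le0 ?addr_ge0// ?mulr_ge0// ltW//.
Qed.

(** The sum telescopes to H(t + 2) - H((t - t^(M+1)) / eps), and for these t the two terms are 1 and
    0. *)
Lemma tchi_sum M t : 0 <= t <= M.+1%:R * Dt -> \sum_(m < M.+1) tchi m t = 1.
Proof.
move=> /andP[t0 tM]; case: sH => _ H0 H1 _ _.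
suff -> : \sum_(m < M.+1) tchi m t = H (t + 2) - H ((t - M.+1%:R * Dt) / eps).
  rewrite H1 ?H0 ?subr0//; last by lra.
  by rewrite pmulr_lle0 ?invr_gt0// subr_le0.
elim: {tM} M => [|M IH]; first by rewrite big_ord1 mul1r.
rewrite big_ord_recr/= IH /wdiff.
have -> : M.+1%:R * Dt + Dt = M.+2%:R * Dt by rewrite -[M.+2%:R]natr1; ring.
by rewrite addrA subrK.
Qed.

Lemma tkap_ge0 m t : 0 <= tkap m t.
Proof. by apply: wder_ge0 sH eps0 _ _ _; exact: time_step_gt0. Qed.

Lemma tkap_near m t : tkap m t != 0 -> 0 <= t - m%:R * Dt <= eps.
Proof. by apply: (wder_supp sH eps0); exact: time_step_gt0. Qed.

Let tau_e : Dt / eps <= eps.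
Proof. by rewrite ler_pdivrMr// -expr2 -Dxe ler_piMl// ltW. Qed.

Let C0 : 0 <= C. Proof. exact: step_const_ge0 sH. Qed.

Lemma tkap_sum M t : \sum_(m < M) tkap m.+1 t <= 8 * C.
Proof.
have d0 := time_step_gt0.
apply: le_trans (_ : \sum_(m < M) C * (Dt / eps) * near3 eps (m%:R * Dt + Dt) t <= _).
  apply: ler_sum => m _; rewrite /tkap -[m.+1%:R]natr1 mulrDl mul1r.
  have := @wder_near _ _ _ _ _ sH eps0 d0 time_step_le (m%:R * Dt + Dt) (m%:R * Dt + Dt) t.
  by rewrite subrr normr0 => /(_ (ltW d0)) /andP[].
rewrite -mulr_sumr.
apply: le_trans (ler_wpM2l _ (near3_count eps0 d0 time_step_le M Dt t)) _.
  by rewrite mulr_ge0// divr_ge0// ltW.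
by rewrite le_eqVlt; apply/orP; left; apply/eqP; field; rewrite !gt_eqF.
Qed.

(** The price of exchanging a time weight for the derivative-type weight at either end of its time
    step. *)
Definition tdefect m t := `|tchi m t - tkap m.+1 t| +
  `|vanish0 (fun m => tkap m t) m - tchi m t|.

(** For m > 0 a defect is of order (Dt / eps)^2 and O(eps / Dt) of them are nonzero. The first
    weight has no such gain: its defect is bounded by 1 + C + 1 only, but it vanishes for t > 2 eps,
    since the weight and its derivative live on t <= Dt + eps. *)
Lemma tdefect_sum M t : 0 < t -> \sum_(m < M) tdefect m t <=
  16 * C * eps + (2 + C) * (nat_of_bool (t <= 2 * eps))%:R.
Proof.
move=> t0; have d0 := time_step_gt0; have dle := time_step_le.
have e2 : 0 <= C * (Dt / eps) ^+ 2 by rewrite mulr_ge0// sqr_ge0.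
have S (m : nat) : tdefect m.+1 t <= 2 * C * (Dt / eps) ^+ 2 * near3 eps (m.+1%:R * Dt) t.
  rewrite /tdefect /tkap -[m.+2%:R]natr1 mulrDl mul1r [X in _ + X]distrC.
  have := @wdiff_wder_next_near _ _ _ _ _ sH eps0 d0 dle (m.+1%:R * Dt) (m.+1%:R * Dt) t.
  rewrite subrr normr0 => /(_ (ltW d0)) h1.
  have := @wdiff_wder_near _ _ _ _ _ sH eps0 d0 dle (m.+1%:R * Dt) (m.+1%:R * Dt) t.
  rewrite subrr normr0 => /(_ (ltW d0)) h2.
  apply: le_trans (lerD h1 h2) _; rewrite le_eqVlt; apply/orP; left; apply/eqP; ring.
have S0 : tdefect 0 t <= (2 + C) * (nat_of_bool (t <= 2 * eps))%:R.
  case: sH => _ H0 H1 hm _.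
  have k1 : tkap 1 t <= C * (Dt / eps) by apply: (wder_le sH eps0 d0).
  have eps1' : Dt / eps <= 1 by rewrite ler_pdivrMr// mul1r.
  have kC : tkap 1 t <= C by apply: le_trans k1 _; rewrite ler_piMr.
  have k0 := tkap_ge0 1 t; have c0 := tchi_ge0 0 t.
  have c1 : tchi 0 t <= 1.
    rewrite /tchi H1; last by lra.
    rewrite lerBlDr lerDl; have [z0|/ltW z0] := leP ((t - Dt) / eps) 0; first by rewrite H0.
    by rewrite -(H0 0)// hm.
  have [te|te] := leP t (2 * eps); rewrite /= ?mulr1 ?mulr0 /tdefect.
    apply: le_trans (lerD (ler_normB _ _) (ler_normB _ _)) _.
    by rewrite normr0 !ger0_norm//; lra.
  have -> : tkap 1 t = 0.
    apply/eqP; apply: contraLR te => /tkap_near; rewrite mul1r => /andP[_ h].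
    by rewrite -leNgt; have := dle; lra.
  have -> : tchi 0 t = 0.
    rewrite /tchi !H1 ?subrr//; first by rewrite ler_pdivlMr// mul1r; have := dle; lra.
    by lra.
  by rewrite subr0 normr0 addr0.
case: M => [|M].
  by rewrite big_ord0 addr_ge0// mulr_ge0// ?mulr_ge0// ?addr_ge0// ltW.
rewrite big_ord_recl addrC; apply: lerD => //.
apply: le_trans (ler_sum _ (fun (m : 'I_M) _ => S m)) _; rewrite -mulr_sumr.
have cnt : \sum_(m < M) near3 eps (m.+1%:R * Dt) t <= 8 * eps / Dt.
  apply: le_trans (near3_count eps0 d0 dle M Dt t); apply: ler_sum => m _.
  by rewrite -[m.+1%:R]natr1 mulrDl mul1r.
apply: le_trans (ler_wpM2l _ cnt) _; first by rewrite -mulrA mulr_ge0.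
have -> : 2 * C * (Dt / eps) ^+ 2 * (8 * eps / Dt) = 16 * C * (Dt / eps).
  by field; rewrite !gt_eqF.
by rewrite ler_wpM2l// mulr_ge0.
Qed.

End KuznetsovPointwise.

(** * Kuznetsov's estimate *)

Section KuznetsovCutoff.
Context {R : realType}.
Local Notation leb := (@lebesgue_measure R).
Variables (H : R -> R) (C eps lam Dx beta L B : R) (f : R -> R).
Hypotheses (sH : is_step H C) (eps0 : 0 < eps) (lam0 : 0 < lam) (lam1 : lam <= 1)
  (Dx0 : 0 < Dx) (Dxe : Dx = eps ^+ 2) (eps1 : eps <= 1)
  (beta0 : 0 <= beta) (L0 : 0 <= L) (B0 : 0 <= B)
  (fL : forall a b, `|f a - f b| <= L * `|a - b|) (f0 : f 0 = 0).
Local Notation Dt := (lam * Dx).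

Variables (T : R) (u V Vx : R -> R -> R) (U0 : R -> R).
Hypotheses (T0 : 0 < T)
  (um : measurable_fun (`[0, T] `*` setT) (fun z : R * R => u z.1 z.2))
  (uL : forall t, 0 <= t <= T -> LI setT (u t)) (uC : CtL1 T u)
  (Vm : measurable_fun (QT T) (fun z : R * R => V z.1 z.2))
  (Vxm : measurable_fun (QT T) (fun z : R * R => Vx z.1 z.2))
  (VB : forall t x, 0 < t < T -> `|V t x| <= B)
  (VxB : forall t x, 0 < t < T -> `|Vx t x| <= B)
  (U0L : LI setT U0).
Hypothesis ent : forall (alpha : R) (phi : R * R -> R), test_fun T phi ->
    0 <=
      \int[(leb \x leb)%E]_(z in QT T)
        (`|u z.1 z.2 - alpha| * 'D_((1, 0) : R * R) phi z)
    + \int[leb]_x (`|U0 x - alpha| * phi (0, x))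
    + \int[(leb \x leb)%E]_(z in QT T)
        (Num.sg (u z.1 z.2 - alpha) * V z.1 z.2
         * (f (u z.1 z.2) - f alpha) * 'D_((0, 1) : R * R) phi z)
    - \int[(leb \x leb)%E]_(z in QT T)
        (f alpha * Num.sg (u z.1 z.2 - alpha) * Vx z.1 z.2 * phi z).

Variables (a : nat -> int -> R) (K TV Tp : R) (M : nat) (om : nat -> R -> R) (W : R -> R).
Hypotheses (TpT : 0 < Tp <= T) (TpM : Tp <= M.+1%:R * Dt) (K0 : 0 <= K) (TV0 : 0 <= TV)
  (uK : forall t, 0 <= t <= T -> \int[leb]_x `|u t x| <= K)
  (aK : forall m, (m <= M)%N -> bsum (a m) (K / Dx))
  (aTV : forall m, (m <= M)%N -> bsum (fun i => a m (i + 1) - a m i) TV)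
  (om0 : forall m t, 0 <= om m t)
  (omW : forall m t, 0 < t < Tp -> (m <= M)%N -> tkap H eps lam Dx m.+1 t != 0 -> om m t <= W t)
  (W0 : forall t, 0 <= W t) (LW : LI `]0, Tp[ W).

Variables (I : nat) (z : int -> R) (tau : R).
Hypotheses (tau0 : 0 <= tau)
  (z01 : forall i, 0 <= z i <= 1) (zI : z (Posz I) = 0) (zNI : z (- Posz I) = 0)
  (zL : forall i, `|z (i + 1) - z i| <= tau).

Local Notation w := (sw H eps Dx).
Local Notation kap := (sk H eps Dx).
Local Notation io := (sio eps Dx).
Local Notation chi := (tchi H eps lam Dx).
Local Notation kt := (tkap H eps lam Dx).
Local Notation td := (tdefect H eps lam Dx).
Local Notation dens m i := (kflux_density u V Vx f (a m i) (w i)).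

Let smoothH : smooth H. Proof. by case: sH. Qed.
Let C0 : 0 <= C. Proof. exact: step_const_ge0 sH. Qed.
Let Dt0 : 0 < Dt. Proof. exact: mulr_gt0. Qed.
Let Dxle : Dx <= eps. Proof. exact: mesh_le eps0 Dxe eps1. Qed.
Let sw_smooth i : smooth (w i). Proof. exact: smooth_wdiff sH eps0 _. Qed.
Let sw_ge0 i x : 0 <= w i x. Proof. exact: (wdiff_ge0 sH eps0 Dx0). Qed.
Let sw_range i : xnode Dx i <= xnode Dx i + (eps + Dx).
Proof. by rewrite lerDl addr_ge0// ltW. Qed.
Let sw_supp i x : w i x != 0 -> xnode Dx i <= x <= xnode Dx i + (eps + Dx).
Proof.
move=> /(wdiff_supp sH eps0 Dx0) /andP[h1 h2].
by rewrite -subr_ge0 h1 -lerBlDl.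
Qed.

(** The integrand at (t, x) of the Kruzkov inequalities with parameters a_i^m and test functions
    chi_m w_i, summed over time levels and cells. *)
Definition kuz_density t x := \sum_(m < M.+1) zsum I (fun i => z i *
  ((chi m)^`()%classic t * (`|u t x - a m i| * w i x) + chi m t * dens m i t x)).

Lemma sw_derive i x : (w i)^`()%classic x = (kap i x - kap (i + 1) x) / Dx.
Proof.
have := wdiff_derive Dx sH eps0 (xnode Dx i) x.
by rewrite -xnodeS -/(sk H eps Dx i x) -/(sk H eps Dx (i + 1) x) => <-; rewrite mulrC mulKf// gt_eqF.
Qed.

(** The constant of [cell_error]. [Aco] and [Bco] gather the coefficients of the local variation
    |a_(i+1) - a_i| and of the sizes |u| + |a_i| + |a_(i+1)|. *)
Definition D1 := C * (beta + 2 * lam * L * (1 + B)).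
Definition Aco m t := td m t * (B / Dx * (C * eps * L)) + kt m.+1 t / Dt * (D1 * (eps * (eps + om m t + tau))).
Definition Bco m t := td m t * (B / Dx * (C * eps * L * tau) + 2 * (B * (C * eps * L))) +
  kt m.+1 t / Dt * (D1 * (eps * (tau + Dx * om m t))).

Variable A : nat -> int -> R.
Hypotheses (AV : forall m t x i, 0 < t < Tp -> io i x != 0 -> `|A m i - V t x| <= om m t)
  (AV' : forall m t x i, 0 < t < Tp -> io i x != 0 ->
    `|A m i - A m (i - 1) - Dx * Vx t x| <= Dx * om m t).
Hypothesis cell : forall m i c, `|a m.+1 i - c| - `|a m i - c| <=
   beta / 2 * (`|a m (i + 1) - c| - 2 * `|a m i - c| + `|a m (i - 1) - c|)
   - lam / 2 * (A m i * (kflx f c (a m i) + kflx f c (a m (i + 1)))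
                - A m (i - 1) * (kflx f c (a m (i - 1)) + kflx f c (a m i)))
   + lam * (Num.sg (c - a m.+1 i) * ((A m i - A m (i - 1)) * f c)).

(** At a frozen point (t, x) the value c = u t x is a mere number. Taken as parameter in the
    discrete entropy inequality it allows all summations by parts to act on the scheme and on the
    weights only. *)
Lemma kuz_density_le t x : 0 < t < Tp -> kuz_density t x <=
  \sum_(m < M.+1) zsum I (fun i => io i x * (Aco m t * `|a m (i + 1) - a m i| +
     Bco m t * (`|u t x| + `|a m i| + `|a m (i + 1)|))).
Proof.
move=> tT; have [w0 w1 k1 wk wk1] := space_weights sH eps0 Dx0 Dxe eps1 x.
have io0 i : 0 <= io i x by exact: near3_ge0.
set c := u t x.
pose D m := zsum I (fun i => z i * w i x * `|a m i - c|).
pose F m := kF f I z (kap^~ x) c (a m); pose Q m := kQ f I z (w^~ x) c (a m).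
pose S m := kS f I z (w^~ x) c (a m).
have E : kuz_density t x = \sum_(m < M.+1) ((chi m)^`()%classic t * D m + chi m t * (V t x * F m / Dx + Vx t x * (Q m - S m))).
  apply: eq_bigr => m _; rewrite /D /F /Q /S /kF /kQ /kS.
  rewrite mulrAC -zsumB -!zsumZ -zsumD -zsumZ -zsumD; apply: eq_zsum => i.
  by rewrite /kflux_density sw_derive -/c [`|c - _|]distrC /kflx; field; rewrite gt_eqF.
have tTT : 0 < t < T.
  by case/andP: tT => -> /lt_le_trans ->//; case/andP: TpT.
pose CE m := cell_error L B lam beta I (io^~ x) C eps tau c Dx (a m) (om m t).
have t0 : 0 < t by case/andP: tT.
rewrite E; apply: le_trans (@time_abel _ D F Q S CE (chi^~ t) (fun m => (chi m)^`()%classic t) (kt^~ t)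
   (V t x) (Vx t x) B lam Dx Dt M lam0 Dx0 (erefl _) (VB _ tTT) (VxB _ tTT) _ _ _ _ _) _.
- by move=> m; exact: (tkap_ge0 sH eps0 lam0 Dx0).
- apply/eqP; apply: contraTT isT => /(tkap_near sH eps0) /andP[+ _].
  by rewrite subr_ge0 => /(le_trans TpM); case/andP: tT => _ tT; rewrite leNgt tT.
- by rewrite (tchi_derive sH eps0 lam0 Dx0)//= sub0r.
- by move=> m; rewrite (tchi_derive sH eps0 lam0 Dx0).
- move=> m; rewrite /D -zsumB.
  have -> : zsum I (fun i => z i * w i x * `|a m.+1 i - c| - z i * w i x * `|a m i - c|) =
     zsum I (fun i => z i * w i x * (`|a m.+1 i - c| - `|a m i - c|)).
    by apply: eq_zsum => i; ring.
  apply: (@cell_inequality _ f L L0 fL f0 B lam beta lam0 beta0 B0 I z (w^~ x) (kap^~ x) (io^~ x) C eps tau C0 (ltW eps0)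
     tau0 z01 zI zNI zL w0 io0 w1 k1 wk wk1 c Dx (a m) Dx0 (A m) (a m.+1) (V t x) (Vx t x) (om m t)) => //.
  + exact: VB.
  + by move=> i; exact: AV.
  + by move=> i; exact: AV'.
apply: ler_sum => m _.
have bF : `|F m| <= zsum I (fun i => io i x * (C * eps * L * `|a m (i + 1) - a m i| +
    C * eps * L * tau * (`|c| + `|a m i| + `|a m (i + 1)|))) by exact: kF_bound.
have bQ : `|Q m| <= zsum I (fun i => io i x * (C * eps * L * (`|c| + `|a m i| + `|a m (i + 1)|))).
  exact: kQ_bound.
have bS : `|S m| <= zsum I (fun i => io i x * (C * eps * L * (`|c| + `|a m i| + `|a m (i + 1)|))).
  exact: kS_bound.
have BD : 0 <= B / Dx by rewrite divr_ge0// ltW.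
set X := `|chi m t - kt m.+1 t|; set Y := `|vanish0 _ _ - _|.
have tdE : td m t = X + Y by [].
apply: le_trans (_ : td m t * (B / Dx * `|F m| + B * `|Q m|) + td m t * (B * `|S m|) + kt m.+1 t / Dt * CE m <= _).
  rewrite lerD2r tdE; apply: lerD; apply: ler_wpM2r.
  - by rewrite addr_ge0// mulr_ge0.
  - by rewrite lerDl; exact: normr_ge0.
  - by rewrite mulr_ge0.
  - by rewrite lerDr; exact: normr_ge0.
have td0 : 0 <= td m t by rewrite tdE; apply: addr_ge0; exact: normr_ge0.
apply: le_trans (_ : td m t * (B / Dx * zsum I (fun i => io i x * (C * eps * L * `|a m (i + 1) - a m i| +
    C * eps * L * tau * (`|c| + `|a m i| + `|a m (i + 1)|))) +
   B * zsum I (fun i => io i x * (C * eps * L * (`|c| + `|a m i| + `|a m (i + 1)|)))) +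
   td m t * (B * zsum I (fun i => io i x * (C * eps * L * (`|c| + `|a m i| + `|a m (i + 1)|)))) + kt m.+1 t / Dt * CE m <= _).
  rewrite lerD2r; apply: lerD; apply: ler_wpM2l => //; last exact: ler_wpM2l.
  by apply: lerD; apply: ler_wpM2l.
rewrite /CE /cell_error -!zsumZ -zsumD -!zsumZ -!zsumD le_eqVlt; apply/orP; left; apply/eqP.
by apply: eq_zsum => i; rewrite /Aco /Bco /D1; ring.
Qed.

Lemma near3_int c : LI setT (near3 eps c) /\ \int[leb]_x near3 eps c x = 6 * eps.
Proof.
have le : c - 3 * eps <= c + 3 * eps.
  by apply: (@le_trans _ _ c); rewrite ?gerBl ?lerDl mulr_ge0// ltW.
have E : near3 eps c = (\1_(`[c - 3 * eps, c + 3 * eps]%classic) : R -> R).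
  apply/funext => x; rewrite /near3 indicE; congr (_%:R); congr nat_of_bool.
  by apply/idP/idP => [h|/set_mem]; [apply/mem_set|]; rewrite /= in_itv/= -ler_distl.
have [h1 h2] := int_itv_indic 0 le; rewrite E; split => //.
by rewrite h2; ring.
Qed.

Lemma zsum_LI (h : int -> R -> R) : (forall i, LI setT (h i)) -> LI setT (fun x => zsum I (fun i => h i x)).
Proof. by move=> Lh; apply: LI_sum => // i; exact: Lh. Qed.

Lemma zsum_int (h : int -> R -> R) : (forall i, LI setT (h i)) ->
  \int[leb]_x zsum I (fun i => h i x) = zsum I (fun i => \int[leb]_x h i x).
Proof. by move=> Lh; rewrite /zsum LI_int_sum// => i; exact: Lh. Qed.

Lemma kuz_density_int t : 0 < t < T -> LI setT (kuz_density t) /\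
  \int[leb]_x kuz_density t x = \sum_(m < M.+1) zsum I (fun i => z i *
    ((chi m)^`()%classic t * kdist u (a m i) (w i) t + chi m t * kflux u V Vx f (a m i) (w i) t)).
Proof.
move=> tT; have tT' : 0 <= t <= T by case/andP: tT => /ltW -> /ltW ->.
have Lk m i : LI setT (fun x => `|u t x - a m i| * w i x).
  exact: (kdist_L1 uL _ (sw_smooth i) (sw_range i) (@sw_supp i) tT').
have Ld m i : LI setT (dens m i t).
  exact: (kflux_density_LI T0 um uL uC Vm Vxm VB VxB fL _ (sw_smooth i) (sw_range i) (@sw_supp i) tT).
have Lmi m i : LI setT (fun x => z i * ((chi m)^`()%classic t * (`|u t x - a m i| * w i x) + chi m t * dens m i t x)).
  by apply: LIZ => //; apply: LID => //; exact: LIZ.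
have Lz m : LI setT (fun x => zsum I (fun i => z i * ((chi m)^`()%classic t * (`|u t x - a m i| * w i x) + chi m t * dens m i t x))).
  by apply: zsum_LI => i; exact: Lmi.
split; first by apply: LI_sum => // m; exact: Lz.
rewrite LI_int_sum//.
apply: eq_bigr => m _; rewrite zsum_int => [|i]; last exact: Lmi.
apply: eq_zsum => i; rewrite LI_intZ//; last by apply: LID => //; exact: LIZ.
by rewrite LI_intD ?LI_intZ//; exact: LIZ.
Qed.

(** Each indicator [io i] has integral 6 eps, and at most 8 eps / Dx of them are nonzero at a given
    x. The first fact handles the terms in the scheme, the second the term in |u|; 20 = 8 + 6 +
    6. *)
Lemma kuz_density_int_le t : 0 < t < Tp -> \int[leb]_x kuz_density t x <=
  \sum_(m < M.+1) (Aco m t * (6 * eps * TV) + Bco m t * (20 * eps * K / Dx)).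
Proof.
move=> tT; have tTT : 0 < t < T.
  by case/andP: tT => -> /lt_le_trans ->//; case/andP: TpT.
have tT' : 0 <= t <= T by case/andP: tTT => /ltW -> /ltW ->.
have [Lk _] := kuz_density_int tTT.
have Lio i : LI setT (io i) by case: (near3_int (i%:~R * Dx)).
have Iio i : \int[leb]_x io i x = 6 * eps by case: (near3_int (i%:~R * Dx)).
have io0 i x : 0 <= io i x by exact: near3_ge0.
have td0 m : 0 <= td m t by rewrite addr_ge0.
have kt0 m : 0 <= kt m t by exact: (tkap_ge0 sH eps0 lam0 Dx0).
have D10 : 0 <= D1 by rewrite !mulr_ge0// addr_ge0// !mulr_ge0// ?addr_ge0// ltW.
have e0 := ltW eps0; have Dx0' := ltW Dx0; have Dt0' := ltW Dt0.
have B0' m : 0 <= Bco m t.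
  rewrite /Bco; apply: addr_ge0; first by rewrite mulr_ge0// addr_ge0// !mulr_ge0// invr_ge0.
  apply: mulr_ge0; first by rewrite divr_ge0.
  by do ?[exact: D10|exact: om0|apply: addr_ge0|apply: mulr_ge0].
have A0' m : 0 <= Aco m t.
  rewrite /Aco; apply: addr_ge0; first by rewrite mulr_ge0// !mulr_ge0// invr_ge0.
  apply: mulr_ge0; first by rewrite divr_ge0.
  by do ?[exact: D10|exact: om0|apply: addr_ge0|apply: mulr_ge0].
pose Sn x := zsum I (fun i => io i x).
have Sn8 x : Sn x <= 8 * eps / Dx.
  apply: le_trans (near3_count eps0 Dx0 Dxle (I + I) (- (I%:R * Dx)) x).
  rewrite /Sn /zsum le_eqVlt; apply/orP; left; apply/eqP; apply: eq_bigr => n _.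
  by rewrite /sio intrB mulrBl.
pose g m x := Aco m t * zsum I (fun i => `|a m (i + 1) - a m i| * io i x) +
  Bco m t * (8 * eps / Dx * `|u t x| + (zsum I (fun i => `|a m i| * io i x) + zsum I (fun i => `|a m (i + 1)| * io i x))).
have Lu : LI setT (fun x => `|u t x|) by apply: LI_abs; exact: uL.
have Lci (c : int -> R) i : LI setT (fun x => c i * io i x) by exact: LIZ.
have Lc (c : int -> R) : LI setT (fun x => zsum I (fun i => c i * io i x)) by apply: zsum_LI => i; exact: Lci.
have Ic (c : int -> R) : \int[leb]_x zsum I (fun i => c i * io i x) = 6 * eps * zsum I c.
  rewrite zsum_int => [|i]; last exact: Lci.
  by rewrite -zsumZ; apply: eq_zsum => i; rewrite LI_intZ// Iio mulrC.
have Lg m : LI setT (g m).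
  apply: LID => //; first exact: LIZ.
  by apply: LIZ => //; apply: LID => //; [exact: LIZ|exact: LID].
have Lh m : LI setT (fun x => 8 * eps / Dx * `|u t x| + (zsum I (fun i => `|a m i| * io i x) + zsum I (fun i => `|a m (i + 1)| * io i x))).
  by apply: LID => //; [exact: LIZ|exact: LID].
apply: le_trans (_ : \int[leb]_x \sum_(m < M.+1) g m x <= _).
  apply: LI_int_le => //; first by apply: LI_sum => // m; exact: Lg.
  move=> x _; apply: le_trans (kuz_density_le x tT) _; apply: ler_sum => m _.
  apply: le_trans (_ : Aco m t * zsum I (fun i => `|a m (i + 1) - a m i| * io i x) +
     Bco m t * (Sn x * `|u t x| + (zsum I (fun i => `|a m i| * io i x) + zsum I (fun i => `|a m (i + 1)| * io i x))) <= _).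
    rewrite le_eqVlt; apply/orP; left; apply/eqP.
    rewrite /Sn.
    rewrite [_ * `|u t x|]mulrC -!zsumZ -!zsumD -!zsumZ -zsumD.
    by apply: eq_zsum => i; ring.
  rewrite /g lerD2l; apply: ler_wpM2l => //.
  by rewrite lerD2r ler_wpM2r.
rewrite LI_int_sum//.
apply: ler_sum => m _; have mM : (m <= M)%N by rewrite -ltnS.
rewrite /g LI_intD//; [|exact: LIZ|exact: LIZ].
rewrite !LI_intZ// LI_intD//; [|exact: LIZ|exact: LID].
rewrite LI_intZ// LI_intD// !Ic.
have h1 : zsum I (fun i => `|a m (i + 1) - a m i|) <= TV by exact: bsum_zsum (aTV mM).
have h2 : zsum I (fun i => `|a m i|) <= K / Dx by exact: bsum_zsum (aK mM).
have h3 : zsum I (fun i => `|a m (i + 1)|) <= K / Dx.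
  exact: (bsum_zsum I (bsum_shift 1 (aK mM))).
have e6 : 0 <= 6 * eps by rewrite mulr_ge0.
apply: lerD; apply: ler_wpM2l => //; first exact: ler_wpM2l.
have e8 : 0 <= 8 * eps / Dx by rewrite mulr_ge0 ?invr_ge0// mulr_ge0.
apply: le_trans (lerD (ler_wpM2l e8 (uK tT')) (lerD (ler_wpM2l e6 h2) (ler_wpM2l e6 h3))) _.
by rewrite le_eqVlt; apply/orP; left; apply/eqP; field; rewrite gt_eqF.
Qed.

Definition D2 := (6 * TV + 40 * K) * (B * C * L + D1 / lam).
Lemma D1_ge0 : 0 <= D1.
Proof. by have l0 := ltW lam0; rewrite !mulr_ge0// addr_ge0// !mulr_ge0// addr_ge0. Qed.

Lemma D2_ge0 : 0 <= D2.
Proof.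
have h : 0 <= D1 / lam by rewrite divr_ge0 ?D1_ge0// ltW.
by do ?[exact: h|apply: addr_ge0|apply: mulr_ge0].
Qed.

(** The factor 24 C + 2 dominates the constants 16 C and 2 + C of [tdefect_sum] and 8 C of
    [tkap_sum]. The indicator of t <= 2 eps is the initial layer of the first time weight. *)
Definition kuz_rate t := D2 * (24 * C + 2) * ((1 + tau / Dx) * (eps + (nat_of_bool (t <= 2 * eps))%:R)
   + eps + tau + tau / Dx + W t).

(** Each term carries one factor eps from the size of the weights and one from the width of their
    supports; together they cancel a 1 / Dx. The modulus [om m t] is always multiplied by the weight
    of index m + 1, so only active levels count and [W] may replace it. *)
Lemma kuz_rate_bound t : 0 < t < Tp -> \int[leb]_x kuz_density t x <= kuz_rate t.
Proof.
move=> tT; apply: le_trans (kuz_density_int_le tT) _.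
have e0 := ltW eps0; have Dx0' := ltW Dx0; have Dt0' := ltW Dt0; have l0 := ltW lam0.
have D10 := D1_ge0.
have td0 m : 0 <= td m t by rewrite addr_ge0.
have kt0 m : 0 <= kt m t by exact: (tkap_ge0 sH eps0 lam0 Dx0).
have r0 : 0 <= tau / Dx by rewrite divr_ge0.
have BCL : 0 <= B * C * L by rewrite !mulr_ge0.
have D1l : 0 <= D1 / lam by rewrite divr_ge0.
have D20 := D2_ge0.
pose Z := eps + tau + tau / Dx + W t.
have Z0 : 0 <= Z by rewrite !addr_ge0.
apply: le_trans (_ : \sum_(m < M.+1) (D2 * (1 + tau / Dx) * td m t + D2 * Z * kt m.+1 t) <= _).
  apply: ler_sum => m _; have mM : (m <= M)%N by rewrite -ltnS.
  have kom : kt m.+1 t * om m t <= kt m.+1 t * W t.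
    have [->|k0] := eqVneq (kt m.+1 t) 0; first by rewrite !mul0r.
    by apply: ler_wpM2l => //; exact: omW.
  apply: le_trans (_ : 6 * TV * (B * C * L * td m t + D1 / lam * (kt m.+1 t * (eps + om m t + tau))) +
     20 * K * (td m t * (B * C * L * (tau / Dx + 2)) + D1 / lam * (kt m.+1 t * (tau / Dx + om m t))) <= _).
    rewrite le_eqVlt; apply/orP; left; apply/eqP; rewrite /Aco /Bco.
    set X1 := td m t; set X2 := kt m.+1 t; set X3 := om m t.
    by rewrite Dxe; field; rewrite !gt_eqF.
  apply: le_trans (_ : 6 * TV * (B * C * L * td m t + D1 / lam * (kt m.+1 t * Z)) +
     20 * K * (td m t * (B * C * L * (tau / Dx + 2)) + D1 / lam * (kt m.+1 t * Z)) <= _).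
    have k1 : kt m.+1 t * (eps + om m t + tau) <= kt m.+1 t * Z.
      rewrite /Z -subr_ge0 (_ : _ - _ = kt m.+1 t * (tau / Dx) + (kt m.+1 t * W t - kt m.+1 t * om m t)); last by ring.
      by rewrite addr_ge0 ?subr_ge0// mulr_ge0.
    have k2 : kt m.+1 t * (tau / Dx + om m t) <= kt m.+1 t * Z.
      rewrite /Z -subr_ge0 (_ : _ - _ = kt m.+1 t * (eps + tau) + (kt m.+1 t * W t - kt m.+1 t * om m t)); last by ring.
      by rewrite addr_ge0 ?subr_ge0// mulr_ge0// addr_ge0.
    by apply: lerD; (apply: ler_wpM2l; first by rewrite mulr_ge0); rewrite lerD2l ler_wpM2l.
  have TVp : 0 <= td m t * (B * C * L * (6 * TV * (tau / Dx) + 20 * K * (tau / Dx)) + D1 / lam * ((6 * TV + 40 * K) * (1 + tau / Dx))).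
    by do ?[exact: td0|exact: D1l|exact: BCL|exact: r0|apply: addr_ge0|apply: mulr_ge0].
  have TVk : 0 <= kt m.+1 t * Z * (B * C * L * (6 * TV + 40 * K) + D1 / lam * (20 * K)).
    by do ?[exact: kt0|exact: D1l|exact: BCL|exact: Z0|apply: addr_ge0|apply: mulr_ge0].
  rewrite -subr_ge0 (_ : _ - _ = td m t * (B * C * L * (6 * TV * (tau / Dx) + 20 * K * (tau / Dx)) + D1 / lam * ((6 * TV + 40 * K) * (1 + tau / Dx)))
    + kt m.+1 t * Z * (B * C * L * (6 * TV + 40 * K) + D1 / lam * (20 * K))); first by rewrite addr_ge0.
  by rewrite /D2; ring.
rewrite big_split/= -mulr_sumr -[X in _ + X <= _]mulr_sumr.
have t0 : 0 < t by case/andP: tT.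
have c1 : 0 <= D2 * (1 + tau / Dx) by rewrite mulr_ge0// addr_ge0.
have c2 : 0 <= D2 * Z by rewrite mulr_ge0.
apply: le_trans (lerD (ler_wpM2l c1 (tdefect_sum sH eps0 lam0 lam1 Dx0 Dxe eps1 M.+1 t0))
  (ler_wpM2l c2 (tkap_sum sH eps0 lam0 lam1 Dx0 Dxe eps1 M.+1 t))) _.
rewrite /kuz_rate; set n := (nat_of_bool _)%:R.
have n0 : 0 <= n by exact: ler0n.
have s0 : 0 <= D2 * (1 + tau / Dx) * ((8 * C + 2) * eps + 23 * C * n) + D2 * Z * (16 * C + 2).
  by do ?[exact: D20|exact: Z0|exact: r0|apply: addr_ge0|apply: mulr_ge0].
rewrite -subr_ge0 (_ : _ - _ = D2 * (1 + tau / Dx) * ((8 * C + 2) * eps + 23 * C * n) + D2 * Z * (16 * C + 2))//.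
by rewrite /Z; ring.
Qed.

Lemma LI_cst_itv (p q k : R) : p <= q -> LI `]p, q[ (cst k) /\ \int[leb]_(t in `]p, q[) (cst k t : R) = k * (q - p).
Proof.
move=> pq; have [L1 _] := int_itv_indic 0 pq.
have mpq : measurable (`]p, q[%classic : set R) by exact: measurable_itv.
split.
  apply: (LI_eq (f := fun t => k * (\1_(`[p, q]%classic) : R -> R) t)) => //.
    move=> t /= tpq; rewrite indicE mem_set ?mulr1//=.
    by move: tpq; rewrite !in_itv/= => /andP[/ltW -> /ltW ->].
  by apply: LIZ => //; apply: integrableS L1.
rewrite Rintegral_cst//; congr (_ * _).
rewrite /= lebesgue_measure_itv/= lte_fin; case: ltP => //= qp.
by apply/esym/eqP; rewrite subr_eq0 eq_le qp.
Qed.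

Lemma early_LI (r : R) : 0 <= r -> LI `]0, Tp[ (fun t => (nat_of_bool (t <= r))%:R : R) /\
  \int[leb]_(t in `]0, Tp[) ((nat_of_bool (t <= r))%:R : R) <= r.
Proof.
move=> r0; have mI : measurable (`]0, Tp[%classic : set R) by exact: measurable_itv.
have [Li Ii] := int_itv_indic 0 r0.
have E t : 0 < t -> (nat_of_bool (t <= r))%:R = (\1_(`[0, r]%classic) : R -> R) t.
  move=> t0; rewrite indicE; congr (_%:R); congr nat_of_bool.
  by apply/idP/idP => [h|/set_mem]; [apply/mem_set|]; rewrite /= in_itv/= ?(ltW t0)// => /andP[].
have Lt : LI `]0, Tp[ (fun t => (nat_of_bool (t <= r))%:R : R).
  apply: (LI_eq (f := (\1_(`[0, r]%classic) : R -> R))) => //.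
    by move=> t /=; rewrite in_itv/= => /andP[t0 _]; rewrite E.
  exact: integrableS Li.
split => //; rewrite -[leRHS]subr0 -Ii.
have -> : \int[leb]_(t in `]0, Tp[) ((nat_of_bool (t <= r))%:R : R) = \int[leb]_(t in `]0, Tp[) (\1_(`[0, r]%classic) : R -> R) t.
  by apply: eq_Rintegral => t; rewrite inE/= in_itv/= => /andP[t0 _]; rewrite E.
rewrite -lee_fin !EFin_intI//; last exact: integrableS Li.
apply: ge0_subset_integral => //; exact: (measurable_int _ Li).
Qed.

Let mI : measurable (`]0, Tp[%classic : set R). Proof. exact: measurable_itv. Qed.
Let Tp0 : 0 <= Tp. Proof. by case/andP: TpT => /ltW. Qed.

Lemma kuz_rate_int : LI `]0, Tp[ kuz_rate /\ \int[leb]_(t in `]0, Tp[) kuz_rate t <=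
  D2 * (24 * C + 2) * ((1 + tau / Dx) * (eps * (T + 2)) + (eps + tau + tau / Dx) * T + \int[leb]_(t in `]0, Tp[) W t).
Proof.
have e2 : 0 <= 2 * eps by rewrite mulr_ge0// ltW.
have [Le Ie] := early_LI e2; have [L1 I1] := LI_cst_itv eps Tp0.
have [L2 I2] := LI_cst_itv (eps + tau + tau / Dx) Tp0.
pose g1 t := (1 + tau / Dx) * (cst eps t + (nat_of_bool (t <= 2 * eps))%:R) : R.
have Lg1' : LI `]0, Tp[ (fun t => cst eps t + (nat_of_bool (t <= 2 * eps))%:R) by exact: LID.
have Lg1 : LI `]0, Tp[ g1 by exact: LIZ.
have Lg2 : LI `]0, Tp[ (fun t => g1 t + cst (eps + tau + tau / Dx) t) by exact: LID.
have Lg3 : LI `]0, Tp[ (fun t => g1 t + cst (eps + tau + tau / Dx) t + W t) by exact: LID.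
have E t : kuz_rate t = D2 * (24 * C + 2) * (g1 t + cst (eps + tau + tau / Dx) t + W t).
  by rewrite /kuz_rate /g1 /= !addrA.
have -> : kuz_rate = (fun t => D2 * (24 * C + 2) * (g1 t + cst (eps + tau + tau / Dx) t + W t)) by apply/funext.
split; first exact: LIZ.
have r0 : 0 <= tau / Dx by rewrite divr_ge0// ltW.
have e0 := ltW eps0; have l0 := ltW lam0.
have D20 := D2_ge0.
rewrite LI_intZ//; apply: ler_wpM2l; first by rewrite mulr_ge0// addr_ge0// mulr_ge0.
rewrite LI_intD// lerD2r LI_intD// I2 subr0 LI_intZ// LI_intD// I1 subr0.
have Tple : Tp <= T by case/andP: TpT.
apply: lerD; last by apply: ler_wpM2l => //; rewrite !addr_ge0.
apply: ler_wpM2l; first by rewrite addr_ge0.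
rewrite mulrDr [eps * 2]mulrC; apply: lerD => //.
by apply: ler_wpM2l.
Qed.

(** Sum of the inequalities [kruzkov_at_time] over cells and levels. At time 0 all time weights
    vanish but the first, so the initial term contains a^0 only. *)
Lemma kuznetsov_cutoff :
  \sum_(m < M.+1) zsum I (fun i => z i * (chi m Tp * kdist u (a m i) (w i) Tp)) <=
  zsum I (fun i => z i * \int[leb]_x (`|U0 x - a 0%N i| * w i x)) +
  D2 * (24 * C + 2) * ((1 + tau / Dx) * (eps * (T + 2)) + (eps + tau + tau / Dx) * T + \int[leb]_(t in `]0, Tp[) W t).
Proof.
have [Lr Ir] := kuz_rate_int; rewrite -lerBlDl; apply: le_trans Ir.
have kat m i := kruzkov_at_time T0 um uL uC Vm Vxm VB VxB fL U0L ent (a m i) (sw_smooth i) (sw_ge0 i) (sw_range i)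
  (@sw_supp i) sH TpT (smooth_tchi lam Dx sH eps0 m) (tchi_ge0 sH eps0 lam0 Dx0 m)
  (fun x => @tchi_supp _ _ _ _ _ _ sH eps0 lam0 Dx0 m x).
pose G m i t := (chi m)^`()%classic t * kdist u (a m i) (w i) t + chi m t * kflux u V Vx f (a m i) (w i) t.
have LG m i : LI `]0, Tp[ (G m i) by case: (kat m i).
have LzG m i : LI `]0, Tp[ (fun t => z i * G m i t) by exact: LIZ.
have LzG' m : LI `]0, Tp[ (fun t => zsum I (fun i => z i * G m i t)).
  by apply: LI_sum => // i; exact: LzG.
have IG : \int[leb]_(t in `]0, Tp[) \sum_(m < M.+1) zsum I (fun i => z i * G m i t) =
   \sum_(m < M.+1) zsum I (fun i => z i * \int[leb]_(t in `]0, Tp[) G m i t).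
  rewrite LI_int_sum//; apply: eq_bigr => m _.
  rewrite LI_int_sum//; apply: eq_bigr => n _.
  by rewrite LI_intZ.
apply: le_trans (_ : \int[leb]_(t in `]0, Tp[) \sum_(m < M.+1) zsum I (fun i => z i * G m i t) <= _); last first.
  apply: LI_int_le => //; first by apply: LI_sum.
  move=> t; rewrite /= in_itv/= => tT; apply: le_trans (kuz_rate_bound tT).
  have tTT : 0 < t < T by case/andP: tT => -> /lt_le_trans ->//; case/andP: TpT.
  by have [_ ->] := kuz_density_int tTT.
rewrite IG lerBlDl.
have -> : zsum I (fun i => z i * \int[leb]_x (`|U0 x - a 0%N i| * w i x)) =
  \sum_(m < M.+1) zsum I (fun i => z i * (chi m 0 * \int[leb]_x (`|U0 x - a m i| * w i x))).
  rewrite big_ord_recl [X in _ + X]big1 ?addr0 => [|m _].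
    by apply: eq_zsum => i; rewrite (tchi_at0 sH eps0 lam0 Dx0)/= mul1r.
  rewrite /zsum big1// => n _.
  by rewrite (tchi_at0 sH eps0 lam0 Dx0)/= mul0r mulr0.
rewrite -big_split/=; apply: ler_sum => m _; rewrite -zsumD; apply: zsum_le => i.
rewrite -mulrDr; apply: ler_wpM2l; first by case/andP: (z01 i).
by case: (kat m i).
Qed.

End KuznetsovCutoff.

(** * Piecewise constant reconstructions *)

Section Reconstruction.
Context {R : realType}.
Local Notation leb := (@lebesgue_measure R).

Lemma LI_dct (D : set R) (h : nat -> R -> R) (f g : R -> R) : measurable D ->
  (forall n, measurable_fun D (h n)) -> measurable_fun D f ->
  (forall x, D x -> h n x @[n --> \oo] --> f x) -> LI D g ->
  (forall n x, D x -> `|h n x| <= g x) ->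
  \int[leb]_(x in D) h n x @[n --> \oo] --> \int[leb]_(x in D) f x.
Proof.
move=> mD mh mf hf Lg hg.
have [Lf _ cv] : [/\ leb.-integrable D (EFin \o f),
   [sequence (\int[leb]_(x in D) `|((EFin \o h n) x - (EFin \o f) x)|)%E]_n @ \oo --> 0%E &
   [sequence (\int[leb]_(x in D) ((EFin \o h n) x))%E]_n @ \oo --> (\int[leb]_(x in D) ((EFin \o f) x))%E].
  apply: (@dominated_convergence _ _ _ leb D mD (fun n => EFin \o h n) (EFin \o f) (EFin \o g)) => //.
  - by move=> n; apply/measurable_EFinP; exact: mh.
  - by apply/measurable_EFinP; exact: mf.
  - by apply: aeW => x Dx; apply: cvg_EFin; [exact: nearW|exact: hf].
  - by apply: aeW => x n Dx; rewrite /= lee_fin hg.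
have Lh n : LI D (h n) by apply: (LI_le (g := g)) => //; exact: hg.
have cv' : (\int[leb]_(x in D) (h n x)%:E)%E @[n --> \oo] --> (\int[leb]_(x in D) f x)%:E.
  by rewrite EFin_intI.
exact: fine_cvg cv'.
Qed.

Variables (Dx : R) (Dx0 : 0 < Dx).

Definition recon (a : int -> R) (x : R) := a (Num.floor (x / Dx + 2^-1)).

Lemma measurable_recon a : measurable_fun setT (recon a).
Proof.
apply: (measurable_floor_comp a); apply: continuous_measurable_fun => x.
apply: cvgD; last exact: cvg_cst.
by apply: cvgM; [exact: cvg_id|exact: cvg_cst].
Qed.

Lemma zsum_telescope I (G : int -> R) :
  zsum I (fun i => G i - G (i + 1)) = G (- Posz I) - G (Posz I).
Proof.
pose F n := - G (Posz n - Posz I).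
rewrite /zsum (eq_bigr (fun n : 'I_(I + I) => F n.+1 - F n)); last first.
  move=> n _; rewrite /F -[n.+1]addn1 PoszD (_ : Posz n + 1 - Posz I = Posz n - Posz I + 1); last by rewrite addrAC.
  by rewrite opprK addrC.
rewrite -(big_mkord xpredT (fun n => F n.+1 - F n)) telescope_sumr// /F.
by rewrite PoszD addrK sub0r opprK addrC.
Qed.

Lemma zsum1 I (i : int) (F : int -> R) : - (Posz I) <= i < Posz I -> (forall j : int, j != i -> F j = 0) -> zsum I F = F i.
Proof.
move=> /andP[h1 h2] Fj.
have h0 : 0 <= i + Posz I by rewrite -lerBlDr sub0r.
have iI : (absz (i + Posz I)%R < I + I)%N by rewrite -ltz_nat gez0_abs// PoszD ltrD2r.
have E : Posz (Ordinal iI) - Posz I = i by rewrite /= gez0_abs// addrK.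
rewrite /zsum (bigD1 (Ordinal iI))//= big1 ?addr0; first by rewrite -[in RHS]E.
move=> n nI; apply: Fj; apply: contra nI => /eqP ni; apply/eqP/val_inj => /=.
by apply/eqP; rewrite -eqz_nat gez0_abs// -ni subrK.
Qed.

(** On [-I Dx, I Dx] the reconstruction is dominated by a finite sum of cell indicators, whose
    integral is at most Dx K; monotone convergence exhausts the line. *)
Lemma recon_LI (a : int -> R) K : bsum a K -> LI setT (recon a) /\ \int[leb]_x `|recon a x| <= Dx * K.
Proof.
move=> aK.
have cellI i : LI setT (\1_(`[(i%:~R - 2^-1) * Dx, (i%:~R + 2^-1) * Dx]%classic) : R -> R) /\
   \int[leb]_x (\1_(`[(i%:~R - 2^-1) * Dx, (i%:~R + 2^-1) * Dx]%classic) x : R) = Dx.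
  have le : (i%:~R - 2^-1) * Dx <= (i%:~R + 2^-1) * Dx by rewrite ler_pM2r// lerD2l; lra.
  have [h1 h2] := int_itv_indic 0 le; split => //; rewrite h2; by field.
pose J i : R -> R := \1_(`[(i%:~R - 2^-1) * Dx, (i%:~R + 2^-1) * Dx]%classic).
pose S (I : nat) : set R := `[- (I%:R * Dx), I%:R * Dx]%classic.
have bnd I x : S I x -> `|recon a x| <= zsum I.+2 (fun i => `|a i| * J i x).
  rewrite /S /= in_itv/= => /andP[x1 x2]; rewrite /recon; set i := Num.floor _ : int.
  have /andP[i1 i2] : i%:~R <= x / Dx + 2^-1 < (i + 1)%:~R by rewrite floor_le floorD1_gt.
  have y1 : - I%:R <= x / Dx by rewrite ler_pdivlMr// mulNr.
  have y2 : x / Dx <= I%:R by rewrite ler_pdivrMr.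
  rewrite intrD in i2.
  have iI : - (Posz I.+2) <= i < Posz I.+2.
    apply/andP; split.
      rewrite -(ler_int R) intrN -[Posz I.+2]/(I.+2%:Z) -natz natz -pmulrn -[I.+2%:R]natr1 -[I.+1%:R]natr1; lra.
    rewrite -(ltr_int R) -[Posz I.+2]/(I.+2%:Z) -pmulrn -[I.+2%:R]natr1 -[I.+1%:R]natr1; lra.
  have Ji : J i x = 1.
    rewrite /J indicE mem_set//= in_itv/=; apply/andP; split.
      by rewrite -ler_pdivlMr//; lra.
    by rewrite -ler_pdivrMr//; move: i2; rewrite mulr1z; lra.
  apply: le_trans (_ : zsum I.+2 (fun j => if j == i then `|a i| else 0) <= _).
    by rewrite (@zsum1 _ i)// ?eqxx// => j /negbTE ->.
  apply: zsum_le => j; case: eqP => [->|_]; first by rewrite Ji mulr1.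
  by rewrite mulr_ge0// indicE ler0n.
have mS I : measurable (S I) by exact: measurable_itv.
have m : measurable_fun setT (fun x => `|recon a x|).
  by apply: measurableT_comp => //; exact: measurable_recon.
have le I : (\int[leb]_(x in S I) (`|recon a x|)%:E <= (Dx * K)%:E)%E.
  have LJ i : LI setT (fun x => `|a i| * J i x) by apply: LIZ => //; case: (cellI i).
  have Lz : LI setT (fun x => zsum I.+2 (fun i => `|a i| * J i x)) by apply: LI_sum => // i; exact: LJ.
  have z0 x : 0 <= zsum I.+2 (fun i => `|a i| * J i x).
    by apply: zsum_ge0 => i; rewrite mulr_ge0// indicE ler0n.
  apply: (@le_trans _ _ (\int[leb]_(x in S I) (zsum I.+2 (fun i => `|a i| * J i x))%:E)%E).
    apply: ge0_le_integral => //.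
    - exact: mS.
    - by apply/measurable_EFinP; apply: measurable_funTS.
    - by apply/measurable_EFinP; apply: measurable_funTS; exact: LI_meas.
    - by move=> x Sx; rewrite lee_fin bnd.
  apply: (@le_trans _ _ (\int[leb]_x (zsum I.+2 (fun i => `|a i| * J i x))%:E)%E).
    apply: ge0_subset_integral.
    - exact: mS.
    - exact: measurableT.
    - by apply/measurable_EFinP; exact: (LI_meas Lz).
    - by move=> x _; rewrite lee_fin.
    - by [].
  rewrite -EFin_intI// lee_fin (@zsum_int _ I.+2 (fun i x => `|a i| * J i x) LJ).
  apply: le_trans (ler_wpM2l (ltW Dx0) (bsum_zsum I.+2 aK)); rewrite -zsumZ.
  apply: zsum_le => i; rewrite LI_intZ//; last by case: (cellI i).
  by case: (cellI i) => _ ->; rewrite mulrC.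
have cv : (\int[leb]_(x in S I) (`|recon a x|)%:E)%E @[I --> \oo] --> (\int[leb]_x (`|recon a x|)%:E)%E.
  have -> : setT = \bigcup_I S I.
    apply/esym/seteqP; split=> // x _.
    have [n nx] : exists n : nat, `|x| <= n%:R * Dx.
      exists (Num.bound (`|x| / Dx)); rewrite -ler_pdivrMr//.
      by apply: ltW; apply: archi_boundP; rewrite divr_ge0// ltW.
    by exists n => //; rewrite /S /= in_itv/= -ler_norml.
  apply: ge0_nondecreasing_set_cvg_integral => //.
  - move=> I I' II'; apply/subsetPset => x; rewrite /S /= !in_itv/= => /andP[h1 h2].
    have : I%:R * Dx <= I'%:R * Dx by rewrite ler_pM2r// ler_nat.
    by move=> h; apply/andP; split; [apply: le_trans h1; rewrite lerN2|apply: le_trans h2 h].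
  - by move=> I; apply/measurable_EFinP; exact: measurable_funTS m.
have tot : (\int[leb]_x (`|recon a x|)%:E <= (Dx * K)%:E)%E.
  have := cvg_lim _ cv => <- //; apply: lime_le; first by apply/cvg_ex; eexists; exact: cv.
  by apply: nearW => I; exact: le.
have [La Ia] := LI_ge0 measurableT m (fun x _ => normr_ge0 _) tot; split => //.
by apply: (LI_le measurableT (g := fun x => `|recon a x|)) => //; exact: measurable_recon.
Qed.

Lemma recon_sub a b x : recon a x - recon b x = recon (fun i => a i - b i) x.
Proof. by []. Qed.

End Reconstruction.

Lemma collect_bounds {R : realType} (X1 X2 X3 X4 Y A0 r s v : R) : X1 <= X2 + (A0 + r) ->
  X2 <= Y + X3 -> X4 <= s -> X3 <= s -> X1 + (X4 + v) <= Y + A0 + (s + s + v) + r.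
Proof. by lra. Qed.

(** * From weighted sums to the L^1 distance *)

Section CutoffRemoval.
Context {R : realType}.
Local Notation leb := (@lebesgue_measure R).
Variables (H : R -> R) (C eps lam Dx : R).
Hypotheses (sH : is_step H C) (eps0 : 0 < eps) (lam0 : 0 < lam) (lam1 : lam <= 1)
  (Dx0 : 0 < Dx) (Dxe : Dx = eps ^+ 2) (eps1 : eps <= 1).
Local Notation Dt := (lam * Dx).
Local Notation w := (sw H eps Dx).
Local Notation chi := (tchi H eps lam Dx).

(** Equal to 1 up to |i| = J + 1, to 0 from 2 (J + 1) on, and affine between with slope 1 / (J + 1),
    which tends to 0 while the mesh stays fixed. *)
Definition zcut (J : nat) (i : int) : R :=
  Num.max 0 (Num.min 1 (2 - `|i%:~R| / J.+1%:R)).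

Lemma zcut01 J i : 0 <= zcut J i <= 1.
Proof. by rewrite /zcut le_max lexx/= ge_max ler01 ge_min lexx. Qed.

Lemma zcut_end J (i : int) : `|i%:~R| = (J.+1 + J.+1)%:R :> R -> zcut J i = 0.
Proof.
move=> iE; rewrite /zcut iE natrD.
have -> : 2 - (J.+1%:R + J.+1%:R) / J.+1%:R = 0 :> R.
  by rewrite mulrDl divff ?pnatr_eq0// -(natrD _ 1 1) subrr.
by rewrite (min_idPr ler01) maxxx.
Qed.

Lemma zcut1 J (i : int) : `|i%:~R| <= J.+1%:R :> R -> zcut J i = 1.
Proof.
move=> iJ; have h : `|i%:~R| / J.+1%:R <= 1 :> R by rewrite ler_pdivrMr ?ltr0n// mul1r.
have e : Num.min 1 (2 - `|i%:~R| / J.+1%:R) = 1 :> R by apply/min_idPl; rewrite lerBrDr (natrD _ 1 1) lerD2l.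
by rewrite /zcut e; apply/max_idPr.
Qed.

Lemma clip_lipschitz (a b : R) : `|Num.max 0 (Num.min 1 a) - Num.max 0 (Num.min 1 b)| <= `|a - b|.
Proof.
wlog ab : a b / a <= b.
  by move=> h; have [/h//|/ltW/h] := leP a b; rewrite distrC [`|b - a|]distrC.
rewrite distrC [`|a - b|]distrC !ger0_norm ?subr_ge0//; last first.
  by rewrite ge_max le_max lexx/= le_max le_min !ge_min lexx ab !orbT.
have m1 : Num.max 0 1 = 1 :> R by apply/max_idPr.
by case: (leP 1 a) => a1; case: (leP 1 b) => b1; case: (leP 0 a) => h1; case: (leP 0 b) => h2; rewrite ?m1; lra.
Qed.

Lemma zcut_lipschitz J i : `|zcut J (i + 1) - zcut J i| <= J.+1%:R^-1.
Proof.
have J0 : 0 < J.+1%:R :> R by rewrite ltr0n.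
apply: le_trans (clip_lipschitz _ _) _.
have -> : 2 - `|(i + 1)%:~R| / J.+1%:R - (2 - `|i%:~R| / J.+1%:R) = (`|i%:~R| - `|(i + 1)%:~R|) / J.+1%:R :> R by ring.
have iJ : `|J.+1%:R^-1| = J.+1%:R^-1 :> R by rewrite ger0_norm// invr_ge0 ltW.
rewrite normrM iJ -[leRHS]mul1r ler_pM2r ?invr_gt0//.
apply: le_trans (ler_dist_dist _ _) _.
by rewrite intrD opprD addrA subrr sub0r normrN normr1.
Qed.

Let C0 : 0 <= C. Proof. exact: step_const_ge0 sH. Qed.

Lemma sw_ge0 i x : 0 <= w i x.
Proof. exact: (wdiff_ge0 sH eps0 Dx0). Qed.

Lemma sw_LI i : LI setT (w i) /\ \int[leb]_x w i x <= 6 * C * Dx.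
Proof.
have [Lio Iio] := near3_int eps0 (i%:~R * Dx).
have [w0 _ _ _ _] := space_weights sH eps0 Dx0 Dxe eps1 0.
have wio x : w i x <= C * eps * sio eps Dx i x.
  by have [w1 _ _ _ _] := space_weights sH eps0 Dx0 Dxe eps1 x; case/andP: (w1 i).
have Lg : LI setT (fun x => C * eps * sio eps Dx i x) by exact: LIZ.
have Lw : LI setT (w i).
  apply: (LI_le measurableT (g := fun x => C * eps * sio eps Dx i x)) => //.
    by apply: cts_measurable; apply: smooth_cts; exact: smooth_wdiff sH eps0 _.
  by move=> x _; rewrite ger0_norm// sw_ge0.
split => //; apply: le_trans (LI_int_le measurableT Lw Lg (fun x _ => wio x)) _.
rewrite LI_intZ// Iio Dxe le_eqVlt; apply/orP; left; apply/eqP; ring.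
Qed.

Lemma sw_sum I x : zsum I (fun i => w i x) =
  H ((x - xnode Dx (- Posz I)) / eps) - H ((x - xnode Dx (Posz I)) / eps).
Proof.
rewrite -(zsum_telescope I (fun i => H ((x - xnode Dx i) / eps))).
by apply: eq_zsum => i; rewrite xnodeS.
Qed.

Lemma step01 y : 0 <= H y <= 1.
Proof.
case: sH => _ H0 H1 hm _; apply/andP; split.
  by have [y0|/ltW y0] := leP y 0; [rewrite H0|rewrite -(H0 0)// hm].
by have [y0|/ltW y0] := leP 1 y; [rewrite H1|rewrite -(H1 1)// hm].
Qed.

Lemma sw_sum_le1 I x : zsum I (fun i => w i x) <= 1.
Proof.
rewrite sw_sum; have /andP[_ h1] := step01 ((x - xnode Dx (- Posz I)) / eps).
by have /andP[h2 _] := step01 ((x - xnode Dx (Posz I)) / eps); lra.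
Qed.

Definition fcut J x := zsum (J.+1 + J.+1) (fun i => zcut J i * w i x).

Lemma fcut01 J x : 0 <= fcut J x <= 1.
Proof.
apply/andP; split.
  by apply: zsum_ge0 => i; rewrite mulr_ge0 ?sw_ge0//; case/andP: (zcut01 J i).
apply: le_trans (sw_sum_le1 (J.+1 + J.+1) x); apply: zsum_le => i.
by rewrite ler_piMl ?sw_ge0//; case/andP: (zcut01 J i).
Qed.

(** Eventually constant: once (J + 1) Dx is far enough beyond |x|, every weight active at x has
    cutoff 1, and the full sum of weights telescopes to 1 - 0. *)
Lemma fcut_cvg x : fcut J x @[J --> \oo] --> (1 : R).
Proof.
pose J0 := Num.bound ((`|x| + 3) / Dx + 3).
apply: cvg_near_cst; near=> J.
have J1 : (`|x| + 3) / Dx + 3 <= J.+1%:R.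
  apply: (@le_trans _ _ J0%:R).
    by apply/ltW/archi_boundP; rewrite addr_ge0// divr_ge0// ?addr_ge0// ltW.
  by rewrite ler_nat; apply: leqW; near: J; exact: nbhs_infty_ge.
have J2 : `|x| + 3 + 3 * Dx <= J.+1%:R * Dx by rewrite -ler_pdivrMr// mulrDl mulfK ?gt_eqF.
have [xl xr] : - `|x| <= x /\ x <= `|x| by rewrite ler_norm lerNl -normrN ler_norm.
have Dxl : Dx <= eps by exact: mesh_le eps0 Dxe eps1.
have d0 := Dx0; have e1 := eps1; have e0 := eps0.
have -> : fcut J x = zsum (J.+1 + J.+1) (fun i => w i x).
  apply: eq_zsum => i; have [->|wi] := eqVneq (w i x) 0; first by rewrite mulr0.
  rewrite zcut1 ?mul1r//; have /andP[h1 h2] := wdiff_supp sH eps0 Dx0 wi.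
  rewrite -(ler_pM2r Dx0) -[X in _ * X](gtr0_norm Dx0) -normrM ler_norml.
  move: h1 h2; rewrite /xnode mulrBl => h1 h2.
  by apply/andP; split; lra.
have E1 : (J.+1 + J.+1)%:R * Dx = J.+1%:R * Dx + J.+1%:R * Dx by rewrite natrD mulrDl.
have JD : 0 <= J.+1%:R * Dx by rewrite mulr_ge0// ltW.
rewrite sw_sum; case: sH => _ H0 H1 _ _; rewrite H1 ?H0 ?subr0//.
  rewrite pmulr_lle0 ?invr_gt0// /xnode subr_le0 -pmulrn mulrBl E1; lra.
by rewrite ler_pdivlMr// mul1r /xnode intrN -pmulrn mulrBl mulNr E1; lra.
Unshelve. all: by end_near. Qed.

Variables (a : nat -> int -> R) (K TV Ct Tp A0 A1 : R) (M : nat) (uT U0 : R -> R).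
Hypotheses (TpM : M%:R * Dt <= Tp <= M.+1%:R * Dt) (TV0 : 0 <= TV) (Ct0 : 0 <= Ct)
  (aK : forall m, (m <= M)%N -> bsum (a m) K)
  (aTV : forall m, (m <= M)%N -> bsum (fun i => a m (i + 1) - a m i) TV)
  (aCt : forall m, (m < M)%N -> bsum (fun i => a m.+1 i - a m i) Ct)
  (uTL : LI setT uT) (U0L : LI setT U0).
Hypothesis cut : forall (I : nat) (z : int -> R) tau, 0 <= tau ->
  (forall i, 0 <= z i <= 1) -> z (Posz I) = 0 -> z (- Posz I) = 0 ->
  (forall i, `|z (i + 1) - z i| <= tau) ->
  \sum_(m < M.+1) zsum I (fun i => z i * (chi m Tp * \int[leb]_x (`|uT x - a m i| * w i x))) <=
  zsum I (fun i => z i * \int[leb]_x (`|U0 x - a 0%N i| * w i x)) + (A0 + A1 * tau).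

Lemma path_oscillation (b : int -> R) (i : int) n : `|b (i + Posz n) - b i| <=
  \sum_(k < n) `|b (i + Posz k + 1) - b (i + Posz k)|.
Proof.
elim: n => [|n IH]; first by rewrite addr0 subrr normr0 big_ord0.
rewrite big_ord_recr/=.
have -> : b (i + Posz n.+1) - b i = (b (i + Posz n) - b i) + (b (i + Posz n + 1) - b (i + Posz n)).
  by rewrite -[n.+1]addn1 PoszD addrA; ring.
by apply: le_trans (ler_normD _ _) _; exact: lerD.
Qed.

(* On the support of the i-th weight, the reconstruction only sees the cells
   i, ..., i + Q - 1. *)
Let Q := (Num.truncn (eps / Dx)).+2.

Lemma recon_oscillation (b : int -> R) i x : w i x * `|recon Dx b x - b i| <=
  w i x * \sum_(k < Q) `|b (i + Posz k + 1) - b (i + Posz k)|.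
Proof.
have [->|wi] := eqVneq (w i x) 0; first by rewrite !mul0r.
apply: ler_wpM2l; first exact: sw_ge0.
have /andP[h1 h2] := wdiff_supp sH eps0 Dx0 wi.
rewrite /recon; set j := Num.floor _ : int.
have /andP[j1 j2] : j%:~R <= x / Dx + 2^-1 < (j + 1)%:~R by rewrite floor_le floorD1_gt.
have x1 : i%:~R <= x / Dx + 2^-1.
  by rewrite -lerBlDr ler_pdivlMr// -subr_ge0.
have x2 : x / Dx + 2^-1 <= i%:~R + eps / Dx + 1.
  rewrite -lerBrDr ler_pdivrMr//.
  have -> : (i%:~R + eps / Dx + 1 - 2^-1) * Dx = xnode Dx i + (eps + Dx) by rewrite /xnode; field; rewrite gt_eqF.
  by rewrite -lerBlDl.
have ij : i <= j by rewrite -ltzD1 -(ltr_int R); exact: le_lt_trans j2.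
have ed : eps / Dx < (Num.truncn (eps / Dx)).+1%:R.
  by rewrite truncnS_gt.
have jQ : (absz (j - i)%R < Q)%N.
  rewrite -ltz_nat gez0_abs ?subr_ge0// -(ltr_int R) intrB -pmulrn /Q -[_.+2%:R]natr1.
  by move: j1 x2 ed; lra.
have {1}-> : j = i + Posz (absz (j - i)%R) by rewrite gez0_abs ?subr_ge0// addrC subrK.
apply: le_trans (path_oscillation _ _ _) _.
rewrite -[leRHS](big_mkord xpredT (fun k => `|b (i + Posz k + 1) - b (i + Posz k)|)).
rewrite -[leLHS](big_mkord xpredT (fun k => `|b (i + Posz k + 1) - b (i + Posz k)|)).
by rewrite [leRHS](big_cat_nat (n := absz (j - i)%R))//= ?lerDl ?sumr_ge0// ltnW.
Qed.

Lemma Q_bound : Dx * Q%:R <= 3 * eps.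
Proof.
have Dxl : Dx <= eps by exact: mesh_le eps0 Dxe eps1.
have h : (Num.truncn (eps / Dx))%:R <= eps / Dx by rewrite truncn_le// divr_ge0// ltW.
rewrite /Q -[_.+2%:R]natr1 -[_.+1%:R]natr1.
have : Dx * (Num.truncn (eps / Dx))%:R <= eps by rewrite mulrC -ler_pdivlMr.
by lra.
Qed.

(** A weight has mass at most 6 C Dx, the Q shifted variations add up to at most Q TV, and Dx Q <= 3
    eps; 18 = 6 * 3. *)
Lemma oscillation_int (b : int -> R) I : bsum b K -> bsum (fun i => b (i + 1) - b i) TV ->
  zsum I (fun i => \int[leb]_x (w i x * `|recon Dx b x - b i|)) <= 18 * C * TV * eps.
Proof.
move=> bK bTV; have [Lr _] := recon_LI Dx0 bK.
pose S i := \sum_(k < Q) `|b (i + Posz k + 1) - b (i + Posz k)|.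
have S0 i : 0 <= S i by apply: sumr_ge0.
apply: le_trans (_ : zsum I (fun i => 6 * C * Dx * S i) <= _).
  apply: zsum_le => i; have [Lw Iw] := sw_LI i.
  have LwS : LI setT (fun x => S i * w i x) by exact: LIZ.
  apply: le_trans (_ : \int[leb]_x (S i * w i x) <= _); last first.
    by rewrite LI_intZ// mulrC ler_wpM2r.
  apply: LI_int_le => //; last by move=> x _; rewrite [S i * _]mulrC recon_oscillation.
  apply: (LI_le measurableT (g := fun x => S i * w i x)) => //.
    apply: measurable_funM; first exact: (LI_meas Lw).
    by apply: measurableT_comp => //; apply: measurable_funB => //; exact: measurable_recon.
  move=> x _; rewrite normrM normr_id ger0_norm ?sw_ge0// [S i * _]mulrC.
  exact: recon_oscillation.
rewrite zsumZ.
have : zsum I S <= Q%:R * TV.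
  have -> : Q%:R * TV = \sum_(k < Q) TV by rewrite sumr_const card_ord mulr_natl.
  rewrite /S /zsum exchange_big/=; apply: ler_sum => k _.
  exact: (bsum_zsum I (bsum_shift (Posz k) bTV)).
move=> h; apply: le_trans (ler_wpM2l _ h) _; first by rewrite !mulr_ge0// ltW.
have := ler_wpM2l (_ : 0 <= 6 * C * TV) Q_bound; rewrite !mulr_ge0// => /(_ isT) h2.
by move: h2; congr (_ <= _); ring.
Qed.

Lemma lag_sum m : (m <= M)%N -> bsum (fun i => a M i - a m i) ((M - m)%:R * Ct).
Proof.
move=> mM; have : forall n, (m + n <= M)%N -> bsum (fun i => a (m + n)%N i - a m i) (n%:R * Ct).
  elim=> [|n IH] mn.
    by move=> s _; rewrite mul0r big1// => i _; rewrite addn0 subrr normr0.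
  rewrite -natr1 mulrDl mul1r; apply: (bsum_le (b := fun i => (a (m + n)%N i - a m i) + (a (m + n).+1 i - a (m + n)%N i))).
    by move=> i; rewrite addnS (_ : _ + _ = a (m + n).+1 i - a m i)//; ring.
  by apply: bsumD; [apply: IH; apply: ltnW; rewrite -addnS|apply: aCt; rewrite -addnS].
by move/(_ (M - m)%N); rewrite subnKC//; apply.
Qed.

Let Dt0 : 0 < Dt. Proof. exact: mulr_gt0. Qed.

Lemma active_lag m : (m <= M)%N -> chi m Tp != 0 -> (M - m)%:R * Dt <= 2 * eps.
Proof.
move=> mM ch; have Dte : Dt <= eps by exact: time_step_le eps0 lam1 Dx0 Dxe eps1.
have /andP[T1 T2] := TpM; have d0 := Dt0.
have [m0|mp] := posnP m.
  move: ch; rewrite m0 subn0 => ch.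
  have : Tp <= eps + Dt.
    rewrite leNgt; apply: contraNN ch => h; case: sH => _ _ H1 _ _.
    have M0 : 0 <= M%:R * Dt by rewrite mulr_ge0// ltW.
    rewrite /tchi !H1 ?subrr//; first by rewrite ler_pdivlMr// mul1r; lra.
    by have := eps0; lra.
  by lra.
have : Tp - m%:R * Dt <= eps + Dt.
  case: m mp ch {mM} => // m _ /(wdiff_supp sH eps0 Dt0) /andP[_]; exact.
by rewrite natrB// mulrBl; lra.
Qed.

(** The weights are partitions of unity in time and, in the limit of the cutoff, in space, so the
    error at Tp is the weighted sum of |uT - a_i^m| up to the oscillation of the scheme over a
    weight and its drift over active levels. Oscillation is paid at the final and at the initial
    time, 36 = 2 * 18; the drift costs 6 C Dx times (M - m) Ct with (M - m) Dt <= 2 eps, whence 12.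
    Dominated convergence in J then removes the cutoff together with its error A1 / (J + 1). *)
Lemma kuznetsov_estimate : \int[leb]_x `|uT x - recon Dx (a M) x| <=
  \int[leb]_x `|U0 x - recon Dx (a 0%N) x| + A0 + (36 * C * TV + 12 * C * Ct / lam) * eps.
Proof.
have mO k : (k <= M)%N -> LI setT (recon Dx (a k)) by move=> kM; case: (recon_LI Dx0 (aK kM)).
pose g x := `|uT x - recon Dx (a M) x|.
have Lg : LI setT g by apply: LI_abs; apply: LIB => //; exact: mO.
have mw i : measurable_fun setT (w i) by apply: LI_meas; case: (sw_LI i).
have w1 i x : w i x <= 1.
  have [_ w2 _ _ _] := space_weights sH eps0 Dx0 Dxe eps1 x.
  have /andP[_ h1] := step01 ((x - xnode Dx i) / eps).
  by have /andP[h2 _] := step01 ((x - (xnode Dx i + Dx)) / eps); rewrite /sw /wdiff; lra.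
have wn i x : `|w i x| <= 1 by rewrite ger0_norm ?sw_ge0.
have Lw (h : R -> R) i : LI setT h -> LI setT (fun x => w i x * h x).
  by move=> Lh; apply: (LI_bM (C := 1)).
have step J : \int[leb]_x (fcut J x * g x) <=
   \int[leb]_x `|U0 x - recon Dx (a 0%N) x| + A0 + (36 * C * TV + 12 * C * Ct / lam) * eps + A1 * J.+1%:R^-1.
  pose I := (J.+1 + J.+1)%N; pose z := zcut J.
  have z01 := zcut01 J; have z0 i : 0 <= z i by case/andP: (z01 i).
  have z1 i : z i <= 1 by case/andP: (z01 i).
  have L1 m i : (m <= M)%N -> LI setT (fun x => `|uT x - a m i| * w i x).
    move=> mM; have Luw := Lw _ i (LI_abs uTL); have [Lwi _] := sw_LI i.
    have Lc : LI setT (fun x => `|a m i| * w i x) by exact: LIZ.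
    apply: (LI_le measurableT (g := fun x => w i x * `|uT x| + `|a m i| * w i x)).
    - apply: measurable_funM => //; apply: measurableT_comp => //.
      by apply: measurable_funB => //; exact: (LI_meas uTL).
    - move=> x _; rewrite normrM normr_id (ger0_norm (sw_ge0 _ _)) [w i x * _]mulrC -mulrDl.
      by rewrite ler_wpM2r ?sw_ge0// ler_normB.
    - exact: LID.
  have L10 i : LI setT (fun x => `|U0 x - a 0%N i| * w i x).
    have Luw := Lw _ i (LI_abs U0L); have [Lwi _] := sw_LI i.
    have Lc : LI setT (fun x => `|a 0%N i| * w i x) by exact: LIZ.
    apply: (LI_le measurableT (g := fun x => w i x * `|U0 x| + `|a 0%N i| * w i x)).
    - apply: measurable_funM => //; apply: measurableT_comp => //.
      by apply: measurable_funB => //; exact: (LI_meas U0L).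
    - move=> x _; rewrite normrM normr_id (ger0_norm (sw_ge0 _ _)) [w i x * _]mulrC -mulrDl.
      by rewrite ler_wpM2r ?sw_ge0// ler_normB.
    - exact: LID.
  have Losc k i : (k <= M)%N -> LI setT (fun x => w i x * `|recon Dx (a k) x - a k i|).
    move=> kM; have [Lwi _] := sw_LI i; have Lr := Lw _ i (LI_abs (mO k kM)).
    have Lc : LI setT (fun x => `|a k i| * w i x) by exact: LIZ.
    apply: (LI_le measurableT (g := fun x => w i x * `|recon Dx (a k) x| + `|a k i| * w i x)).
    - apply: measurable_funM => //; apply: measurableT_comp => //.
      by apply: measurable_funB => //; exact: measurable_recon.
    - move=> x _; rewrite normrM normr_id (ger0_norm (sw_ge0 _ _)) [`|a k i| * _]mulrC -mulrDr.
      by rewrite ler_wpM2l ?sw_ge0// ler_normB.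
    - exact: LID.
  have Lgw i : LI setT (fun x => w i x * g x) by exact: Lw.
  have lhs : \int[leb]_x (fcut J x * g x) <=
     \sum_(m < M.+1) zsum I (fun i => z i * (chi m Tp * \int[leb]_x (`|uT x - a m i| * w i x))) +
     (zsum I (fun i => \int[leb]_x (w i x * `|recon Dx (a M) x - a M i|)) + 12 * C * Ct / lam * eps).
    have -> : \int[leb]_x (fcut J x * g x) = \sum_(m < M.+1) zsum I (fun i => z i * (chi m Tp * \int[leb]_x (w i x * g x))).
      have E : (fun x => fcut J x * g x) = (fun x => zsum I (fun i => z i * (w i x * g x))).
        apply/funext => x; rewrite /fcut mulrC -zsumZ; apply: eq_zsum => i; rewrite /z; ring.
      have Lz i : LI setT (fun x => z i * (w i x * g x)) by exact: LIZ.
      rewrite E (@zsum_int _ I (fun i x => z i * (w i x * g x)) Lz).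
      rewrite exchange_big/=; apply: eq_bigr => n _.
      rewrite -mulr_sumr -mulr_suml (tchi_sum sH eps0)// ?mul1r ?LI_intZ//.
      by case/andP: TpM => T1 ->; rewrite (le_trans _ T1)// mulr_ge0// ltW.
    have chi0 m : 0 <= chi m Tp by exact: (tchi_ge0 sH eps0 lam0 Dx0).
    apply: le_trans (_ : \sum_(m < M.+1) (zsum I (fun i => z i * (chi m Tp * \int[leb]_x (`|uT x - a m i| * w i x))) +
       chi m Tp * (zsum I (fun i => \int[leb]_x (w i x * `|recon Dx (a M) x - a M i|)) + 12 * C * Ct / lam * eps)) <= _).
      apply: ler_sum => m _; have mM : (m <= M)%N by rewrite -ltnS.
      have [c0|cn] := eqVneq (chi m Tp) 0.
        by rewrite c0 mul0r addr0; apply: zsum_le => i; rewrite !mul0r.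
      (* The difference is split as (uT - a_i^m) - (recon a^M - a_i^M) - (a_i^M - a_i^m): Kruzkov
         term, oscillation in space, drift in time. *)
      have key i : \int[leb]_x (w i x * g x) <= \int[leb]_x (`|uT x - a m i| * w i x) +
          (\int[leb]_x (w i x * `|recon Dx (a M) x - a M i|) + `|a M i - a m i| * (6 * C * Dx)).
        have [Lwi Iwi] := sw_LI i.
        have Lc : LI setT (fun x => `|a M i - a m i| * w i x) by exact: LIZ.
        apply: le_trans (_ : \int[leb]_x (`|uT x - a m i| * w i x + (w i x * `|recon Dx (a M) x - a M i| + `|a M i - a m i| * w i x)) <= _).
          have Ls : LI setT (fun x => w i x * `|recon Dx (a M) x - a M i| + `|a M i - a m i| * w i x).
            by apply: LID => //; exact: Losc.
          apply: LI_int_le => //; first by apply: LID => //; exact: L1.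
          move=> x _; rewrite mulrC -[X in _ <= _ + (X + _)]mulrC -!mulrDl ler_wpM2r ?sw_ge0// /g.
          have -> : uT x - recon Dx (a M) x = (uT x - a m i) - (recon Dx (a M) x - a M i) - (a M i - a m i) by ring.
          apply: le_trans (ler_normB _ _) _; rewrite addrA lerD2r; exact: ler_normB.
        rewrite LI_intD//; [|exact: L1|by apply: LID => //; exact: Losc].
        rewrite lerD2l LI_intD//; last exact: Losc.
        by rewrite lerD2l LI_intZ// ler_wpM2l.
      apply: le_trans (_ : zsum I (fun i => z i * (chi m Tp * \int[leb]_x (`|uT x - a m i| * w i x)) +
         chi m Tp * (\int[leb]_x (w i x * `|recon Dx (a M) x - a M i|) + `|a M i - a m i| * (6 * C * Dx))) <= _).
        apply: zsum_le => i.
        apply: le_trans (_ : z i * (chi m Tp * (\int[leb]_x (`|uT x - a m i| * w i x) +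
          (\int[leb]_x (w i x * `|recon Dx (a M) x - a M i|) + `|a M i - a m i| * (6 * C * Dx)))) <= _).
          by rewrite !ler_wpM2l.
        rewrite !mulrDr lerD2l -!mulrDr ler_piMl// mulr_ge0// addr_ge0//.
          by apply: Rintegral_ge0 => x _; rewrite mulr_ge0// sw_ge0.
        by rewrite mulr_ge0// !mulr_ge0// ltW.
      rewrite zsumD lerD2l zsumZ ler_wpM2l// zsumD lerD2l.
      have -> : zsum I (fun i => `|a M i - a m i| * (6 * C * Dx)) = 6 * C * Dx * zsum I (fun i => `|a M i - a m i|).
        by rewrite -zsumZ; apply: eq_zsum => i; rewrite mulrC.
      have c6 : 0 <= 6 * C * Dx by rewrite !mulr_ge0// ltW.
      apply: le_trans (ler_wpM2l c6 (bsum_zsum I (lag_sum mM))) _.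
      have cl : 0 <= 6 * C * Ct / lam by rewrite mulr_ge0 ?invr_ge0 ?mulr_ge0// ltW.
      have := ler_wpM2l cl (active_lag mM cn); congr (_ <= _); field; rewrite gt_eqF//.
    rewrite big_split/= lerD2l -mulr_suml (tchi_sum sH eps0) ?mul1r//.
    by case/andP: TpM => T1 ->; rewrite (le_trans _ T1)// mulr_ge0// ltW.
  apply: le_trans lhs _.
  have oscM := oscillation_int I (aK (leqnn M)) (aTV (leqnn M)).
  have osc0 := oscillation_int I (aK (leq0n M)) (aTV (leq0n M)).
  have iN (i : int) : `|i%:~R| = (J.+1 + J.+1)%:R :> R -> z i = 0 by exact: zcut_end.
  have J0 : 0 <= J.+1%:R^-1 :> R by rewrite invr_ge0.
  have zI : z (Posz I) = 0 by apply: iN; rewrite -pmulrn normr_nat.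
  have zNI : z (- Posz I) = 0 by apply: iN; rewrite intrN normrN -pmulrn normr_nat.
  have := cut J0 z01 zI zNI (zcut_lipschitz J).
  have rhs : zsum I (fun i => z i * \int[leb]_x (`|U0 x - a 0%N i| * w i x)) <=
     \int[leb]_x `|U0 x - recon Dx (a 0%N) x| + zsum I (fun i => \int[leb]_x (w i x * `|recon Dx (a 0%N) x - a 0%N i|)).
    pose g0 x := `|U0 x - recon Dx (a 0%N) x|.
    have Lg0 : LI setT g0 by apply: LI_abs; apply: LIB => //; exact: mO.
    have Lg0w i : LI setT (fun x => w i x * g0 x) by exact: Lw.
    apply: le_trans (_ : zsum I (fun i => \int[leb]_x (w i x * g0 x) + \int[leb]_x (w i x * `|recon Dx (a 0%N) x - a 0%N i|)) <= _).
      apply: zsum_le => i.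
      apply: le_trans (_ : \int[leb]_x (`|U0 x - a 0%N i| * w i x) <= _).
        rewrite ler_piMl//; apply: Rintegral_ge0 => x _; by rewrite mulr_ge0// sw_ge0.
      rewrite -LI_intD//; last exact: Losc.
      apply: LI_int_le => //; first by apply: LID => //; exact: Losc.
      move=> x _; rewrite mulrC -mulrDr ler_wpM2l ?sw_ge0// /g0.
      apply: le_trans (ler_normD _ _); by rewrite addrA subrK.
    rewrite zsumD lerD2r -(@zsum_int _ I (fun i x => w i x * g0 x) Lg0w).
    apply: LI_int_le => //; first exact: (@zsum_LI _ I (fun i x => w i x * g0 x)).
    move=> x _; rewrite (_ : zsum I _ = g0 x * zsum I (fun i => w i x)); last first.
      by rewrite -zsumZ; apply: eq_zsum => i; rewrite mulrC.
    by rewrite -/(g0 x) -[leRHS]mulr1; apply: ler_wpM2l; [exact: normr_ge0|exact: sw_sum_le1].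
  move=> h; move: h rhs oscM osc0; rewrite -/I -/z; set X1 := \sum_(m < _) _; set X2 := zsum I _; set X3 := zsum I _; set X4 := zsum I _.
  set Y := \int[leb]_x _; set v := 12 * C * Ct / lam * eps; set r := A1 * _.
  have -> : (36 * C * TV + 12 * C * Ct / lam) * eps = 18 * C * TV * eps + 18 * C * TV * eps + v by rewrite /v; ring.
  exact: collect_bounds.
have cv : \int[leb]_x (fcut J x * g x) @[J --> \oo] --> \int[leb]_x g x.
  apply: (LI_dct (g := g)) => //.
  - move=> J; apply: measurable_funM; last exact: LI_meas.
    by apply: measurable_sum => i; apply: measurable_funM => //.
  - exact: LI_meas.
  - move=> x _; rewrite -[X in _ --> X]mul1r; apply: cvgM; [exact: fcut_cvg|exact: cvg_cst].
  - move=> J x _; have /andP[f0 f1] := fcut01 J x.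
    by rewrite normrM (ger0_norm f0) normr_id ler_piMl.
have cv2 : \int[leb]_x `|U0 x - recon Dx (a 0%N) x| + A0 + (36 * C * TV + 12 * C * Ct / lam) * eps + A1 * J.+1%:R^-1 @[J --> \oo] -->
   \int[leb]_x `|U0 x - recon Dx (a 0%N) x| + A0 + (36 * C * TV + 12 * C * Ct / lam) * eps + A1 * 0.
  apply: cvgD; first exact: cvg_cst.
  by apply: cvgM; [exact: cvg_cst|exact: cvg_harmonic].
rewrite mulr0 addr0 in cv2.
by apply: ler_cvg_to cv cv2 _; apply: nearW => J; exact: step.
Qed.

End CutoffRemoval.

(** * Translations and cell averages *)

Section Variation.
Context {R : realType}.
Local Notation leb := (@lebesgue_measure R).

Lemma LI_subset (D E : set R) (f : R -> R) : measurable D -> measurable E -> D `<=` E -> LI E f -> LI D f.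
Proof. by move=> mD mE DE; exact: integrableS. Qed.

Lemma Ck1_of_derivative (F dF : R -> R) : (forall x, is_derive x (1 : R) F (dF x)) ->
  continuous dF -> Ck 1 F.
Proof.
move=> D cdF; have cF : continuous F by apply: derivable_cts => x; case: (D x).
have dir (x v : R) : is_derive x v F (v * dF x).
  have e0 : x + 0 *: v = x by rewrite scale0r addr0.
  rewrite -[X in is_derive X]e0; apply/(is_derive_lineP F).
  have Dg : is_derive (0 : R) (1 : R) (fun s : R => x + s *: v) v.
    have := is_deriveD (is_derive_cst x (0 : R) (1 : R)) (is_deriveZ v (is_derive_id (0 : R) (1 : R))).
    rewrite add0r [v *: _]mulr1; congr is_derive.
    by apply/funext => s; rewrite !fctE /GRing.scale/= mulrC.
  have := @is_derive1_comp _ F (fun s : R => x + s *: v) 0 (dF x) v.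
  by rewrite e0 mulrC => /(_ (D x) Dg).
have dd (x v : R) : derivable F x v by case: (dir x v).
move=> [|v [|? ?]]//= _; split=> //; have -> : (fun x => 'D_v F x) = (fun x => v * dF x).
  by apply/funext => x; case: (dir x v).
by move=> x; apply: cvgM; [exact: cvg_cst|exact: cdF].
Qed.

Lemma compact_support_itv (F : R -> R) (a b : R) : (forall x, F x != 0 -> a <= x <= b) ->
  compact_support F.
Proof.
move=> Fab; apply: (@subclosed_compact _ _ `[a, b]%classic).
- exact: closed_closure.
- exact: segment_compact.
apply: support_in_closed; last by move=> x /Fab; rewrite /= in_itv.
by apply: interval_closed.
Qed.

Lemma antiderivative (s : R -> R) : continuous s -> LI setT s ->
  exists F, forall x : R, is_derive x (1 : R) F (s x).
Proof.
move=> cs Ls; exists (fun x => \int[leb]_(t in `]-oo, x]) s t) => x.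
have Lu : leb.-integrable `]-oo, (x + 1)] (EFin \o s) by apply: integrableS Ls.
have x1 : x < x + 1 by rewrite ltrDl.
have [] := @continuous_FTC1 R s -oo%O x (x + 1) x1 Lu _ (cs x); first by rewrite /= ltNyr.
move=> d e; rewrite derive1E in e; rewrite -e; exact: derivableP.
Qed.

(** Minus the mean P of s over [y - h, y] is admissible in the definition of the variation: it is
    C^1, compactly supported, and bounded by 1 by the mean value theorem. As P' = (s(x - h) - s(x))
    / h, pairing U with P' is pairing the increment of U with s, divided by h. *)
Lemma translation_test (U s : R -> R) (V h a b : R) : LI setT U -> (TV U <= V%:E)%E -> 0 < h ->
  continuous s -> (forall x, `|s x| <= 1) -> a <= b -> (forall x, s x != 0 -> a <= x <= b) ->
  LI setT (fun x => (U (x + h) - U x) * s x) /\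
  \int[leb]_x ((U (x + h) - U x) * s x) <= h * V.
Proof.
move=> LU UV h0 cs s1 ab sab.
have ms : measurable_fun setT s by exact: cts_measurable.
have Ls : LI setT s.
  have [Li _] := int_itv_indic 0 ab.
  apply: (LI_eq (f := fun x => s x * (\1_(`[a, b]%classic) : R -> R) x)) => //; last exact: (LI_bM (C := 1)).
  move=> x _; rewrite indicE; have [->|/sab sx] := eqVneq (s x) 0; first by rewrite mul0r.
  by rewrite mem_set ?mulr1//= in_itv.
have LUs (g : R -> R) : LI setT g -> LI setT (fun x => g x * s x).
  move=> Lg; apply: (LI_eq (f := fun x => s x * g x)) => //; first by move=> x _; rewrite mulrC.
  exact: (LI_bM (C := 1)).
have LUh := L1_shift h LU.
have Lsplit : LI setT (fun x => (U (x + h) - U x) * s x) by apply: LUs; exact: LIB.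
split => //.
have csh : continuous (fun x => s (x - h)).
  move=> x; apply: (@continuous_comp _ _ _ (fun y => y - h) s); last exact: cs.
  by apply: cvgB; [exact: cvg_id|exact: cvg_cst].
have LUsh : LI setT (fun x => U x * s (x - h)).
  apply: (LI_eq (f := fun x => s (x - h) * U x)) => //; first by move=> x _; rewrite mulrC.
  by apply: (LI_bM (C := 1)) => //; exact: cts_measurable.
have [F DF] := antiderivative cs Ls.
have shD (x : R) : is_derive x (1 : R) (fun y => F (y - h)) (s (x - h)).
  have Dg : is_derive x (1 : R) (fun y : R => y - h) 1.
    by apply: (is_derive_eq (is_deriveB (is_derive_id x (1 : R)) (is_derive_cst h x (1 : R)))); rewrite subr0.
  by have := @is_derive1_comp _ F (fun y : R => y - h) x _ _ (DF (x - h)) Dg; rewrite mulr1.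
pose P y := h^-1 * (F (y - h) - F y).
have DP (x : R) : is_derive x (1 : R) P (h^-1 * (s (x - h) - s x)).
  by have := is_deriveZ h^-1 (is_deriveB (shD x) (DF x)); exact.
have cF : continuous F by apply: derivable_cts => x; case: (DF x).
have mvt y : exists2 c, y - h <= c <= y & F y - F (y - h) = s c * h.
  have yh : y - h <= y by rewrite gerBl ltW.
  have [c cI E] := MVT_segment yh (fun z _ => DF z) (continuous_subspaceT cF).
  by exists c; [move: cI; rewrite in_itv|rewrite E; congr (_ * _); rewrite opprB addrC subrK].
have PE y c : F y - F (y - h) = s c * h -> P y = - s c.
  move=> E; rewrite /P -opprB E mulrN mulrC mulfK// gt_eqF//.
have cdP : continuous (fun x => h^-1 * (s (x - h) - s x)).
  move=> x; apply: cvgM; first exact: cvg_cst.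
  by apply: cvgB; [exact: csh|exact: cs].
have tst : [/\ Ck 1 P, compact_support P & forall x, `|P x| <= 1].
  split; first exact: (Ck1_of_derivative DP cdP).
    apply: (@compact_support_itv _ a (b + h)) => y; have [c /andP[c1 c2] /PE ->] := mvt y.
    rewrite oppr_eq0 => /sab /andP[h1 h2].
    by rewrite (le_trans h1 c2)/= -lerBlDr (le_trans c1 h2).
  by move=> y; have [c _ /PE ->] := mvt y; rewrite normrN.
have dP x : P^`()%classic x = h^-1 * (s (x - h) - s x) by rewrite derive1E; case: (DP x).
have : ((\int[leb]_x (U x * P^`()%classic x))%:E <= V%:E)%E.
  apply: le_trans UV; apply: ereal_sup_ubound.
  by exists P.
rewrite lee_fin => bnd.
have E1 : \int[leb]_x (U (x + h) * s x) = \int[leb]_x (U x * s (x - h)).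
  rewrite -(int_shift h LUsh); apply: eq_Rintegral => x _.
  by rewrite addrK.
have -> : \int[leb]_x ((U (x + h) - U x) * s x) = \int[leb]_x (U x * s (x - h)) - \int[leb]_x (U x * s x).
  rewrite -E1 -LI_intB//; [|exact: LUs|exact: LUs].
  by apply: eq_Rintegral => x _; rewrite mulrBl.
rewrite -LI_intB//; last exact: LUs.
rewrite mulrC -ler_pdivrMr// mulrC -LI_intZ//; last by apply: LIB => //; exact: LUs.
apply: le_trans bnd; rewrite le_eqVlt; apply/orP; left; apply/eqP.
by apply: eq_Rintegral => x _; rewrite dP; ring.
Qed.

Lemma bounded_itv_limit (f : R -> R) (V : R) : LI setT f ->
  (forall n : nat, \int[leb]_(x in `[- n%:R, n%:R]) `|f x| <= V) -> \int[leb]_x `|f x| <= V.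
Proof.
move=> Lf le; have Lab := LI_abs Lf.
pose S (n : nat) : set R := `[- n%:R, n%:R]%classic.
have mS n : measurable (S n) by exact: measurable_itv.
have cv : (\int[leb]_(x in S n) (`|f x|)%:E)%E @[n --> \oo] --> (\int[leb]_x (`|f x|)%:E)%E.
  have -> : setT = \bigcup_n S n.
    apply/esym/seteqP; split=> // x _; exists (Num.bound `|x|) => //.
    by rewrite /S /= in_itv/= -ler_norml; apply/ltW/archi_boundP.
  apply: ge0_nondecreasing_set_cvg_integral => //.
  - move=> n n' nn'; apply/subsetPset => x; rewrite /S /= !in_itv/= => /andP[h1 h2].
    have : n%:R <= n'%:R :> R by rewrite ler_nat.
    by move=> h; apply/andP; split; [apply: le_trans h1; rewrite lerN2|apply: le_trans h2 h].
  - by move=> n; apply/measurable_EFinP; apply: measurable_funTS; exact: (LI_meas Lab).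
rewrite -lee_fin EFin_intI// -(cvg_lim _ cv)//; apply: lime_le; first by apply/cvg_ex; eexists; exact: cv.
have Ln n : LI (S n) (fun x => `|f x|) by apply: LI_subset Lab.
apply: nearW => n; rewrite -EFin_intI//.
by rewrite lee_fin; exact: le.
Qed.

(* Duality: the sign of the translation increment g is approximated by
   phi * k / (eta + |k|), with k continuous and L1-close to g and phi a cutoff. *)
Lemma translation_bound (H : R -> R) (CH : R) (U : R -> R) (V h : R) : is_step H CH ->
  LI setT U -> (TV U <= V%:E)%E -> 0 < h -> \int[leb]_x `|U (x + h) - U x| <= h * V.
Proof.
move=> sH LU UV h0; pose g x := U (x + h) - U x.
have Lg : LI setT g by apply: LIB => //; exact: L1_shift.
apply: (bounded_itv_limit Lg) => n; apply/ler_addgt0Pr => e e0.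
have sm : smooth H by case: sH.
pose X : R := n%:R; have X0 : 0 <= X by exact: ler0n.
have XX : - X - 1 <= X + 1 by lra.
pose E : set R := `[(- X - 1), (X + 1)]%classic.
have mE : measurable E by exact: measurable_itv.
have LgE : LI E g by apply: integrableS Lg.
pose phi x := H (x - (- X - 1)) - H (x - X).
have h01 := step01 sH.
have cphi : continuous phi.
  have sh (c : R) : continuous (fun x => H (x - c)).
    move=> x; apply: (@continuous_comp _ _ _ (fun y => y - c) H); last exact: smooth_cts.
    by apply: cvgB; [exact: cvg_id|exact: cvg_cst].
  by move=> x; apply: cvgB; exact: sh.
have phi01 x : 0 <= phi x <= 1.
  rewrite /phi; have := h01 (x - (- X - 1)); have := h01 (x - X).
  case: sH => _ _ _ hm _; have : H (x - X) <= H (x - (- X - 1)) by apply: hm; lra.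
  by lra.
have phi1 x : - X <= x <= X -> phi x = 1.
  case: sH => _ H0 H1 _ _ /andP[x1 x2]; rewrite /phi H1; last by lra.
  by rewrite H0 ?subr0//; lra.
have phiE x : phi x != 0 -> - X - 1 <= x <= X + 1.
  case: sH => _ H0 H1 _ _; rewrite /phi; apply: contraNT; rewrite negb_and -!ltNge => /orP[x1|x1].
    by rewrite !H0 ?subrr//; lra.
  by rewrite !H1 ?subrr//; lra.
(* The budget e is split evenly: eta |E| <= e / 2 since |E| = 2 X + 2, and twice the L^1 distance e
   / 4 from g to k. *)
pose eta := e / (2 * (2 * X + 3)).
have eta0 : 0 < eta by rewrite divr_gt0// mulr_gt0//; lra.
have [k ck [Lk kg]] : exists2 k : R -> R, continuous k & LI E k /\ \int[leb]_(x in E) `|g x - k x| <= e / 4.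
  have [k_ [ck Lk kc]] := approximation_continuous_integrable mE (itv_mu_fin _ _) LgE.
  have Lgk m : LI E (fun x => `|g x - k_ m x|) by apply: LI_abs; apply: LIB => //; exact: Lk.
  have e4 : 0 < e / 4 by rewrite divr_gt0.
  have kc' : (\int[leb]_(x in E) `|g x - k_ m x|)%:E @[m --> \oo] --> (0 : R)%:E.
    apply: cvg_trans kc; apply: near_eq_cvg; apply: nearW => m.
    by rewrite EFin_intI.
  have /cvgrPdist_le kc2 : (fine \o (fun m => (\int[leb]_(x in E) `|g x - k_ m x|)%:E)) m @[m --> \oo] --> (0 : R) by exact: fine_cvg kc'.
  have [m _ /(_ m (leqnn m))] := kc2 _ e4.
  rewrite /= sub0r normrN => hm; exists (k_ m); first exact: ck.
  by split; [exact: Lk|exact: le_trans (ler_norm _) hm].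
pose den x := eta + `|k x|.
have den0 x : 0 < den x by rewrite ltr_wpDr.
pose s x := phi x * (k x / den x).
have cs : continuous s.
  move=> x; apply: cvgM; first exact: cphi.
  apply: cvgM; first exact: ck.
  apply: cvgV; first by rewrite gt_eqF.
  by apply: cvgD; [exact: cvg_cst|apply: cvg_norm; exact: ck].
have s1 x : `|s x| <= 1.
  have /andP[p0 p1] := phi01 x.
  rewrite normrM (ger0_norm p0) -[leRHS]mulr1; apply: ler_pM => //.
  rewrite normrM normfV (gtr0_norm (den0 x)) ler_pdivrMr// mul1r /den lerDr ltW//.
have sE x : s x != 0 -> - X - 1 <= x <= X + 1.
  by rewrite mulf_eq0 negb_or => /andP[/phiE].
have [Lgs Igs] := translation_test LU UV h0 cs s1 XX sE.
pose S : set R := `[- n%:R, n%:R]%classic.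
have SE : S `<=` E.
  by move=> x; rewrite /S /E /= !in_itv/= -/X => /andP[? ?]; apply/andP; split; lra.
have mS : measurable S by exact: measurable_itv.
have LgkE : LI E (fun x => `|g x - k x|) by apply: LI_abs; exact: LIB.
have Lgp : LI E (fun x => phi x * `|g x|).
  apply: (LI_bM (C := 1)) => //; first exact: cts_measurable.
    by move=> x _; have /andP[? ?] := phi01 x; rewrite ger0_norm.
  exact: LI_abs.
have step1 : \int[leb]_(x in S) `|g x| <= \int[leb]_(x in E) (phi x * `|g x|).
  have LgS : LI S (fun x => `|g x|) by apply: LI_abs; apply: integrableS Lg.
  rewrite -lee_fin !EFin_intI//.
  apply: (@le_trans _ _ (\int[leb]_(x in S) (phi x * `|g x|)%:E)%E).
    rewrite le_eqVlt; apply/orP; left; apply/eqP; apply: eq_integral => x; rewrite inE /S/= in_itv/= => xS.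
    by rewrite phi1 ?mul1r.
  apply: ge0_subset_integral => //; first by apply/measurable_EFinP; exact: (LI_meas Lgp).
  by move=> x _; rewrite lee_fin mulr_ge0//; case/andP: (phi01 x).
have LgsE : LI E (fun x => g x * s x) by apply: integrableS Lgs.
have [Lc Ic] : LI E (cst eta) /\ \int[leb]_(x in E) (cst eta x : R) = eta * (2 * X + 2).
  have [L1 I1] := int_itv_indic 0 XX.
  have [L2 I2] : LI E (cst (1 : R)) /\ \int[leb]_(x in E) (cst (1 : R) x : R) = 2 * X + 2.
    split.
      apply: (LI_eq (f := (\1_E : R -> R))) => //; last exact: integrableS L1.
      by move=> x Ex; rewrite indicE mem_set.
    rewrite Rintegral_cst// mul1r /E /= lebesgue_measure_itv/= lte_fin.
    by case: ltP => [_|]; rewrite /=; lra.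
  have E1 : (cst eta : R -> R) = (fun x => eta * cst 1 x) by apply/funext => x /=; rewrite mulr1.
  by rewrite E1; split; [exact: LIZ|rewrite LI_intZ// I2].
have L2 : LI E (fun x => g x * s x + 2 * `|g x - k x|) by apply: LID => //; exact: LIZ.
have step2 : \int[leb]_(x in E) (phi x * `|g x|) <= \int[leb]_(x in E) (g x * s x + 2 * `|g x - k x| + cst eta x).
  apply: LI_int_le => //; first exact: LID.
  move=> x _ /=; have /andP[p0 p1] := phi01 x.
  have a1 : phi x * `|g x| <= phi x * `|k x| + `|g x - k x|.
    apply: le_trans (_ : phi x * (`|k x| + `|g x - k x|) <= _).
      by rewrite ler_wpM2l// -[X in `|X| <= _](subrK (k x)) addrC ler_normD.
    by rewrite mulrDr lerD2l ler_piMl.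
  have a2 : phi x * `|k x| <= k x * s x + eta.
    have -> : k x * s x = phi x * (`|k x| - eta * `|k x| / den x).
      rewrite /s; have -> : k x * (phi x * (k x / den x)) = phi x * (`|k x| ^+ 2 / den x).
        by rewrite real_normK ?num_real//; ring.
      by congr (_ * _); rewrite /den; field; rewrite gt_eqF// den0.
    rewrite mulrBr -addrA lerDl addrC subr_ge0.
    apply: le_trans (_ : 1 * (eta * 1) <= _); last by rewrite mul1r mulr1.
    apply: ler_pM => //; first by apply: divr_ge0; [apply: mulr_ge0 => //; exact: ltW|exact: ltW].
    rewrite -mulrA; apply: ler_wpM2l; first exact: ltW.
    by rewrite ler_pdivrMr// mul1r /den lerDr ltW.
  have a3 : k x * s x <= g x * s x + `|g x - k x|.
    rewrite -lerBlDl -mulrBl; apply: le_trans (ler_norm _) _.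
    by rewrite normrM distrC ler_piMr.
  by lra.
have E3 : \int[leb]_(x in E) (g x * s x) = \int[leb]_x (g x * s x).
  rewrite Rintegral_mkcond; apply: eq_Rintegral => x _; rewrite patchE.
  case: ifPn => // /negP xE; have [->|/sE sx] := eqVneq (s x) 0; first by rewrite mulr0.
  by exfalso; apply: xE; rewrite inE /E/= in_itv.
apply: le_trans step1 _; apply: le_trans step2 _.
rewrite LI_intD// LI_intD//; last exact: LIZ.
rewrite LI_intZ// Ic E3.
have eE : eta * (2 * X + 2) <= e / 2.
  rewrite /eta mulrAC ler_pdivrMr ?mulr_gt0//; last by lra.
  have : 0 <= e * X by rewrite mulr_ge0// ltW.
  have := ltW e0; lra.
by move: Igs kg eE; rewrite -/(g _); lra.
Qed.

End Variation.

Section CellAverages.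
Context {R : realType}.
Local Notation leb := (@lebesgue_measure R).
Variables (Dx : R) (Dx0 : 0 < Dx).

Definition cellnum (x : R) : int := Num.floor (x / Dx + 2^-1).

Lemma cellP (i : int) (x : R) : cell Dx i%:~R x <-> cellnum x = i.
Proof.
rewrite /cell /= in_itv/= /cellnum; split.
  move=> /andP[x1 x2]; apply: floor_def; rewrite -lerBlDr ler_pdivlMr// x1 /=.
  by rewrite -ltrBrDr ltr_pdivrMr// intrD (_ : i%:~R + 1%:~R - 2^-1 = i%:~R + 2^-1)//; lra.
move=> <-; have /andP[h1 h2] : (Num.floor (x / Dx + 2^-1))%:~R <= x / Dx + 2^-1 < (Num.floor (x / Dx + 2^-1) + 1)%:~R.
  by rewrite floor_le floorD1_gt.
move: h2; rewrite intrD mulr1z => h2.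
rewrite -ler_pdivlMr// -ltr_pdivrMr//; apply/andP; split; lra.
Qed.

Lemma measurable_cell q : measurable (cell Dx q). Proof. exact: measurable_itv. Qed.

Lemma cellnum_shift x : cellnum (x + Dx) = cellnum x + 1.
Proof.
apply: floor_def; have /andP[h1 h2] : (cellnum x)%:~R <= x / Dx + 2^-1 < (cellnum x + 1)%:~R.
  by rewrite floor_le floorD1_gt.
have -> : (x + Dx) / Dx + 2^-1 = x / Dx + 2^-1 + 1 by field; rewrite gt_eqF.
by move: h1 h2; rewrite !intrD mulr1z; lra.
Qed.

Lemma cell_int (g : R -> R) (i : int) :
  \int[leb]_(x in cell Dx i%:~R) g x = \int[leb]_x ((cellnum x == i)%:R * g x).
Proof.
rewrite Rintegral_mkcond; apply: eq_Rintegral => x _; rewrite patchE.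
case: ifPn => xi; first by have /cellP -> : cell Dx i%:~R x by [rewrite inE in xi]; rewrite eqxx mul1r.
case: eqP => [/cellP ci|_]; last by rewrite mul0r.
by rewrite mem_set in xi.
Qed.

Lemma cellind_LI (g : R -> R) (i : int) : LI setT g -> LI setT (fun x => (cellnum x == i)%:R * g x).
Proof.
move=> Lg; apply: (LI_bM (C := 1)) => //; last by move=> x _; rewrite normr_nat lern1 leq_b1.
exact: (measurable_recon Dx (fun j => (j == i)%:R)).
Qed.

Lemma bsum_cell_int (g : R -> R) : LI setT g ->
  bsum (fun i : int => \int[leb]_(x in cell Dx i%:~R) g x) (\int[leb]_x `|g x|).
Proof.
move=> Lg s us; have La := LI_abs Lg.
apply: le_trans (_ : \sum_(i <- s) \int[leb]_x ((cellnum x == i)%:R * `|g x|) <= _).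
  apply: ler_sum => i _; rewrite cell_int.
  apply: LI_int_absle => //; [exact: cellind_LI|exact: cellind_LI|].
  by move=> x _; rewrite normrM normr_nat.
rewrite -LI_int_sum// => [|i]; last exact: cellind_LI.
apply: LI_int_le => //; first by apply: LI_sum => // i; exact: cellind_LI.
move=> x _; rewrite -mulr_suml -[leRHS]mul1r; apply: ler_wpM2r => //.
rewrite -natr_sum lern1.
have -> : (\sum_(i <- s) (cellnum x == i) = count_mem (cellnum x) s)%N.
  by rewrite -sum1_count [RHS]big_mkcond; apply: eq_bigr => i _ /=; rewrite eq_sym; case: eqP.
by rewrite count_uniq_mem// leq_b1.
Qed.

Definition average (U : R -> R) (i : int) := Dx^-1 * \int[leb]_(x in cell Dx i%:~R) U x.

Lemma bsum_average (U : R -> R) : LI setT U -> bsum (average U) ((\int[leb]_x `|U x|) / Dx).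
Proof.
move=> LU; have D0 : 0 <= Dx^-1 by rewrite invr_ge0 ltW.
rewrite mulrC; apply: bsum_le (bsumZ D0 (bsum_cell_int LU)) => i.
by rewrite /average normrM (ger0_norm D0) [leRHS]ger0_norm// mulr_ge0.
Qed.

Variables (U : R -> R) (V : R).
Hypotheses (LU : LI setT U) (V0 : 0 <= V)
  (tr : forall h, 0 < h -> \int[leb]_x `|U (x + h) - U x| <= h * V).

(** The difference of neighbouring averages is the average of U(x + Dx) - U(x) over one cell, so the
    translation estimate with h = Dx applies. *)
Lemma average_variation : bsum (fun i => average U (i + 1) - average U i) V.
Proof.
have LUh := L1_shift Dx LU; have Ld : LI setT (fun x => U (x + Dx) - U x) by exact: LIB.
have D0 : 0 <= Dx^-1 by rewrite invr_ge0 ltW.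
have E i : average U (i + 1) - average U i = Dx^-1 * \int[leb]_(x in cell Dx i%:~R) (U (x + Dx) - U x).
  rewrite /average -mulrBr !cell_int; congr (_ * _).
  rewrite -(int_shift Dx (cellind_LI (i + 1) LU)) -LI_intB//; [|exact: L1_shift (cellind_LI _ _)|exact: cellind_LI].
  apply: eq_Rintegral => x _; rewrite cellnum_shift (inj_eq (addIr _)) mulrBr//.
apply: (bsumW _ (bsum_le _ (bsumZ D0 (bsum_cell_int Ld)))).
  by rewrite mulrC ler_pdivrMr// mulrC; exact: tr.
by move=> i; rewrite E normrM (ger0_norm D0) [leRHS]ger0_norm// mulr_ge0.
Qed.

Lemma translation_abs h : \int[leb]_x `|U (x + h) - U x| <= `|h| * V.
Proof.
have [h0|h0|->] := ltgtP h 0.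
- have Ld : LI setT (fun x => `|U (x - h) - U x|) by apply: LI_abs; apply: LIB => //; exact: L1_shift.
  rewrite ltr0_norm//; apply: le_trans (tr (h := - h) _); last by rewrite oppr_gt0.
  rewrite -(int_shift h Ld) le_eqVlt; apply/orP; left; apply/eqP; apply: eq_Rintegral => x _.
  by rewrite addrK distrC.
- by rewrite gtr0_norm//; exact: tr.
- rewrite normr0 mul0r (_ : \int[leb]_x _ = \int[leb]_x (cst 0 x : R)); last first.
    by apply: eq_Rintegral => x _; rewrite addr0 subrr normr0.
  by rewrite Rintegral_cst// mul0r.
Qed.

(** Points of one cell are at most Dx apart, so the error at x is at most Dx^-1 times the integral
    of |U(x + h) - U(x)| over |h| <= Dx. After exchanging the integrals, each h costs at most Dx V,
    over a length 2 Dx. *)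
Lemma average_error : \int[leb]_x `|U x - recon Dx (average U) x| <= 2 * Dx * V.
Proof.
have mU := LI_meas LU.
have La : LI setT (recon Dx (average U)) by case: (recon_LI Dx0 (bsum_average LU)).
have Lg : LI setT (fun x => `|U x - recon Dx (average U) x|) by apply: LI_abs; exact: LIB.
pose S : set R := `[- Dx, Dx]%classic.
pose J : R -> R := \1_S.
have DD : - Dx <= Dx by have := Dx0; lra.
have [LJ IJ] := int_itv_indic 0 DD.
have mJ : measurable_fun setT J := LI_meas LJ.
have J0 h : 0 <= J h by rewrite /J indicE ler0n.
pose F (z : R * R) : R := J z.2 * `|U (z.1 + z.2) - U z.1|.
have mF : measurable_fun setT F.
  apply: measurable_funM; first by apply: (measurableT_comp mJ); exact: measurable_snd.
  apply: measurableT_comp => //; apply: measurable_funB.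
    apply: (measurableT_comp mU); apply: measurable_funD; [exact: measurable_fst|exact: measurable_snd].
  by apply: (measurableT_comp mU); exact: measurable_fst.
have F0 z : 0 <= F z by rewrite mulr_ge0.
have LUh h : LI setT (fun x => `|U (x + h) - U x|) by apply: LI_abs; apply: LIB => //; exact: L1_shift.
have LFx x : LI setT (fun h => F (x, h)).
  have Lx : LI setT (fun h => `|U (x + h)| + `|U x| * J h).
    apply: LID => //; last exact: LIZ.
    apply: LI_abs; apply: (LI_eq (f := fun h => U (h + x))) => //; first by move=> h _; rewrite addrC.
    exact: L1_shift.
  apply: (LI_le measurableT (g := fun h => `|U (x + h)| + `|U x| * J h)) => //.
    have mUx : measurable_fun setT (fun h => U (x + h)).
      by have := measurable_shift x mU; under eq_fun do rewrite addrC.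
    apply: measurable_funM => //; apply: measurableT_comp => //; apply: measurable_funB; first exact: mUx.
    by rewrite /=; exact: measurable_cst.
  move=> h _; rewrite /F ger0_norm; last exact: F0.
  rewrite /= /J indicE; case: (h \in S); rewrite ?mul1r ?mulr1 ?ler_normB// mul0r addr_ge0// mulr_ge0//.
have pw x : `|U x - recon Dx (average U) x| <= Dx^-1 * \int[leb]_h F (x, h).
  pose j := cellnum x.
  have Lj : LI setT (fun y => (cellnum y == j)%:R * U y) by exact: cellind_LI.
  have sub y : cellnum y = j -> J (y - x) = 1.
    move=> yj; have /cellP := yj; have /cellP : cellnum x = j by [].
    rewrite /cell /= !in_itv/= => /andP[x1 x2] /andP[y1 y2].
    have e : (j%:~R + 2^-1) * Dx - (j%:~R - 2^-1) * Dx = Dx by field.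
    by rewrite /J indicE mem_set// /S /= in_itv/=; apply/andP; split; lra.
  have Lone : LI setT (fun y => (cellnum y == j)%:R : R).
    have L1 : LI setT (fun y => J (y - x)).
      by apply: (@L1_shift _ J (- x)).
    apply: (LI_le measurableT (g := fun y => J (y - x))) => //.
      exact: (measurable_recon Dx (fun i => (i == j)%:R)).
    by move=> y _; case: eqP => [/sub ->|_]; rewrite ?normr1 ?normr0.
  have Ione : \int[leb]_y ((cellnum y == j)%:R : R) = Dx.
    have := cell_int (cst 1) j; rewrite Rintegral_cst; last exact: measurable_cell.
    rewrite mul1r => e.
    have -> : \int[leb]_y ((cellnum y == j)%:R : R) = \int[leb]_y ((cellnum y == j)%:R * cst 1 y).
      by apply: eq_Rintegral => y _; rewrite mulr1.
    rewrite -e /cell /= lebesgue_measure_itv/= lte_fin.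
    have e' : (j%:~R + 2^-1) * Dx - (j%:~R - 2^-1) * Dx = Dx by field.
    by case: ltP => /=; [|move=> h; exfalso; have := Dx0]; lra.
  have LUx : LI setT (fun y => U x * (cellnum y == j)%:R) by exact: LIZ.
  have LF' : LI setT (fun y => F (x, y - x)) by exact: (@L1_shift _ (fun h => F (x, h)) (- x)).
  have -> : U x - recon Dx (average U) x = Dx^-1 * \int[leb]_y (U x * (cellnum y == j)%:R - (cellnum y == j)%:R * U y).
    rewrite LI_intB// LI_intZ// Ione mulrBr mulrC mulfK ?gt_eqF//.
    by rewrite /recon -/(cellnum x) -/j /average cell_int.
  have D0 : 0 <= Dx^-1 by rewrite invr_ge0 ltW.
  rewrite normrM (ger0_norm D0) ler_wpM2l//.
  rewrite -(int_shift (- x) (LFx x)); apply: LI_int_absle => //; first exact: LIB.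
  move=> y _; rewrite [U x * _]mulrC -mulrBr normrM normr_nat /F/=.
  rewrite addrCA subrr addr0 distrC; apply: ler_wpM2r => //.
  by case: eqP => [/sub ->|_].
have D0 : 0 <= Dx^-1 by rewrite invr_ge0 ltW.
have mFE : measurable_fun setT (EFin \o F) by apply/measurable_EFinP.
have F0E z : (0 <= (EFin \o F) z)%E by rewrite /= lee_fin.
have mFF := @measurable_fun_fubini_tonelli_F _ _ _ _ _ leb (EFin \o F) mFE F0E.
have mFG := @measurable_fun_fubini_tonelli_G _ _ _ _ _ leb (EFin \o F) mFE F0E.
have inner h : (\int[leb]_x (F (x, h))%:E <= (Dx * V * J h)%:E)%E.
  have LFh : LI setT (fun x : R => F (x, h)) by exact: (LIZ (J h) measurableT (LUh h)).
  have Eh : \int[leb]_x F (x, h) = J h * \int[leb]_x `|U (x + h) - U x| by rewrite -LI_intZ.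
  rewrite -EFin_intI// lee_fin Eh mulrC; have [hS|hS] := boolP (h \in S).
    have J1 : J h = 1 by rewrite /J indicE hS.
    rewrite J1 !mulr1; apply: le_trans (translation_abs h) _; rewrite ler_wpM2r//.
    by move: hS; rewrite inE /S/= in_itv/= -ler_norml.
  by have -> : J h = 0 by [rewrite /J indicE (negbTE hS)]; rewrite !mulr0.
rewrite -lee_fin EFin_intI//.
apply: (@le_trans _ _ (\int[leb]_x ((Dx^-1)%:E * \int[leb]_h (F (x, h))%:E))%E).
  apply: ge0_le_integral.
  - exact: measurableT.
  - by move=> x _; rewrite lee_fin.
  - by apply/measurable_EFinP; exact: (LI_meas Lg).
  - by apply: measurable_funeM; exact: mFF.
  - by move=> x _; rewrite -EFin_intI// -EFinM lee_fin.
have EZ : (\int[leb]_x ((Dx^-1)%:E * \int[leb]_h (F (x, h))%:E) = (Dx^-1)%:E * \int[leb]_x \int[leb]_h (F (x, h))%:E)%E.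
  apply: ge0_integralZl => //.
  by move=> x _; apply: integral_ge0 => h _; rewrite lee_fin.
rewrite EZ.
rewrite (@fubini_tonelli _ _ _ _ _ leb leb (EFin \o F) mFE F0E).
have -> : 2 * Dx * V = Dx^-1 * (Dx * V * (2 * Dx)) by field; rewrite gt_eqF.
rewrite [X in (_ <= X)%E]EFinM; apply: lee_wpmul2l; first by rewrite lee_fin.
apply: (@le_trans _ _ (\int[leb]_h (Dx * V * J h)%:E)%E).
  apply: ge0_le_integral.
  - exact: measurableT.
  - by move=> h _; apply: integral_ge0 => x _; rewrite lee_fin.
  - exact: mFG.
  - by apply/measurable_EFinP; exact: measurable_funM.
  - by move=> h _; exact: inner.
rewrite -EFin_intI//; last exact: LIZ.
rewrite lee_fin LI_intZ// ler_wpM2l ?mulr_ge0 ?(ltW Dx0)//.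
by rewrite IJ; have := Dx0; lra.
Qed.

End CellAverages.

(** * The discrete memory *)

Section DiscreteConvolution.
Context {R : realType}.
Local Notation leb := (@lebesgue_measure R).

Lemma zsumS I (a : int -> R) : zsum I.+1 a = a (Negz I) + zsum I a + a (Posz I).
Proof.
rewrite /zsum addSn addnS big_ord_recl big_ord_recr/= -!addrA; congr (_ + (_ + _)).
- by congr a; rewrite sub0r NegzE.
- by apply: eq_bigr => n _; congr a; rewrite /bump/= add1n -[n.+1]addn1 -[I.+1]addn1 !PoszD opprD addrACA subrr addr0.
- by congr a; rewrite /bump/= add1n -[(I + I).+1]addn1 -[I.+1]addn1 !PoszD opprD addrACA subrr addr0 addrK.
Qed.

Lemma sumZ_lim (a : int -> R) (l : R) : zsum I a @[I --> \oo] --> l -> sumZ a = l.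
Proof.
move=> al; rewrite /sumZ.
have -> : (fun M => \sum_(0 <= m < M) (a (Posz m) + a (Negz m))) = (fun I => zsum I a).
  apply/funext; elim=> [|I IH]; first by rewrite big_nil /zsum big_ord0.
  by rewrite big_nat_recr//= IH zsumS; ring.
exact: cvg_lim.
Qed.

Variables (Dx : R) (Dx0 : 0 < Dx).

(** The reflection y -> q Dx - y exchanges the cells of centres p and q - p, except that it moves
    the closed end to the other side; hence the passage to closed intervals. *)
Lemma kernel_cell_integral (mu : R -> R) (q : R) (p : int) : continuous mu ->
  \int[leb]_(y in cell Dx (q - p%:~R)) mu y = \int[leb]_(y in cell Dx p%:~R) mu (q * Dx - y).
Proof.
move=> cm.
pose a := (p%:~R - 2^-1) * Dx; pose b := (p%:~R + 2^-1) * Dx; pose s := q * Dx.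
have ab : a <= b by rewrite ler_pM2r// lerD2l; lra.
have cr : continuous (fun z => mu (s + z)).
  move=> z; apply: (@continuous_comp _ _ _ (fun y => s + y) mu); last exact: cm.
  by apply: cvgD; [exact: cvg_cst|exact: cvg_id].
have crn : continuous (fun z => mu (s - z)).
  move=> z; apply: (@continuous_comp _ _ _ (fun y => s - y) mu); last exact: cm.
  by apply: cvgB; [exact: cvg_cst|exact: cvg_id].
have Lseg (h : R -> R) (u v : R) : continuous h -> LI `[u, v] h.
  by move=> ch; apply: continuous_compact_integrable; [exact: segment_compact|exact: continuous_subspaceT].
have sub (u v : R) : (`[u, v[%classic : set R) `<=` `[u, v].
  by move=> x; rewrite /= !in_itv/= => /andP[-> /ltW ->].
have half (h : R -> R) (u v : R) : continuous h -> \int[leb]_(y in `[u, v[) h y = \int[leb]_(y in `[u, v]) h y.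
  by move=> ch; apply: Rintegral_itv_bndo_bndc; apply: (LI_subset _ _ (sub u v)) => //; exact: Lseg.
rewrite /cell !half// -/a -/b -/s.
have -> : \int[leb]_(y in `[a, b]) mu (s - y) = \int[leb]_(z in `[- b, - a]) mu (s + z).
  by rewrite /Rintegral (integration_by_substitution_oppr ab (continuous_subspaceT cr)).
have -> : (q - p%:~R - 2^-1) * Dx = s - b by rewrite /s /b; ring.
have -> : (q - p%:~R + 2^-1) * Dx = s - a by rewrite /s /a; ring.
rewrite Rintegral_mkcond [RHS]Rintegral_mkcond.
have L1 : LI setT (mu \_ `[s - b, s - a]).
  have := @integrable_mkcond _ _ R leb `[s - b, s - a]%classic (EFin \o mu) (measurable_itv _).
  by rewrite restrict_EFin => -[H _]; apply/H/Lseg.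
rewrite -(int_shift s L1); apply: eq_Rintegral => z _; rewrite !patchE [z + s]addrC.
have -> : (s + z \in `[s - b, s - a]%classic) = (z \in `[- b, - a]%classic) => //.
by apply/idP/idP => /set_mem zI; apply/mem_set; move: zI; rewrite /= !in_itv/= !lerD2l.
Qed.

(** The partial sums are integrals of the integrand truncated to the cells of the window; dominated
    convergence with C |recon a| as majorant. *)
Lemma zsum_recon_cvg (a : int -> R) (m : R -> R) K C : bsum a K -> continuous m -> (forall y, `|m y| <= C) ->
  zsum I (fun p => a p * \int[leb]_(y in cell Dx p%:~R) m y) @[I --> \oo] --> \int[leb]_y (recon Dx a y * m y).
Proof.
move=> aK cm mC; have [Lr _] := recon_LI Dx0 aK.
have mm : measurable_fun setT m by exact: cts_measurable.
have mi p : measurable_fun setT (fun y : R => (cellnum Dx y == p)%:R : R).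
  exact: (measurable_recon Dx (fun j => (j == p)%:R)).
have Lr1 p : LI setT (fun y => (cellnum Dx y == p)%:R : R).
  have b1 : bsum (fun j : int => (j == p)%:R : R) 1.
    move=> s us; apply: le_trans (_ : \sum_(i <- s) (i == p)%:R <= _).
      by apply: ler_sum => i _; rewrite normr_nat.
    rewrite -natr_sum lern1; have -> : (\sum_(i <- s) (i == p) = count_mem p s)%N.
      by rewrite -sum1_count [RHS]big_mkcond; apply: eq_bigr => i _ /=; case: eqP.
    by rewrite count_uniq_mem// leq_b1.
  by case: (recon_LI Dx0 b1).
pose h I y := zsum I (fun p => a p * ((cellnum Dx y == p)%:R * m y)).
have Lm p : LI setT (fun y => (cellnum Dx y == p)%:R * m y).
  apply: (LI_eq (f := fun y => m y * (cellnum Dx y == p)%:R)) => //; first by move=> y _; rewrite mulrC.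
  exact: (LI_bM (C := C)).
have Lp p : LI setT (fun y => a p * ((cellnum Dx y == p)%:R * m y)) by exact: LIZ.
have E : (fun I => zsum I (fun p => a p * \int[leb]_(y in cell Dx p%:~R) m y)) = (fun I => \int[leb]_y h I y).
  apply/funext => I; rewrite /h (@zsum_int _ I (fun p y => a p * ((cellnum Dx y == p)%:R * m y)) Lp).
  by apply: eq_zsum => p; rewrite cell_int// LI_intZ.
have hE I y : h I y = if (- Posz I <= cellnum Dx y < Posz I) then recon Dx a y * m y else 0.
  rewrite /h; case: ifPn => yI.
    rewrite (@zsum1 _ I (cellnum Dx y))//; first by rewrite eqxx mul1r.
    by move=> j; rewrite eq_sym => /negbTE ->; rewrite mul0r mulr0.
  rewrite /zsum big1// => n _; case: eqP => [ye|_]; last by rewrite mul0r mulr0.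
  exfalso; move/negP: yI; apply; rewrite ye.
  by rewrite lerBrDr addNr lez_nat leq0n/= ltrBlDr -PoszD ltz_nat ltn_ord.
rewrite E; apply: (LI_dct (g := fun y => C * `|recon Dx a y|)) => //.
- by move=> I; apply: measurable_sum => n; exact: (LI_meas (Lp _)).
- by apply: measurable_funM => //; exact: measurable_recon.
- move=> y _; apply: cvg_near_cst; near=> I; rewrite hE ifT//.
  have : (absz (cellnum Dx y) < I)%N by near: I; exact: nbhs_infty_gt.
  by rewrite -ltz_nat abszE ltr_norml => /andP[/ltW -> ->].
- by apply: LIZ => //; exact: LI_abs.
- move=> I y _; rewrite hE; case: ifP => _; first by rewrite normrM mulrC ler_wpM2r.
  by rewrite normr0 mulr_ge0//; exact: le_trans (mC 0).
Unshelve. all: by end_near. Qed.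

End DiscreteConvolution.

Section MemoryWeights.
Context {R : realType}.
Local Notation leb := (@lebesgue_measure R).

(* The weights of the discrete memory are increments of the distribution function P
   of the rescaled kernel. *)
Lemma memory_weights (G : R -> R) (delta : R) : 0 < delta -> C2_halfline G ->
  (forall t, 0 <= t -> 0 <= G t) ->
  closure [set t | 0 <= t /\ G t != 0] `<=` `[0, 1] ->
  (\int[leb]_(t in `[0%R, +oo[) (G t)%:E = 1)%E ->
  exists P : R -> R, [/\ {homo P : s t / s <= t}, P 0 = 0, forall s, P s <= 1,
    forall s, delta < s -> P s = 1 &
    forall Dt l, 0 < Dt -> Dt * (Dt^-1 * \int[leb]_(t in tcell Dt l) rescale delta G t) =
       P (l.+1%:R * Dt) - P (l%:R * Dt)].
Proof.
move=> d0 [cG _ _ _] G0 Gs G1.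
pose Z : set R := `[0, +oo[%classic.
have mZ : measurable Z by exact: measurable_itv.
have mG : measurable_fun Z G by apply: subspace_continuous_measurable_fun.
pose g := G \_ Z.
have mg : measurable_fun setT g by apply/(measurable_restrictT _ mZ).
have g0 t : 0 <= g t.
  by rewrite /g patchE; case: ifPn => // tZ; apply: G0; move: tZ; rewrite inE /Z/= in_itv/= andbT.
have g1 : (\int[leb]_t (g t)%:E = 1)%E.
  rewrite -G1 [RHS]integral_mkcond; apply: eq_integral => t _.
  by rewrite /g !patchE; case: ifP.
have gneg t : t < 0 -> g t = 0.
  by move=> t0; rewrite /g patchE ifF//; apply/negP; rewrite inE /Z/= in_itv/= andbT leNgt t0.
have gbig t : 1 < t -> g t = 0.
  move=> t1; rewrite /g patchE; case: ifPn => // tZ; apply/eqP; apply: contraTT t1 => Gt.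
  have : [set` `[0, 1]] t.
    by apply: Gs; apply: subset_closure; split => //; move: tZ; rewrite inE /Z/= in_itv/= andbT.
  by rewrite /= in_itv/= -leNgt => /andP[].
pose gd t := delta^-1 * g (delta^-1 * t + 0).
have di : 0 < delta^-1 by rewrite invr_gt0.
have gd0 t : 0 <= gd t by rewrite mulr_ge0// ltW.
have mgd : measurable_fun setT gd.
  apply: measurable_funM => //; apply: (measurableT_comp mg); apply: measurable_funD => //.
have gdI : (\int[leb]_t (gd t)%:E = 1)%E.
  rewrite /gd; under eq_integral do rewrite EFinM.
  rewrite ge0_integralZl//; last 3 first.
  - by apply/measurable_EFinP; apply: (measurableT_comp mg); apply: measurable_funD.
  - by move=> t _; rewrite lee_fin.
  - by rewrite lee_fin ltW.
  rewrite (@ge0_integral_affine R (EFin \o g) delta^-1 0 di).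
  - by rewrite g1 mule1 -EFinM invrK mulVf// gt_eqF.
  - exact/measurable_EFinP.
  - by move=> x; rewrite /= lee_fin.
have Lgd : LI setT gd.
  have gd1 : (\int[leb]_t (gd t)%:E <= 1%:E)%E by rewrite gdI.
  by case: (LI_ge0 measurableT mgd (fun x _ => gd0 x) gd1).
have Igd : \int[leb]_t gd t = 1 by apply: EFin_inj; rewrite EFin_intI.
have gdneg t : t < 0 -> gd t = 0.
  by move=> t0; rewrite /gd addr0 gneg ?mulr0// pmulr_rlt0.
have gdbig t : delta < t -> gd t = 0.
  by move=> t0; rewrite /gd addr0 gbig ?mulr0// mulrC ltr_pdivlMr// mul1r.
have gdE t : 0 <= t -> gd t = rescale delta G t.
  move=> t0; rewrite /gd /rescale addr0 mulrC [delta^-1 * t]mulrC mulrC /g patchE mem_set//.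
  by rewrite /Z/= in_itv/= andbT divr_ge0// ltW.
have mlt (s : R) : measurable_fun setT (fun t : R => ((t < s)%R)%:R : R).
  have -> : (fun t : R => ((t < s)%R)%:R) = (\1_(`]-oo, s[%classic) : R -> R).
    apply/funext => t; rewrite indicE; congr (_%:R); congr nat_of_bool.
    by apply/idP/idP => [h|/set_mem]; [apply/mem_set|]; rewrite /= in_itv.
  exact: measurable_indic.
have Ls s : LI setT (fun t => ((t < s)%R)%:R * gd t).
  by apply: (LI_bM (C := 1)) => // t _; rewrite normr_nat lern1 leq_b1.
exists (fun s => \int[leb]_t (((t < s)%R)%:R * gd t)); split.
- move=> s t st; apply: LI_int_le => // x _; apply: ler_wpM2r => //.
  by rewrite ler_nat; case: (ltP x s) => // xs; rewrite (lt_le_trans xs st).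
- rewrite (_ : \int[leb]_t _ = \int[leb]_t (cst 0 t : R)); first by rewrite Rintegral_cst// mul0r.
  by apply: eq_Rintegral => t _; case: ltP => [/gdneg ->|_]; rewrite ?mulr0 ?mul0r.
- move=> s; rewrite -[leRHS]Igd; apply: LI_int_le => // x _.
  by rewrite ler_piMl// lern1 leq_b1.
- move=> s ds; rewrite -[RHS]Igd; apply: eq_Rintegral => t _.
  by case: ltP => [_|/(lt_le_trans ds)/gdbig ->]; rewrite ?mul1r ?mulr0.
- move=> Dt l Dt0; rewrite mulrA divff ?gt_eqF// mul1r -LI_intB//.
  rewrite Rintegral_mkcond; apply: eq_Rintegral => t _; rewrite patchE -mulrBl.
  have ll : l%:R * Dt <= l.+1%:R * Dt by rewrite ler_pM2r// ler_nat.
  case: ifPn => tl.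
    move: tl; rewrite inE /tcell /= in_itv/= => /andP[t1 t2].
    rewrite t2 ltNge t1 subr0 mul1r gdE//.
    by apply: le_trans t1; rewrite mulr_ge0// ltW.
  have [t1|t1] := ltP t (l%:R * Dt).
    by rewrite (lt_le_trans t1 ll) subrr mul0r.
  have [t2|t2] := ltP t (l.+1%:R * Dt); last by rewrite subrr mul0r.
  by exfalso; move/negP: tl; apply; rewrite inE /tcell /= in_itv/= t1.
Qed.

End MemoryWeights.

Section MemoryAverage.
Context {R : realType}.
Local Notation leb := (@lebesgue_measure R).
Variables (Dx Dt delta : R) (Dx0 : 0 < Dx) (Dt0 : 0 < Dt).

(** What the estimates retain of the temporal kernel: nonnegative weights on time lags, of total
    mass at most 1, of mass exactly 1 once the available past exceeds delta, and carried by lags of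
    at most delta. *)
Definition memory_weight (w : nat -> R) := [/\ forall l, 0 <= w l,
  forall n, \sum_(l < n) w l <= 1, forall n, delta < n%:R * Dt -> \sum_(l < n) w l = 1 &
  forall l, w l != 0 -> l%:R * Dt <= delta].

Lemma memory_weightP (G : R -> R) : 0 < delta -> C2_halfline G -> (forall t, 0 <= t -> 0 <= G t) ->
  closure [set t | 0 <= t /\ G t != 0] `<=` `[0, 1] ->
  (\int[leb]_(t in `[0%R, +oo[) (G t)%:E = 1)%E ->
  memory_weight (fun l => Dt * (Dt^-1 * \int[leb]_(t in tcell Dt l) rescale delta G t)).
Proof.
move=> d0 cG G0 Gs G1; have [P [Ph P0 P1 Pd PE]] := memory_weights d0 cG G0 Gs G1.
have E n : \sum_(l < n) (Dt * (Dt^-1 * \int[leb]_(t in tcell Dt l) rescale delta G t)) = P (n%:R * Dt).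
  under eq_bigr do rewrite PE//.
  elim: n => [|n IH]; first by rewrite big_ord0 mul0r P0.
  by rewrite big_ord_recr/= IH addrC subrK.
split=> [l|n|n dn|l]; rewrite ?E ?PE//; last 2 first.
- exact: Pd.
- apply: contraNT; rewrite -ltNge => dl; rewrite !Pd ?subrr//.
  by apply: lt_le_trans dl _; rewrite ler_pM2r// ler_nat.
by rewrite subr_ge0; apply: Ph; rewrite ler_pM2r// ler_nat.
Qed.

Variables (w : nat -> R) (v : nat -> int -> R) (n : nat) (K : R).
Hypotheses (wP : memory_weight w) (vK : forall m, (m <= n)%N -> bsum (v m) K).

Definition memory (y : R) := \sum_(m < n.+1) w (n - m) * recon Dx (v m) y.

Let vLI (m : 'I_n.+1) : LI setT (recon Dx (v m)) /\ \int[leb]_x `|recon Dx (v m) x| <= Dx * K.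
Proof. by apply: recon_LI => //; apply: vK; rewrite -ltnS. Qed.

Let w0 l : 0 <= w l. Proof. by case: wP. Qed.

Let Lterm (m : 'I_n.+1) : LI setT (fun y => w (n - m) * recon Dx (v m) y).
Proof. by apply: LIZ => //; case: (vLI m). Qed.

Let K0 : 0 <= K. Proof. by have := vK (leq0n n); exact: bsum_ge0. Qed.

Lemma sum_weights : \sum_(m < n.+1) w (n - m) = \sum_(l < n.+1) w l.
Proof.
rewrite (reindex_inj rev_ord_inj)/=; apply: eq_bigr => i _.
by rewrite subSS subKn// -ltnS.
Qed.

Lemma memory_LI : LI setT memory /\ \int[leb]_y `|memory y| <= Dx * K.
Proof.
have LM : LI setT memory by apply: LI_sum => // m; exact: Lterm.
split => //.
have La (m : 'I_n.+1) : LI setT (fun y => w (n - m) * `|recon Dx (v m) y|).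
  by apply: LIZ => //; apply: LI_abs; case: (vLI m).
apply: le_trans (_ : \int[leb]_y \sum_(m < n.+1) w (n - m) * `|recon Dx (v m) y| <= _).
  apply: LI_int_le => //; [exact: LI_abs|by apply: LI_sum|].
  move=> y _; apply: le_trans (ler_norm_sum _ _ _) _; apply: ler_sum => m _.
  by rewrite normrM (ger0_norm (w0 _)).
rewrite LI_int_sum//; apply: le_trans (_ : \sum_(m < n.+1) w (n - m) * (Dx * K) <= _).
  apply: ler_sum => m _; have [Lm Im] := vLI m.
  by rewrite LI_intZ//; [exact: ler_wpM2l|exact: LI_abs].
rewrite -mulr_suml sum_weights -[leRHS]mul1r ler_wpM2r//; first by rewrite mulr_ge0// ltW.
by case: wP.
Qed.

(** With s the sum of the available weights, the difference is -(1 - s) v^n minus the weighted sum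
    of v^n - v^m. The missing mass 1 - s is nonzero only while the past is no longer than delta, and
    weights vanish on lags beyond delta. *)
Lemma memory_lag Ct : 0 <= Ct -> 0 <= delta ->
  (forall m, (m <= n)%N -> bsum (fun i => v n i - v m i) ((n - m)%:R * Ct)) ->
  \int[leb]_y `|memory y - recon Dx (v n) y| <=
    (nat_of_bool ((n.+1%:R * Dt <= delta)%R))%:R * (Dx * K) + Dx * (delta / Dt * Ct).
Proof.
move=> Ct0 d0 vlag; have [Ln In] := vLI ord_max; have [LM _] := memory_LI.
have Llag (m : 'I_n.+1) : LI setT (fun y => recon Dx (v n) y - recon Dx (v m) y) /\
    \int[leb]_y `|recon Dx (v n) y - recon Dx (v m) y| <= Dx * ((n - m)%:R * Ct).
  have E : (fun y => recon Dx (v n) y - recon Dx (v m) y) = recon Dx (fun i => v n i - v m i).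
    by apply/funext => y; rewrite recon_sub.
  have mn : (m <= n)%N by rewrite -ltnS.
  have := recon_LI Dx0 (vlag m mn); rewrite -E => -[L I]; split; [exact: L|exact: I].
pose s := \sum_(l < n.+1) w l.
have s1 : s <= 1 by case: wP => _ h _ _; exact: h.
have La (m : 'I_n.+1) : LI setT (fun y => w (n - m) * `|recon Dx (v n) y - recon Dx (v m) y|).
  by apply: LIZ => //; apply: LI_abs; case: (Llag m).
have Ls : LI setT (fun y => (1 - s) * `|recon Dx (v n) y|) by apply: LIZ => //; exact: LI_abs.
apply: le_trans (_ : \int[leb]_y ((1 - s) * `|recon Dx (v n) y| +
    \sum_(m < n.+1) w (n - m) * `|recon Dx (v n) y - recon Dx (v m) y|) <= _).
  apply: LI_int_le => //; first by apply: LI_abs; exact: LIB.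
    by apply: LID => //; apply: LI_sum.
  move=> y _; have -> : memory y - recon Dx (v n) y = - ((1 - s) * recon Dx (v n) y) -
      \sum_(m < n.+1) w (n - m) * (recon Dx (v n) y - recon Dx (v m) y).
    under [in RHS]eq_bigr do rewrite mulrBr.
    by rewrite sumrB -mulr_suml sum_weights -/s -/(memory y); ring.
  apply: le_trans (ler_normB _ _) _; rewrite normrN normrM ger0_norm ?subr_ge0// lerD2l.
  apply: le_trans (ler_norm_sum _ _ _) _; apply: ler_sum => m _.
  by rewrite normrM (ger0_norm (w0 _)).
rewrite LI_intD//; last by apply: LI_sum.
rewrite LI_intZ//; last exact: LI_abs.
apply: lerD.
  have DK : 0 <= Dx * K by rewrite mulr_ge0// ltW.
  apply: le_trans (_ : (1 - s) * (Dx * K) <= _); first by rewrite ler_wpM2l// subr_ge0.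
  have [h|h] := leP (n.+1%:R * Dt) delta; rewrite ?mul1r ?mul0r.
    rewrite ler_piMl// lerBlDr lerDl; apply: sumr_ge0 => l _; exact: w0.
  by case: wP => _ _ /(_ _ h) + _; rewrite -/s => ->; rewrite subrr mul0r.
rewrite LI_int_sum//; apply: le_trans (_ : \sum_(m < n.+1) w (n - m) * (Dx * (delta / Dt * Ct)) <= _).
  apply: ler_sum => m _; have [Lm Im] := Llag m; rewrite LI_intZ//; last exact: LI_abs.
  have [->|wm] := eqVneq (w (n - m)) 0; first by rewrite !mul0r.
  rewrite ler_wpM2l//; apply: le_trans Im _; rewrite ler_pM2l//; apply: ler_wpM2r => //.
  by rewrite ler_pdivlMr//; case: wP => _ _ _; exact.
rewrite -mulr_suml sum_weights -[leRHS]mul1r ler_wpM2r//.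
have dx0 := ltW Dx0; have dt0 := ltW Dt0.
by do ?[apply: divr_ge0|apply: mulr_ge0].
Qed.

End MemoryAverage.

Section SchemeVelocity.
Context {R : realType} (N : nat).
Local Notation leb := (@lebesgue_measure R).
Variables (mu G : 'I_N -> 'I_N -> R -> R) (Dx Dt K C : R).
Hypotheses (Dx0 : 0 < Dx) (muc : forall j k, continuous (mu j k)) (muC : forall j k x, `|mu j k x| <= C).

Definition fv_memory (V : 'I_N -> nat -> int -> R) k n j :=
  memory Dx (fun l => Dt * Gam_avg G Dt j k l) (V j) n.

(* The discrete space-time convolution is the exact space convolution of a
   time average of piecewise constant reconstructions. *)
Lemma fv_convE (V : 'I_N -> nat -> int -> R) k n q : (forall j m, (m <= n)%N -> bsum (V j m) K) ->
  fv_conv mu G Dx Dt V k n q = convs (fun j => mu j k) (fv_memory V k n) (q * Dx).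
Proof.
move=> VK; apply/rowP => j; rewrite !mxE /conv.
have cm : continuous (fun y => mu j k (q * Dx - y)).
  move=> y; apply: (@continuous_comp _ _ _ (fun y => q * Dx - y) (mu j k)); last exact: muc.
  by apply: cvgB; [exact: cvg_cst|exact: cvg_id].
have VKm (m : 'I_n.+1) : bsum (V j m) K by apply: VK; rewrite -ltnS.
have Lm (m : 'I_n.+1) : LI setT (fun y => recon Dx (V j m) y * mu j k (q * Dx - y)).
  by apply: (conv_LI (C := C)) => //; case: (recon_LI Dx0 (VKm m)).
under eq_Rintegral do rewrite /fv_memory /memory mulr_suml.
have -> : \int[leb]_x \sum_(i < n.+1) Dt * Gam_avg G Dt j k (n - i) * recon Dx (V j i) x * mu j k (q * Dx - x) =
  \sum_(i < n.+1) Dt * Gam_avg G Dt j k (n - i) * \int[leb]_y (recon Dx (V j i) y * mu j k (q * Dx - y)).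
  under eq_Rintegral do under eq_bigr do rewrite -mulrA.
  rewrite LI_int_sum//; first by apply: eq_bigr => i _; rewrite LI_intZ.
  by move=> i; exact: LIZ.
rewrite mulr_sumr; apply: eq_bigr => m _.
rewrite (@sumZ_lim _ _ (Dx^-1 * Gam_avg G Dt j k (n - m) *
   \int[leb]_y (recon Dx (V j m) y * mu j k (q * Dx - y)))).
  by rewrite !mulrA [Dx * Dt]mulrC mulfK ?gt_eqF.
have h := zsum_recon_cvg Dx0 (VKm m) cm (fun y => muC j k (q * Dx - y)).
have -> : (fun I => zsum I (fun p => mu_avg mu Dx j k (q - p%:~R) * Gam_avg G Dt j k (n - m) * V j m p)) =
   (fun I => (Dx^-1 * Gam_avg G Dt j k (n - m)) *
      zsum I (fun p => V j m p * \int[leb]_(y in cell Dx p%:~R) mu j k (q * Dx - y))).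
  apply/funext => I; rewrite -zsumZ; apply: eq_zsum => p.
  by rewrite /mu_avg kernel_cell_integral//; ring.
by apply: cvgM; [exact: cvg_cst|exact: h].
Qed.

End SchemeVelocity.

(** * Error estimate for the scheme *)

Section VelocityEstimates.
Context {R : realType} (N : nat).
Local Notation leb := (@lebesgue_measure R).

Definition L1ball (K : R) (g : 'I_N -> R -> R) := forall j, LI setT (g j) /\ \int[leb]_y `|g j y| <= K.

(** The interface through which velocities enter the error estimate: V is a functional of the
    density, V' its space derivative, and no formula for V' is used beyond these bounds. *)
Definition velocity_bounds (K Lam : R) (V V' : ('I_N -> R -> R) -> R -> R) :=
  [/\ forall g x, `|V g x| <= Lam, forall g, L1ball K g -> c11 (V g) (V' g) Lam &
  forall g h x, L1ball K g -> L1ball K h ->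
    `|V g x - V h x| <= Lam * l1dist g h /\ `|V' g x - V' h x| <= Lam * l1dist g h].

Lemma velocity_estimates (nu : 'I_N -> 'rV[R]_N -> R) (mu : 'I_N -> 'I_N -> R -> R) (K : R) : 0 <= K ->
  (forall k, Ck 2 (nu k) /\ Wkinfty 2 (nu k)) -> (forall j k, Ck 2 (mu j k) /\ Wkinfty 2 (mu j k)) ->
  exists C Lam V', [/\ 0 <= Lam, forall j k, continuous (mu j k), forall j k x, `|mu j k x| <= C &
    forall k, velocity_bounds K Lam (vel (nu k) (fun j => mu j k)) (V' k)].
Proof.
move=> K0 hnu hmu.
have /choice[Cm Hm] : forall jk : 'I_N * 'I_N, exists C, let m := mu jk.1 jk.2 in
    [/\ 0 <= C, forall x, `|m x| <= C, c11 m m^`()%classic C,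
    forall x y, `|m^`()%classic x - m^`()%classic y| <= C * `|x - y| & continuous m^`()%classic].
  by move=> [j k]; have [ck wk] := hmu j k; exact: kernel_c11.
have /choice[Cn Hn] : forall k, exists C, exists d : 'I_N -> 'rV[R]_N -> R, [/\ 0 <= C, forall a, `|nu k a| <= C,
    forall a i, `|d i a| <= C, forall a v, `|nu k (a + v) - nu k a| <= C * l1n v &
    (forall i a v, `|d i (a + v) - d i a| <= C * l1n v) /\
    forall a v, `|nu k (a + v) - nu k a - \sum_i v 0 i * d i a| <= C * l1n v ^+ 2].
  by move=> k; have [ck wk] := hnu k; exact: velocity_function_c11.
have {Hn}/choice[d Hn] := Hn.
have Sm0 : 0 <= \sum_jk Cm jk by apply: sumr_ge0 => jk _; case: (Hm jk).
have Sn0 : 0 <= \sum_k Cn k by apply: sumr_ge0 => k _; case: (Hn k).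
pose C := \sum_jk Cm jk + \sum_k Cn k.
have C0 : 0 <= C by rewrite addr_ge0.
have Cmle j k : Cm (j, k) <= C.
  rewrite /C (bigD1 (j, k))//= -addrA lerDl addr_ge0// sumr_ge0// => i _; by case: (Hm i).
have Cnle k : Cn k <= C.
  by rewrite /C addrC (bigD1 k)//= -addrA lerDl addr_ge0// sumr_ge0// => i _; case: (Hn i).
have l0 (v : 'rV[R]_N) : 0 <= l1n v by apply: sumr_ge0.
have muC j k x : `|mu j k x| <= C by have [_ h _ _ _] := Hm (j, k); exact: le_trans (h x) (Cmle j k).
have mu11 j k : c11 (mu j k) (mu j k)^`()%classic C.
  by have [_ _ h _ _] := Hm (j, k); exact: c11W (Cmle j k) h.
have dmuc j k : continuous (mu j k)^`()%classic by have [_ _ _ _ h] := Hm (j, k).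
have nuC k a : `|nu k a| <= C by have [_ h _ _ _] := Hn k; exact: le_trans (h a) (Cnle k).
have dC k a i : `|d k i a| <= C by have [_ _ h _ _] := Hn k; exact: le_trans (h a i) (Cnle k).
have nuL k a v : `|nu k (a + v) - nu k a| <= C * l1n v.
  by have [_ _ _ h _] := Hn k; apply: le_trans (h a v) _; exact: ler_wpM2r.
have dL k i a v : `|d k i (a + v) - d k i a| <= C * l1n v.
  by have [_ _ _ _ [h _]] := Hn k; apply: le_trans (h i a v) _; exact: ler_wpM2r.
have nuT k a v : `|nu k (a + v) - nu k a - \sum_i v 0 i * d k i a| <= C * l1n v ^+ 2.
  by have [_ _ _ _ [_ h]] := Hn k; apply: le_trans (h a v) _; apply: ler_wpM2r => //; exact: sqr_ge0.
exists C, (vconst N C K), (fun k => dvel (fun j => mu j k) (fun j => (mu j k)^`()%classic) (d k)); split.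
- exact: vconst_ge0.
- by move=> j k; exact: (@mu_cts _ _ (fun j => mu j k) (fun j => (mu j k)^`()%classic) C (fun j => mu11 j k)).
- exact: muC.
- move=> k; split.
  + move=> g x; exact: vel_bound.
  + by move=> g Pg; exact: (vel_c11 C0 (dC k) (nuL k) (nuT k) (fun j => muC j k) (fun j => mu11 j k) (fun j => @dmuc j k) K0 Pg).
  + move=> g h x Pg Ph; exact: (vel_lipschitz C0 (dC k) (nuL k) (dL k) (fun j => muC j k) (fun j => mu11 j k) (fun j => @dmuc j k) K0 x Pg Ph).
Qed.

End VelocityEstimates.

(** * Joint measurability and Gronwall's inequality *)

Section TimeDependence.
Context {R : realType}.
Local Notation leb := (@lebesgue_measure R).

Lemma measurable_slabs (c : R) (F : int -> R -> R) : (forall p, measurable_fun setT (F p)) ->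
  measurable_fun setT (fun z : R * R => F (Num.floor (z.1 * c)) z.2).
Proof.
move=> mF.
have m1 : measurable_fun setT (fun t : R => t * c) by exact: measurable_funM.
have mi (p : int) : measurable_fun setT (fun z : R * R => (Num.floor (z.1 * c) == p)%:R : R).
  exact: (measurableT_comp (measurable_floor_comp (fun i => (i == p)%:R : R) m1) measurable_fst).
have mp (p : int) : measurable_fun setT (fun z : R * R => (Num.floor (z.1 * c) == p)%:R * F p z.2 : R).
  by apply: measurable_funM; [exact: mi|exact: (measurableT_comp (mF p) measurable_snd)].
apply: (@measurable_fun_cvg _ _ R _ (fun I (z : R * R) =>
   zsum I (fun p => (Num.floor (z.1 * c) == p)%:R * F p z.2))).
  by move=> I; apply: measurable_sum => n; exact: mp.
move=> z _; apply: cvg_near_cst; near=> I.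
rewrite (@zsum1 _ I (Num.floor (z.1 * c))) ?eqxx ?mul1r//.
  have : (absz (Num.floor (z.1 * c)) < I)%N by near: I; exact: nbhs_infty_gt.
  by rewrite -ltz_nat abszE ltr_norml => /andP[/ltW -> ->].
by move=> j; rewrite eq_sym => /negbTE ->; rewrite mul0r.
Unshelve. all: by end_near. Qed.

(** Measurable in x and continuous in t: F is the pointwise limit of its samples at the times
    floor(t (n + 1)) / (n + 1), each constant on time slabs. A sample outside ]0, T[ is replaced by
    0, which does not affect the limit because t > 1 / (n + 1) eventually. *)
Lemma measurable_caratheodory (T : R) (F : R -> R -> R) :
  (forall t, 0 < t < T -> measurable_fun setT (F t)) ->
  (forall t x e, 0 < t < T -> 0 < e -> exists2 d, 0 < d &
    forall s, 0 < s < T -> `|s - t| < d -> `|F s x - F t x| < e) ->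
  measurable_fun (QT T) (fun z : R * R => F z.1 z.2).
Proof.
move=> mF cF.
pose r (n : nat) (p : int) := p%:~R / n.+1%:R : R.
pose G n p x := if 0 < r n p < T then F (r n p) x else 0.
have mG n p : measurable_fun setT (G n p).
  by rewrite /G; case E: (_ && _); [exact: mF|exact: measurable_cst].
apply: (@measurable_fun_cvg _ _ R _ (fun n (z : R * R) => G n (Num.floor (z.1 * n.+1%:R)) z.2)).
  by move=> n; apply: measurable_funS (measurable_slabs n.+1%:R (mG n)).
move=> [t x] [/=]; rewrite in_itv/= => tT _; have /andP[t0 t1] := tT.
apply/cvgrPdist_lt => e e0; have [d d0 Hd] := cF t x e tT e0.
have m0 : 0 < Num.min t d by rewrite lt_min t0.
near=> n.
have n0 : 0 < n.+1%:R :> R by [].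
have nd : n.+1%:R^-1 < Num.min t d.
  by near: n; exact: (near_infty_natSinv_lt (PosNum m0)).
have [rt tr] : r n (Num.floor (t * n.+1%:R)) <= t /\ t < r n (Num.floor (t * n.+1%:R)) + n.+1%:R^-1.
  split; first by rewrite /r ler_pdivrMr// floor_le.
  by rewrite /r -{2}[n.+1%:R^-1]mul1r -mulrDl ltr_pdivlMr// -(intrD _ _ 1) floorD1_gt.
set q := r n _ in rt tr *.
move: nd; rewrite lt_min => /andP[nt nd].
move: (n.+1%:R^-1) tr nt nd => h tr nt nd.
have q0 : 0 < q by clear -tr nt; lra.
rewrite /G -/q q0 (le_lt_trans rt t1)/= distrC; apply: Hd; first by rewrite q0 (le_lt_trans rt t1).
by rewrite ler0_norm; clear -tr nd rt; lra.
Unshelve. all: by end_near. Qed.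

Lemma smoothn_expR n : smoothn n (@expR R).
Proof. elim: n => //= n IH; split=> //.
by have -> : (@expR R)^`()%classic = expR by apply/funext => x; rewrite derive1E derive_val. Qed.

Lemma exp_weight (l b : R) : 0 < l -> 0 < b ->
  LI `]0, b[ (fun t => expR (l * t)) /\ \int[leb]_(t in `]0, b[) expR (l * t) <= expR (l * b) / l.
Proof.
move=> l0 b0; pose F (t : R) := l^-1 * expR (l * t + 0).
have sF : smooth F.
  apply: (smoothM (f := cst l^-1)); first exact: smooth_cst.
  by apply: smooth_affine => n; exact: smoothn_expR.
have DF : F^`()%classic = (fun t => expR (l * t)).
  apply/funext => t; rewrite derive1E.
  have D1 : is_derive t (1 : R) (fun y : R => l * y + 0) l.
    apply: (is_derive_eq (is_deriveD (is_deriveZ _ _) _)).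
    by rewrite /GRing.scale/= mulr1 addr0.
  have D2 := @is_derive1_comp _ expR (fun y : R => l * y + 0) t _ _ (is_derive_expR _) D1.
  have D3 : is_derive t (1 : R) F (l^-1 * (expR (l * t + 0) * l)) by exact: (is_deriveZ l^-1 D2).
  by rewrite derive_val addr0 mulrC mulfK// gt_eqF.
have [LF IF] := int_derive1_smooth b0 sF; rewrite DF in LF IF; split=> //.
by rewrite IF /F !addr0 mulr0 expR0 mulrC gerBl mulr1 invr_ge0 ltW.
Qed.

(** The second hypothesis is the integral inequality already evaluated on an exponential majorant,
    with l large enough to contract it by 1/2. Applied to the best majorant it gives sup <= A + sup
    / 2; the a priori bound M makes the supremum finite. *)
Lemma gronwall (E : R -> R) (l A M T : R) : 0 <= l -> 0 <= A -> (forall t, 0 < t <= T -> 0 <= E t <= M) ->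
  (forall S, 0 <= S -> (forall t, 0 < t <= T -> E t <= S * expR (l * t)) ->
    forall t, 0 < t <= T -> E t <= A + S / 2 * expR (l * t)) ->
  forall t, 0 < t <= T -> E t <= 2 * A * expR (l * t).
Proof.
move=> l0 A0 EM step t0 t0T.
pose X := [set E t * expR (- (l * t)) | t in [set t | 0 < t <= T]].
have em (t : R) : 0 < t <= T -> expR (- (l * t)) <= 1.
  by move=> /andP[tp _]; rewrite -expR0 ler_expR oppr_le0 mulr_ge0// ltW.
have X0 : X !=set0 by exists (E t0 * expR (- (l * t0))), t0.
have XM : ubound X M.
  move=> _ [t /= tT <-]; have /andP[E0 E1] := EM _ tT.
  apply: le_trans E1; rewrite -[leRHS]mulr1; apply: ler_wpM2l => //; exact: em.
have hX : has_sup X by split => //; exists M.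
have inX t : 0 < t <= T -> E t * expR (- (l * t)) <= sup X.
  by move=> tT; apply: sup_upper_bound => //; exists t.
have ee (t : R) : expR (- (l * t)) * expR (l * t) = 1 by rewrite -expRD addNr expR0.
have bnd t : 0 < t <= T -> E t <= sup X * expR (l * t).
  by move=> tT; rewrite -[leLHS]mulr1 -(ee t) mulrA ler_wpM2r ?expR_ge0// inX.
have S0 : 0 <= sup X.
  apply: le_trans (inX _ t0T); rewrite mulr_ge0 ?expR_ge0//.
  by case/andP: (EM _ t0T).
have S2 : sup X <= A + sup X / 2.
  apply: ge_sup => // _ [t /= tT <-].
  apply: le_trans (ler_wpM2r (expR_ge0 _) (step _ S0 bnd t tT)) _.
  have -> : (A + sup X / 2 * expR (l * t)) * expR (- (l * t)) =
    A * expR (- (l * t)) + sup X / 2 * (expR (- (l * t)) * expR (l * t)) by ring.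
  rewrite ee mulr1 lerD2r.
  by rewrite -[leRHS]mulr1; apply: ler_wpM2l => //; exact: em.
apply: le_trans (bnd _ t0T) _; rewrite ler_wpM2r ?expR_ge0//.
by clear -S2; lra.
Qed.

End TimeDependence.

Section L1Distance.
Context {R : realType} (N : nat).
Local Notation leb := (@lebesgue_measure R).

Lemma l1dist_sym (g h : 'I_N -> R -> R) : l1dist g h = l1dist h g.
Proof. by apply: eq_bigr => j _; apply: eq_Rintegral => y _; rewrite distrC. Qed.

Lemma l1dist_triangle K (g h w : 'I_N -> R -> R) : L1ball K g -> L1ball K h -> L1ball K w ->
  l1dist g w <= l1dist g h + l1dist h w.
Proof.
move=> Pg Ph Pw; rewrite /l1dist -big_split/=; apply: ler_sum => j _.
have [Lg _] := Pg j; have [Lh _] := Ph j; have [Lw _] := Pw j.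
rewrite -LI_intD//; [|by apply: LI_abs; exact: LIB..].
apply: LI_int_le => //; [by apply: LI_abs; exact: LIB|by apply: LID => //; apply: LI_abs; exact: LIB|].
by move=> y _; exact: ler_distD.
Qed.

Variables (T : R) (U : 'I_N -> R -> R -> R) (K Lam : R) (V V' : ('I_N -> R -> R) -> R -> R).
Hypotheses (Uball : forall t, 0 <= t <= T -> L1ball K (fun j => U j t)) (UC : forall j, CtL1 T (U j))
  (Vb : velocity_bounds K Lam V V') (Lam0 : 0 <= Lam).

Lemma l1dist_near t e : 0 <= t <= T -> 0 < e -> exists2 d, 0 < d &
  forall s, 0 <= s <= T -> `|s - t| < d -> l1dist (fun j => U j s) (fun j => U j t) < e.
Proof.
move=> tT e0; pose r := e / N.+1%:R.
have r0 : 0 < r by rewrite divr_gt0.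
have /choice[d Hd] : forall j, exists d, 0 < d /\ forall s, 0 <= s <= T -> `|s - t| < d ->
    \int[leb]_x `|U j s x - U j t x| < r.
  move=> j; have [d d0 Hd] := CtL1_near (fun t tT => (Uball tT j).1) (@UC j) tT r0.
  by exists d.
exists (\big[Num.min/1]_j d j).
  by apply: lt_bigmin => // j _; case: (Hd j).
move=> s sT sd; apply: le_lt_trans (_ : \sum_(j < N) r < e).
  apply: ler_sum => j _; apply: ltW; apply: (Hd j).2 => //.
  by apply: lt_le_trans sd _; exact: bigmin_le.
by rewrite sumr_const card_ord -[_ *+ N]mulr_natl /r mulrCA gtr_pMr// ltr_pdivrMr// mul1r ltr_nat.
Qed.

(** Continuity in time comes from that of U in L^1 through the Lipschitz dependence on the density,
    measurability in x from Lipschitz continuity in x. *)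
Lemma velocity_measurable :
  measurable_fun (QT T) (fun z : R * R => V (fun j => U j z.1) z.2) /\
  measurable_fun (QT T) (fun z : R * R => V' (fun j => U j z.1) z.2).
Proof.
have [_ V11 VL] := Vb.
have tT' (t : R) : 0 < t < T -> 0 <= t <= T by move=> /andP[/ltW -> /ltW ->].
have cts (g : R -> R) c : 0 <= c -> (forall x y, `|g x - g y| <= c * `|x - y|) -> continuous g.
  move=> c0 gL x; apply/cvgrPdist_lt => e e0; near=> y.
  apply: le_lt_trans (gL x y) _.
  apply: le_lt_trans (_ : (c + 1) * `|x - y| < e); first by rewrite ler_wpM2r// lerDl.
  rewrite mulrC -ltr_pdivlMr ?ltr_wpDl//; near: y.
  by apply: cvgr_dist_lt => //; rewrite divr_gt0// ltr_wpDl.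
have near (F : ('I_N -> R -> R) -> R -> R) t x e :
    (forall g h x, L1ball K g -> L1ball K h -> `|F g x - F h x| <= Lam * l1dist g h) ->
    0 < t < T -> 0 < e -> exists2 d, 0 < d & forall s, 0 < s < T -> `|s - t| < d ->
      `|F (fun j => U j s) x - F (fun j => U j t) x| < e.
  move=> FL tT e0; have e' : 0 < e / (Lam + 1) by rewrite divr_gt0// ltr_wpDl.
  have [d d0 Hd] := l1dist_near (tT' _ tT) e'; exists d => // s sT sd.
  apply: le_lt_trans (FL _ _ x (Uball (tT' _ sT)) (Uball (tT' _ tT))) _.
  have := Hd s (tT' _ sT) sd; rewrite ltr_pdivlMr ?ltr_wpDl// => h; apply: le_lt_trans h.
  by rewrite mulrC ler_wpM2l ?l1dist_ge0// lerDl.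
split; apply: (@measurable_caratheodory _ _ (fun t x => _ (fun j => U j t) x)).
- move=> t /tT' tT; apply: cts_measurable; apply: (cts _ Lam) => // x y.
  by have [_ h _] := V11 _ (Uball tT); have := h y (x - y); rewrite [y + _]addrC subrK.
- by move=> t x e; apply: near => g h y Pg Ph; case: (VL g h y Pg Ph).
- move=> t /tT' tT; apply: cts_measurable; apply: (cts _ (2 * Lam)); first by rewrite mulr_ge0.
  by move=> x y; exact: c11_derive Lam0 (V11 _ (Uball tT)).
- by move=> t x e; apply: near => g h y Pg Ph; case: (VL g h y Pg Ph).
Unshelve. all: by end_near. Qed.

End L1Distance.

Lemma affine_growth {R : realDomainType} (q t0 m d c X : R) : d * c <= d * c * (q * X) ->
  q * ((t0 + m * d * c) * X) + d * c <= (t0 + (m + 1) * d * c) * (q * X).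
Proof.
have -> : (t0 + (m + 1) * d * c) * (q * X) = q * ((t0 + m * d * c) * X) + d * c * (q * X) by ring.
by rewrite lerD2l.
Qed.

Lemma rate_bound {R : realType} (N eps Dx delta TV0 kc T Lam X K R' Z : R) :
  0 <= eps -> 0 <= N -> 0 <= delta -> 0 <= TV0 -> 0 <= kc -> 0 <= T -> 0 <= Lam -> 0 <= X -> 0 <= R' -> Dx <= eps ->
  2 * Dx * TV0 + kc * (eps * (2 * T + 2) + Lam * ((8 * eps + delta * X + 2 * eps * X) * T + N * K * (delta + eps) + Z)) +
    R' * eps <=
  (2 * TV0 + kc * (2 * T + 2 + Lam * ((8 + 3 * X) * T + N * K)) + R') * (eps + delta) + kc * Lam * Z.
Proof.
move=> e0 N0 d0 TV00 kc0 T0 Lam0 X0 R0 De.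
rewrite -subr_ge0; have De' : 0 <= eps - Dx by rewrite subr_ge0.
set D := _ - _.
have -> : D = 2 * TV0 * (eps - Dx) + 2 * TV0 * delta + kc * ((2 * T + 2) * delta +
  Lam * (T * (8 * delta + X * (eps + 2 * delta)))) + R' * delta by rewrite /D; ring.
by do ?[assumption|apply: addr_ge0|apply: mulr_ge0].
Qed.

(** * Bounds on the scheme and its error, uniform in the mesh *)

Section SchemeBounds.
Context {R : realType} (N : nat).
Local Notation leb := (@lebesgue_measure R).
Variables (f : 'I_N -> R -> R) (nu : 'I_N -> 'rV[R]_N -> R) (mu G : 'I_N -> 'I_N -> R -> R)
  (beta : R) (U0 : 'I_N -> R -> R) (Dx lam L B C K TV0 Lam delta T : R)
  (V' : 'I_N -> ('I_N -> R -> R) -> R -> R).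
Local Notation Dt := (lam * Dx).
Local Notation V k := (vel (nu k) (fun j => mu j k)).
Hypotheses (L0 : 0 <= L) (B0 : 0 <= B) (lam0 : 0 < lam) (beta0 : 0 < beta)
  (Dx0 : 0 < Dx) (K0 : 0 <= K) (TV00 : 0 <= TV0) (Lam0 : 0 <= Lam) (d0 : 0 <= delta) (T0 : 0 <= T)
  (fL : forall k a b, `|f k a - f k b| <= L * `|a - b|) (f0 : forall k, f k 0 = 0)
  (cfl1 : lam * (L * B) <= beta) (cfl2 : lam * (L * B) <= 2 / 3 - beta)
  (nuB : forall k a, `|nu k a| <= B)
  (muc : forall j k, continuous (mu j k)) (muC : forall j k x, `|mu j k x| <= C)
  (Vb : forall k, velocity_bounds K Lam (V k) (V' k))
  (wP : forall j k, memory_weight Dt delta (fun l => Dt * Gam_avg G Dt j k l))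
  (U0L : forall k, LI setT (U0 k)) (U0K : forall k, \int[leb]_x `|U0 k x| <= K)
  (U0tr : forall k (h : R), 0 < h -> \int[leb]_x `|U0 k (x + h) - U0 k x| <= h * TV0).

Local Notation a := (fv f nu mu G beta U0 Dx Dt).
Definition scheme_velocity k n (i : int) := nu k (fv_conv mu G Dx Dt a k n (i%:~R + 2^-1)).
Local Notation A := scheme_velocity.
Local Notation mem k n := (fv_memory G Dx Dt a k n).

Let Dt0 : 0 < Dt. Proof. exact: mulr_gt0. Qed.

Let AB k n i : `|A k n i| <= B. Proof. exact: nuB. Qed.

Lemma fv_step k n i : a k n.+1 i = lf_step (f k) lam beta (A k n i) (A k n (i - 1))
  (a k n (i - 1)) (a k n i) (a k n (i + 1)).
Proof.
have E : Dt / Dx = lam by rewrite mulfK ?gt_eqF.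
rewrite fvS /fv_next /lf_step /LFflux E /scheme_velocity.
by have -> : (i - 1)%:~R + 2^-1 = i%:~R - 2^-1 :> R by rewrite intrD; field.
Qed.

Lemma fv_L1 n k : bsum (a k n) (K / Dx).
Proof.
elim: n k => [|n IH] k.
  by apply: bsumW (bsum_average Dx0 (U0L k)); rewrite ler_pM2r ?invr_gt0.
exact: (scheme_L1 L0 lam0 (fL k) (f0 k) cfl1 cfl2 (AB k n) (fv_step k n) (IH k)).
Qed.

Lemma memory_ball k n : L1ball K (mem k n).
Proof.
move=> j; have [LM IM] := @memory_LI _ Dx Dt delta Dx0 _ (a j) n (K / Dx) (wP j k) (fun m _ => @fv_L1 m j).
by split; [exact: LM|apply: le_trans IM _; rewrite mulrC divfK ?gt_eqF].
Qed.

Lemma scheme_velocityE k n i : A k n i = V k (mem k n) ((i%:~R + 2^-1) * Dx).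
Proof.
rewrite /A /vel; congr (nu k _).
exact: (@fv_convE _ _ mu G Dx Dt (K / Dx) C Dx0 muc muC a k n (i%:~R + 2^-1) (fun j m _ => @fv_L1 m j)).
Qed.

Let A11 k n : c11 (V k (mem k n)) (V' k (mem k n)) Lam.
Proof. by have [_ h _] := Vb k; apply: h; exact: memory_ball. Qed.

Lemma scheme_velocity_diff k n i : `|A k n (i + 1) - A k n i| <= Lam * Dx.
Proof.
rewrite !scheme_velocityE; have [_ h _] := A11 k n.
have -> : ((i + 1)%:~R + 2^-1) * Dx = (i%:~R + 2^-1) * Dx + Dx by rewrite intrD; ring.
by have := h ((i%:~R + 2^-1) * Dx) Dx; rewrite (gtr0_norm Dx0).
Qed.

(** Expansions to the right and to the left of the same point: the slopes cancel. *)
Lemma scheme_velocity_diff2 k n i : `|A k n (i + 1) - 2 * A k n i + A k n (i - 1)| <= 2 * Lam * Dx ^+ 2.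
Proof.
rewrite !scheme_velocityE; have [_ _ h] := A11 k n; set y := (i%:~R + 2^-1) * Dx.
have -> : ((i + 1)%:~R + 2^-1) * Dx = y + Dx by rewrite /y intrD; ring.
have -> : ((i - 1)%:~R + 2^-1) * Dx = y - Dx by rewrite /y intrD; ring.
set W := V k _; have h1 := h y Dx; have h2 := h y (- Dx); rewrite sqrrN in h2.
have -> : W (y + Dx) - 2 * W y + W (y - Dx) = (W (y + Dx) - W y - Dx * V' k (mem k n) y) +
  (W (y - Dx) - W y - - Dx * V' k (mem k n) y) by ring.
apply: le_trans (ler_normD _ _) _; apply: le_trans (lerD h1 h2) _.
by rewrite le_eqVlt; apply/orP; left; apply/eqP; ring.
Qed.

Let c1 := L * Lam.
Let c2 := 2 * Lam * L * K.
Let c10 : 0 <= c1. Proof. exact: mulr_ge0. Qed.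
Let c20 : 0 <= c2. Proof. by rewrite !mulr_ge0. Qed.

(** Discrete Gronwall: one step multiplies the variation by 1 + c1 Dt and adds c2 Dt, so n steps
    give at most (TV0 + n Dt c2) (1 + c1 Dt)^n. *)
Definition TVbound := (TV0 + T * c2) * expR (c1 * T).

Lemma TVbound_ge0 : 0 <= TVbound.
Proof. by rewrite mulr_ge0 ?expR_ge0// addr_ge0// mulr_ge0. Qed.

Lemma fv_TV n k : n%:R * Dt <= T -> bsum (fun i => a k n (i + 1) - a k n i) TVbound.
Proof.
move=> nT; have dt := ltW Dt0.
have H m : bsum (fun i => a k m (i + 1) - a k m i) ((TV0 + m%:R * Dt * c2) * (1 + c1 * Dt) ^+ m).
  elim: m => [|m IH].
    rewrite !mul0r addr0 expr0 mulr1.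
    exact: (average_variation Dx0 (U0L k) (@U0tr k)).
  have := scheme_TV L0 lam0 (fL k) (f0 k) cfl1 cfl2 (AB k m) (fv_step k m) (@fv_L1 m k) IH
    (scheme_velocity_diff k m) (scheme_velocity_diff2 k m).
  apply: bsumW; set X := (1 + c1 * Dt) ^+ m.
  have p1 : 1 <= 1 + c1 * Dt by rewrite lerDl mulr_ge0.
  have X1 : 1 <= (1 + c1 * Dt) * X by rewrite -exprS exprn_ege1.
  have -> : 1 + lam * L * (Lam * Dx) = 1 + c1 * Dt by rewrite /c1; ring.
  have -> : lam * (2 * Lam * Dx ^+ 2) * L * (K / Dx) = Dt * c2 by rewrite /c2; field; rewrite gt_eqF.
  have : Dt * c2 <= Dt * c2 * ((1 + c1 * Dt) * X) by rewrite ler_peMr// mulr_ge0.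
  by rewrite exprS -/X -natr1; exact: affine_growth.
apply: bsumW (H n); apply: ler_pM.
- by do ?[exact: c20|exact: dt|apply: addr_ge0|apply: mulr_ge0].
- by rewrite exprn_ge0// addr_ge0// mulr_ge0.
- by rewrite lerD2l ler_wpM2r.
apply: le_trans (_ : expR (c1 * Dt) ^+ n <= _).
  rewrite lerXn2r ?nnegrE ?expR_ge0 ?expR_ge1Dx//.
  by rewrite addr_ge0// mulr_ge0.
rewrite -expRM_natl ler_expR (_ : _ * _ = c1 * (n%:R * Dt)); last by ring.
exact: ler_wpM2l.
Qed.

Definition Ctbound := beta * TVbound + lam * (B * L * TVbound + Lam * L * K).

Lemma Ctbound_ge0 : 0 <= Ctbound.
Proof.
have b := ltW beta0; have l := ltW lam0; have t := TVbound_ge0.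
by rewrite /Ctbound; do ?[exact: t|apply: addr_ge0|apply: mulr_ge0].
Qed.

Lemma fv_time n k : n%:R * Dt <= T -> bsum (fun i => a k n.+1 i - a k n i) Ctbound.
Proof.
move=> nT; have := scheme_time L0 B0 lam0 beta0 (fL k) (f0 k) (AB k n) (fv_step k n) (@fv_L1 n k)
  (@fv_TV n k nT) (scheme_velocity_diff k n).
by rewrite (_ : Lam * Dx * L * (K / Dx) = Lam * L * K)//; field; rewrite gt_eqF.
Qed.

Lemma fv_lag n m k : n%:R * Dt <= T -> (m <= n)%N -> bsum (fun i => a k n i - a k m i) ((n - m)%:R * Ctbound).
Proof.
move=> nT mn; apply: (@lag_sum _ (a k)) => // l ln; apply: fv_time.
by apply: le_trans nT; rewrite ler_pM2r// ler_nat ltnW.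
Qed.

Lemma fv_memory_lag k n : n%:R * Dt <= T -> l1dist (mem k n) (fun j => recon Dx (a j n)) <=
  N%:R * ((nat_of_bool ((n.+1%:R * Dt <= delta)%R))%:R * K + delta / lam * Ctbound).
Proof.
move=> nT; have -> : N%:R * ((nat_of_bool ((n.+1%:R * Dt <= delta)%R))%:R * K + delta / lam * Ctbound) =
   \sum_(j < N) ((nat_of_bool ((n.+1%:R * Dt <= delta)%R))%:R * K + delta / lam * Ctbound).
  by rewrite sumr_const card_ord mulr_natl.
apply: ler_sum => j _.
apply: le_trans (memory_lag Dx0 Dt0 (wP j k) (fun m _ => @fv_L1 m j) Ctbound_ge0 d0 _) _.
  by move=> m mn; exact: fv_lag.
rewrite [Dx * (K / Dx)]mulrC divfK ?gt_eqF// lerD2l.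
by rewrite le_eqVlt; apply/orP; left; apply/eqP; field; rewrite !gt_eqF.
Qed.

Variables (H : R -> R) (CH eps : R) (U : 'I_N -> R -> R -> R).
Hypotheses (sH : is_step H CH) (eps0 : 0 < eps) (eps1 : eps <= 1) (Dxe : Dx = eps ^+ 2)
  (lam1 : lam <= 1) (Tpos : 0 < T) (hU : entropy_solution T f nu mu U0 U)
  (UK : forall k t, 0 <= t <= T -> \int[leb]_x `|U k t x| <= K).

Definition cell_time (t : R) : nat := Num.truncn (t / Dt).
Definition recons n (j : 'I_N) := recon Dx (a j n).
Definition total_error (t : R) := l1dist (fun j => U j t) (recons (cell_time t)).
Local Notation E := total_error.

Let UL k t : 0 <= t <= T -> LI setT (U k t).
Proof. by move=> tT; have [/(_ k) [_ /(_ _ tT) [h _] _ _] _] := hU. Qed.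

Let UC k : CtL1 T (U k).
Proof. by have [/(_ k) [_ _ h _] _] := hU. Qed.

Let Uball t : 0 <= t <= T -> L1ball K (fun j => U j t).
Proof. by move=> tT j; split; [exact: UL|exact: UK]. Qed.

Let CH0 : 0 <= CH. Proof. exact: step_const_ge0 sH. Qed.
Let Dxle : Dx <= eps. Proof. exact: mesh_le eps0 Dxe eps1. Qed.
Let Dtle : Dt <= eps. Proof. exact: time_step_le eps0 lam1 Dx0 Dxe eps1. Qed.
Let TV0' : 0 <= TVbound. Proof. exact: TVbound_ge0. Qed.
Let Ct0' : 0 <= Ctbound. Proof. exact: Ctbound_ge0. Qed.

Lemma recons_ball n : L1ball K (recons n).
Proof.
move=> j; have [Lr Ir] := recon_LI Dx0 (@fv_L1 n j); split=> //.
by apply: le_trans Ir _; rewrite mulrC divfK ?gt_eqF.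
Qed.

Lemma cell_timeP t : 0 <= t -> (cell_time t)%:R * Dt <= t < (cell_time t).+1%:R * Dt.
Proof.
move=> t0; have := @truncn_itv _ (t / Dt); rewrite divr_ge0 ?(ltW Dt0)// => /(_ isT).
by rewrite ler_pdivlMr// ltr_pdivrMr.
Qed.

Lemma recons_lag n m : n%:R * Dt <= T -> (m <= n)%N ->
  l1dist (recons m) (recons n) <= N%:R * (Dx * ((n - m)%:R * Ctbound)).
Proof.
move=> nT mn; have -> : N%:R * (Dx * ((n - m)%:R * Ctbound)) = \sum_(j < N) (Dx * ((n - m)%:R * Ctbound)).
  by rewrite sumr_const card_ord mulr_natl.
apply: ler_sum => j _; have [_ I] := recon_LI Dx0 (@fv_lag n m j nT mn).
apply: le_trans I; rewrite le_eqVlt; apply/orP; left; apply/eqP.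
by apply: eq_Rintegral => y _; rewrite distrC recon_sub.
Qed.

(* While the m-th time weight is active, s - t^m is O(eps), and the memory reaches
   back to times O(delta) earlier, except for s <= delta + eps. *)
Let om k m s := Lam * (8 * eps + l1dist (mem k m) (fun j => U j s)).
Let W S l s := Lam * (8 * eps + N%:R * (delta / lam * Ctbound) + N%:R * (2 * eps / lam * Ctbound) +
   N%:R * K * (nat_of_bool ((s <= delta + eps)%R))%:R + S * expR (l * s)).

(** The distance from the memory at level m to U at time s is split at the reconstructions of level
    m and of the current level n: memory lag, drift of the scheme, error at time s. The active
    weight forces 0 <= s - t^(m+1) <= eps, so the drift lasts at most eps + Dt <= 2 eps, and t^(m+1)
    <= delta implies s <= delta + eps. *)
Lemma modulus_bound k m s S l : 0 < s <= T -> 0 <= S -> E s <= S * expR (l * s) ->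
  tkap H eps lam Dx m.+1 s != 0 -> om k m s <= W S l s.
Proof.
move=> sT S0 Es /(tkap_near sH eps0) /andP[]; rewrite subr_ge0 => ms sm.
have /andP[s0 sT'] := sT; have s00 := ltW s0.
have /andP[n1 n2] := cell_timeP s00; set n := cell_time s in n1 n2 *.
have mn : (m.+1 <= n)%N by rewrite -ltnS -(ltr_nat R) -(ltr_pM2r Dt0); exact: le_lt_trans n2.
have nT : n%:R * Dt <= T by exact: le_trans sT'.
have mT : m%:R * Dt <= T.
  by apply: le_trans nT; rewrite ler_pM2r// ler_nat ltnW.
have Ub := Uball (_ : 0 <= s <= T); rewrite s00 sT' in Ub; have {}Ub := Ub isT.
rewrite /om /W ler_wpM2l//.
have t1 := l1dist_triangle (memory_ball k m) (recons_ball m) Ub.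
have t2 := l1dist_triangle (recons_ball m) (recons_ball n) Ub.
have h1 := @fv_memory_lag k m mT.
have h2 := @recons_lag n m nT (ltnW mn).
have h3 : l1dist (recons n) (fun j => U j s) <= S * expR (l * s) by rewrite l1dist_sym.
have h4 : N%:R * (Dx * ((n - m)%:R * Ctbound)) <= N%:R * (2 * eps / lam * Ctbound).
  apply: ler_wpM2l => //; rewrite mulrA; apply: ler_wpM2r; first exact: Ct0'.
  rewrite ler_pdivlMr// -mulrA mulrC -mulrA natrB ?(ltnW mn)// mulrBl.
  have := Dtle; move: sm n1; rewrite -natr1 mulrDl mul1r; lra.
have h5 : N%:R * ((nat_of_bool ((m.+1%:R * Dt <= delta)%R))%:R * K) <=
    N%:R * K * (nat_of_bool ((s <= delta + eps)%R))%:R.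
  rewrite -mulrA; apply: ler_wpM2l => //; rewrite mulrC; apply: ler_wpM2l => //.
  rewrite ler_nat; case: (leP (m.+1%:R * Dt) delta) => // md.
  by rewrite (_ : s <= delta + eps)//; lra.
rewrite mulrDr in h1; lra.
Qed.

Lemma memory_modulus S l t : 0 < t <= T -> 0 <= S -> 0 < l ->
  [/\ forall s, 0 <= W S l s, LI `]0, t[ (W S l) & \int[leb]_(s in `]0, t[) W S l s <=
    Lam * ((8 * eps + N%:R * (delta / lam * Ctbound) + N%:R * (2 * eps / lam * Ctbound)) * T +
      N%:R * K * (delta + eps) + S * (expR (l * t) / l))].
Proof.
move=> /andP[t0 tT] S0 l0.
pose c := 8 * eps + N%:R * (delta / lam * Ctbound) + N%:R * (2 * eps / lam * Ctbound).
have NK0 : 0 <= N%:R * K by rewrite mulr_ge0.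
have c0 : 0 <= c.
  have e := ltW eps0; have ll := ltW lam0; have ct := Ct0'.
  by rewrite /c; do ?[exact: ct|apply: addr_ge0|apply: divr_ge0|apply: mulr_ge0].
have de0 : 0 <= delta + eps by rewrite addr_ge0// ltW.
have mI : measurable (`]0, t[%classic : set R) by exact: measurable_itv.
have [L1 I1] := LI_cst_itv c (ltW t0).
have [L2 I2] := early_LI t de0.
have [L3 I3] := exp_weight l0 t0.
have L2' : LI `]0, t[ (fun s => N%:R * K * (nat_of_bool ((s <= delta + eps)%R))%:R) by exact: LIZ.
have L3' : LI `]0, t[ (fun s => S * expR (l * s)) by exact: LIZ.
have L12 : LI `]0, t[ (fun s => cst c s + N%:R * K * (nat_of_bool ((s <= delta + eps)%R))%:R) by exact: LID.
have L123 : LI `]0, t[ (fun s => cst c s + N%:R * K * (nat_of_bool ((s <= delta + eps)%R))%:R + S * expR (l * s)) by exact: LID.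
split=> [s||].
- rewrite /W mulr_ge0// -/c addr_ge0//; last by rewrite mulr_ge0// expR_ge0.
  by rewrite addr_ge0// mulr_ge0.
- exact: LIZ.
- rewrite LI_intZ// ler_wpM2l// LI_intD// LI_intD// I1 subr0 !LI_intZ//.
  apply: lerD; first apply: lerD; exact: ler_wpM2l.
Qed.

Let Vx k s (x : R) : R := derive1 (fun x => nu k (space_conv mu U k s x)) x.

Let VxE k s x : 0 <= s <= T -> Vx k s x = V' k (fun j => U j s) x.
Proof.
move=> sT; have [_ h _] := Vb k; rewrite /Vx derive1E.
exact: (@derive_val _ _ _ _ _ _ _ (is_derive_c11 x (h _ (Uball sT)))).
Qed.

(** The constant 8 of [om] is dictated by the gradient: the interface lies within 7/2 eps of x and
    the slope has Lipschitz constant 2 Lam, so the error is Lam Dx (Dx + 7 eps) plus the dependence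
    on the density. *)
Lemma velocity_consistency k m s x i : 0 <= s <= T -> sio eps Dx i x != 0 ->
  `|A k m i - V k (fun j => U j s) x| <= om k m s /\
  `|A k m i - A k m (i - 1) - Dx * V' k (fun j => U j s) x| <= Dx * om k m s.
Proof.
move=> sT; rewrite /sio /near3 pnatr_eq0 eqb0 negbK => xi.
have [_ V11 VL] := Vb k; have Us := Uball sT.
have [d1 d2] := VL _ _ x (memory_ball k m) Us.
have W11 := V11 _ (memory_ball k m); have [_ Wl Wt] := W11.
have D2 : 0 <= Dx / 2 by rewrite divr_ge0// ltW.
rewrite !scheme_velocityE; set Wv := V k (mem k m) in Wl Wt d1 *; set Wd := V' k (mem k m) in W11 Wt d2 *.
have e0 := ltW eps0.
split.
  set y := (i%:~R + 2^-1) * Dx.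
  have yx : `|y - x| <= 8 * eps.
    have -> : y - x = Dx / 2 - (x - i%:~R * Dx) by rewrite /y; ring.
    apply: le_trans (ler_normB _ _) _; rewrite (ger0_norm D2).
    by have := Dxle; lra.
  have := Wl x (y - x); rewrite [x + _]addrC subrK => h.
  rewrite (_ : Wv y - _ = (Wv y - Wv x) + (Wv x - V k (fun j => U j s) x)); last by ring.
  apply: le_trans (ler_normD _ _) _; rewrite /om mulrDr; apply: lerD => //.
  by apply: le_trans h _; exact: ler_wpM2l.
set y := (i%:~R - 2^-1) * Dx.
have -> : (i%:~R + 2^-1) * Dx = y + Dx by rewrite /y; field.
have -> : ((i - 1)%:~R + 2^-1) * Dx = y by rewrite /y intrD; field.
have yx : `|y - x| <= 7 / 2 * eps.
  have -> : y - x = - (Dx / 2 + (x - i%:~R * Dx)) by rewrite /y; ring.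
  rewrite normrN; apply: le_trans (ler_normD _ _) _; rewrite (ger0_norm D2).
  by have := Dxle; lra.
have h1 := Wt y Dx; have h2 := c11_derive y x Lam0 W11.
rewrite (_ : Wv (y + Dx) - Wv y - _ = (Wv (y + Dx) - Wv y - Dx * Wd y) + Dx * (Wd y - Wd x) +
  Dx * (Wd x - V' k (fun j => U j s) x)); last by ring.
apply: le_trans (ler_normD _ _) _; apply: le_trans (lerD (ler_normD _ _) (le_refl _)) _.
rewrite (normrM Dx (Wd y - _)) (normrM Dx (Wd x - _)) (gtr0_norm Dx0).
rewrite /om !mulrDr; apply: lerD; last by rewrite ler_pM2l.
apply: le_trans (_ : Lam * Dx ^+ 2 + Dx * (2 * Lam * (7 / 2 * eps)) <= _).
  apply: lerD => //; rewrite ler_pM2l//; apply: le_trans h2 _.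
  by apply: ler_wpM2l => //; exact: mulr_ge0.
have -> : Lam * Dx ^+ 2 + Dx * (2 * Lam * (7 / 2 * eps)) = Dx * (Lam * (Dx + 7 * eps)) by field.
rewrite ler_pM2l//; apply: ler_wpM2l => //.
by have := Dxle; lra.
Qed.

Definition kuznetsov_const := D2 CH lam beta L Lam K TVbound * (24 * CH + 2).

Lemma kuznetsov_const_ge0 : 0 <= kuznetsov_const.
Proof.
apply: mulr_ge0; last by rewrite addr_ge0// mulr_ge0.
exact: (D2_ge0 sH lam0 (ltW beta0) L0 Lam0 K0 TV0').
Qed.

(** The localised inequality and the removal of the weights, assembled for one component. What is
    integrated in time is the majorant S exp(l s), never the error itself. *)
Lemma component_estimate k t S l : 0 < t <= T -> 0 <= S -> 0 < l ->
  (forall s, 0 < s <= T -> E s <= S * expR (l * s)) ->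
  \int[leb]_x `|U k t x - recons (cell_time t) k x| <= 2 * Dx * TV0 +
    kuznetsov_const * (eps * (2 * T + 2) +
     Lam * ((8 * eps + N%:R * (delta / lam * Ctbound) + N%:R * (2 * eps / lam * Ctbound)) * T +
      N%:R * K * (delta + eps) + S * (expR (l * t) / l))) +
    (36 * CH * TVbound + 12 * CH * Ctbound / lam) * eps.
Proof.
move=> tT S0 l0 ES; have /andP[t0 tT'] := tT.
have [W0 LW IW] := memory_modulus tT S0 l0.
have st s : 0 < s < t -> 0 < s <= T by move=> /andP[-> /ltW /le_trans ->].
have sT s : 0 < s < T -> 0 <= s <= T by move=> /andP[/ltW -> /ltW ->].
have st' s : 0 < s < t -> 0 <= s <= T by move=> /st /andP[/ltW -> ->].
set M := cell_time t; have /andP[M1 M2] := cell_timeP (ltW t0).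
have MT m : (m <= M)%N -> m%:R * Dt <= T.
  by move=> mM; apply: le_trans tT'; apply: le_trans M1; rewrite ler_pM2r// ler_nat.
have [um _ _ _] := hU.1 k.
have [Vm Vxm] := velocity_measurable Uball UC (Vb k) Lam0.
have [VB V11 _] := Vb k.
have mQT : measurable (QT T) by apply: measurableX => //; exact: measurable_itv.
have Vxm' : measurable_fun (QT T) (fun z : R * R => Vx k z.1 z.2).
  apply: eq_measurable_fun Vxm => z; rewrite inE => -[/=]; rewrite in_itv/= => zT _.
  by rewrite VxE// sT.
have VxB s x : 0 < s < T -> `|Vx k s x| <= Lam.
  by move=> /sT h; rewrite VxE//; have [+ _ _] := V11 _ (Uball h); apply.
have om0 m s : 0 <= om k m s.
  by rewrite /om mulr_ge0// addr_ge0 ?l1dist_ge0// mulr_ge0// ltW.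
have aK m : (m <= M)%N -> bsum (a k m) (K / Dx) by move=> _; exact: fv_L1.
have aTV m : (m <= M)%N -> bsum (fun i => a k m (i + 1) - a k m i) TVbound by move=> /MT; exact: fv_TV.
have aCt m : (m < M)%N -> bsum (fun i => a k m.+1 i - a k m i) Ctbound by move=> /ltnW /MT; exact: fv_time.
have omW m s : 0 < s < t -> (m <= M)%N -> tkap H eps lam Dx m.+1 s != 0 -> om k m s <= W S l s.
  by move=> /st sT' _; apply: modulus_bound => //; exact: ES.
have AV m s x i : 0 < s < t -> sio eps Dx i x != 0 ->
    `|A k m i - nu k (space_conv mu U k s x)| <= om k m s.
  by move=> /st' h xi; have [h' _] := velocity_consistency k m h xi; exact: h'.
have AV' m s x i : 0 < s < t -> sio eps Dx i x != 0 ->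
    `|A k m i - A k m (i - 1) - Dx * Vx k s x| <= Dx * om k m s.
  by move=> /st' h xi; rewrite VxE//; have [_ h'] := velocity_consistency k m h xi; exact: h'.
have cell m i c := @lf_step_entropy _ (f k) L B lam beta L0 lam0 (fL k) cfl1 cfl2 (A k m i) (A k m (i - 1))
  (a k m (i - 1)) (a k m i) (a k m (i + 1)) c (AB k m i) (AB k m (i - 1)).
pose IWt := \int[leb]_(s in `]0, t[) W S l s.
apply: le_trans (kuznetsov_estimate sH eps0 lam0 lam1 Dx0 Dxe eps1
  (A0 := kuznetsov_const * (eps * (T + 2) + eps * T + IWt))
  (* This coefficient blows up with the mesh, harmlessly: its factor tau tends to 0 while Dx is
     fixed. *)
  (A1 := kuznetsov_const * (Dx^-1 * (eps * (T + 2)) + (1 + Dx^-1) * T))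
  (_ : M%:R * Dt <= t <= M.+1%:R * Dt) TV0' Ct0' aK aTV aCt (UL _ _) (U0L k) _) _.
- by rewrite M1 ltW.
- by rewrite (ltW t0).
- move=> I z tau tau0 z01 zI zNI zL.
  apply: le_trans (kuznetsov_cutoff sH eps0 lam0 lam1 Dx0 Dxe eps1 (ltW beta0) L0 Lam0 (fL k) (f0 k) Tpos um
    (@UL k) (@UC k) Vm Vxm' (fun s x _ => VB _ x) VxB (U0L k) (hU.2 k) tT (ltW M2) K0 TV0' (@UK k) aK aTV om0 omW W0 LW
    tau0 z01 zI zNI zL AV AV' _) _.
    by move=> m i c; rewrite fv_step; exact: cell.
  rewrite lerD2l -/kuznetsov_const -/IWt.
  by rewrite le_eqVlt; apply/orP; left; apply/eqP; ring.
rewrite lerD2r; apply: lerD.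
  by exact: (average_error Dx0 (U0L k) TV00 (@U0tr k)).
apply: ler_wpM2l.
  exact: kuznetsov_const_ge0.
rewrite (_ : eps * (T + 2) + eps * T = eps * (2 * T + 2)); last by ring.
by rewrite lerD2l.
Qed.

Definition local_rate := 2 * TV0 +
  kuznetsov_const * (2 * T + 2 + Lam * ((8 + 3 * (N%:R * (Ctbound / lam))) * T + N%:R * K)) +
  (36 * CH * TVbound + 12 * CH * Ctbound / lam).
(** Integrating exp(l s) gains 1 / l, and this l makes N times the feedback constant
    [kuznetsov_const * Lam] divided by l at most 1/2, the contraction required by [gronwall]. The
    added 1 keeps it positive. *)
Definition growth_rate := 2 * (N%:R * (kuznetsov_const * Lam) + 1).
Definition error_const := 2 * (N%:R * local_rate) * expR (growth_rate * T).

Lemma growth_rate_gt0 : 0 < growth_rate.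
Proof.
have kc := kuznetsov_const_ge0; rewrite /growth_rate; apply: mulr_gt0 => //.
by apply: ltr_wpDl => //; do ?[exact: kc|apply: mulr_ge0].
Qed.

Let tail0 : 0 <= 36 * CH * TVbound + 12 * CH * Ctbound / lam.
Proof.
have l0 := ltW lam0.
by do ?[exact: TV0'|exact: CH0|exact: Ct0'|exact: l0|apply: addr_ge0|apply: divr_ge0|apply: mulr_ge0].
Qed.

Lemma local_rate_ge0 : 0 <= local_rate.
Proof.
have kc := kuznetsov_const_ge0; have ct : 0 <= Ctbound / lam by rewrite divr_ge0// ltW.
by rewrite /local_rate; do ?[exact: kc|exact: ct|exact: tail0|apply: addr_ge0|apply: mulr_ge0].
Qed.

Lemma component_rate k t S : 0 < t <= T -> 0 <= S ->
  (forall s, 0 < s <= T -> E s <= S * expR (growth_rate * s)) ->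
  \int[leb]_x `|U k t x - recons (cell_time t) k x| <= local_rate * (eps + delta) +
    kuznetsov_const * Lam * (S * (expR (growth_rate * t) / growth_rate)).
Proof.
move=> tT S0 ES; apply: le_trans (component_estimate k tT S0 growth_rate_gt0 ES) _.
have kc := kuznetsov_const_ge0; have ct : 0 <= Ctbound / lam by rewrite divr_ge0// ltW.
have X0 : 0 <= N%:R * (Ctbound / lam) by rewrite mulr_ge0.
have R0 := tail0.
rewrite (_ : delta / lam * Ctbound = delta * (Ctbound / lam)); last by ring.
rewrite (_ : 2 * eps / lam * Ctbound = 2 * eps * (Ctbound / lam)); last by ring.
rewrite ![N%:R * (_ * (Ctbound / lam))]mulrCA /local_rate.
move: (N%:R * (Ctbound / lam)) X0 => X X0.
move: (36 * CH * TVbound + 12 * CH * Ctbound / lam) R0 => R' R0.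
have e0 := ltW eps0; have n0 : 0 <= N%:R :> R by [].
have h := @rate_bound R _ _ _ _ _ _ _ _ _ _ _ (S * (expR (growth_rate * t) / growth_rate)) e0 n0 d0 TV00 kc T0 Lam0 X0 R0 Dxle.
exact: h.
Qed.

Lemma total_error_bound t : 0 < t <= T -> E t <= error_const * (eps + delta).
Proof.
move=> tT; have kc := kuznetsov_const_ge0; have g0 := growth_rate_gt0; have lr := local_rate_ge0.
have ed : 0 <= eps + delta by rewrite addr_ge0// ltW.
have st s : 0 < s <= T -> 0 <= s <= T by move=> /andP[/ltW -> ->].
have sumE (F : 'I_N -> R) c : (forall j, F j <= c) -> \sum_j F j <= N%:R * c.
  move=> Fc; apply: le_trans (_ : \sum_(j < N) c <= _); first exact: ler_sum.
  by rewrite sumr_const card_ord mulr_natl.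
have A0 : 0 <= N%:R * (local_rate * (eps + delta)) by rewrite !mulr_ge0.
(* The a priori bound needed for the supremum: both densities have mass at most K per component. *)
have EM s : 0 < s <= T -> 0 <= E s <= N%:R * (K + K).
  move=> sT; rewrite l1dist_ge0/=; apply: sumE => j.
  have [Lu Iu] := Uball (st _ sT) j; have [Lr Ir] := recons_ball (cell_time s) j.
  apply: le_trans (_ : \int[leb]_y (`|U j s y| + `|recons (cell_time s) j y|) <= _).
    apply: LI_int_le => //; [by apply: LI_abs; exact: LIB|by apply: LID => //; exact: LI_abs|].
    by move=> y _; exact: ler_normB.
  by rewrite LI_intD//; [exact: lerD|exact: LI_abs..].
have step S : 0 <= S -> (forall s, 0 < s <= T -> E s <= S * expR (growth_rate * s)) ->
    forall s, 0 < s <= T -> E s <= N%:R * (local_rate * (eps + delta)) + S / 2 * expR (growth_rate * s).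
  move=> S0 ES s sT; apply: le_trans (sumE _ _ (fun j => component_rate j sT S0 ES)) _.
  rewrite mulrDr lerD2l.
  have h : N%:R * (kuznetsov_const * Lam) / growth_rate <= 1 / 2.
    rewrite ler_pdivrMr// /growth_rate; set y := N%:R * _.
    by rewrite (_ : 1 / 2 * (2 * (y + 1)) = y + 1) ?lerDl//; field.
  have Se : 0 <= S * expR (growth_rate * s) by rewrite mulr_ge0// expR_ge0.
  have := ler_wpM2l Se h; congr (_ <= _); ring.
apply: le_trans (gronwall (ltW g0) A0 EM step tT) _.
rewrite /error_const (_ : 2 * (N%:R * (local_rate * (eps + delta))) * expR (growth_rate * t) =
  2 * (N%:R * local_rate) * expR (growth_rate * t) * (eps + delta)); last by ring.
apply: ler_wpM2r => //; apply: ler_wpM2l; first by rewrite !mulr_ge0.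
by rewrite ler_expR; apply: ler_wpM2l; [exact: ltW|case/andP: tT].
Qed.
End SchemeBounds.

Section Constants.
Context {R : realType}.

Lemma lip_constP (g : R -> R) : lipschitz g -> 0 <= lip_const g /\
  forall a b, `|g a - g b| <= lip_const g * `|a - b|.
Proof.
move=> [M [_ HM]]; have H := HM (M + 1) (ltr_pwDr ltr01 (lexx M)).
have gM a b : `|g a - g b| <= (M + 1) * `|a - b| by exact: (H (a, b)).
have ub : ubound [set `|g z.1 - g z.2| / `|z.1 - z.2| | z in [set z : R * R | z.1 != z.2]] (M + 1).
  move=> _ [z /= z12 <-]; rewrite ler_pdivrMr ?normr_gt0 ?subr_eq0//; exact: gM.
have le a b : a != b -> `|g a - g b| / `|a - b| <= lip_const g.
  move=> ab; apply: sup_upper_bound; last by exists (a, b).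
  by split; [exists (`|g a - g b| / `|a - b|), (a, b)|exists (M + 1)].
split; first by apply: le_trans (le 0 1 _); [exact: divr_ge0|rewrite eq_sym oner_eq0].
move=> a b; have [->|ab] := eqVneq a b; first by rewrite !subrr normr0 mulr0.
by rewrite -ler_pdivrMr ?normr_gt0 ?subr_eq0// le.
Qed.

Lemma sup_normP (V : normedModType R) (g : V -> R) (M : R) : (forall x, `|g x| <= M) ->
  forall x, `|g x| <= sup_norm g.
Proof.
move=> gM x; apply: sup_upper_bound; last by exists x.
by split; [exists `|g x|, x|exists M => _ [y _ <-]].
Qed.

(** Clearing the denominator bounds lambda + 6 lambda L B by 1, by 4 - 6 beta and by 6 beta;
    dropping one of the two terms, and dividing the last two bounds by 6, gives the three claims. *)
Lemma CFL_bounds (lambda beta L B : R) : 0 < lambda -> 0 <= L -> 0 <= B ->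
  lambda <= Num.min 1 (Num.min (4 - 6 * beta) (6 * beta)) / (1 + 6 * L * B) ->
  [/\ lambda <= 1, lambda * (L * B) <= beta & lambda * (L * B) <= 2 / 3 - beta].
Proof.
move=> l0 L0 B0; have LB : 0 <= L * B by rewrite mulr_ge0.
have D0 : 0 < 1 + 6 * L * B by rewrite -mulrA; lra.
rewrite ler_pdivlMr// !le_min => /andP[h1 /andP[h2 h3]].
have lLB : 0 <= lambda * (L * B) by rewrite mulr_ge0// ltW.
have E : lambda * (1 + 6 * L * B) = lambda + 6 * (lambda * (L * B)) by ring.
rewrite E in h1 h2 h3; split; lra.
Qed.

Lemma TV_real (u : R -> R) : BV u -> exists2 V, 0 <= V & (TV u <= V%:E)%E.
Proof.
rewrite /BV; case: (TV u) => [r _||_]; [|by rewrite ltxx|by exists 0 => //; rewrite leNye].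
by exists `|r|; rewrite ?lee_fin ?ler_norm.
Qed.

End Constants.

Section ErrorOfScheme.
Context {R : realType} (N : nat).
Local Notation leb := (@lebesgue_measure R).
Variables (T : R) (f : 'I_N -> R -> R) (nu : 'I_N -> 'rV[R]_N -> R)
  (mu Gam : 'I_N -> 'I_N -> R -> R) (beta lambda : R) (U0 : 'I_N -> R -> R) (U : 'I_N -> R -> R -> R).
Hypotheses (hT : 0 < T)
  (hf : forall k, lipschitz (f k) /\ f k 0 = 0)
  (hnu : forall k, Ck 2 (nu k) /\ Wkinfty 2 (nu k))
  (hmu : forall j k, Ck 2 (mu j k) /\ Wkinfty 2 (mu j k))
  (hGam : forall j k, C2_halfline (Gam j k) /\ forall t, 0 <= t -> 0 <= Gam j k t)
  (hGam_supp : forall j k, closure [set t | 0 <= t /\ Gam j k t != 0] `<=` `[0, 1])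
  (hGam_mass : forall j k, (\int[leb]_(t in `[0%R, +oo[) (Gam j k t)%:E = 1)%E)
  (hU0 : forall k, L1_01 (U0 k) /\ BV (U0 k))
  (hU : entropy_solution T f nu mu U0 U)
  (hbeta : 0 < beta) (hlambda : 0 < lambda) (hCFL : CFL f nu beta lambda).

Let Ufv (p : R * R) := fv_fun f nu mu (fun j k => rescale p.2 (Gam j k)) beta U0 p.1 (lambda * p.1).

Let LU k t : 0 <= t <= T -> LI setT (U k t).
Proof. by move=> tT; have [/(_ k) [_ /(_ _ tT) [h _] _ _] _] := hU. Qed.

(** All constants, as sums or maxima over components, are fixed before the mesh and delta are
    introduced, which is the uniformity hidden in the O. The restriction to Dx <= 1 gives eps = sqrt
    Dx <= 1, hence Dx <= eps. *)
Lemma scheme_error : exists2 C, 0 <= C & forall p k t, 0 < p.1 <= 1 -> 0 < p.2 -> 0 < t <= T ->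
  LI setT (Ufv p k t) /\ \int[leb]_x `|Ufv p k t x - U k t x| <= C * (Num.sqrt p.1 + p.2).
Proof.
have [H [CH sH]] := @smooth_step_exists R.
have LU0 k : LI setT (U0 k) by have [[h _] _] := hU0 k.
have /choice[KU HKU] : forall k, exists K, 0 <= K /\ forall t, 0 <= t <= T -> \int[leb]_x `|U k t x| <= K.
  by move=> k; apply: (CtL1_bounded hT (@LU k)); have [/(_ k) [_ _ h _] _] := hU.
have /choice[V0 HV0] : forall k, exists V, 0 <= V /\ (TV (U0 k) <= V%:E)%E.
  by move=> k; have [_ /TV_real[V V0 VT]] := hU0 k; exists V.
have I0 k : 0 <= \int[leb]_x `|U0 k x| by exact: Rintegral_ge0.
pose K := \sum_k KU k + \sum_k \int[leb]_x `|U0 k x|.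
have SK0 : 0 <= \sum_k KU k by apply: sumr_ge0 => k _; case: (HKU k).
have SI0 : 0 <= \sum_k \int[leb]_x `|U0 k x| by apply: sumr_ge0.
have K0 : 0 <= K by rewrite addr_ge0.
have UK k t : 0 <= t <= T -> \int[leb]_x `|U k t x| <= K.
  move=> tT; apply: le_trans ((HKU k).2 t tT) _.
  by rewrite /K (bigD1 k)//= -addrA lerDl addr_ge0// sumr_ge0// => j _; case: (HKU j).
have U0K k : \int[leb]_x `|U0 k x| <= K.
  by rewrite /K [X in _ + X](bigD1 k)//= addrCA lerDl addr_ge0// sumr_ge0.
pose TV0 := \sum_k V0 k.
have TV00 : 0 <= TV0 by apply: sumr_ge0 => k _; case: (HV0 k).
have U0tr k h : 0 < h -> \int[leb]_x `|U0 k (x + h) - U0 k x| <= h * TV0.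
  move=> h0; apply: (translation_bound sH) => //; apply: le_trans (HV0 k).2 _.
  by rewrite lee_fin /TV0 (bigD1 k)//= lerDl sumr_ge0// => j _; case: (HV0 j).
have [C [Lam [V' [Lam0 muc muC Vb]]]] := velocity_estimates K0 hnu hmu.
pose L := \big[Num.max/0]_(k < N) lip_const (f k); pose B := \big[Num.max/0]_(k < N) sup_norm (nu k).
have L0 : 0 <= L by exact: bigmax_ge_id.
have B0 : 0 <= B by exact: bigmax_ge_id.
have fL k a b : `|f k a - f k b| <= L * `|a - b|.
  apply: le_trans ((lip_constP (hf k).1).2 a b) _; apply: ler_wpM2r => //.
  exact: (le_bigmax _ (fun k => lip_const (f k))).
have f0 k : f k 0 = 0 by case: (hf k).
have nuB k a : `|nu k a| <= B.
  have [_ /(_ [::] isT) [M HM]] := hnu k.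
  apply: le_trans (sup_normP HM a) _; exact: (le_bigmax _ (fun k => sup_norm (nu k))).
have [lam1 cfl1 cfl2] := CFL_bounds hlambda L0 B0 hCFL.
exists `|error_const N beta lambda L B K TV0 Lam T CH| => // -[Dx delta] k t /= /andP[Dx0 Dx1] d0 tT.
have Dt0 : 0 < lambda * Dx by exact: mulr_gt0.
have wP j k' := memory_weightP Dt0 d0 (hGam j k').1 (hGam j k').2 (@hGam_supp j k') (hGam_mass j k').
have e0 : 0 < Num.sqrt Dx by rewrite sqrtr_gt0.
have e1 : Num.sqrt Dx <= 1 by rewrite -[leRHS]sqrtr1 ler_wsqrtr.
have Dxe : Dx = Num.sqrt Dx ^+ 2 by rewrite sqr_sqrtr// ltW.
have tT' : 0 <= t <= T by case/andP: tT => /ltW -> ->.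
have Et := total_error_bound (G := fun j k => rescale delta (Gam j k)) L0 B0 hlambda hbeta Dx0 K0 TV00 Lam0
  (ltW d0) (ltW hT) fL f0 cfl1 cfl2 nuB muc muC Vb wP LU0 U0K U0tr sH e0 e1 Dxe lam1 hT hU UK tT.
have rb := recons_ball mu (fun j k => rescale delta (Gam j k)) L0 hlambda Dx0 fL f0 cfl1 cfl2 nuB LU0 U0K
  (cell_time Dx lambda t) k.
split; first by case: rb.
apply: le_trans (le_trans Et _); last first.
  by apply: ler_wpM2r; [rewrite addr_ge0// ltW|exact: ler_norm].
rewrite /total_error /l1dist (bigD1 k)//= (_ : \int[leb]_x _ = \int[leb]_x `|U k t x - Ufv (Dx, delta) k t x|).
  by rewrite lerDl sumr_ge0// => j _; exact: Rintegral_ge0.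
by apply: eq_Rintegral => x _; rewrite distrC.
Qed.

Lemma fv_fun_measurable p k : measurable_fun (QT T) (fun z : R * R => Ufv p k z.1 z.2).
Proof.
have mQ : measurable (QT T) by apply: measurableX => //; exact: measurable_itv.
(* Negative slabs are given level 0, in agreement with [truncn]. *)
have m := @measurable_slabs R (lambda * p.1)^-1 (fun i => recon p.1
  (fv f nu mu (fun j k => rescale p.2 (Gam j k)) beta U0 p.1 (lambda * p.1) k (if i is Posz n then n else 0%N))) (fun i => measurable_recon _ _).
apply: eq_measurable_fun (measurable_funS measurableT (@subsetT _ _) m) => z _.
by rewrite /Ufv /fv_fun /recon truncEfloor.
Qed.

End ErrorOfScheme.

(** * Convergence as the mesh and delta tend to 0 *)

Lemma mesh_to0_unit {R : realType} (T lambda : R) : \forall p \near mesh_to0 T lambda,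
  [/\ 0 < p.1, p.1 <= 1, 0 < p.2 & p.2 <= 1].
Proof.
have lt1 : \forall x \near nbhs (0 : R), x < 1.
  by apply: open_nbhs_nbhs; split; [exact: open_lt|exact: ltr01].
rewrite near_withinE; exists ([set x | x < 1], [set x | x < 1]); first by split.
by move=> [x y] [/= /ltW x1 /ltW y1] [p1 p2 _].
Qed.

Lemma strip_error {R : realType} (T M : R) (g u : R * R -> R) : 0 < T -> 0 <= M ->
  measurable_fun (QT T) g -> measurable_fun (QT T) u ->
  (forall t, 0 < t < T -> LI setT (fun x => `|g (t, x) - u (t, x)|) /\
    \int[lebesgue_measure]_x `|g (t, x) - u (t, x)| <= M) ->
  (\int[(lebesgue_measure \x lebesgue_measure)%E]_(z in QT T) (`|g z - u z|)%:E <= (M * T)%:E)%E.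
Proof.
move=> T0 M0 mg mu gu; have mI : measurable (`]0, T[%classic : set R) by exact: measurable_itv.
pose F (z : R * R) := `|g z - u z|.
have mF : measurable_fun (QT T) F by apply: measurableT_comp => //; exact: measurable_funB.
have sl t : `]0, T[%classic t -> LI setT (fun x => F (t, x)) /\ \int[lebesgue_measure]_x F (t, x) <= M.
  by rewrite /= in_itv/= => tT; exact: gu.
have muT : (lebesgue_measure (`]0%R, T[%classic : set R) <= T%:E)%E.
  by rewrite lebesgue_measure_itv/= lte_fin T0 sube0.
have LF := tonelli_strip mI mF (fun z => normr_ge0 _) muT sl M0.
have [LG IG] := fubini_strip mI LF (fun t h => (sl t h).1).
rewrite -(EFin_int _ LF); last by apply: measurableX.
rewrite lee_fin IG.
have [Lc Ic] := LI_cst_itv M (ltW T0); rewrite subr0 in Ic; rewrite -Ic.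
by apply: LI_int_le => // t h; case: (sl t h).
Qed.

Theorem theorem7 (R : realType) (N : nat) (T : R)
    (f : 'I_N -> R -> R) (nu : 'I_N -> 'rV[R]_N -> R)
    (mu Gam : 'I_N -> 'I_N -> R -> R)
    (CGam beta lambda : R)
    (U0 : 'I_N -> R -> R) (U : 'I_N -> R -> R -> R)
    (hN : (0 < N)%N) (hT : 0 < T)
    (hf : forall k, lipschitz (f k) /\ f k 0 = 0 /\ f k 1 = 0)
    (hnu : forall k, [/\ Ck 2 (nu k), BV_rV (nu k) & Wkinfty 2 (nu k)])
    (hmu : forall j k, Ck 2 (mu j k) /\ Wkinfty 2 (mu j k))
    (hGam : forall j k, [/\ C2_halfline (Gam j k), W2infty_halfline (Gam j k) &
                            forall t, 0 <= t -> 0 <= Gam j k t])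
    (hGam_supp : forall j k,
       closure [set t | 0 <= t /\ Gam j k t != 0] `<=` `[0, 1])
    (hGam_mass : forall j k,
       (\int[lebesgue_measure]_(t in `[0%R, +oo[) (Gam j k t)%:E = 1)%E)
    (hCGam : 0 < CGam)
    (hGam_moment : forall j k,
       (\int[lebesgue_measure]_(t in `[0%R, +oo[) (t * Gam j k t)%:E
          <= CGam%:E)%E)
    (hU0 : forall k, L1_01 (U0 k) /\ BV (U0 k))
    (hU : entropy_solution T f nu mu U0 U)
    (hbeta : 0 < beta < 2 / 3) (hlambda : 0 < lambda)
    (hCFL : CFL f nu beta lambda) :
  let Ufv (p : R * R) : 'I_N -> R -> R -> R :=
    fv_fun f nu mu (fun j k => rescale p.2 (Gam j k)) beta U0
      p.1 (lambda * p.1) in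
  ((\sum_(k < N) \int[(lebesgue_measure \x lebesgue_measure)%E]_(z in QT T)
      (`|Ufv p k z.1 z.2 - U k z.1 z.2|)%:E)%E
     @[p --> mesh_to0 T lambda] --> 0%E) /\
  exists C : R, \forall p \near mesh_to0 T lambda,
    (\sum_(k < N) 'N[lebesgue_measure]_1[
       EFin \o (fun x => Ufv p k T x - U k T x)%R]
     <= (C * (Num.sqrt p.2 + Num.sqrt p.1))%:E)%E.
Proof.
move=> Ufv; have /andP[b0 _] := hbeta.
have hf' k : lipschitz (f k) /\ f k 0 = 0 by have [? [? _]] := hf k.
have hnu' k : Ck 2 (nu k) /\ Wkinfty 2 (nu k) by have [? _ ?] := hnu k.
have hGam' j k : C2_halfline (Gam j k) /\ forall t, 0 <= t -> 0 <= Gam j k t by have [? _ ?] := hGam j k.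
have [C C0 Cerr] := scheme_error hT hf' hnu' hmu hGam' hGam_supp hGam_mass hU0 hU b0 hlambda hCFL.
have LU k t : 0 <= t <= T -> LI setT (U k t).
  by move=> tT; have [/(_ k) [_ /(_ _ tT) [h _] _ _] _] := hU.
have sumE (F : 'I_N -> \bar R) (c : R) : (forall j, (F j <= c%:E)%E) -> (\sum_j F j <= (N%:R * c)%:E)%E.
  move=> Fc; apply: le_trans (_ : (\sum_(j < N) c%:E <= _)%E); first exact: lee_sum.
  by rewrite sumEFin lee_fin sumr_const card_ord mulr_natl.
split; last first.
  exists (N%:R * C); have TT : 0 < T <= T by rewrite hT/=.
  near=> p; have [p1 p1' p2 p2'] : [/\ 0 < p.1, p.1 <= 1, 0 < p.2 & p.2 <= 1].
    by near: p; exact: mesh_to0_unit.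
  rewrite -mulrA; apply: sumE => k.
  have p11 : 0 < p.1 <= 1 by rewrite p1.
  have [Lk Ik] := Cerr p k T p11 p2 TT.
  rewrite Lnorm1 -EFin_intI//; last first.
    by apply: LI_abs; apply: LIB => //; apply: LU; rewrite ltW/=.
  rewrite lee_fin; apply: le_trans Ik _; apply: ler_wpM2l => //.
  (* The bound is linear in delta, and delta <= sqrt delta because delta <= 1 near the limit. *)
  rewrite addrC lerD2r -{1}[p.2]sqr_sqrtr ?(ltW p2)// expr2 ler_piMl ?sqrtr_ge0//.
  by rewrite -[leRHS]sqrtr1 ler_wsqrtr.
(* The error bound holds at every time with one constant, so integrating it over ]0, T[ gives the
   L^1 bound on the space-time strip. *)
have err_int k p : 0 < p.1 <= 1 -> 0 < p.2 ->
    (\int[(lebesgue_measure \x lebesgue_measure)%E]_(z in QT T)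
      (`|Ufv p k z.1 z.2 - U k z.1 z.2|)%:E <= (C * (Num.sqrt p.1 + p.2) * T)%:E)%E.
  move=> p1 p2; have M0 : 0 <= C * (Num.sqrt p.1 + p.2).
    by rewrite mulr_ge0// addr_ge0 ?sqrtr_ge0// ltW.
  have mU : measurable_fun (QT T) (fun z : R * R => U k z.1 z.2).
    have [/(_ k) [mU _ _ _] _] := hU; apply: measurable_funS mU.
      by apply: measurableX => //; exact: measurable_itv.
    by move=> [t x] [/=]; rewrite in_itv/= => /andP[/ltW h1 /ltW h2] _; split => //=; rewrite in_itv/= h1.
  have mF : measurable_fun (QT T) (fun z : R * R => Ufv p k z.1 z.2) by exact: fv_fun_measurable.
  apply: (@strip_error R T _ (fun z => Ufv p k z.1 z.2) (fun z => U k z.1 z.2) hT M0 mF mU) => t /andP[t0 tT].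
  have h1 : 0 < t <= T by rewrite t0 ltW.
  have h2 : 0 <= t <= T by rewrite !ltW.
  have [Lf If] := Cerr p k t p1 p2 h1; split=> //.
  by apply: LI_abs; apply: LIB => //; exact: LU.
have Ff : Filter (mesh_to0 T lambda) by exact: within_filter.
apply: (@squeeze_cvge _ _ _ R (cst 0%E) _ (fun p => (N%:R * (C * (Num.sqrt p.1 + p.2) * T))%:E)).
- near=> p; have [p1 p1' p2 p2'] : [/\ 0 < p.1, p.1 <= 1, 0 < p.2 & p.2 <= 1].
    by near: p; exact: mesh_to0_unit.
  apply/andP; split; first by apply: sume_ge0 => k _; apply: integral_ge0 => z _; rewrite lee_fin.
  by apply: sumE => k; apply: err_int; rewrite ?p1.
- exact: cvg_cst.
- apply: cvg_EFin; first by near=> p.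
  apply: (cvg_trans (G := (N%:R * (C * (Num.sqrt p.1 + p.2) * T)) @[p --> nbhs ((0, 0) : R * R)])).
    by apply: cvg_app; exact: cvg_within.
  have : N%:R * (C * (Num.sqrt p.1 + p.2) * T) @[p --> nbhs ((0, 0) : R * R)] -->
      N%:R * (C * (Num.sqrt 0 + 0) * T).
    apply: cvgM; first exact: cvg_cst.
    apply: cvgM; last exact: cvg_cst.
    apply: cvgM; first exact: cvg_cst.
    apply: cvgD; last exact: cvg_snd.
    apply: (@cvg_comp _ _ _ (fun p : R * R => p.1) Num.sqrt); first exact: cvg_fst.
    exact: sqrt_continuous.
  by rewrite sqrtr0 addr0 mulr0 mul0r mulr0.
Unshelve. all: by end_near. Qed.
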